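(* Let $(\mathcal{A},X)$ and $(\mathcal{B},Y)$ be objects in $\mathfrak{C}^{\mathbb{N}}_{\mathrm{pr}}$. If $(\mathcal{A},X)$ and $(\mathcal{B},Y)$ are aligned shift equivalent, then $(\mathcal{O}_X^0,\mathcal{O}_X^1)$ and $(\mathcal{O}_Y^0,\mathcal{O}_Y^1)$ are aligned shift equivalent. Likewise, if $(\mathcal{A},X)$ and $(\mathcal{B},Y)$ are homotopy shift equivalent, then $(\mathcal{O}_X^0,\mathcal{O}_X^1)$ and $(\mathcal{O}_Y^0,\mathcal{O}_Y^1)$ are homotopy shift equivalent.
   Context: Correspondences. For C*-algebras $\mathcal{A},\mathcal{B}$, an $\mathcal{A}-\mathcal{B}$ correspondence is a right Hilbert $\mathcal{B}$-module $X$ with a $*$-homomorphism $\phi_X:\mathcal{A}\to\mathcal{L}(X)$ into the adjointable operators, always assumed non-degenerate ($\phi_X(\mathcal{A})X=X$). It is full if the inner products span a dense subspace of $\mathcal{B}$, proper if $\phi_X(\mathcal{A})\subseteq\mathcal{K}(X)$ (generalized compacts), injective if $\phi_X$ is injective, regular if injective and proper. A unitary correspondence isomorphism is an inner-product-preserving surjective bimodule map. Tensor products are interior tensor products, and associativity isomorphisms are suppressed. Bicategory $\mathfrak{C}^{\mathbb{N}}_{\mathrm{pr}}$. Objects: pairs $(\mathcal{A},X)$ with $X$ a full regular correspondence over $\mathcal{A}$. A 1-arrow $[F,\Phi_F]:(\mathcal{B},Y)\leftarrow(\mathcal{A},X)$ is a full proper $\mathcal{B}-\mathcal{A}$ correspondence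 $F$ with a unitary correspondence isomorphism $\Phi_F:Y\otimes_{\mathcal{B}}F\to F\otimes_{\mathcal{A}}X$. A 2-arrow $[F,\Phi_F]\to[G,\Phi_G]$ is a unitary correspondence isomorphism $\Psi:F\to G$ with $(\Psi\otimes1_X)\Phi_F=\Phi_G(1_Y\otimes\Psi)$. Composition of 1-arrows: $[G,\Phi_G]\otimes[F,\Phi_F]=[G\otimes F,\Phi_G\odot\Phi_F]$, $\Phi_G\odot\Phi_F=(1_G\otimes\Phi_F)(\Phi_G\otimes1_F)$. $[X^{\otimes m},1_{X^{\otimes m+1}}]:(\mathcal{A},X)\leftarrow(\mathcal{A},X)$ is the 1-arrow whose isomorphism is the associativity identification $X\otimes X^{\otimes m}\cong X^{\otimes m}\otimes X$. Cuntz-Pimsner algebra. For a regular correspondence $X$ over $\mathcal{A}$, $\mathcal{O}_X$ is the universal C*-algebra for covariant representations $(\pi,t)$: $\pi$ a non-degenerate $*$-homomorphism of $\mathcal{A}$, $t$ linear on $X$, $t(\xi)^*t(\eta)=\pi(\langle\xi,\eta\rangle)$, $\pi(a)t(\xi)=t(a\xi)$, and $\psi(\phi_X(a))=\pi(a)$ where $\psi(\theta_{\xi,\eta})=t(\xi)t(\eta)^*$ on $\mathcal{K}(X)$. The gauge action $\gamma$ of $\mathbb{T}$ fixes $\mathcal{A}$ and multiplies $X$ by $z$; $\mathcal{O}_X^n=\{T\in\mathcal{O}_X:\gamma_z(T)=z^nT\ \forall z\in\mathbb{T}\}$. $\mathcal{O}_X^1$ is a correspondence over the C*-algebra $\mathcal{O}_X^0$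 with actions by multiplication and $\langle S,T\rangle=S^*T$; for $X$ full and regular, $(\mathcal{O}_X^0,\mathcal{O}_X^1)$ is again an object. Homotopy. Let $I=[0,1]$. $C(I,X)$ is the natural correspondence over $C(I,\mathcal{A})$. For $t\in I$, $\mathcal{A}_t$ is the $C(I,\mathcal{A})-\mathcal{A}$ correspondence $\mathcal{A}$ with left action $f\cdot a=f(t)a$, and $\mathrm{ev}_t=[\mathcal{A}_t,\eta_t]:(C(I,\mathcal{A}),C(I,X))\leftarrow(\mathcal{A},X)$ with $\eta_t$ the canonical unitary isomorphism $C(I,X)\otimes_{C(I,\mathcal{A})}\mathcal{A}_t\to\mathcal{A}_t\otimes_{\mathcal{A}}X$ (both sides identified with $X$, via $f\otimes a\mapsto f(t)a$). For a 1-arrow $[H,\Phi_H]:(\mathcal{B},Y)\leftarrow(C(I,\mathcal{A}),C(I,X))$ put $[H_t,\Phi_{H_t}]=[H,\Phi_H]\otimes\mathrm{ev}_t$. A homotopy from $[F,\Phi_F]$ to $[G,\Phi_G]$ (1-arrows $(\mathcal{B},Y)\leftarrow(\mathcal{A},X)$) consists of such $[H,\Phi_H]$ with 2-arrows $h_0:[H_0,\Phi_{H_0}]\to[F,\Phi_F]$ and $h_1:[H_1,\Phi_{H_1}]\to[G,\Phi_G]$. Homotopy shift equivalence. $(\mathcal{A},X)$ and $(\mathcal{B},Y)$ are homotopy shift equivalent with lag $m$ if there are 1-arrows $[M,\Phi_M]:(\mathcal{A},X)\leftarrow(\mathcal{B},Y)$ and $[N,\Phi_N]:(\mathcal{B},Y)\leftarrow(\mathcal{A},X)$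 such that $[M\otimes N,\Phi_M\odot\Phi_N]$ is homotopic to $[X^{\otimes m},1_{X^{\otimes m+1}}]$ and $[N\otimes M,\Phi_N\odot\Phi_M]$ is homotopic to $[Y^{\otimes m},1_{Y^{\otimes m+1}}]$; homotopy shift equivalent means for some $m\ge1$. Aligned shift equivalence. A concrete shift between $X$ and $Y$ with lag $m\ge1$ is a tuple $(M,N,\Phi_M,\Phi_N,\Psi_X,\Psi_Y)$ where $M$ is an $\mathcal{A}-\mathcal{B}$ correspondence, $N$ is a $\mathcal{B}-\mathcal{A}$ correspondence, and $\Phi_M:X\otimes_{\mathcal{A}}M\to M\otimes_{\mathcal{B}}Y$, $\Phi_N:Y\otimes_{\mathcal{B}}N\to N\otimes_{\mathcal{A}}X$, $\Psi_X:M\otimes_{\mathcal{B}}N\to X^{\otimes m}$, $\Psi_Y:N\otimes_{\mathcal{A}}M\to Y^{\otimes m}$ are unitary correspondence isomorphisms. It is aligned if $(\Psi_X\otimes\mathrm{id}_X)(\mathrm{id}_M\otimes\Phi_N)(\Phi_M\otimes\mathrm{id}_N)=\mathrm{id}_X\otimes\Psi_X$ and $(\Psi_Y\otimes\mathrm{id}_Y)(\mathrm{id}_N\otimes\Phi_M)(\Phi_N\otimes\mathrm{id}_M)=\mathrm{id}_Y\otimes\Psi_Y$. $(\mathcal{A},X)$ and $(\mathcal{B},Y)$ are aligned shift equivalent if there is an aligned concrete shift between $X$ and $Y$ with some lag $m\ge1$. *)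

(* Defs.v *)
From HB Require Import structures.
From mathcomp Require Import all_boot all_order all_algebra.
From mathcomp Require Import all_classical all_reals all_analysis.
From mathcomp Require Import ring.
From mathcomp.real_closed Require Import complex.

Set Implicit Arguments.
Unset Strict Implicit.
Unset Printing Implicit Defensive.
Import Order.TTheory GRing.Theory Num.Theory numFieldNormedType.Exports.
Local Open Scope ring_scope.
Local Open Scope complex_scope.
Local Open Scope classical_set_scope.

(* Used for objects which are unique up to unique isomorphism, or unique: some
   x with P x if there is one, and d otherwise. *)
Definition some_or (T : Type) (d : T) (P : T -> Prop) : T :=
  if pselect (exists x, P x) is left e then projT1 (cid e) else d.

Definition lspan (R : realType) (V : lmodType R[i]) (S : set V) : set V :=
  [set v | exists n (c : 'I_n -> R[i]) (s : 'I_n -> V),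
     (forall i, S (s i)) /\ v = \sum_(i < n) c i *: s i].

Record closedSub (R : realType) (V : completeNormedModType R[i]) := ClosedSub {
  cset : set V;
  cset0 : cset 0;
  cset_lin : forall (c : R[i]) x y, cset x -> cset y -> cset (c *: x + y);
  cset_closed : closed cset }.

Definition cset_pred (R : realType) (V : completeNormedModType R[i])
  (S : closedSub V) : {pred V} := mem (cset S).

Section ClosedSubType.
Context (R : realType) (V : completeNormedModType R[i]) (S : closedSub V).

Fact csub_submod : submod_closed (cset_pred S).
Proof.
split; first exact/mem_set/cset0.
by move=> c x y /set_mem hx /set_mem hy; exact/mem_set/cset_lin.
Qed.
HB.instance Definition _ := GRing.isSubmodClosed.Build _ _ _ csub_submod.

Record csub := CSub { cval : V; _ : cval \in cset_pred S }.
HB.instance Definition _ := [isSub for cval].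
HB.instance Definition _ := [Choice of csub by <:].
HB.instance Definition _ := [SubChoice_isSubLmodule of csub by <:].

Lemma csubP (x : csub) : cset S (cval x).
Proof. by case: x => x /= /set_mem. Qed.

Definition mkcsub x (Sx : cset S x) : csub := CSub (mem_set Sx).

Definition csub_norm (x : csub) : R[i] := `|cval x|.
Fact csub_normD x y : csub_norm (x + y) <= csub_norm x + csub_norm y.
Proof. exact: ler_normD. Qed.
Fact csub_normZ (l : R[i]) x : csub_norm (l *: x) = `|l| * csub_norm x.
Proof. exact: normrZ. Qed.
Fact csub_norm0 x : csub_norm x = 0 -> x = 0.
Proof. by move/normr0_eq0 => h; apply: val_inj. Qed.
HB.instance Definition _ :=
  Lmodule_isNormed.Build R[i] csub csub_normD csub_normZ csub_norm0.

Fact csub_complete (F : set_system csub) :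
  ProperFilter F -> cauchy F -> cvg F.
Proof.
move=> FF /cauchyP Fc.
have /cauchy_cvg/cvg_ex[l Fl] : cauchy (cval @ F).
  apply/cauchyP => e e0; have [x Fx] := Fc e e0; exists (cval x).
  by move: Fx; rewrite -!ball_normE.
have Sl : cset S l.
  apply: (@closed_cvg _ _ F _ cval _ (@cset_closed _ _ S) _ _ Fl).
  by apply: nearW => x; exact: csubP.
apply/cvg_ex; exists (mkcsub Sl); apply/fcvgrPdist_lt => e e0.
by move/cvgrPdist_lt : Fl => /(_ e e0).
Qed.
HB.instance Definition _ := Uniform_isComplete.Build csub csub_complete.
End ClosedSubType.


Definition I01 (R : realType) : topologicalType := set_type (`[0, 1] : set R).

Section I01.
Context (R : realType).
Local Notation I := (I01 R).

Fact I01_0 : (0 : R) \in (`[0, 1] : set R).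
Proof. by apply/mem_set => /=; rewrite in_itv /= lexx ler01. Qed.
Fact I01_1 : (1 : R) \in (`[0, 1] : set R).
Proof. by apply/mem_set => /=; rewrite in_itv /= lexx ler01. Qed.
Definition i0 : I := SigSub I01_0.
Definition i1 : I := SigSub I01_1.

Fact clamp_subproof (x : R) : Num.max 0 (Num.min 1 x) \in (`[0, 1] : set R).
Proof.
apply/mem_set => /=; rewrite in_itv /= le_max lexx /= ge_max ler01 /=.
by rewrite ge_min lexx.
Qed.
Definition clamp (x : R) : I := SigSub (clamp_subproof x).
Lemma clampK (t : I) : clamp (\val t) = t.
Proof.
apply: val_inj => /=; have /set_mem := valP t.
rewrite /= in_itv /= => /andP[t0 t1].
by rewrite (min_idPr t1) (max_idPr t0).
Qed.
Lemma clamp_continuous : continuous clamp.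
Proof.
apply/(@continuous_comp_initial _ _ _ set_val) => x /=.
apply: (@continuous_max _ _ (fun=> 0) (fun x : R => Num.min 1 x)).
  exact: cvg_cst.
by apply: (@continuous_min _ _ (fun=> 1) (fun x : R => x)); [exact: cvg_cst | exact: cvg_id].
Qed.
End I01.

Definition rnorm (R : realType) (V : normedModType R[i]) (v : V) : R :=
  complex.Re `|v|.

Section rnorm.
Context (R : realType) (V : normedModType R[i]).
Implicit Types v w : V.

Lemma rnormE v : `|v| = (rnorm v)%:C.
Proof.
have := normr_ge0 v; rewrite /rnorm; case: `|v| => a b.
by rewrite lecE /= => /andP[/eqP -> _].
Qed.
Lemma rnorm_ge0 v : 0 <= rnorm v.
Proof. by have := normr_ge0 v; rewrite rnormE (lecR 0). Qed.
Lemma rnormD v w : rnorm (v + w) <= rnorm v + rnorm w.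
Proof. by have := ler_normD v w; rewrite !rnormE -rmorphD lecR. Qed.
Lemma rnorm_dist v w : `|rnorm v - rnorm w| <= rnorm (v - w).
Proof.
rewrite ler_norml lerBlDr lerBrDl lerBlDr.
have := rnormD (v - w) w; rewrite subrK => ->; rewrite andbT.
have := rnormD (w - v) v; rewrite subrK /rnorm distrC => h.
by rewrite addrC.
Qed.

Lemma rnorm_continuous (T : topologicalType) (f : T -> V) :
  continuous f -> continuous (fun x => rnorm (f x)).
Proof.
move=> cf x; apply/cvgrPdist_lt => e e0.
have e0' : 0 < e%:C by rewrite ltcR.
have /cvgrPdist_lt/(_ _ e0') := cf x.
apply: filterS => y; rewrite rnormE ltcR; apply: le_lt_trans.
exact: rnorm_dist.
Qed.

Lemma approx_continuous (T : topologicalType) (g : T -> V) :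
  (forall e : R[i], 0 < e ->
    exists f : T -> V, continuous f /\ forall t, `|f t - g t| <= e) ->
  continuous g.
Proof.
move=> near_g x; apply/cvgrPdist_lt => e e0.
have e3 : 0 < e / 3 by rewrite divr_gt0 // ltr0n.
have [f [cf fg]] := near_g _ e3.
have /cvgrPdist_lt/(_ _ e3) := cf x.
apply: filterS => y fxy.
have -> : g x - g y = - (f x - g x) + (f x - f y) + (f y - g y).
  by rewrite opprB -!addrA; congr (_ + _); rewrite addKr addKr.
rewrite (_ : e = e / 3 + e / 3 + e / 3); last by field.
rewrite (le_lt_trans (ler_normD _ _)) // ltr_leD //.
by rewrite (le_lt_trans (ler_normD _ _)) // normrN ler_ltD.
Qed.
End rnorm.

Section ContI.
Context (R : realType) (V : completeNormedModType R[i]).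
Local Notation I := (I01 R).

Definition contI_pred : {pred (I -> V)} := mem [set f : I -> V | continuous f].

Fact contI_submod : submod_closed contI_pred.
Proof.
split; first by apply/mem_set => /=; exact: cst_continuous.
move=> c f g /set_mem cf /set_mem cg; apply/mem_set => /= x.
apply: (@cvgD _ _ _ (nbhs x) _ (fun t => c *: f t) g); last exact: cg.
by apply: cvgZl_tmp; exact: cf.
Qed.
HB.instance Definition _ := GRing.isSubmodClosed.Build _ _ _ contI_submod.

Record contI := ContI { contI_fun :> I -> V; _ : contI_fun \in contI_pred }.
HB.instance Definition _ := [isSub for contI_fun].
HB.instance Definition _ := [Choice of contI by <:].
HB.instance Definition _ := [SubChoice_isSubLmodule of contI by <:].

Definition mkcontI (f : I -> V) (cf : continuous f) : contI := ContI (mem_set cf).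
Implicit Types f g : contI.
Lemma contIP f : continuous f.
Proof. by case: f => f /= /set_mem. Qed.
Lemma contI_eq f g : f =1 g -> f = g.
Proof. by move=> fg; apply: val_inj; apply/funext. Qed.
Lemma contID f g t : (f + g) t = f t + g t. Proof. by []. Qed.
Lemma contIZ (c : R[i]) f t : (c *: f) t = c *: f t. Proof. by []. Qed.
Lemma contIB f g t : (f - g) t = f t - g t. Proof. by []. Qed.

Definition contI_rnorm f : R := sup (range (fun t => rnorm (f t))).

Lemma contI_has_sup f : has_sup (range (fun t => rnorm (f t))).
Proof.
split; first by exists (rnorm (f (i0 R))); exists (i0 R).
have cf : {within `[0%R, 1%R], continuous (fun x => rnorm (f (clamp x)))}.
  apply: continuous_subspaceT; apply: rnorm_continuous => x.
  by apply: continuous_comp; [exact: clamp_continuous | exact: contIP].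
have [c _ hc] := EVT_max ler01 cf.
exists (rnorm (f (clamp c))) => _ [t _ <-].
by rewrite -{1}(clampK t); apply: hc; have /set_mem := valP t.
Qed.

Lemma contI_le f t : rnorm (f t) <= contI_rnorm f.
Proof. by apply: sup_ubound; [exact: (contI_has_sup f).2 | exists t]. Qed.
Lemma contI_lub f M : (forall t, rnorm (f t) <= M) -> contI_rnorm f <= M.
Proof.
by move=> h; apply: ge_sup; [exact: (contI_has_sup f).1 | move=> _ [t _ <-]].
Qed.
Lemma contI_rnorm_ge0 f : 0 <= contI_rnorm f.
Proof. exact: le_trans (rnorm_ge0 _) (contI_le f (i0 R)). Qed.

Definition contI_norm f : R[i] := (contI_rnorm f)%:C.

Fact contI_normD f g : contI_norm (f + g) <= contI_norm f + contI_norm g.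
Proof.
rewrite /contI_norm -rmorphD lecR; apply: contI_lub => t.
by rewrite (le_trans (rnormD _ _)) // lerD // contI_le.
Qed.
Fact contI_normZ (l : R[i]) f : contI_norm (l *: f) = `|l| * contI_norm f.
Proof.
have lE : `|l| = (complex.Re `|l|)%:C.
  have := normr_ge0 l; case: `|l| => a b.
  by rewrite lecE /= => /andP[/eqP -> _].
have r0 : 0 <= complex.Re `|l|.
  by have := normr_ge0 l; rewrite {1}lE (lecR 0).
set r := complex.Re `|l| in lE r0 *.
have nE t : rnorm ((l *: f) t) = r * rnorm (f t).
  by apply: complexI; rewrite -rnormE contIZ normrZ lE rmorphM /= -rnormE.
rewrite /contI_norm lE -rmorphM; congr (_%:C); apply/eqP; rewrite eq_le.
apply/andP; split.
  by apply: contI_lub => t; rewrite nE ler_wpM2l // contI_le.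
have [r00|r00] := eqVneq r 0; first by rewrite r00 mul0r contI_rnorm_ge0.
have rp : 0 < r by rewrite lt_def r00.
rewrite -ler_pdivlMl //; apply: contI_lub => t.
by rewrite ler_pdivlMl // -nE contI_le.
Qed.
Fact contI_norm0 f : contI_norm f = 0 -> f = 0.
Proof.
move=> /complexI f0; apply: contI_eq => t; apply/eqP.
suff ft0 : rnorm (f t) = 0 by rewrite -normr_eq0 rnormE ft0.
by apply/eqP; rewrite eq_le rnorm_ge0 andbT -f0 contI_le.
Qed.
HB.instance Definition _ :=
  Lmodule_isNormed.Build R[i] contI contI_normD contI_normZ contI_norm0.

Lemma contI_normE f : `|f| = (contI_rnorm f)%:C. Proof. by []. Qed.
Lemma contI_norm_le f t : `|f t| <= `|f|.
Proof. by rewrite rnormE contI_normE lecR contI_le. Qed.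
Lemma contI_norm_lub f (M : R[i]) :
  (forall t, `|f t| <= M) -> `|f| <= M.
Proof.
move=> h; have M0 : 0 <= M := le_trans (normr_ge0 _) (h (i0 R)).
case: M h M0 => a b h; rewrite lecE /= => /andP[/eqP b0 _]; subst b.
rewrite contI_normE lecR; apply: contI_lub => t.
by have := h t; rewrite rnormE lecR.
Qed.

Fact contI_complete (F : set_system contI) :
  ProperFilter F -> cauchy F -> cvg F.
Proof.
move=> FF /cauchyP Fc.
have cvgt t : exists l : V, (fun f : contI => f t) @ F --> l.
  have /cauchy_cvg/cvg_ex[l Fl] : cauchy ((fun f : contI => f t) @ F).
    apply/cauchyP => e e0; have [f Ff] := Fc e e0; exists (f t).
    move: Ff; rewrite -!ball_normE => Ff.
    apply: (@filterS _ F _ _ _ _ Ff) => h /=.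
    by move=> fh; apply: le_lt_trans fh; rewrite -contIB contI_norm_le.
  by exists l.
have [g gP] := choice cvgt.
have near_g (e : R[i]) : 0 < e -> exists f : contI,
    F (ball f e) /\ forall t, `|f t - g t| <= e.
  move=> e0; have e2 : 0 < e / 2 by rewrite divr_gt0 // ltr0n.
  have [f Ff] := Fc _ e2; exists f; split.
    apply: filterS Ff => h; apply: le_ball.
    by rewrite ler_pdivrMr ?ltr0n // ler_peMr ?ler1n // ltW.
  move=> t; have /cvgrPdist_lt/(_ _ e2) Ft := gP t.
  have [h []] := filter_ex (filterI Ff Ft); rewrite -ball_normE /= => fh gh.
  have -> : f t - g t = (f t - h t) + (h t - g t) by rewrite subrKA.
  rewrite (le_trans (ler_normD _ _)) // (splitr e) lerD //.
    by rewrite -contIB (le_trans (contI_norm_le _ _)) // ltW.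
  by rewrite distrC ltW.
have cg : continuous g.
  apply: approx_continuous => e e0; have [f [_ fg]] := near_g e e0.
  by exists f; split => //; exact: contIP.
apply/cvg_ex; exists (mkcontI cg); apply/fcvgrPdist_lt => e e0.
have e3 : 0 < e / 3 by rewrite divr_gt0 // ltr0n.
have [f [Ff fg]] := near_g _ e3.
move: Ff; rewrite -ball_normE; apply: filterS => h /= fh.
apply: (@le_lt_trans _ _ (e / 3 + e / 3)); last first.
  rewrite -mulrDl ltr_pdivrMr ?ltr0n // -mulr2n -[X in X < _]mulr_natr.
  by rewrite ltr_pM2l // ltr_nat.
apply: contI_norm_lub => t; rewrite contIB /=.
have -> : g t - h t = - (f t - g t) + (f t - h t).
  by rewrite opprB -!addrA addKr.
rewrite (le_trans (ler_normD _ _)) // normrN lerD //.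
by rewrite -contIB (le_trans (contI_norm_le _ _)) // ltW.
Qed.
HB.instance Definition _ := Uniform_isComplete.Build contI contI_complete.
End ContI.


Lemma bounded2_continuous (R : realType) (T : topologicalType)
    (V W U : normedModType R[i]) (b : V -> W -> U) (K : R[i])
    (f : T -> V) (g : T -> W) :
  0 < K -> (forall x y, `|b x y| <= K * (`|x| * `|y|)) ->
  (forall x x' y, b (x - x') y = b x y - b x' y) ->
  (forall x y y', b x (y - y') = b x y - b x y') ->
  continuous f -> continuous g -> continuous (fun t => b (f t) (g t)).
Proof.
move=> K0 bK bl br cf cg x; apply/cvgrPdist_lt => e e0.
pose M := `|f x| + `|g x| + 1.
have M0 : 0 < M by rewrite ltr_wpDl // addr_ge0.
pose d := e / (2 * (K * M)).
have KM0 : 0 < K * M by rewrite mulr_gt0.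
have d0 : 0 < d by rewrite divr_gt0 // mulr_gt0 // ltr0n.
have /cvgrPdist_lt/(_ _ d0) fd := cf x.
have /cvgrPdist_lt/(_ _ ltr01) f1 := cf x.
have /cvgrPdist_lt/(_ _ d0) gd := cg x.
near=> y.
have -> : b (f x) (g x) - b (f y) (g y) =
          b (f x - f y) (g x) + b (f y) (g x - g y).
  by rewrite bl br subrKA.
have eE : e = K * (d * M) + K * (M * d).
  rewrite /d; field; rewrite (gt_eqF K0) (gt_eqF M0) //.
have fyM : `|f y| <= M.
  have -> : f y = f x - (f x - f y) by rewrite opprB addrC subrK.
  rewrite (le_trans (ler_normB _ _)) // /M -addrA lerD //.
  rewrite addrC ler_wpDr //.
  by rewrite ltW //; near: y.
rewrite (le_lt_trans (ler_normD _ _)) // eE ltr_leD //.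
  rewrite (le_lt_trans (bK _ _)) // ltr_pM2l //.
  apply: (@le_lt_trans _ _ (`|f x - f y| * M)).
    by rewrite ler_wpM2l // /M -addrA addrCA ler_wpDr // addr_ge0.
  by rewrite ltr_pM2r //; near: y.
rewrite (le_trans (bK _ _)) // ler_pM2l // ler_pM //.
by rewrite ltW //; near: y.
Unshelve. all: by end_near. Qed.

(* C*-algebras need not be unital, so they are not MathComp rings. *)
Record cstarAlg (R : realType) := CStarAlg {
  calg :> completeNormedModType R[i];
  cmul : calg -> calg -> calg;
  cadj : calg -> calg;
  cmul_linearr : forall a, linear (cmul a);
  cmul_linearl : forall b, linear (cmul^~ b);
  cmulA : associative cmul;
  cadj_linear : forall (c : R[i]) a b,
    cadj (c *: a + b) = c^* *: cadj a + cadj b;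
  cadjK : involutive cadj;
  cadjM : forall a b, cadj (cmul a b) = cmul (cadj b) (cadj a);
  cnormM : forall a b, `|cmul a b| <= `|a| * `|b|;
  cnormC : forall a, `|cmul (cadj a) a| = `|a| ^+ 2 }.

Definition positive (R : realType) (A : cstarAlg R) (a : A) : Prop :=
  exists b : A, a = cmul (cadj b) b.

(* Contractivity is automatic for *-homomorphisms of C*-algebras; it is recorded
   here, and likewise in lact_norm and cov_compacts, because that theorem is
   not available. *)
Definition star_hom (R : realType) (A B : cstarAlg R) (f : A -> B) : Prop :=
  [/\ linear f,
      forall a b, f (cmul a b) = cmul (f a) (f b),
      forall a, f (cadj a) = cadj (f a) &
      forall a, `|f a| <= `|a| ].

(* The data and the algebraic and metric axioms of an A-B correspondence: a
   complete right inner product B-module with a *-homomorphism from A to its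
   adjointable operators; lact_adj makes each lact a linear over the scalars
   and over B, see lact_linear and lact_ract. The two remaining axioms,
   positivity of the inner product and nondegeneracy, are the predicate
   correspondence below. They are separate because C(I, X), the evaluation
   modules and the spectral subspaces of a Cuntz-Pimsner algebra satisfy them
   only by theorems of C*-algebra theory (square roots, factorization). *)
Record preCorr (R : realType) (A B : cstarAlg R) := PreCorr {
  pcar :> completeNormedModType R[i];
  ract : pcar -> B -> pcar;
  ip : pcar -> pcar -> B;
  lact : A -> pcar -> pcar;
  ract_linearr : forall x, linear (ract x);
  ract_linearl : forall b, linear (ract^~ b);
  ractM : forall x b c, ract x (cmul b c) = ract (ract x b) c;
  ip_linear : forall x, linear (ip x);
  ip_adj : forall x y, cadj (ip x y) = ip y x;
  ip_ract : forall x y b, ip x (ract y b) = cmul (ip x y) b;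
  ip_norm : forall x, `|ip x x| = `|x| ^+ 2;
  lact_linearl : forall x, linear (lact^~ x);
  lactM : forall a b x, lact (cmul a b) x = lact a (lact b x);
  lact_adj : forall a x y, ip (lact a x) y = ip x (lact (cadj a) y);
  lact_norm : forall a x, `|lact a x| <= `|a| * `|x| }.

Section LinearTheory.
Context (R : realType).
Lemma lin_sub (V W : lmodType R[i]) (f : V -> W) :
  linear f -> forall x y, f (x - y) = f x - f y.
Proof.
by move=> lf x y; rewrite addrC -scaleN1r lf scaleN1r addrC.
Qed.
Lemma lin_scale (V W : lmodType R[i]) (f : V -> W) :
  linear f -> forall (c : R[i]) x, f (c *: x) = c *: f x.
Proof.
move=> lf c x; have f0 : f 0 = 0 by have := lin_sub lf 0 0; rewrite !subrr.
by have := lf c x 0; rewrite f0 !addr0.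
Qed.

End LinearTheory.

Section CStarTheory.
Context (R : realType) (A : cstarAlg R).
Lemma cadj_sub (a b : A) : cadj (a - b) = cadj a - cadj b.
Proof.
by rewrite addrC -scaleN1r cadj_linear rmorphN rmorph1 scaleN1r addrC.
Qed.
Lemma cnorm_adj (a : A) : `|cadj a| = `|a|.
Proof.
suff h (b : A) : `|b| <= `|cadj b|.
  by apply/eqP; rewrite eq_le h -{2}(cadjK a) h.
have [->|b0] := eqVneq b 0; first by rewrite normr0.
have bp : 0 < `|b| by rewrite normr_gt0.
by rewrite -(ler_pM2r bp) -expr2 -cnormC cnormM.
Qed.

Lemma cadj0 : cadj (0 : A) = 0.
Proof. by rewrite -(subrr (0 : A)) cadj_sub !subrr. Qed.
Lemma cmul_subl (a a' b : A) : cmul (a - a') b = cmul a b - cmul a' b.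
Proof. exact: (lin_sub (cmul_linearl b)). Qed.
Lemma cmul_subr (a b b' : A) : cmul a (b - b') = cmul a b - cmul a b'.
Proof. exact: (lin_sub (cmul_linearr a)). Qed.
Lemma cadjZ (c : R[i]) (a : A) : cadj (c *: a) = c^*%R *: cadj a.
Proof. by rewrite -[c *: a]addr0 cadj_linear cadj0 addr0. Qed.
Lemma cmulZl (c : R[i]) (a b : A) : cmul (c *: a) b = c *: cmul a b.
Proof. exact: (lin_scale (cmul_linearl b)). Qed.
Lemma cmulZr (c : R[i]) (a b : A) : cmul a (c *: b) = c *: cmul a b.
Proof. exact: (lin_scale (cmul_linearr a)). Qed.
Lemma cadj_continuous (T : topologicalType) (f : T -> A) :
  continuous f -> continuous (fun t => cadj (f t)).
Proof.
move=> cf x; apply/cvgrPdist_lt => e e0.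
have /cvgrPdist_lt/(_ _ e0) := cf x.
by apply: filterS => y; rewrite -cadj_sub cnorm_adj.
Qed.
Lemma cmul_continuous (T : topologicalType) (f g : T -> A) :
  continuous f -> continuous g -> continuous (fun t => cmul (f t) (g t)).
Proof.
move=> cf cg; apply: (@bounded2_continuous R T A A A (@cmul R A) 1 f g) => // [a b|a a' b|a b b'].
- by rewrite mul1r cnormM.
- exact: cmul_subl.
- exact: cmul_subr.
Qed.
End CStarTheory.

Section PreCorrTheory.
Context (R : realType) (A B : cstarAlg R) (X : preCorr A B).
Implicit Types x y : X.

Lemma ip_linearl (c : R[i]) x x' y :
  ip (c *: x + x') y = c^* *: ip x y + ip x' y.
Proof. by rewrite -ip_adj ip_linear cadj_linear !ip_adj. Qed.
Lemma ip_sublE x x' y : ip (x - x') y = ip x y - ip x' y.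
Proof.
by rewrite addrC -scaleN1r ip_linearl rmorphN rmorph1 scaleN1r addrC.
Qed.
Lemma lact_linear a : linear (@lact _ _ _ X a).
Proof.
move=> c x y; apply/eqP; rewrite -subr_eq0 -normr_eq0; set z := _ - _.
suff h w : ip w z = 0 by rewrite -sqrf_eq0 -ip_norm h normr0.
rewrite /z (lin_sub (ip_linear w)) ip_linear -[a](cadjK a) -!lact_adj ip_linear.
by rewrite subrr.
Qed.

Lemma lact_ract a x b : lact a (ract x b) = ract (lact a x) b.
Proof.
apply/eqP; rewrite -subr_eq0 -normr_eq0; set z := _ - _.
suff h w : ip w z = 0 by rewrite -sqrf_eq0 -ip_norm h normr0.
rewrite /z (lin_sub (ip_linear w)) ip_ract -[a](cadjK a) -!lact_adj ip_ract.
by rewrite subrr.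
Qed.
Lemma ip_addl x x' y : ip (x + x') y = ip x y + ip x' y.
Proof. by rewrite -[x]scale1r ip_linearl rmorph1 !scale1r. Qed.
Lemma ip_addr x y y' : ip x (y + y') = ip x y + ip x y'.
Proof. by rewrite -[y]scale1r ip_linear !scale1r. Qed.

Lemma ip0l y : ip (0 : X) y = 0.
Proof. by rewrite -(subrr (0 : X)) ip_sublE subrr. Qed.
Lemma ip0r x : ip x (0 : X) = 0.
Proof. by rewrite -(subrr (0 : X)) (lin_sub (ip_linear x)) !subrr. Qed.
Lemma ip_scalel (c : R[i]) x y : ip (c *: x) y = c^* *: ip x y.
Proof. by rewrite -[c *: x]addr0 ip_linearl ip0l addr0. Qed.
Lemma ip_scaler (c : R[i]) x y : ip x (c *: y) = c *: ip x y.
Proof. by rewrite (lin_scale (ip_linear x)). Qed.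

Lemma ip_polar x y :
  ip x y + ip y x = ip (x + y) (x + y) - ip x x - ip y y.
Proof.
rewrite ip_addl !ip_addr.
move: (ip x x) (ip x y) (ip y x) (ip y y) => a b c d.
by rewrite addrA (addrAC _ d) addrK -(addrA a) (addrC a) addrK.
Qed.

Lemma ip_polar_bound x y : `|ip x y + ip y x| <= 2 * (`|x| + `|y|) ^+ 2.
Proof.
rewrite ip_polar (le_trans (ler_normB _ _)) //.
apply: (le_trans (lerD (ler_normB _ _) (lexx _))); rewrite !ip_norm.
have -> : 2 * (`|x| + `|y|) ^+ 2 = (`|x| + `|y|) ^+ 2 + `|x| ^+ 2 + `|y| ^+ 2
    + 2 * `|x| * `|y| by ring.
rewrite ler_wpDr ?mulr_ge0 // !lerD2r.
by rewrite lerXn2r ?nnegrE ?addr_ge0 // ler_normD.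
Qed.

Lemma ip_bound x y : `|ip x y| <= 2 * (`|x| + `|y|) ^+ 2.
Proof.
have h1 := ip_polar_bound x y; have h2 := ip_polar_bound x ('i *: y).
have ni : `|'i : R[i]| = 1 by rewrite normCi.
move: h2; rewrite normrZ ni mul1r ip_scaler ip_scalel.
rewrite conjCi scaleNr -scalerBr normrZ ni mul1r => h2.
suff : `|2%:R *: ip x y| <= 2 * (2 * (`|x| + `|y|) ^+ 2).
  by rewrite normrZ ger0_norm // ler_pM2l.
rewrite scaler_nat.
have -> : ip x y *+ 2 = (ip x y + ip y x) + (ip x y - ip y x).
  by rewrite addrACA subrr addr0.
by rewrite (le_trans (ler_normD _ _)) // mulr_natl mulr2n lerD.
Qed.

Lemma ip_bounded x y : `|ip x y| <= 8 * (`|x| * `|y|).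
Proof.
have [->|x0] := eqVneq x 0; first by rewrite ip0l !normr0 mul0r mulr0.
have [->|y0] := eqVneq y 0; first by rewrite ip0r !normr0 !mulr0.
have xp : 0 < `|x| by rewrite normr_gt0.
have yp : 0 < `|y| by rewrite normr_gt0.
have := ip_bound (`|x|^-1 *: x) (`|y|^-1 *: y).
rewrite !normrZ !ger0_norm ?invr_ge0 // !mulVf ?gt_eqF //.
rewrite ip_scalel ip_scaler !normrZ norm_conjC !ger0_norm ?invr_ge0 //.
rewrite mulrA -invfM ler_pdivrMl ?mulr_gt0 // => /le_trans; apply.
by rewrite le_eqVlt; apply/orP; left; apply/eqP; ring.
Qed.

Lemma ract_bounded x b : `|ract x b| <= `|x| * `|b|.
Proof.
rewrite -(@ler_pXn2r _ 2) ?nnegrE ?mulr_ge0 //.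
rewrite -ip_norm ip_ract -ip_adj ip_ract cadjM ip_adj exprMn.
rewrite (le_trans (cnormM _ _)) // (le_trans (ler_pM _ _ (cnormM _ _) (lexx _))) //.
rewrite cnorm_adj ip_norm le_eqVlt; apply/orP; left; apply/eqP; ring.
Qed.

Lemma ip_continuous (T : topologicalType) (f g : T -> X) :
  continuous f -> continuous g -> continuous (fun t => ip (f t) (g t)).
Proof.
move=> cf cg; apply: (@bounded2_continuous R T X X B (@ip R A B X) 8 f g) => // [x y|x x' y|x y y'].
- exact: ip_bounded.
- exact: ip_sublE.
- exact: (lin_sub (ip_linear _)).
Qed.
Lemma ract_continuous (T : topologicalType) (f : T -> X) (g : T -> B) :
  continuous f -> continuous g -> continuous (fun t => ract (f t) (g t)).
Proof.
move=> cf cg; apply: (@bounded2_continuous R T X B X (@ract R A B X) 1 f g) => // [x y|x x' y|x y y'].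
- by rewrite mul1r ract_bounded.
- exact: (lin_sub (ract_linearl _)).
- exact: (lin_sub (ract_linearr _)).
Qed.
Lemma lact_continuous (T : topologicalType) (f : T -> A) (g : T -> X) :
  continuous f -> continuous g -> continuous (fun t => lact (f t) (g t)).
Proof.
move=> cf cg; apply: (@bounded2_continuous R T A X X (@lact R A B X) 1 f g) => // [x y|x x' y|x y y'].
- by rewrite mul1r lact_norm.
- exact: (lin_sub (lact_linearl _)).
- exact: (lin_sub (@lact_linear _)).
Qed.
End PreCorrTheory.

Section ContIStructures.
Context (R : realType).

Lemma contI_norm_sq (V W : completeNormedModType R[i])
    (f : contI V) (g : contI W) :
  (forall t, `|g t| = `|f t| ^+ 2) -> `|g| = `|f| ^+ 2.
Proof.
move=> h; apply/eqP; rewrite eq_le; apply/andP; split.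
  by apply: contI_norm_lub => t; rewrite h ler_pXn2r ?nnegrE // contI_norm_le.
rewrite -[leRHS]sqrtCK ler_pXn2r ?nnegrE ?sqrtC_ge0 //.
apply: contI_norm_lub => t.
rewrite -(@ler_pXn2r _ 2) ?nnegrE ?sqrtC_ge0 // sqrtCK -h.
exact: contI_norm_le.
Qed.

Section Alg.
Variable A : cstarAlg R.
Definition contI_mul (f g : contI A) : contI A :=
  mkcontI (cmul_continuous (@contIP _ _ f) (@contIP _ _ g)).
Definition contI_adj (f : contI A) : contI A :=
  mkcontI (cadj_continuous (@contIP _ _ f)).

Definition contI_alg : cstarAlg R.
Proof.
refine (@CStarAlg R (contI A) contI_mul contI_adj _ _ _ _ _ _ _ _).
- by move=> f c g h; apply: contI_eq => t; exact: cmul_linearr.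
- by move=> f c g h; apply: contI_eq => t; exact: (cmul_linearl (f t)).
- by move=> f g h; apply: contI_eq => t; exact: cmulA.
- by move=> c f g; apply: contI_eq => t; exact: cadj_linear.
- by move=> f; apply: contI_eq => t; exact: cadjK.
- by move=> f g; apply: contI_eq => t; exact: cadjM.
- move=> f g; apply: contI_norm_lub => t; rewrite (le_trans (cnormM _ _)) //.
  by rewrite ler_pM // contI_norm_le.
- by move=> f; apply: contI_norm_sq => t; exact: cnormC.
Defined.
End Alg.

Section Corr.
Variables (A B : cstarAlg R) (X : preCorr A B).
Definition contI_ract (f : contI X) (g : contI B) : contI X :=
  mkcontI (ract_continuous (@contIP _ _ f) (@contIP _ _ g)).
Definition contI_ip (f g : contI X) : contI B :=
  mkcontI (ip_continuous (@contIP _ _ f) (@contIP _ _ g)).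
Definition contI_lact (g : contI A) (f : contI X) : contI X :=
  mkcontI (lact_continuous (@contIP _ _ g) (@contIP _ _ f)).

Definition contI_corr : preCorr (contI_alg A) (contI_alg B).
Proof.
refine (@PreCorr R (contI_alg A) (contI_alg B) (contI X)
  contI_ract contI_ip contI_lact _ _ _ _ _ _ _ _ _ _ _).
- by move=> f c g h; apply: contI_eq => t; exact: ract_linearr.
- by move=> f c g h; apply: contI_eq => t; exact: (ract_linearl (f t)).
- by move=> f g h; apply: contI_eq => t; exact: ractM.
- by move=> f c g h; apply: contI_eq => t; exact: ip_linear.
- by move=> f g; apply: contI_eq => t; exact: ip_adj.
- by move=> f g h; apply: contI_eq => t; exact: ip_ract.
- by move=> f; apply: contI_norm_sq => t; exact: ip_norm.
- by move=> f c g h; apply: contI_eq => t; exact: (lact_linearl (f t)).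
- by move=> f g h; apply: contI_eq => t; exact: lactM.
- by move=> f g h; apply: contI_eq => t; exact: lact_adj.
- move=> f g; apply: contI_norm_lub => t; rewrite (le_trans (lact_norm _ _)) //.
  by rewrite ler_pM // contI_norm_le.
Defined.
End Corr.

(* A as a right module over itself, with C(I, A) acting through evaluation at t *)
Definition ev_corr (A : cstarAlg R) (t : I01 R) : preCorr (contI_alg A) A.
Proof.
refine (@PreCorr R (contI_alg A) A A (@cmul _ A)
  (fun a b => cmul (cadj a) b) (fun (f : contI A) a => cmul (f t) a)
  _ _ _ _ _ _ _ _ _ _ _).
- exact: cmul_linearr.
- exact: cmul_linearl.
- exact: cmulA.
- by move=> a; exact: cmul_linearr.
- by move=> a b; rewrite cadjM cadjK.
- by move=> a b c; rewrite cmulA.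
- exact: cnormC.
- by move=> a c f g; exact: (cmul_linearl a).
- by move=> f g a; rewrite cmulA.
- by move=> f a b; rewrite cadjM cmulA.
- by move=> f a; rewrite (le_trans (cnormM _ _)) // ler_wpM2r // contI_norm_le.
Defined.
End ContIStructures.

Section Correspondences.
Context (R : realType) (A B : cstarAlg R).

Section OneCorrespondence.
Variable X : preCorr A B.

Definition correspondence : Prop :=
  (forall x : X, positive (ip x x)) /\
  (forall x : X, exists a (y : X), x = lact a y).

Definition full : Prop :=
  closure (lspan [set ip x y | x in [set: X] & y in [set: X]]) = [set: B].

Definition rank1 (x y : X) : X -> X := fun z => ract x (ip y z).

Definition adjoint_pair (S T : X -> X) : Prop :=
  forall x y, ip (S x) y = ip x (T y).

Definition compacts : set (X -> X) :=
  [set S | (exists T, adjoint_pair S T) /\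
     forall e : R[i], 0 < e -> exists s : seq (X * X),
       forall z, `|S z - \sum_(p <- s) rank1 p.1 p.2 z| <= e * `|z| ].

Definition proper_corr : Prop := forall a, compacts (lact a).

Definition lact_injective : Prop := injective (fun a => lact a : X -> X).

Definition regular : Prop := lact_injective /\ proper_corr.
End OneCorrespondence.

Definition unitary (X Y : preCorr A B) (f : X -> Y) : Prop :=
  [/\ linear f,
      forall a x, f (lact a x) = lact a (f x),
      forall x b, f (ract x b) = ract (f x) b,
      forall x y, ip (f x) (f y) = ip x y &
      forall y, exists x, f x = y].
End Correspondences.

Section Tensor.
Context (R : realType).

(* Z with tau is an interior tensor product of X and Y; this determines (Z, tau)
   up to a unique unitary isomorphism. *)
Record interior_tensor (A B C : cstarAlg R) (X : preCorr A B) (Y : preCorr B C)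
    (Z : preCorr A C) (tau : X -> Y -> Z) : Prop := InteriorTensor {
  it_linearr : forall x, linear (tau x);
  it_linearl : forall y, linear (tau^~ y);
  it_balanced : forall x b y, tau (ract x b) y = tau x (lact b y);
  it_lact : forall a x y, lact a (tau x y) = tau (lact a x) y;
  it_ract : forall x y c, ract (tau x y) c = tau x (ract y c);
  it_ip : forall x y x' y',
    ip (tau x y) (tau x' y') = ip y (lact (ip x x') y');
  it_pos : forall z : Z, positive (ip z z);
  it_dense :
    closure (lspan [set tau x y | x in [set: X] & y in [set: Y]]) = [set: Z] }.

(* only the default value of some_or in tensor_model *)
Definition null_corr (A B C : cstarAlg R) (Y : preCorr B C) : preCorr A C.
Proof.
refine (@PreCorr R A C Y (@ract _ _ _ Y) (@ip _ _ _ Y) (fun _ _ => 0)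
  _ _ _ _ _ _ _ _ _ _ _).
- exact: ract_linearr.
- exact: ract_linearl.
- exact: ractM.
- exact: ip_linear.
- exact: ip_adj.
- exact: ip_ract.
- exact: ip_norm.
- by move=> x c a b; rewrite scaler0 addr0.
- by [].
- by move=> a x y; rewrite ip0l ip0r.
- by move=> a x; rewrite normr0 mulr_ge0.
Defined.

Section Binary.
Variables (A B C : cstarAlg R) (X : preCorr A B) (Y : preCorr B C).

Definition tensor_model : {Z : preCorr A C & X -> Y -> Z} :=
  some_or (existT (fun Z : preCorr A C => X -> Y -> Z) (null_corr A Y) (fun _ _ => 0))
    (fun Z => interior_tensor (projT2 Z)).

Definition tensor : preCorr A C := projT1 tensor_model.
Definition tens : X -> Y -> tensor := projT2 tensor_model.

(* the continuous linear map sending x \ot y to b x y *)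
Definition tlift (V : completeNormedModType R[i]) (b : X -> Y -> V) :
    tensor -> V :=
  some_or (fun=> 0) (fun h => [/\ linear h, continuous h &
                            forall x y, h (tens x y) = b x y]).
End Binary.
End Tensor.

Notation "X \ox Y" := (tensor X Y) (at level 40, left associativity).
Notation "x \ot y" := (tens x y) (at level 40, left associativity).

Section TensorMaps.
Context (R : realType) (A B C D : cstarAlg R).

Definition tmap (X X' : preCorr A B) (Y Y' : preCorr B C)
    (f : X -> X') (g : Y -> Y') : X \ox Y -> X' \ox Y' :=
  tlift (fun x y => f x \ot g y).

Variables (X : preCorr A B) (Y : preCorr B C) (Z : preCorr C D).

Definition assoc : (X \ox Y) \ox Z -> X \ox (Y \ox Z) :=
  tlift (fun w z => tlift (fun x y => x \ot (y \ot z)) w).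

Definition assocV : X \ox (Y \ox Z) -> (X \ox Y) \ox Z :=
  tlift (fun x w => tlift (fun y z => (x \ot y) \ot z) w).
End TensorMaps.
Arguments assoc {R A B C D} X Y Z _.
Arguments assocV {R A B C D} X Y Z _.

Section Arrows.
Context (R : realType).
Implicit Types A B C : cstarAlg R.

Definition object A (X : preCorr A A) : Prop :=
  [/\ correspondence X, full X & regular X].

Definition arrow1 A B (Y : preCorr B B) (X : preCorr A A)
    (F : preCorr B A) (Phi : Y \ox F -> F \ox X) : Prop :=
  [/\ correspondence F, full F, proper_corr F & unitary Phi].

Definition arrow2 A B (Y : preCorr B B) (X : preCorr A A)
    (F : preCorr B A) (PhiF : Y \ox F -> F \ox X)
    (G : preCorr B A) (PhiG : Y \ox G -> G \ox X) (Psi : F -> G) : Prop :=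
  unitary Psi /\
  forall w : Y \ox F, tmap Psi idfun (PhiF w) = PhiG (tmap idfun Psi w).

(* (1_G \ox PhiF) (PhiG \ox 1_F), with the associativity maps written out *)
Definition odot A B C (Z : preCorr C C) (Y : preCorr B B) (X : preCorr A A)
    (G : preCorr C B) (PhiG : Z \ox G -> G \ox Y)
    (F : preCorr B A) (PhiF : Y \ox F -> F \ox X) :
    Z \ox (G \ox F) -> (G \ox F) \ox X :=
  fun w => assocV G F X
    (tmap idfun PhiF (assoc G Y F (tmap PhiG idfun (assocV Z G F w)))).

(* X^(n+1), so that a lag m = n.+1 is at least 1 *)
Fixpoint tpowS A (X : preCorr A A) (n : nat) : preCorr A A :=
  if n is n'.+1 then X \ox tpowS X n' else X.

(* the associativity identification of X \ox X^(n+1) with X^(n+1) \ox X *)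
Fixpoint tpowS_shift A (X : preCorr A A) (n : nat) :
    X \ox tpowS X n -> tpowS X n \ox X :=
  match n return X \ox tpowS X n -> tpowS X n \ox X with
  | 0 => idfun
  | n'.+1 => fun w => assocV X (tpowS X n') X (tmap idfun (@tpowS_shift A X n') w)
  end.

Definition ev_mul A (X : preCorr A A) (t : I01 R) : ev_corr A t \ox X -> X :=
  tlift (fun (a : ev_corr A t) (x : X) => lact (a : A) x).

(* C(I, X) \ox A_t and A_t \ox X are both identified with X, the first by
   f \ot a |-> f(t) a and the second by ev_mul. *)
Definition eta A (X : preCorr A A) (t : I01 R) :
    contI_corr X \ox ev_corr A t -> ev_corr A t \ox X :=
  some_or (fun=> 0) (fun h => unitary h /\
    forall (f : contI_corr X) (a : ev_corr A t),
      ev_mul (h (f \ot a)) = ract ((f : contI X) t) a).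

Definition homotopic A B (Y : preCorr B B) (X : preCorr A A)
    (F : preCorr B A) (PhiF : Y \ox F -> F \ox X)
    (G : preCorr B A) (PhiG : Y \ox G -> G \ox X) : Prop :=
  exists (H : preCorr B (contI_alg A)) (PhiH : Y \ox H -> H \ox contI_corr X),
  [/\ arrow1 PhiH,
      exists h0 : H \ox ev_corr A (i0 R) -> F,
        arrow2 (odot PhiH (@eta A X (i0 R))) PhiF h0 &
      exists h1 : H \ox ev_corr A (i1 R) -> G,
        arrow2 (odot PhiH (@eta A X (i1 R))) PhiG h1].

Definition homotopy_shift_equivalent A B
    (X : preCorr A A) (Y : preCorr B B) : Prop :=
  exists (n : nat)
    (M : preCorr A B) (PhiM : X \ox M -> M \ox Y)
    (N : preCorr B A) (PhiN : Y \ox N -> N \ox X),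
  [/\ arrow1 PhiM, arrow1 PhiN,
      homotopic (odot PhiM PhiN) (@tpowS_shift A X n) &
      homotopic (odot PhiN PhiM) (@tpowS_shift B Y n)].

Record concrete_shift A B (X : preCorr A A) (Y : preCorr B B) (n : nat) :=
  ConcreteShift {
    cs_M : preCorr A B;
    cs_N : preCorr B A;
    cs_PhiM : X \ox cs_M -> cs_M \ox Y;
    cs_PhiN : Y \ox cs_N -> cs_N \ox X;
    cs_PsiX : cs_M \ox cs_N -> tpowS X n;
    cs_PsiY : cs_N \ox cs_M -> tpowS Y n;
    cs_corrM : correspondence cs_M;
    cs_corrN : correspondence cs_N;
    cs_unitaryM : unitary cs_PhiM;
    cs_unitaryN : unitary cs_PhiN;
    cs_unitaryX : unitary cs_PsiX;
    cs_unitaryY : unitary cs_PsiY }.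

Definition aligned A B (X : preCorr A A) (Y : preCorr B B) n
    (s : concrete_shift X Y n) : Prop :=
  let: ConcreteShift M N PhiM PhiN PsiX PsiY _ _ _ _ _ _ := s in
  (forall w : X \ox (M \ox N),
     tmap PsiX idfun (odot PhiM PhiN w) = tpowS_shift (tmap idfun PsiX w)) /\
  (forall w : Y \ox (N \ox M),
     tmap PsiY idfun (odot PhiN PhiM w) = tpowS_shift (tmap idfun PsiY w)).

Definition aligned_shift_equivalent A B
    (X : preCorr A A) (Y : preCorr B B) : Prop :=
  exists n (s : concrete_shift X Y n), aligned s.
End Arrows.

Section CuntzPimsner.
Context (R : realType) (A : cstarAlg R) (X : preCorr A A).

(* psi is a *-homomorphism on the compacts; its values elsewhere are irrelevant. *)
Record covariant (D : cstarAlg R) (pi : A -> D) (t : X -> D) : Prop :=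
  Covariant {
  cov_hom : star_hom pi;
  cov_nondeg : forall d, exists a d', d = cmul (pi a) d';
  cov_linear : linear t;
  cov_ip : forall x y, cmul (cadj (t x)) (t y) = pi (ip x y);
  cov_lact : forall a x, cmul (pi a) (t x) = t (lact a x);
  cov_compacts : exists psi : (X -> X) -> D,
    [/\ [/\ forall (c : R[i]) S T, compacts S -> compacts T ->
              psi (fun x => c *: S x + T x) = c *: psi S + psi T,
            forall S T, compacts S -> compacts T ->
              psi (S \o T) = cmul (psi S) (psi T),
            forall S T, compacts S -> compacts T -> adjoint_pair S T ->
              psi T = cadj (psi S) &
            forall S (c : R[i]), compacts S ->
              (forall x, `|S x| <= c * `|x|) -> 0 <= c -> `|psi S| <= c],
        forall x y, psi (rank1 x y) = cmul (t x) (cadj (t y)) &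
        forall a, psi (lact a) = pi a] }.

Record cuntzPimsner := CuntzPimsner {
  cp_alg :> cstarAlg R;
  cp_pi : A -> cp_alg;
  cp_t : X -> cp_alg;
  cp_cov : covariant cp_pi cp_t;
  cp_univ : forall (D : cstarAlg R) (pi : A -> D) (t : X -> D),
    covariant pi t -> exists! s : cp_alg -> D,
      [/\ star_hom s, forall a, s (cp_pi a) = pi a &
          forall x, s (cp_t x) = t x] }.

Variable O : cuntzPimsner.

Section Gauge.
Variables (z : R[i]) (z1 : `|z| = 1).

Let zz : z * z^*%R = 1.
Proof. by rewrite -normCK z1 expr1n. Qed.

Fact gauge_covariant : covariant (@cp_pi O) (fun x => z *: cp_t O x).
Proof.
have [pih nd tl tip tla [psi [hpsi psi1 psil]]] := cp_cov O.
split => //.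
- by move=> c x y; rewrite tl scalerDr !scalerA mulrC.
- by move=> x y; rewrite cadjZ cmulZl cmulZr scalerA mulrC zz scale1r.
- by move=> a x; rewrite cmulZr tla.
- exists psi; split => // x y.
  by rewrite cadjZ cmulZl cmulZr scalerA zz scale1r.
Qed.

Fact gauge_ex : exists s : O -> O,
  [/\ star_hom s, forall a, s (cp_pi O a) = cp_pi O a &
      forall x, s (cp_t O x) = z *: cp_t O x].
Proof. by have [s [hs _]] := cp_univ O gauge_covariant; exists s. Qed.

(* the value at z of the gauge action; unique by cp_univ *)
Definition gauge : O -> O := projT1 (cid gauge_ex).
Lemma gaugeP : [/\ star_hom gauge, forall a, gauge (cp_pi O a) = cp_pi O a &
      forall x, gauge (cp_t O x) = z *: cp_t O x].
Proof. exact: (projT2 (cid gauge_ex)). Qed.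
End Gauge.

Definition homog (n : int) : set O :=
  [set T | forall (z : R[i]) (z1 : `|z| = 1), gauge z1 T = z ^ n *: T].

Fact homog_lin n (c : R[i]) S T :
  homog n S -> homog n T -> homog n (c *: S + T).
Proof.
move=> hS hT z z1; have [[gl _ _ _] _ _] := gaugeP z1.
by rewrite gl hS hT scalerDr !scalerA mulrC.
Qed.

Fact homog0 n : homog n 0.
Proof.
move=> z z1; have [[gl _ _ _] _ _] := gaugeP z1.
by rewrite scaler0 -(subrr (0 : O)) (lin_sub gl) !subrr.
Qed.

Fact norm_expz (z : R[i]) (n : int) : `|z| = 1 -> `|z ^ n| = 1.
Proof. by case: n => k z1; rewrite /exprz ?normfV normrX z1 expr1n ?invr1. Qed.

Fact conj_expz (z : R[i]) (n : int) : ((z ^ n)^* = (z^* ) ^ n)%R.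
Proof. by case: n => k; rewrite /exprz ?fmorphV rmorphXn. Qed.

Fact homog_closed n : closed (homog n).
Proof.
move=> T clT z z1; have [[gl _ _ gn] _ _] := gaugeP z1.
apply/eqP; rewrite -subr_eq0 -normr_eq0; apply/negPn/negP => h0.
have e0 : 0 < `|gauge z1 T - z ^ n *: T| / 2.
  by rewrite divr_gt0 ?ltr0n // lt_def h0 normr_ge0.
have [S [hS]] := clT _ (nbhsx_ballx T _ e0).
rewrite -ball_normE /= ltr_pdivlMr ?ltr0n //.
suff hle : `|gauge z1 T - z ^ n *: T| <= `|T - S| * 2.
  by move=> /(le_lt_trans hle); rewrite ltxx.
have -> : gauge z1 T - z ^ n *: T = gauge z1 (T - S) - z ^ n *: (T - S).
  by rewrite (lin_sub gl) (hS z z1) scalerBr opprB addrA subrK.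
rewrite (le_trans (ler_normB _ _)) // mulr_natr mulr2n lerD //.
by rewrite normrZ norm_expz // mul1r.
Qed.

Definition homogS n : closedSub O :=
  ClosedSub (homog0 n) (@homog_lin n) (@homog_closed n).

Fact homogM m n k (S T : O) : k = m + n ->
  homog m S -> homog n T -> homog k (cmul S T).
Proof.
move=> -> hS hT z z1; have [[_ gM _ _] _ _] := gaugeP z1.
have z0 : z != 0 by rewrite -normr_eq0 z1 oner_eq0.
by rewrite gM hS hT cmulZl cmulZr scalerA expfzDr.
Qed.

Fact homog_adj m k (S : O) : k = - m -> homog m S -> homog k (cadj S).
Proof.
move=> -> hS z z1; have [[_ _ ga _] _ _] := gaugeP z1.
have zc : z^*%R = z^-1.
  by rewrite invC_norm z1 expr1n invr1 mul1r.
by rewrite ga hS cadjZ conj_expz zc exprz_inv.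
Qed.

Let O0 := csub (homogS 0).
Let O1 := csub (homogS 1).

Definition core_mul (a b : O0) : O0 :=
  @mkcsub _ _ (homogS 0) _
    (homogM (erefl : 0 = 0 + 0 :> int) (csubP a) (csubP b)).
Definition core_adj (a : O0) : O0 :=
  @mkcsub _ _ (homogS 0) _ (homog_adj (erefl : 0 = - 0 :> int) (csubP a)).

(* the fixed point algebra O_X^0, and O_X^1 as a correspondence over it *)
Definition core_alg : cstarAlg R.
Proof.
refine (@CStarAlg R O0 core_mul core_adj _ _ _ _ _ _ _ _).
- by move=> a c x y; apply: val_inj; exact: cmul_linearr.
- by move=> a c x y; apply: val_inj; exact: (cmul_linearl (cval a)).
- by move=> a b c; apply: val_inj; exact: cmulA.
- by move=> c a b; apply: val_inj; exact: cadj_linear.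
- by move=> a; apply: val_inj; exact: cadjK.
- by move=> a b; apply: val_inj; exact: cadjM.
- by move=> a b; exact: cnormM.
- by move=> a; exact: cnormC.
Defined.

Definition core_ract (S : O1) (a : O0) : O1 :=
  @mkcsub _ _ (homogS 1) _
    (homogM (erefl : 1 = 1 + 0 :> int) (csubP S) (csubP a)).
Definition core_lact (a : O0) (S : O1) : O1 :=
  @mkcsub _ _ (homogS 1) _
    (homogM (erefl : 1 = 0 + 1 :> int) (csubP a) (csubP S)).
Definition core_ip (S T : O1) : O0 :=
  @mkcsub _ _ (homogS 0) _
    (homogM (m := -1) (n := 1) (erefl (0 : int))
      (homog_adj (m := 1) (erefl (-1 : int)) (csubP S)) (csubP T)).

Definition core_corr : preCorr core_alg core_alg.
Proof.
refine (@PreCorr R core_alg core_alg O1 core_ract core_ip core_lact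
  _ _ _ _ _ _ _ _ _ _ _).
- by move=> S c a b; apply: val_inj; exact: cmul_linearr.
- by move=> a c S T; apply: val_inj; exact: (cmul_linearl (cval a)).
- by move=> S a b; apply: val_inj; exact: cmulA.
- by move=> S c T U; apply: val_inj; exact: cmul_linearr.
- by move=> S T; apply: val_inj; rewrite /= cadjM cadjK.
- by move=> S T a; apply: val_inj; exact: cmulA.
- by move=> S; exact: cnormC.
- by move=> S c a b; apply: val_inj; exact: (cmul_linearl (cval S)).
- by move=> a b S; apply: val_inj; rewrite /= cmulA.
- by move=> a S T; apply: val_inj; rewrite /= cadjM cmulA.
- by move=> a S; exact: cnormM.
Defined.
End CuntzPimsner.

(* Main.v *)
From HB Require Import structures.
Require Import Defs.
From mathcomp Require Import all_boot all_order all_algebra.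
From mathcomp Require Import all_classical all_reals all_analysis.
From mathcomp Require Import ring lra.
From mathcomp.real_closed Require Import complex.

Set Implicit Arguments.
Unset Strict Implicit.
Unset Printing Implicit Defensive.
Import Order.TTheory GRing.Theory Num.Theory numFieldNormedType.Exports.
Local Open Scope ring_scope.
Local Open Scope complex_scope.
Local Open Scope classical_set_scope.

(* A 1-arrow [F, Phi] from (A, X) to (B, Y) extends to the Cuntz-Pimsner
   algebras: E = F \ox_A O_X is a Hilbert O_X-module on which the elements y of Y
   act by t(y) (f \ot T) = Phi (y \ot f) T, where F \ox X acts on O_X through
   (f \ot x) T = f \ot t(x) T, and by the universal property of O_Y this makes E
   an O_Y-O_X correspondence.  The gauge action gives isometries
   U_z (f \ot T) = f \ot g_z(T) of E, and the spectral subspace of degree 0 is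
   an O_Y^0-O_X^0 correspondence K, whose isomorphism
   O_Y^1 \ox K = E^1 = K \ox O_X^1 makes it a 1-arrow.  E is a lift both of F and
   of K.  Lifts are compatible with composition, with 2-arrows, with the powers
   of X (lifted by O_X with its degree shifted) and with evaluation at points of
   [0,1], and a unitary between two lifts which commutes with the U_z restricts
   to a 2-arrow between the degree 0 parts.  So F |-> K carries the diagrams which
   define both equivalences for X and Y to those for the cores. *)

(** * Linear identities *)

(** Positivity means being of the form [b^* b], and inner products on completed tensor products,
    spectral subspaces and path modules must be positive again. [Pos] therefore expresses positivity
    by norms of left multiplications, which behave well under subalgebras and limits, and
    Kaplansky's argument identifies it with the algebraic form. Algebras have no unit, so elements
    like [1 - e] occur only through their action. A second obstacle is the homotopy: its
    correspondence lives over [C(I, A)], and its lift should live over [C(I, O_X)], which one would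
    otherwise have to identify with the Cuntz-Pimsner algebra of [C(I, X)]. Lifts are therefore
    defined for an arbitrary graded algebra on the right ([rep]), and their construction uses the
    universal property on the left only. Integrals over the circle are replaced by finitely many
    two-point averages. Both equivalences need the same transport, because the alignment conditions
    say precisely that [Psi_X] and [Psi_Y] are 2-arrows onto the powers. *)

Inductive lexp (K : Type) :=
  | LZero | LAtom of nat | LAdd of lexp K & lexp K | LOpp of lexp K
  | LScale of K & lexp K.
Arguments LZero {K}.
Arguments LAtom {K} _.

Section Lmod.
Context (K : comPzRingType) (V : lmodType K).

Fixpoint leval (env : seq V) (e : lexp K) : V :=
  match e with
  | LZero => 0
  | LAtom n => nth 0 env n
  | LAdd a b => leval env a + leval env b
  | LOpp a => - leval env a
  | LScale c a => c *: leval env a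
  end.

(** [eqn] instead of [==] lets the [cbv] in [lmod_on] decide equality of atoms by computation, which
    leaves only identities between scalars. *)
Fixpoint lcoef (e : lexp K) (i : nat) : K :=
  match e with
  | LZero => 0
  | LAtom n => if eqn n i then 1 else 0
  | LAdd a b => lcoef a i + lcoef b i
  | LOpp a => - lcoef a i
  | LScale c a => c * lcoef a i
  end.

Fixpoint lall (n : nat) (P : nat -> Prop) : Prop :=
  if n is n'.+1 then P n' /\ lall n' P else True.

Lemma levalE env e : leval env e = \sum_(i < size env) lcoef e i *: nth 0 env i.
Proof.
elim: e => /= [|n|a -> b ->|a ->|c a ->].
- by rewrite big1 // => i _; rewrite scale0r.
- have [ni|ni] := ltnP n (size env); last first.
    rewrite nth_default // big1 // => i _.
    by rewrite -[eqn n i]/(n == i) gtn_eqF ?scale0r // (leq_trans (ltn_ord i)).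
  rewrite (bigD1 (Ordinal ni)) //= -[eqn n n]/(n == n) eqxx scale1r big1 ?addr0 // => i.
  by rewrite -val_eqE /= -[eqn n i]/(n == i) eq_sym => /negPf ->; rewrite scale0r.
- by rewrite -big_split /=; apply: eq_bigr => i _; rewrite scalerDl.
- by rewrite -sumrN; apply: eq_bigr => i _; rewrite scaleNr.
- by rewrite scaler_sumr; apply: eq_bigr => i _; rewrite scalerA.
Qed.

Lemma lmod_eq env e1 e2 :
  lall (size env) (fun i => lcoef e1 i = lcoef e2 i) ->
  leval env e1 = leval env e2.
Proof.
move=> h; rewrite !levalE; apply: eq_bigr => i _; congr (_ *: _).
have := ltn_ord i; elim: (size env) (i : nat) h => // n IH k /= [hn hk].
by rewrite ltnS leq_eqVlt => /orP[/eqP -> //|]; exact: IH.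
Qed.
End Lmod.

Ltac lfind x l :=
  lazymatch l with
  | x :: _ => constr:(0%N)
  | _ :: ?l' => let n := lfind x l' in constr:(S n)
  end.
Ltac ladd x l :=
  match l with
  | _ => let _ := lfind x l in l
  | _ => constr:(x :: l)
  end.
Ltac latoms V l t :=
  lazymatch t with
  | GRing.zero => l
  | GRing.add ?a ?b => let l' := latoms V l a in latoms V l' b
  | GRing.opp ?a => latoms V l a
  | GRing.scale _ ?a => latoms V l a
  | _ => ladd t l
  end.
Ltac lreify K l t :=
  lazymatch t with
  | GRing.zero => constr:(@LZero K)
  | GRing.add ?a ?b =>
      let a' := lreify K l a in let b' := lreify K l b in
      constr:(@LAdd K a' b')
  | GRing.opp ?a => let a' := lreify K l a in constr:(@LOpp K a')
  | GRing.scale ?c ?a => let a' := lreify K l a in constr:(@LScale K c a')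
  | _ => let n := lfind t l in constr:(@LAtom K n)
  end.
(* proves an identity of linear combinations in an R[i]-module, comparing the
   coefficients of the atoms *)
Ltac lmod_on K V :=
  lazymatch goal with
  | |- ?a = ?b =>
    let l0 := constr:(@nil V) in
    let l1 := latoms V l0 a in let l := latoms V l1 b in
    let ea := lreify K l a in let eb := lreify K l b in
    apply: (@lmod_eq K V l ea eb);
    cbv [lall lcoef eqn size]; repeat split
  end.
Ltac lmod :=
  lazymatch goal with
  | |- @eq ?T _ _ =>
    lazymatch goal with
    | R : realType |- _ =>
      let V := constr:(T : lmodType R[i]) in
      lmod_on (R[i] : comPzRingType) V; try ring; try (by field)
    end
  end.

(** * Real-valued norms and limits *)

Section Norm.
Context (R : realType).
Implicit Types V W : completeNormedModType R[i].

Definition cabs (c : R[i]) : R := complex.Re `|c|.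
Lemma cabsE c : `|c| = (cabs c)%:C.
Proof.
have := normr_ge0 c; rewrite /cabs; case: `|c| => a b.
by rewrite lecE /= => /andP[/eqP -> _].
Qed.
Lemma cabs_ge0 c : 0 <= cabs c.
Proof. by have := normr_ge0 c; rewrite cabsE (lecR 0). Qed.
Lemma cabs_real (r : R) : cabs r%:C = `|r|.
Proof. by apply: complexI; rewrite -cabsE normc_def /= expr0n addr0 sqrtr_sqr. Qed.
Lemma cabsM c d : cabs (c * d) = cabs c * cabs d.
Proof. by apply: complexI; rewrite -cabsE normrM !cabsE -rmorphM. Qed.

Section OneSpace.
Context (V : normedModType R[i]).
Implicit Types v w : V.
Lemma rnormZ c v : rnorm (c *: v) = cabs c * rnorm v.
Proof. by apply: complexI; rewrite -rnormE normrZ cabsE rnormE -rmorphM. Qed.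
Lemma rnormZr (r : R) v : rnorm (r%:C *: v) = `|r| * rnorm v.
Proof. by rewrite rnormZ cabs_real. Qed.
Lemma rnorm0 : rnorm (0 : V) = 0.
Proof. by apply: complexI; rewrite -rnormE normr0. Qed.
Lemma rnorm0_eq0 v : rnorm v = 0 -> v = 0.
Proof. by move=> h; apply: normr0_eq0; rewrite rnormE h. Qed.
Lemma rnormN v : rnorm (- v) = rnorm v.
Proof. by apply: complexI; rewrite -!rnormE normrN. Qed.
Lemma rnormBC v w : rnorm (v - w) = rnorm (w - v).
Proof. by rewrite -rnormN opprB. Qed.
Lemma rnormB v w : rnorm (v - w) <= rnorm v + rnorm w.
Proof. by rewrite -[rnorm w]rnormN; exact: rnormD. Qed.
Lemma rnorm_le0 v : rnorm v <= 0 -> v = 0.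
Proof. by move=> h; apply: rnorm0_eq0; apply/eqP; rewrite eq_le h rnorm_ge0. Qed.
Lemma rnorm_eps v : (forall e, 0 < e -> rnorm v <= e) -> v = 0.
Proof. by move=> h; apply: rnorm_le0; apply/ler_addgt0Pl => e e0; rewrite addr0 h. Qed.
Lemma rnorm_tri (v w u : V) : rnorm (v - w) <= rnorm (v - u) + rnorm (u - w).
Proof. by have := rnormD (v - u) (u - w); rewrite addrA subrK. Qed.
End OneSpace.

Lemma normc_le (V W : normedModType R[i]) (v : V) (w : W) (c : R) :
  (`|v| <= c%:C * `|w|) = (rnorm v <= c * rnorm w).
Proof. by rewrite !rnormE -rmorphM lecR. Qed.

Definition slim (V : normedModType R[i]) (u : nat -> V) (l : V) :=
  forall e : R, 0 < e -> exists N, forall n, (N <= n)%N -> rnorm (u n - l) <= e.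

Lemma complete_seq V (u : nat -> V) :
  (forall e : R, 0 < e -> exists N, forall n, (N <= n)%N -> rnorm (u n - u N) <= e) ->
  exists l, slim u l.
Proof.
move=> hu; have /cauchy_cvg/cvg_ex[l ul] : cauchy (u @ \oo).
  apply/cauchyP => e e0.
  have er : e = (complex.Re e)%:C by case: (e) e0 => a b; rewrite ltcE /= => /andP[/eqP ->].
  have r0 : 0 < complex.Re e / 2 by rewrite divr_gt0 // -ltcR -er.
  have [N hN] := hu _ r0; exists (u N); exists N => // n /= Nn.
  rewrite -ball_normE /= rnormE rnormBC er ltcR (le_lt_trans (hN _ Nn)) //.
  by rewrite gtr_pMr ?invf_lt1 ?ltr1n // -ltcR -er.
exists l => e e0; have e0' : 0 < e%:C by rewrite ltcR.
move/cvgrPdist_lt : ul => /(_ _ e0')[N _ hN]; exists N => n Nn.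
by have := hN n Nn; rewrite /= rnormE ltcR rnormBC => /ltW.
Qed.

(** The increments of [u] are dominated by those of a bounded monotone real sequence, so no rate of
    convergence is needed. Square roots, resolvents and Cohen factorization all converge by this
    criterion. *)
Lemma complete_mono V (u : nat -> V) (d : nat -> R) (M : R) :
  (forall n, rnorm (u n.+1 - u n) <= d n.+1 - d n) -> (forall n, d n <= M) ->
  exists l, slim u l.
Proof.
move=> ud dM.
have d1 n : d n <= d n.+1 by rewrite -subr_ge0 (le_trans _ (ud n)) // rnorm_ge0.
have dm m k : rnorm (u (k + m)%N - u m) <= d (k + m)%N - d m.
  elim: k => [|k IH]; first by rewrite !subrr rnorm0.
  rewrite (le_trans (rnorm_tri _ _ (u (k + m)%N))) //.
  by have := ud (k + m)%N; rewrite -addSn; lra.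
apply: complete_seq => e e0.
have hs : has_sup (range d) by split; [exists (d 0%N); exists 0%N | exists M => _ [n _ <-]].
have [_ [N _ <-] hN] := sup_adherent e0 hs.
exists N => n Nn; rewrite -(subnK Nn) (le_trans (dm _ _)) //.
have : d (n - N + N)%N <= sup (range d) by apply: sup_ubound; [exact: hs.2|exists (n - N + N)%N].
by lra.
Qed.

Lemma slim_unique (V : normedModType R[i]) (u : nat -> V) l l' : slim u l -> slim u l' -> l = l'.
Proof.
move=> ul ul'; apply/eqP; rewrite -subr_eq0; apply/eqP; apply: rnorm_eps => e e0.
have e2 : 0 < e / 2 by lra.
have [N hN] := ul _ e2; have [N' hN'] := ul' _ e2.
have := hN _ (leq_maxl N N'); have := hN' _ (leq_maxr N N').
by have := rnorm_tri l l' (u (maxn N N')); rewrite (rnormBC l (u _)); lra.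
Qed.
Lemma slim_cst (V : normedModType R[i]) (l : V) : slim (fun=> l) l.
Proof. by move=> e e0; exists 0%N => n _; rewrite subrr rnorm0 ltW. Qed.
Lemma slim_shift (V : normedModType R[i]) (u : nat -> V) l : slim u l -> slim (fun n => u n.+1) l.
Proof. by move=> h e e0; have [N hN] := h e e0; exists N => n Nn; rewrite hN // leqW. Qed.
(* [f] may be discontinuous elsewhere; only a modulus of continuity at [l] is needed *)
Lemma slim_bound (V W : normedModType R[i]) (u : nat -> V) l (f : nat -> W) m (K : R) :
  slim u l -> (forall n, rnorm (f n - m) <= K * rnorm (u n - l)) -> slim f m.
Proof.
move=> ul fK e e0; have k0 : 0 < `|K| + 1 by have := normr_ge0 K; lra.
have [N hN] := ul _ (divr_gt0 e0 k0); exists N => n Nn.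
rewrite (le_trans (fK n)) //; have := hN n Nn; rewrite ler_pdivlMr // => h.
apply: le_trans h; rewrite mulrC ler_wpM2l ?rnorm_ge0 //.
by rewrite (le_trans (ler_norm K)) // lerDl.
Qed.
Lemma slim_bounded (V : normedModType R[i]) (u : nat -> V) l : slim u l ->
  exists N M, forall n, (N <= n)%N -> rnorm (u n) <= M.
Proof.
move=> ul; have [N hN] := ul 1 ltr01; exists N, (rnorm l + 1) => n Nn.
by have := hN n Nn; have := rnormD (u n - l) l; rewrite subrK; lra.
Qed.
Lemma slimD (V : normedModType R[i]) (u v : nat -> V) l m :
  slim u l -> slim v m -> slim (fun n => u n + v n) (l + m).
Proof.
move=> ul vm e e0; have e2 : 0 < e / 2 by lra.
have [N hN] := ul _ e2; have [N' hN'] := vm _ e2.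
exists (maxn N N') => n; rewrite geq_max => /andP[/hN h /hN' h'].
have := rnormD (u n - l) (v n - m).
by rewrite (_ : _ + _ = u n + v n - (l + m)); [lra|lmod].
Qed.
Lemma slimZ (V : normedModType R[i]) c (u : nat -> V) l : slim u l -> slim (fun n => c *: u n) (c *: l).
Proof.
by move=> ul; apply: (slim_bound (K := cabs c) ul) => n; rewrite -scalerBr rnormZ.
Qed.
Lemma slim_le (V : normedModType R[i]) (u : nat -> V) l K :
  slim u l -> (forall n, rnorm (u n) <= K) -> rnorm l <= K.
Proof.
move=> ul uK; apply/ler_addgt0Pl => e e0; have [N hN] := ul _ e0.
have := hN N (leqnn _); have := uK N; have := rnormD (u N) (l - u N).
by rewrite addrC subrK rnormBC; lra.
Qed.

Lemma closureP (V : normedModType R[i]) (S : set V) (x : V) :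
  closure S x <-> forall e : R, 0 < e -> exists2 y, S y & rnorm (x - y) <= e.
Proof.
split=> [Sx e e0|h B].
  have e0' : 0 < e%:C by rewrite ltcR.
  have [y [Sy]] := Sx _ (nbhsx_ballx x _ e0'); rewrite -ball_normE /= rnormE ltcR.
  by move/ltW; exists y.
rewrite -nbhs_ballE => -[e /= e0].
have er : e = (complex.Re e)%:C by case: (e) e0 => a b; rewrite ltcE /= => /andP[/eqP ->].
have r0 : 0 < complex.Re e by rewrite -ltcR -er.
have [|y Sy xy] := h (complex.Re e / 2); first by rewrite divr_gt0.
move=> sub; exists y; split => //; apply: sub.
rewrite -ball_normE /= rnormE er ltcR (le_lt_trans xy) //.
by lra.
Qed.
End Norm.

(** * Positive elements of a C*-algebra *)

Section CStar.
Context (R : realType) (A : cstarAlg R).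
Implicit Types a b c x y z : A.

Lemma cmulDl a b c : cmul (a + b) c = cmul a c + cmul b c.
Proof. by rewrite -[a]scale1r (cmul_linearl c) !scale1r. Qed.
Lemma cmulDr a b c : cmul a (b + c) = cmul a b + cmul a c.
Proof. by rewrite -[b]scale1r (cmul_linearr a) !scale1r. Qed.
Lemma cmul0l c : cmul (0 : A) c = 0.
Proof. by have := cmulZl 0 0 c; rewrite !scale0r. Qed.
Lemma cmul0r c : cmul c (0 : A) = 0.
Proof. by have := cmulZr 0 c 0; rewrite !scale0r. Qed.
Lemma cmulNl a c : cmul (- a) c = - cmul a c.
Proof. by rewrite -scaleN1r cmulZl scaleN1r. Qed.
Lemma cmulNr a c : cmul a (- c) = - cmul a c.
Proof. by rewrite -scaleN1r cmulZr scaleN1r. Qed.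
Lemma cadjD a b : cadj (a + b) = cadj a + cadj b.
Proof. by rewrite -[a]scale1r cadj_linear rmorph1 !scale1r. Qed.
Lemma cadjN a : cadj (- a) = - cadj a.
Proof. by rewrite -scaleN1r cadjZ rmorphN rmorph1 scaleN1r. Qed.
Lemma conj_real (r : R) : (r%:C)^*%R = r%:C :> R[i].
Proof. by apply: conj_Creal; rewrite realE -!(rmorph0 (real_complex R)) !lecR le_total. Qed.
Lemma cadjZr (r : R) a : cadj (r%:C *: a) = r%:C *: cadj a.
Proof. by rewrite cadjZ conj_real. Qed.

Definition cE := (cmulDl, cmulDr, cmulNl, cmulNr, cmulZl, cmulZr, cmul0l, cmul0r).
Definition cadjE := (cadjD, cadjN, cadjZr, cadjM, cadjK, cadj0).

Lemma rnormM a b : rnorm (cmul a b) <= rnorm a * rnorm b.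
Proof. by have := cnormM a b; rewrite !rnormE -rmorphM lecR. Qed.
Lemma rnormC a : rnorm (cmul (cadj a) a) = rnorm a ^+ 2.
Proof. by apply: complexI; rewrite rmorphXn /= -!rnormE cnormC. Qed.
Lemma rnorm_adj a : rnorm (cadj a) = rnorm a.
Proof. by apply: complexI; rewrite -!rnormE cnorm_adj. Qed.
Lemma rnormCr a : rnorm (cmul a (cadj a)) = rnorm a ^+ 2.
Proof. by rewrite -{1}[a]cadjK rnormC rnorm_adj. Qed.
Lemma rnorm_sa a : cadj a = a -> rnorm (cmul a a) = rnorm a ^+ 2.
Proof. by move=> ha; rewrite -{1}ha rnormC. Qed.
Lemma cC0 a : cmul (cadj a) a = 0 -> a = 0.
Proof.
move=> h; apply: rnorm0_eq0; apply/eqP.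
by rewrite -[_ == 0](sqrf_eq0 (rnorm a)) -rnormC h rnorm0.
Qed.
(** Testing at [a^*] and the C*-identity: left multiplication is isometric. Elements of the
    unitization can thus be handled as operators such as [x -> t x - a x] on [A] itself. *)
Lemma rnorm_op a K : 0 <= K -> (forall x, rnorm (cmul a x) <= K * rnorm x) -> rnorm a <= K.
Proof.
move=> K0 h; have := h (cadj a); rewrite rnormCr rnorm_adj.
have [->|a0] := eqVneq a 0; first by rewrite rnorm0.
rewrite expr2 ler_pM2r // lt_neqAle rnorm_ge0 andbT eq_sym.
by apply: contra_neq a0 => /rnorm0_eq0.
Qed.

Lemma slimM (u v : nat -> A) l m :
  slim u l -> slim v m -> slim (fun n => cmul (u n) (v n)) (cmul l m).
Proof.
move=> ul vm e e0; have [N1 [M hM]] := slim_bounded ul.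
pose K := `|M| + rnorm m + 1.
have m0 := rnorm_ge0 m; have M0 := normr_ge0 M; have K0 : 0 < K by rewrite /K; lra.
have e2 : 0 < e / (2 * K) by rewrite divr_gt0 // mulr_gt0.
have [N2 h2] := ul _ e2; have [N3 h3] := vm _ e2.
exists (maxn N1 (maxn N2 N3)) => n; rewrite !geq_max => /and3P[/hM k1 /h2 k2 /h3 k3].
have -> : cmul (u n) (v n) - cmul l m = cmul (u n) (v n - m) + cmul (u n - l) m.
  by rewrite !cE; lmod.
rewrite (le_trans (rnormD _ _)) //.
have -> : e = K * (e / (2 * K)) + (e / (2 * K)) * K by field; rewrite gt_eqF.
apply: lerD; apply: (le_trans (rnormM _ _)); apply: ler_pM => //; rewrite ?rnorm_ge0 //.
- by rewrite (le_trans k1) // /K (le_trans (ler_norm M)) //; lra.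
- by rewrite /K; lra.
Qed.
Lemma slim_adj (u : nat -> A) l : slim u l -> slim (fun n => cadj (u n)) (cadj l).
Proof.
by move=> h; apply: (slim_bound (K := 1) h) => n; rewrite mul1r -cadj_sub rnorm_adj.
Qed.

(* [(l - a) +- i s] are multiples of unitaries *)
Lemma unitary_trick (l : R) a s : 0 <= l -> cadj a = a -> cadj s = s ->
  cmul a s = cmul s a -> cmul a a + cmul s s = (2 * l)%:C *: a ->
  forall x, rnorm (l%:C *: x - cmul a x) <= l * rnorm x.
Proof.
move=> l0 ha hs has h x.
have hss y : cmul (cmul y s) s = (2 * l)%:C *: cmul y a - cmul (cmul y a) a.
  by rewrite -!cmulA -cmulZr -h !cE; lmod.
have hsa y : cmul (cmul y s) a = cmul (cmul y a) s by rewrite -!cmulA has.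
set p := l%:C *: x - cmul a x.
have key (i : R[i]) : i * i = -1 -> i^*%R = - i ->
    rnorm (p + i *: cmul s x) = l * rnorm x.
  move=> ii ic.
  have vv : cmul (cadj (p + i *: cmul s x)) (p + i *: cmul s x)
            = (l * l)%:C *: cmul (cadj x) x.
    rewrite /p !(cadjD, cadjN, cadjZr, cadjM, cadjZ) ha hs ic !cE !cmulA hss hsa.
    rewrite !(rmorphM, rmorph_nat) !(scalerDr, scalerA, scalerN, scaleNr, mulrN, mulNr, opprK, cE).
    rewrite ii; lmod.
  apply/eqP; rewrite -(@eqrXn2 _ 2) ?mulr_ge0 ?rnorm_ge0 //.
  by rewrite -rnormC vv rnormZr rnormC exprMn ger0_norm ?mulr_ge0 // expr2.
have i2 : ('i : R[i])%R * 'i%R = -1 by rewrite -expr2 sqrCi.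
have h1 := key 'i%R i2 (conjCi _).
have h2 := key (- 'i%R); rewrite mulrNN i2 rmorphN /= conjCi in h2.
have {}h2 := h2 erefl erefl.
have -> : p = (2^-1)%:C *: ((p + 'i%R *: cmul s x) + (p + - 'i%R *: cmul s x)).
  by rewrite fmorphV rmorph_nat; lmod.
rewrite rnormZr; have := rnormD (p + 'i%R *: cmul s x) (p + - 'i%R *: cmul s x).
by rewrite h1 h2 ger0_norm ?invr_ge0 //; lra.
Qed.

(** * Square roots by successive approximation *)

Section Iteration.
(** Scalar majorant of the iteration [W' = (u + W^2)/2] for a contraction [u]: the iterates are
    polynomials in [u] with non-negative coefficients, and [vseq n] is the sum of the coefficients.
    The rate of convergence to 1 serves only to find the limit of the scalar parts [nuseq]. *)
Fixpoint vseq (n : nat) : R := if n is n'.+1 then (1 + vseq n' ^+ 2) / 2 else 0.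
Lemma vseq_bd n : 0 <= vseq n <= 1.
Proof. by elim: n => [|n /andP[h1 h2]] /=; [lra|apply/andP; split; nra]. Qed.
Lemma vseq_rate n : 1 - vseq n <= 2 / (n.+2)%:R.
Proof.
elim: n => [|n IH] /=; first by lra.
have /andP[h1 h2] := vseq_bd n.
set d := 1 - vseq n in IH; have -> : vseq n = 1 - d by rewrite /d; lra.
have d0 : 0 <= d <= 1 by rewrite /d; lra.
have -> : (n.+3)%:R = (n.+2)%:R + 1 :> R by rewrite -natr1.
have : 2 <= (n.+2)%:R :> R by rewrite ler_nat.
move: (n.+2)%:R IH => m IH m2.
have m0 : 0 < m by lra.
rewrite ler_pdivlMr; last by lra.
move: IH; rewrite ler_pdivlMr // => IH.
nra.
Qed.
Lemma vseq_lim (e : R) : 0 < e -> exists N, forall n, (N <= n)%N -> `|vseq n - 1| <= e.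
Proof.
move=> e0; pose N := Num.bound (2 / e); exists N => n Nn.
have /andP[h1 h2] := vseq_bd n; rewrite distrC ger0_norm ?subr_ge0 //.
apply: (le_trans (vseq_rate n)); rewrite ler_pdivrMr ?ltr0n // mulrC -ler_pdivrMr //.
apply: (le_trans (ltW (archi_boundP _))); first by rewrite divr_ge0 // ltW.
by rewrite ler_nat (leq_trans Nn) // -addn2 leq_addr.
Qed.

Variables (b : bool) (a : A).
Hypothesis hu : forall x, rnorm (b%:R *: x - cmul a x) <= rnorm x.

(** In the unitization put [u = b - a] and [W n = nuseq n - sseq n]; the recursion
    [W' = (u + W^2)/2] is split here into its scalar part and its part in [A]. The limit satisfies
    [(1 - W)^2 = 1 - u]. For [b = true] this makes the limit [s] a square root of [a], for
    [b = false] it makes [1 + s] a square root of [1 + a]. *)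
Definition nuseq n : R := if b then vseq n else 0.
Fixpoint sseq (n : nat) : A :=
  if n is n'.+1 then
    (2^-1)%:C *: (a + (2 * nuseq n')%:C *: sseq n' - cmul (sseq n') (sseq n'))
  else 0.
Definition W n x := (nuseq n)%:C *: x - cmul (sseq n) x.

Lemma nuseqS n : nuseq n.+1 = (b%:R + nuseq n ^+ 2) / 2.
Proof. by rewrite /nuseq; case: (b) => //=; rewrite expr0n /= add0r mul0r. Qed.
Lemma WS n x : W n.+1 x = (2^-1)%:C *: ((b%:R *: x - cmul a x) + W n (W n x)).
Proof.
rewrite /W nuseqS /= !cE -!cmulA.
rewrite !(rmorphM, rmorphD, rmorphXn, rmorph_nat, fmorphV) /=; lmod.
Qed.
Lemma W_lin n x y : W n (x - y) = W n x - W n y.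
Proof. by rewrite /W !cE; lmod. Qed.
Lemma W_bd n x : rnorm (W n x) <= vseq n * rnorm x.
Proof.
elim: n x => [|n IH] x.
  by rewrite /W /nuseq /= if_same !cE scale0r subrr rnorm0 mul0r.
rewrite WS rnormZr ger0_norm ?invr_ge0 //.
have := rnormD (b%:R *: x - cmul a x) (W n (W n x)); have := hu x.
have := IH (W n x); have := IH x; have /andP[v0 v1] := vseq_bd n; have := rnorm_ge0 x => /=.
nra.
Qed.
(** [W'^2 - W^2 = W' (W' - W) + (W' - W) W], estimated term by term; the same factorization of
    scalars shows that half of [v'^2 - v^2] is the next increment of [vseq]. *)
Lemma W_diff n x : rnorm (W n.+1 x - W n x) <= (vseq n.+1 - vseq n) * rnorm x.
Proof.
elim: n x => [|n IH] x.
  by rewrite {2}/W /nuseq /= if_same !cE scale0r !subr0 (le_trans (W_bd _ _)).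
rewrite [W n.+2 x]WS {2}[W n.+1 x]WS.
have -> : (2^-1)%:C *: (b%:R *: x - cmul a x + W n.+1 (W n.+1 x)) -
   (2^-1)%:C *: (b%:R *: x - cmul a x + W n (W n x)) =
   (2^-1)%:C *: (W n.+1 (W n.+1 x - W n x) + (W n.+1 (W n x) - W n (W n x))).
  by rewrite (W_lin n.+1 (W n.+1 x) (W n x)); lmod.
rewrite rnormZr ger0_norm ?invr_ge0 //.
have := rnormD (W n.+1 (W n.+1 x - W n x)) (W n.+1 (W n x) - W n (W n x)).
have := W_bd n.+1 (W n.+1 x - W n x); have := IH x; have := IH (W n x); have := W_bd n x.
have -> : vseq n.+2 = (1 + vseq n.+1 ^+ 2) / 2 by [].
have e1 : vseq n.+1 = (1 + vseq n ^+ 2) / 2 by [].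
have d0 : 0 <= vseq n.+1 - vseq n by rewrite e1; have := vseq_bd n; nra.
have /andP[v0 v1] := vseq_bd n; have /andP[v2 v3] := vseq_bd n.+1.
move: e1 d0 v0 v1 v2 v3; move: (vseq n.+1) (vseq n) => v' v e1 d0 v0 v1 v2 v3.
move: (rnorm_ge0 x) (rnorm_ge0 (W n x)); move: (rnorm x) (rnorm (W n x)) => X Y.
set P := rnorm (W n.+1 (W n x) - _); set Q := rnorm (W n.+1 x - _).
set S := rnorm (W _ (_ - _)); set T := rnorm _ => X0 Y0 h1 h2 h3 h4 h5.
have h6 : v' * Q <= v' * ((v' - v) * X) by rewrite ler_wpM2l.
have h7 : (v' - v) * Y <= (v' - v) * (v * X) by rewrite ler_wpM2l.
by rewrite (_ : (1 + v' ^+ 2) / 2 - v' = (v' * (v' - v) + (v' - v) * v) / 2); [lra|rewrite {2}e1; lra].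
Qed.
Lemma nu_diff n : `|nuseq n.+1 - nuseq n| <= vseq n.+1 - vseq n.
Proof.
have d0 : 0 <= vseq n.+1 - vseq n by rewrite /=; have := vseq_bd n; nra.
by rewrite /nuseq; case: (b); [rewrite ger0_norm|rewrite subrr normr0].
Qed.
Lemma sseq_diff n : rnorm (sseq n.+1 - sseq n) <= 2 * vseq n.+1 - 2 * vseq n.
Proof.
have d0 : 0 <= vseq n.+1 - vseq n by rewrite /=; have := vseq_bd n; nra.
rewrite -mulrBr; apply: rnorm_op => [|x]; first by lra.
have -> : cmul (sseq n.+1 - sseq n) x =
  (nuseq n.+1 - nuseq n)%:C *: x - (W n.+1 x - W n x).
  by rewrite /W !cE rmorphB; lmod.
have := rnormB ((nuseq n.+1 - nuseq n)%:C *: x) (W n.+1 x - W n x).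
have := W_diff n x; rewrite rnormZr; have := nu_diff n; have := rnorm_ge0 x.
set p := `|_|; nra.
Qed.

(** The operations by which the iterates arise from [a]. Instances for selfadjointness and for
    commutation give these properties of square roots without a second look at the construction. *)
Definition sq_closed (S : A -> Prop) :=
  [/\ S 0, forall (r : R) x y, S x -> S y -> S (r%:C *: x + y),
    forall x, S x -> S (cmul x x) & forall u l, (forall n, S (u n)) -> slim u l -> S l].

Lemma iteration : exists s : A,
  [/\ (2:R)%:C *: s = a + (2 * b%:R : R)%:C *: s - cmul s s,
    forall x, rnorm (b%:R *: x - cmul s x) <= rnorm x &
    forall S, sq_closed S -> S a -> S s].
Proof.
have [|s ss] := complete_mono (d := fun n => 2 * vseq n) (M := 2) sseq_diff.
  by move=> n; have := vseq_bd n; lra.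
have nul : slim (fun n => (nuseq n)%:C : R[i]^o) (b%:R).
  move=> e /vseq_lim[N hN]; exists N => n /hN; rewrite /nuseq; case: (b) => /= h.
    by rewrite -(rmorph1 (real_complex R)) -rmorphB; rewrite /rnorm -/(cabs _) cabs_real.
  by rewrite subrr rnorm0 (le_trans (normr_ge0 _) h).
have nuZ : forall (u : nat -> A) l, slim u l -> slim (fun n => (nuseq n)%:C *: u n) (b%:R *: l).
  move=> u l ul; have h1 : slim (fun n => (nuseq n)%:C *: l) (b%:R *: l).
    apply: (slim_bound (K := rnorm l) nul) => n; rewrite -scalerBl rnormZ mulrC.
    by rewrite ler_wpM2l ?rnorm_ge0.
  have h2 : slim (fun n => (nuseq n)%:C *: (u n - l)) 0.
    apply: (slim_bound (K := 1) ul) => n; rewrite subr0 mul1r rnormZr.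
    rewrite ler_piMl ?rnorm_ge0 // /nuseq; case: (b); last by rewrite normr0.
    by have /andP[h2 h3] := vseq_bd n; rewrite ger0_norm.
  have := slimD h1 h2; rewrite addr0; congr slim; apply/funext => n; lmod.
exists s; split.
- have h1 := slimZ (2:R)%:C (slim_shift ss).
  apply: (slim_unique h1).
  have h2 := slimD (slimD (slim_cst a) (slimZ (2:R)%:C (nuZ _ _ ss))) (slimZ (-1) (slimM ss ss)).
  have e1 : a + 2%:C *: (b%:R *: s) + -1 *: cmul s s = a + (2 * b%:R : R)%:C *: s - cmul s s.
    by rewrite rmorphM rmorph_nat; lmod.
  rewrite -e1; move: h2; congr slim; apply/funext => n /=.
  by rewrite !(rmorphM, rmorph_nat, fmorphV) /=; lmod.
- move=> x; rewrite -[rnorm x]mul1r.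
  have h : slim (fun n => W n x) (b%:R *: x - cmul s x).
    have := slimD (nuZ _ _ (slim_cst x)) (slimZ (-1) (slimM ss (slim_cst x))).
    by rewrite scaleN1r; congr slim; apply/funext => n; rewrite scaleN1r.
  apply: (slim_le h) => n; rewrite (le_trans (W_bd _ _)) // mul1r.
  by rewrite ler_piMl ?rnorm_ge0 //; have /andP[] := vseq_bd n.
- move=> S [S0 Sl Sq Sc] Sa; apply: (Sc sseq) => //; elim=> //= n IH.
  rewrite -[_ *: _]addr0; apply: (Sl) => //.
  rewrite addrC -scaleN1r -(rmorph1 (real_complex R)) -rmorphN; apply: (Sl); first exact: Sq.
  by rewrite addrC; exact: Sl.
Qed.
End Iteration.
End CStar.

(** * The order of a C*-algebra and the positivity of [b^* b] *)

Section CStarPos.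
Context (R : realType) (A : cstarAlg R).
Implicit Types a b c x y z w s : A.

Lemma sq_closed_sa : sq_closed (fun a => cadj a = a).
Proof.
split=> [|r x y hx hy|x hx|u l hu ul].
- by rewrite cadj0.
- by rewrite cadjD cadjZr hx hy.
- by rewrite cadjM hx.
- by apply: (slim_unique (slim_adj ul)); rewrite (_ : (fun n => _) = u) //; apply/funext.
Qed.
Lemma sq_closed_comm c : sq_closed (fun a => cmul a c = cmul c a).
Proof.
split=> [|r x y hx hy|x hx|u l hu ul].
- by rewrite !cE.
- by rewrite !cE hx hy.
- by rewrite -cmulA hx !cmulA hx.
- apply: (slim_unique (slimM ul (slim_cst c))).
  by rewrite (_ : (fun n => _) = (fun n => cmul c (u n))); [exact: slimM (slim_cst c) ul|apply/funext].
Qed.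

(* [(1 - w)^2 = 1 - a] in the unitization *)
Lemma sqrt_one_minus a : cadj a = a -> rnorm a <= 1 ->
  exists w, [/\ cadj w = w, (2:R)%:C *: w = a + cmul w w &
               forall c, cmul a c = cmul c a -> cmul w c = cmul c w].
Proof.
move=> ha a1; have [|s [hs _ cs]] := @iteration R A false (- a).
  move=> x; rewrite scale0r add0r !cE opprK (le_trans (rnormM _ _)) //.
  by rewrite ler_piMl ?rnorm_ge0.
exists (- s); split.
- by rewrite cadjN (cs _ sq_closed_sa) // cadjN ha.
- by rewrite scalerN hs mulr0 rmorph0 scale0r !cE; lmod.
- move=> c ac; rewrite !cE (cs _ (sq_closed_comm c)) //.
  by rewrite !cE ac.
Qed.

(* [|t - a| <= t] in the unitization, i.e. [0 <= a <= 2 t] for selfadjoint [a] *)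
Definition bdpos (t : R) a := forall x, rnorm (t%:C *: x - cmul a x) <= t * rnorm x.
Definition Pos a := cadj a = a /\ exists2 t : R, 0 < t & bdpos t a.

Lemma bdposZ t r a : 0 <= r -> bdpos t a -> bdpos (r * t) (r%:C *: a).
Proof.
move=> r0 h x; rewrite !cE rmorphM -scalerA -scalerBr rnormZr ger0_norm // -mulrA.
by rewrite ler_wpM2l.
Qed.
Lemma bdposD t t' a a' : bdpos t a -> bdpos t' a' -> bdpos (t + t') (a + a').
Proof.
move=> h h' x; rewrite !cE rmorphD mulrDl; apply: le_trans (lerD (h x) (h' x)).
by apply: le_trans (rnormD _ _); rewrite le_eqVlt; apply/orP; left; apply/eqP; congr rnorm; lmod.
Qed.
Lemma bdpos_le t t' a : t <= t' -> bdpos t a -> bdpos t' a.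
Proof.
move=> tt h x; have -> : t'%:C *: x - cmul a x = (t' - t)%:C *: x + (t%:C *: x - cmul a x).
  by rewrite rmorphB; lmod.
rewrite (le_trans (rnormD _ _)) // rnormZr ger0_norm ?subr_ge0 //.
by have := h x; lra.
Qed.
Lemma bdpos_norm t a : 0 <= t -> bdpos t a -> rnorm a <= 2 * t.
Proof.
move=> t0 h; apply: rnorm_op; first by lra.
move=> x; have -> : cmul a x = t%:C *: x - (t%:C *: x - cmul a x) by lmod.
by rewrite (le_trans (rnormB _ _)) // rnormZr ger0_norm //; have := h x; lra.
Qed.

Lemma Pos_sa a : Pos a -> cadj a = a. Proof. by case. Qed.
Lemma PosD a b : Pos a -> Pos b -> Pos (a + b).
Proof.
move=> [ha [t t0 h]] [hb [t' t0' h']]; split; first by rewrite cadjD ha hb.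
by exists (t + t'); [lra|exact: bdposD].
Qed.
Lemma PosZ (r : R) a : 0 <= r -> Pos a -> Pos (r%:C *: a).
Proof.
move=> r0 [ha [t t0 h]]; split; first by rewrite cadjZr ha.
exists ((r + 1) * t); first by nra.
by apply: (bdpos_le (t := r * t)); [nra|exact: bdposZ].
Qed.
Lemma Pos0 : Pos (0 : A).
Proof.
split; first exact: cadj0.
by exists 1 => // x; rewrite !cE subr0 rnormZr normr1.
Qed.

Lemma Pos_sqrt a : Pos a ->
  exists s, [/\ Pos s, cmul s s = a & forall c, cmul a c = cmul c a -> cmul s c = cmul c s].
Proof.
move=> [ha [t t0 h]]; pose a' := (t^-1)%:C *: a.
have t1 : 0 < t^-1 by rewrite invr_gt0.
have h' : bdpos 1 a' by have := bdposZ (ltW t1) h; rewrite mulVf ?gt_eqF.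
have [|s [hs sb cs]] := @iteration R A true a'.
  by move=> x; have := h' x; rewrite mul1r.
have ss : cmul s s = a'.
  have : a' + (2 * true%:R : R)%:C *: s - cmul s s - (2:R)%:C *: s = 0 by rewrite -hs subrr.
  rewrite mulr1 => e; apply/eqP; rewrite eq_sym -subr_eq0 -e; apply/eqP; lmod.
have sa : cadj s = s by apply: (cs _ sq_closed_sa); rewrite cadjZr ha.
exists ((Num.sqrt t)%:C *: s); split.
- by apply: PosZ; rewrite ?sqrtr_ge0 //; split => //; exists 1 => // x; rewrite mul1r; exact: sb.
- rewrite !cE scalerA -rmorphM -expr2 sqr_sqrtr ?ltW // ss /a' scalerA -rmorphM.
  by rewrite mulfV ?gt_eqF // scale1r.
- move=> c ac; rewrite !cE (cs _ (sq_closed_comm c)) //.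
  by rewrite !cE ac.
Qed.

Lemma bdpos_trick (l : R) a s : 0 <= l -> cadj a = a -> cadj s = s ->
  cmul a s = cmul s a -> cmul a a + cmul s s = (2 * l)%:C *: a -> bdpos l a.
Proof. by move=> l0 ha hs has h x; exact: (unitary_trick (s := s)). Qed.

Lemma comm_sq a : cmul (cmul a a) a = cmul a (cmul a a). Proof. by rewrite cmulA. Qed.

(** Choose [w] with [(1 - w)^2 = 1 - a^2]. As [w^2 + a^2 = 2 w], the elements [(1 - w) +- i a] are
    unitaries, so [1 - w] is a contraction, and so is its square. *)
Lemma bdpos_sq1 a : cadj a = a -> rnorm a <= 1 -> bdpos 1 (cmul a a).
Proof.
move=> ha a1.
have aa : cadj (cmul a a) = cmul a a by rewrite cadjM ha.
have [|w [hw ww cw]] := sqrt_one_minus aa.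
  by rewrite rnorm_sa // expr_le1 // rnorm_ge0.
have h : bdpos 1 w.
  apply: (bdpos_trick (s := a)) => //; first by apply: cw; rewrite comm_sq.
  by rewrite addrC mulr1 ww.
move=> x; have -> : 1%:C *: x - cmul (cmul a a) x =
    1%:C *: (1%:C *: x - cmul w x) - cmul w (1%:C *: x - cmul w x).
  have -> : cmul a a = (2:R)%:C *: w - cmul w w by rewrite ww addrK.
  by rewrite !cE cmulA rmorph1 (_ : (2:R)%:C = 2%:R) ?rmorph_nat //; lmod.
by rewrite mul1r (le_trans (h _)) // mul1r (le_trans (h _)) // mul1r.
Qed.
Lemma bdpos_sq a (t : R) : cadj a = a -> 0 < t -> rnorm (cmul a a) <= t -> bdpos t (cmul a a).
Proof.
move=> ha t0; rewrite rnorm_sa // => at2.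
have st : 0 < Num.sqrt t by rewrite sqrtr_gt0.
pose b := ((Num.sqrt t)^-1)%:C *: a.
have hb : cadj b = b by rewrite cadjZr ha.
have b1 : rnorm b <= 1.
  rewrite rnormZr ger0_norm ?invr_ge0 ?sqrtr_ge0 // ler_pdivrMl // mulr1.
  by rewrite -(@ler_pXn2r _ 2) ?nnegrE ?rnorm_ge0 ?sqrtr_ge0 // sqr_sqrtr // ltW.
have := bdposZ (ltW t0) (bdpos_sq1 hb b1); rewrite mulr1 /b !cE !scalerA -!rmorphM.
by rewrite -mulrA -invfM -expr2 sqr_sqrtr ?ltW // mulfV ?gt_eqF // scale1r.
Qed.
Lemma Pos_sq a : cadj a = a -> Pos (cmul a a).
Proof.
move=> ha; split; first by rewrite cadjM ha.
exists (rnorm (cmul a a) + 1); first by have := rnorm_ge0 (cmul a a); lra.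
by apply: bdpos_sq => //; have := rnorm_ge0 (cmul a a); lra.
Qed.
(** The witness in [Pos] may be any positive bound of the norm: write [a] as a square. This
    uniformity is what passes to limits and to paths. *)
Lemma Pos_bd a (t : R) : Pos a -> 0 < t -> rnorm a <= t -> bdpos t a.
Proof. by move=> /Pos_sqrt[s [[hs _] <- _]] t0 h; exact: bdpos_sq. Qed.

(** By [Pos_bd] all close approximants share the constant [rnorm a + 1], and the inequality [bdpos]
    with a fixed constant survives the limit. *)
Lemma Pos_lim a : (forall e : R, 0 < e -> exists2 b, Pos b & rnorm (a - b) <= e) -> Pos a.
Proof.
move=> h.
have ha : cadj a = a.
  apply/eqP; rewrite -subr_eq0; apply/eqP; apply: rnorm_eps => e e0.
  have [|b [hb _] ab] := h (e / 2); first by lra.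
  have := rnorm_tri (cadj a) a b; rewrite -{1}hb -cadj_sub rnorm_adj (rnormBC b); lra.
split=> //; pose t := rnorm a + 1; have t0 : 0 < t by have := rnorm_ge0 a; rewrite /t; lra.
exists t => // x; apply/ler_addgt0Pl => e e0.
have k0 : 0 < rnorm x + 1 by have := rnorm_ge0 x; lra.
pose d := Num.min 1 (e / (rnorm x + 1)).
have d0 : 0 < d by rewrite lt_min ltr01 divr_gt0.
have [b pb ab] := h d d0.
have d1 : d <= 1 by rewrite ge_min lexx.
have d2 : d * (rnorm x + 1) <= e by rewrite -ler_pdivlMr // ge_min lexx orbT.
have bt : rnorm b <= t by have := rnorm_tri b 0 a; rewrite !subr0 (rnormBC b) /t; lra.
have := Pos_bd pb t0 bt x; have := rnormM (a - b) x.
have := rnorm_tri (t%:C *: x - cmul a x) 0 (t%:C *: x - cmul b x).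
rewrite !subr0 (_ : t%:C *: x - cmul a x - (t%:C *: x - cmul b x) = - cmul (a - b) x); last first.
  by rewrite !cE; lmod.
by rewrite rnormN; have := rnorm_ge0 x; have := rnorm_ge0 (a - b); nra.
Qed.

(* [a (m - a) >= 0] squeezes the spectrum of [a] into [0, m] *)
Lemma Pos_squeeze a (m : R) : 0 <= m -> cadj a = a -> Pos (m%:C *: a - cmul a a) ->
  rnorm a <= m.
Proof.
move=> m0 ha /Pos_sqrt[s [[hs _] ss cs]].
have := bdpos_norm _ (@bdpos_trick (m / 2) a s _ ha hs _ _).
have -> : 2 * (m / 2) = m by lra.
apply => //; rewrite ?divr_ge0 //.
- by apply/esym/cs; rewrite !cE cmulA.
- by rewrite ss; lmod.
Qed.

(** Scale to norm 1 and put [q = c c^*]. The real and imaginary parts of [c] show that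
    [c^* c + c c^*] is half a sum of two squares, so [q] is this half sum plus [e^2], hence
    positive. On the other hand [q + q^2 = c (1 - e^2) c^*] has norm at most 1, which is impossible
    for a positive [q] of norm 1. *)
Lemma no_neg_square c e : cadj e = e -> cmul (cadj c) c = - cmul e e -> c = 0.
Proof.
move=> he hc; apply/eqP/negPn/negP => c0.
have n0 : 0 < rnorm c.
  rewrite lt_neqAle rnorm_ge0 andbT eq_sym; apply: contra_neq c0; exact: rnorm0_eq0.
wlog n1 : c e he hc c0 n0 / rnorm c = 1.
  move=> H; pose r : R := (rnorm c)^-1.
  have r0 : 0 < r by rewrite invr_gt0.
  apply: (H (r%:C *: c) (r%:C *: e)); rewrite ?rnormZr ?ger0_norm ?ltW //.
  - by rewrite cadjZr he.
  - by rewrite cadjZr !cE hc; lmod.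
  - by rewrite scaler_eq0 negb_or c0 andbT -(rmorph0 (real_complex R)) (inj_eq (@complexI _)) gt_eqF.
  - by rewrite mulr_gt0.
  - by rewrite /r mulVf // gt_eqF.
pose q := cmul c (cadj c).
have hq : cadj q = q by rewrite cadjM cadjK.
have q1 : rnorm q = 1 by rewrite rnormCr n1 expr1n.
have Pq : Pos q.
  pose x := c + cadj c; pose y := 'i%R *: (c - cadj c).
  have hx : cadj x = x by rewrite cadjD cadjK addrC.
  have hy : cadj y = y by rewrite cadjZ conjCi cadj_sub cadjK /y; lmod.
  have -> : q = (2^-1)%:C *: (cmul x x + cmul y y) + cmul e e.
    have ii : ('i : R[i])%R * 'i%R = -1 by rewrite -expr2 sqrCi.
    have -> : cmul y y = - cmul (c - cadj c) (c - cadj c).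
      by rewrite /y cmulZl cmulZr scalerA ii scaleN1r.
    by rewrite /x !cE hc /q fmorphV rmorph_nat; lmod.
  by apply: PosD; [apply: PosZ; rewrite ?invr_ge0 //; apply: PosD|]; exact: Pos_sq.
have e1 : rnorm e <= 1.
  have := rnormC c; rewrite hc rnormN rnorm_sa // n1 expr1n => h.
  by rewrite -(@ler_pXn2r _ 2) ?nnegrE ?rnorm_ge0 // h expr1n.
have k1 : rnorm (q + cmul q q) <= 1.
  have -> : q + cmul q q = cmul c (1%:C *: cadj c - cmul (cmul e e) (cadj c)).
    have -> : cmul e e = - cmul (cadj c) c by rewrite hc opprK.
    by rewrite /q !cE rmorph1 !cmulA; lmod.
  rewrite (le_trans (rnormM _ _)) // n1 mul1r (le_trans (bdpos_sq1 he e1 _)) //.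
  by rewrite mul1r rnorm_adj n1.
have hk : cadj (q + cmul q q) = q + cmul q q by rewrite cadjD cadjM hq.
clearbody q; have [w [hw ww cw]] := sqrt_one_minus hk k1.
have [g [[hg _] gg cg]] := Pos_sqrt Pq.
have qg : cmul q g = cmul g q by rewrite -gg cmulA.
have qw : cmul w q = cmul q w by apply: cw; rewrite !cE cmulA.
have gw : cmul g w = cmul w g by apply: cg; rewrite qw.
have h1 : cadj (cmul g q - (2^-1)%:C *: g) = cmul g q - (2^-1)%:C *: g.
  by rewrite !cadjE hg hq qg.
have h2 : cadj (g - cmul g w) = g - cmul g w by rewrite !cadjE hg hw gw.
(* From [q >= 0] and [q + q^2 <= 1] the spectrum of [q] lies below [(sqrt 5 - 1)/2], and [5/8] is a
   rational number just above. It has an exact certificate: with [g^2 = q] and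
   [(1 - w)^2 = 1 - q - q^2], the sum of [q (q - 1/2)^2] and [q (1 - w)^2] is twice
   [5/8 q - q^2]. *)
have : rnorm q <= 5 / 8.
  have m0 : (0 : R) <= 5 / 8 by lra.
  apply: (Pos_squeeze m0 hq).
  have -> : (5 / 8)%:C *: q - cmul q q =
     (2^-1)%:C *: (cmul (cmul g q - (2^-1)%:C *: g) (cmul g q - (2^-1)%:C *: g)
       + cmul (g - cmul g w) (g - cmul g w)).
    have e1' : cmul (cmul g w) g = cmul q w by rewrite -cmulA -gw cmulA gg.
    have e2' : cmul (cmul (cmul g w) g) w = cmul q (2%:C *: w - (q + cmul q q)).
      by rewrite e1' -cmulA ww addrC addKr.
    have e3' : cmul (cmul g q) g = cmul q q by rewrite -cmulA qg cmulA gg.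
    rewrite !cE !cmulA e2' e3' gg e1'.
    rewrite !(cE, cmulA, rmorphM, fmorphV, rmorph_nat); lmod.
  by apply: PosZ; rewrite ?invr_ge0 //; apply: PosD; exact: Pos_sq.
by rewrite q1; lra.
Qed.

(* Kaplansky: for [h = b^* b], [k] the modulus of [h] and [c = b (k - h)], the
   element [c^* c] is minus a square, which forces [c = 0] *)
Lemma Pos_adj_mul b : Pos (cmul (cadj b) b).
Proof.
set h := cmul _ _; have hh : cadj h = h by rewrite cadjM cadjK.
have [k [Pk kk ck]] := Pos_sqrt (Pos_sq hh).
have [r [[hr _] rr cr]] := Pos_sqrt Pk.
have hk := Pos_sa Pk.
have kh : cmul k h = cmul h k by apply: ck; rewrite comm_sq.
have rh : cmul r h = cmul h r by apply: cr.
have rk : cmul r k = cmul k r by rewrite -rr cmulA.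
pose d := k - h; have hd : cadj d = d by rewrite cadj_sub hk hh.
pose e := cmul d r.
have dr : cmul d r = cmul r d by rewrite /d !cE rh rk.
have he : cadj e = e by rewrite cadjM hr hd -dr.
have dh : cmul d h = cmul h d by rewrite /d !cE kh.
have dk : cmul d k = cmul k d by rewrite /d !cE kh.
have dhk : cmul d (h + k) = 0 by rewrite /d !cE kk kh; lmod.
(* Next to [d], [h] acts as [- k] because [d (h + k) = k^2 - h^2 = 0]. Hence
   [c^* c = d h d = - d k d], and [k = r^2]. *)
have cc : cmul (cadj (cmul b d)) (cmul b d) = - cmul e e.
  rewrite cadjM hd -cmulA (cmulA _ b) -/h /e.
  rewrite -[cmul (cmul d r) _]cmulA (cmulA r) -dr -(cmulA d) rr.
  have -> : cmul h d = - cmul k d.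
    apply/eqP; rewrite -subr_eq0 opprK -dh -dk -cmulDr dhk //.
  by rewrite -dk !cE.
have c0 := no_neg_square he cc.
have e0 : cmul d (cmul h d) = 0.
  have -> : cmul d (cmul h d) = cmul (cadj (cmul b d)) (cmul b d).
    by rewrite cadjM hd /h !cmulA.
  by rewrite c0 cmul0r.
(* With [d h d = 0], the same rule gives [d^2 = -2 h d] and so [d^3 = 0]; a selfadjoint nilpotent
   element vanishes. *)
have d3 : cmul d (cmul d d) = 0.
  have ed : cmul k d = - cmul h d.
    by apply/eqP; rewrite -subr_eq0 opprK -dh -dk addrC -cmulDr dhk.
  have -> : cmul d d = cmul k d - cmul h d by rewrite -cmulNl -cmulDl.
  have -> : cmul k d - cmul h d = (-2) *: cmul h d by rewrite ed; lmod.
  by rewrite cmulZr e0 scaler0.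
have d0 : d = 0.
  have dd0 : cmul d d = 0 by apply: cC0; rewrite cadjM hd -cmulA d3 cmul0r.
  by apply: cC0; rewrite hd dd0.
have -> : h = k by apply/esym/eqP; rewrite -subr_eq0 -/d d0.
exact: Pk.
Qed.

Lemma positiveP a : positive a <-> Pos a.
Proof.
split=> [[b ->]|/Pos_sqrt[s [[hs _] <- _]]]; first exact: Pos_adj_mul.
by exists s; rewrite hs.
Qed.

Lemma Pos_conj a b : Pos a -> Pos (cmul (cadj b) (cmul a b)).
Proof.
move=> /Pos_sqrt[s [[hs _] <- _]].
have -> : cmul (cadj b) (cmul (cmul s s) b) = cmul (cadj (cmul s b)) (cmul s b).
  by rewrite cadjM hs !cmulA.
exact: Pos_adj_mul.
Qed.
(** [1 - a/t = (1 - w)^2] in the unitization, so the difference is [t v^* v] for [v = b - w b]. *)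
Lemma Pos_conj_le a b (t : R) : 0 < t -> cadj a = a -> rnorm a <= t ->
  Pos (t%:C *: cmul (cadj b) b - cmul (cadj b) (cmul a b)).
Proof.
move=> t0 ha h; have [||w [hw ww _]] := @sqrt_one_minus ((t^-1)%:C *: a).
- by rewrite cadjZr ha.
- by rewrite rnormZr ger0_norm ?invr_ge0 ?(ltW t0) // ler_pdivrMl // mulr1.
have -> : t%:C *: cmul (cadj b) b - cmul (cadj b) (cmul a b) =
    t%:C *: cmul (cadj (b - cmul w b)) (b - cmul w b).
  have -> : a = t%:C *: ((t^-1)%:C *: a).
    by rewrite scalerA -rmorphM mulfV ?gt_eqF // scale1r.
  have -> : (t^-1)%:C *: a = (2:R)%:C *: w - cmul w w by rewrite ww addrK.
  by rewrite !(cadjE, cE, cmulA) hw rmorph_nat; lmod.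
by apply: PosZ; [exact: ltW|exact: Pos_adj_mul].
Qed.

(** For [a = r^2] and [M] above the norm of [b], [M a - a^2 = r (M - b) r + r (b - a) r] is
    positive, and [Pos_squeeze] applies. *)
Lemma Pos_mono a b : Pos a -> Pos (b - a) -> rnorm a <= rnorm b.
Proof.
move=> Pa Pba; apply/ler_addgt0Pl => e e0; set M := e + rnorm b.
have M0 : 0 < M by have := rnorm_ge0 b; rewrite /M; lra.
have hb : cadj b = b by rewrite -[b](subrK a) cadjD (Pos_sa Pba) (Pos_sa Pa).
apply: Pos_squeeze (ltW M0) (Pos_sa Pa) _.
have [r [[hr _] rr _]] := Pos_sqrt Pa.
have -> : M%:C *: a - cmul a a = (M%:C *: cmul (cadj r) r - cmul (cadj r) (cmul b r)) +
  cmul (cadj r) (cmul (b - a) r).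
  by rewrite hr !cE -rr !cmulA; lmod.
apply: PosD; last exact: Pos_conj.
by apply: Pos_conj_le => //; rewrite /M; lra.
Qed.

(* for [alpha = <x,x>], [beta = <y,y>], [c = <x,y>] *)
Lemma cauchy_schwarz_gen alpha beta c :
  cadj alpha = alpha -> (forall b, Pos (beta - cmul (cadj b) c - cmul (cadj c) b + cmul (cadj b) (cmul alpha b))) ->
  rnorm c ^+ 2 <= rnorm alpha * rnorm beta.
Proof.
move=> ha h; apply/ler_addgt0Pl => e e0.
have b0 := rnorm_ge0 beta; have k0 : 0 < rnorm beta + 1 by lra.
pose d := e / (rnorm beta + 1); have d0 : 0 < d by rewrite divr_gt0.
have dE : d * (rnorm beta + 1) = e by rewrite divfK // gt_eqF.
pose t := d + rnorm alpha; have t0 : 0 < t by have := rnorm_ge0 alpha; rewrite /t; lra.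
suff : rnorm ((t^-1)%:C *: cmul (cadj c) c) <= rnorm beta.
  rewrite rnormZr ger0_norm ?invr_ge0 ?(ltW t0) // rnormC ler_pdivrMl //.
  by rewrite /t; nra.
apply: Pos_mono; first by apply: PosZ; [rewrite invr_ge0 ltW|exact: Pos_adj_mul].
have at1 : rnorm alpha <= t by rewrite /t; lra.
(* At [b = c/t] the hypothesis, together with [alpha <= t], becomes [beta - c^* c / t >= 0]. *)
have := PosD (h ((t^-1)%:C *: c)) (Pos_conj_le ((t^-1)%:C *: c) t0 ha at1).
congr Pos; rewrite !(cadjE, cE).
have -> : t%:C *: ((t^-1)%:C *: ((t^-1)%:C *: cmul (cadj c) c)) = (t^-1)%:C *: cmul (cadj c) c.
  by rewrite (scalerA t%:C) -rmorphM mulfV ?gt_eqF // scale1r.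
lmod.
Qed.
End CStarPos.

(** * Closed spans and bounded linear maps *)

Section Spans.
Context (R : realType).
Implicit Types V W : completeNormedModType R[i].

(** Closed subspaces as predicates, with closedness in terms of approximation. [cspan_min] then
    works as an induction principle: check a property on a total set, conclude everywhere. *)
Definition lin_closed V (P : V -> Prop) :=
  [/\ P 0, forall (c : R[i]) x y, P x -> P y -> P (c *: x + y) &
      forall x, (forall e : R, 0 < e -> exists2 y, P y & rnorm (x - y) <= e) -> P x].

Definition cspan V (S : set V) : set V := closure (lspan S).

Lemma lspan0 V (S : set V) : lspan S 0.
Proof.
exists 0%N, (fun=> 0), (fun=> 0); split; first by case.
by rewrite big_ord0.
Qed.
Lemma lspan_lin V (S : set V) (c : R[i]) x y : lspan S x -> lspan S y -> lspan S (c *: x + y).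
Proof.
move=> [m [d [s [Ss ->]]]] [n [e [t [St ->]]]].
exists (m + n)%N, (fun k => match fintype.split k with inl i => c * d i | inr j => e j end),
  (fun k => match fintype.split k with inl i => s i | inr j => t j end); split.
  by move=> k; case: (fintype.split k).
rewrite big_split_ord /= scaler_sumr; congr (_ + _); apply: eq_bigr => i _.
  by rewrite -[lshift _ _]/(unsplit (inl i)) unsplitK scalerA.
by rewrite -[rshift _ _]/(unsplit (inr i)) unsplitK.
Qed.
Lemma lspan_sub V (S : set V) : S `<=` lspan S.
Proof.
move=> x Sx; exists 1%N, (fun=> 1), (fun=> x); split => //.
by rewrite big_ord1 scale1r.
Qed.

Lemma cspan_closed V (S : set V) : lin_closed (cspan S).
Proof.
split.
- by apply/closureP => e e0; exists 0; [exact: lspan0|rewrite subrr rnorm0 ltW].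
- move=> c x y /closureP hx /closureP hy; apply/closureP => e e0.
  have k0 : 0 < cabs c + 1 by have := cabs_ge0 c; lra.
  have [|x' Sx xx] := hx (e / 2 / (cabs c + 1)); first by rewrite !divr_gt0.
  have [|y' Sy yy] := hy (e / 2); first by lra.
  exists (c *: x' + y'); first exact: lspan_lin.
  have -> : c *: x + y - (c *: x' + y') = c *: (x - x') + (y - y') by lmod.
  have := rnormD (c *: (x - x')) (y - y'); rewrite rnormZ.
  have : (cabs c + 1) * rnorm (x - x') <= e / 2 by rewrite mulrC -ler_pdivlMr.
  by have := rnorm_ge0 (x - x'); nra.
- move=> x hx; apply/closureP => e e0.
  have e2 : 0 < e / 2 by lra.
  have [y /closureP hy xy] := hx _ e2; have [z Sz yz] := hy _ e2.
  by exists z => //; have := rnorm_tri x z y; lra.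
Qed.
Lemma cspan_sub V (S : set V) x : S x -> cspan S x.
Proof. by move=> Sx; apply: subset_closure; exact: lspan_sub. Qed.
Lemma cspan_min V (S : set V) (P : V -> Prop) :
  lin_closed P -> (forall x, S x -> P x) -> forall x, cspan S x -> P x.
Proof.
move=> [P0 Pl Pc] SP x /closureP hx; apply: Pc => e e0; have [y [n [c [s [Ss ->]]]] xy] := hx e e0.
exists (\sum_i c i *: s i) => //.
elim/big_rec: _ => // i z _ Pz; apply: Pl => //; exact: SP.
Qed.
Lemma cspan_mono V (S T : set V) x : S `<=` T -> cspan S x -> cspan T x.
Proof.
by move=> ST; apply: cspan_min => [|y /ST]; [exact: cspan_closed|exact: cspan_sub].
Qed.

Definition blin V W (f : V -> W) :=
  linear f /\ exists2 C : R, 0 <= C & forall x, rnorm (f x) <= C * rnorm x.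

Section Linear.
Context (V W : lmodType R[i]) (f : V -> W) (lf : linear f).
Lemma linD x y : f (x + y) = f x + f y.
Proof. by rewrite -[x]scale1r lf !scale1r. Qed.
Lemma linZ c x : f (c *: x) = c *: f x. Proof. exact: lin_scale. Qed.
Lemma linN x : f (- x) = - f x. Proof. by rewrite -scaleN1r linZ scaleN1r. Qed.
Lemma lin0 : f 0 = 0. Proof. by rewrite -(scale0r (0 : V)) linZ scale0r. Qed.
Lemma linB x y : f (x - y) = f x - f y. Proof. exact: lin_sub. Qed.
Lemma linS I (r : seq I) (F : I -> V) : f (\sum_(i <- r) F i) = \sum_(i <- r) f (F i).
Proof.
elim: r => [|i r IH]; first by rewrite !big_nil lin0.
by rewrite !big_cons linD IH.
Qed.
End Linear.

Lemma blin_lin V W (f : V -> W) : blin f -> linear f. Proof. by case. Qed.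
Lemma blin_id V : blin (fun x : V => x).
Proof. by split=> //; exists 1 => // x; rewrite mul1r. Qed.
Lemma blin0 V W : blin ((fun=> 0) : V -> W).
Proof.
split; first by move=> c x y; rewrite scaler0 addr0.
by exists 0 => // x; rewrite rnorm0 mul0r.
Qed.
Lemma blin_comp V W (U : completeNormedModType R[i]) (g : W -> U) (f : V -> W) :
  blin g -> blin f -> blin (fun x => g (f x)).
Proof.
move=> [lg [C C0 hC]] [lf [D D0 hD]]; split; first by move=> c x y; rewrite lf lg.
exists (C * D); first exact: mulr_ge0.
by move=> x; rewrite (le_trans (hC _)) // -mulrA ler_wpM2l.
Qed.
Lemma blin_lc V W (c : R[i]) (f g : V -> W) : blin f -> blin g -> blin (fun x => c *: f x + g x).
Proof.
move=> [lf [C C0 hC]] [lg [D D0 hD]]; split.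
  by move=> d x y; rewrite lf lg; lmod.
have c0 := cabs_ge0 c; exists (cabs c * C + D); first by rewrite addr_ge0 ?mulr_ge0.
move=> x; rewrite (le_trans (rnormD _ _)) // rnormZ mulrDl lerD // -mulrA.
by rewrite ler_wpM2l.
Qed.
Lemma blinB V W (f g : V -> W) : blin f -> blin g -> blin (fun x => f x - g x).
Proof.
move=> bf bg; rewrite (_ : (fun x => _) = (fun x => -1 *: g x + f x)); first exact: blin_lc.
by apply/funext => x; rewrite scaleN1r addrC.
Qed.

Lemma lin_closed_preim V W (f : V -> W) (P : W -> Prop) :
  blin f -> lin_closed P -> lin_closed (fun x => P (f x)).
Proof.
move=> [lf [C C0 hC]] [P0 Pl Pc]; split.
- by rewrite lin0.
- by move=> c x y Px Py; rewrite lf; exact: Pl.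
- move=> x hx; apply: Pc => e e0; have k0 : 0 < C + 1 by lra.
  have [|y Py xy] := hx (e / (C + 1)); first exact: divr_gt0.
  exists (f y) => //; rewrite -linB // (le_trans (hC _)) //.
  by move: xy; rewrite ler_pdivlMr //; have := rnorm_ge0 (x - y); nra.
Qed.
Lemma lin_closed0 V : lin_closed (fun x : V => x = 0).
Proof.
split=> // [c x y -> ->|x hx]; first by rewrite scaler0 addr0.
by apply: rnorm_eps => e /hx[_ ->]; rewrite subr0.
Qed.
Lemma lin_closed_eq V W (f g : V -> W) : blin f -> blin g -> lin_closed (fun x => f x = g x).
Proof.
move=> bf bg; have := lin_closed_preim (blinB bf bg) (@lin_closed0 W).
have E x : (f x - g x = 0) = (f x = g x).
  by apply/propext; split=> [/eqP|->]; rewrite ?subrr // subr_eq0 => /eqP.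
by rewrite (_ : (fun x => _ = 0) = (fun x => f x = g x)) //; apply/funext => x; rewrite E.
Qed.
Lemma lin_closedA V I (P : I -> V -> Prop) :
  (forall i, lin_closed (P i)) -> lin_closed (fun x => forall i, P i x).
Proof.
move=> h; split=> [i|c x y Px Py i|x hx i]; first by case: (h i).
- by case: (h i) => _ + _; apply.
- by case: (h i) => _ _; apply => e /hx[y Py xy]; exists y.
Qed.
Lemma cspan_map V W (f : V -> W) (S : set V) (T : set W) x : blin f ->
  (forall y, S y -> cspan T (f y)) -> cspan S x -> cspan T (f x).
Proof.
move=> bf ST; apply: (@cspan_min V S (fun x => cspan T (f x))) => //.
by apply: lin_closed_preim => //; exact: cspan_closed.
Qed.

Lemma blin_ext V W (S : set V) (f g : V -> W) : blin f -> blin g ->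
  (forall x, S x -> f x = g x) -> forall x, cspan S x -> f x = g x.
Proof. by move=> bf bg; apply: cspan_min; exact: lin_closed_eq. Qed.

Lemma linear_continuousP V W (f : V -> W) : linear f ->
  (continuous f <-> exists2 C : R, 0 <= C & forall x, rnorm (f x) <= C * rnorm x).
Proof.
move=> lf; split=> [cf|[C C0 hC]].
  have /cvgrPdist_lt/(_ _ ltr01) : f x @[x --> (0 : V)] --> f 0 := cf 0.
  rewrite (lin0 lf) => /nbhs_ballP[d /= d0]; rewrite -ball_normE /= => sub.
  have dr : d = (complex.Re d)%:C by case: (d) d0 => a b; rewrite ltcE /= => /andP[/eqP ->].
  set r := complex.Re d in dr; have r0 : 0 < r by rewrite -ltcR -dr.
  exists (2 / r); first by rewrite divr_ge0 // ltW.
  move=> x; have [->|x0] := eqVneq x 0; first by rewrite (lin0 lf) !rnorm0 mulr0.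
  have n0 : 0 < rnorm x.
    rewrite lt_neqAle rnorm_ge0 andbT eq_sym; apply: contra_neq x0; exact: rnorm0_eq0.
  pose k := r / 2 / rnorm x; have k0 : 0 < k by rewrite !divr_gt0.
  have := sub (k%:C *: x); rewrite /= sub0r normrN rnormE rnormZr dr ltcR.
  rewrite ger0_norm ?(ltW k0) // /k divfK ?gt_eqF // => /(_ _).
  rewrite sub0r normrN linZ // rnormE rnormZr ger0_norm ?(ltW k0) // => h.
  have := h; rewrite -(rmorph1 (real_complex R)) ltcR => {}h.
  have /h : r / 2 < r by lra.
  rewrite /k -ltr_pdivlMl ?(divr_gt0, k0) // => {}h; apply/ltW/(lt_le_trans h).
  by rewrite le_eqVlt; apply/orP; left; apply/eqP; field; rewrite !gt_eqF.
move=> x; apply/cvgrPdist_lt => e e0.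
have er : e = (complex.Re e)%:C by case: (e) e0 => a b; rewrite ltcE /= => /andP[/eqP ->].
set r := complex.Re e in er; have r0 : 0 < r by rewrite -ltcR -er.
have k0 : 0 < C + 1 by lra.
have d0 : 0 < (r / (C + 1))%:C by rewrite ltcR divr_gt0.
have := @nbhsx_ballx _ _ x _ d0; rewrite -ball_normE; apply: filterS => y /=.
rewrite !rnormE er !ltcR -linB // ltr_pdivlMr // => h.
by apply: (le_lt_trans (hC _)); apply: le_lt_trans h; have := rnorm_ge0 (x - y); nra.
Qed.
(** The interface with [tlift], whose specification asks for continuity. *)
Lemma blinP V W (f : V -> W) : blin f <-> linear f /\ continuous f.
Proof.
by split=> -[lf h]; split => //; apply/(linear_continuousP lf).
Qed.

(** * Extension of maps from a total family *)

Section Extension.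
Variables (V W : completeNormedModType R[i]) (I : Type) (tau : I -> V) (b : I -> W) (C : R).
Definition fsum (U : lmodType R[i]) (f : I -> U) (s : seq (R[i] * I)) : U :=
  \sum_(p <- s) p.1 *: f p.2.
Definition fscale (c : R[i]) (s : seq (R[i] * I)) := [seq (c * p.1, p.2) | p <- s].
Lemma fsum_cat (U : lmodType R[i]) (f : I -> U) s t : fsum f (s ++ t) = fsum f s + fsum f t.
Proof. exact: big_cat. Qed.
Lemma fsum_scale (U : lmodType R[i]) (f : I -> U) c s : fsum f (fscale c s) = c *: fsum f s.
Proof.
by rewrite /fsum big_map scaler_sumr; apply: eq_bigr => p _; rewrite scalerA.
Qed.
Lemma fsum1 (U : lmodType R[i]) (f : I -> U) i : fsum f [:: (1, i)] = f i.
Proof. by rewrite /fsum big_seq1 scale1r. Qed.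

Hypothesis tot : forall x, cspan (range tau) x.
Lemma fsum_dense x (e : R) : 0 < e -> exists s, rnorm (x - fsum tau s) <= e.
Proof.
move=> e0; have /closureP/(_ e e0)[y [n [c [v [hv ->]]]] xy] : cspan (range tau) x by exact: tot.
have [s es] : exists s, \sum_i c i *: v i = fsum tau s.
  elim/big_rec: _ => [|i z _ [s ->]]; first by exists [::]; rewrite /fsum big_nil.
  have [j _ <-] := hv i; exists ((c i, j) :: s).
  by rewrite /fsum big_cons.
by exists s; rewrite -es.
Qed.

Hypothesis C0 : 0 <= C.
Hypothesis bd : forall s, rnorm (fsum b s) <= C * rnorm (fsum tau s).

(** The value at [x] is characterized rather than computed: it is the [w] whose distance to [b(s)]
    is at most [C] times the distance of [x] to [tau(s)], for every formal combination [s]. The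
    bound, the values on [tau] and linearity all follow from this condition, and relations among the
    [tau i] need no separate treatment. *)
Lemma extension : exists h : V -> W,
  [/\ linear h, forall x, rnorm (h x) <= C * rnorm x & forall i, h (tau i) = b i].
Proof.
have bd2 s t : rnorm (fsum b s - fsum b t) <= C * rnorm (fsum tau s - fsum tau t).
  by have := bd (s ++ fscale (-1) t); rewrite !fsum_cat !fsum_scale !scaleN1r.
have ex x : exists w, forall s, rnorm (w - fsum b s) <= C * rnorm (x - fsum tau s).
  have [s hs] := choice (fun n : nat => fsum_dense x (e := n.+1%:R^-1) (ltac:(by rewrite invr_gt0))).
  have inv_small (e : R) : 0 < e -> exists N, forall n, (N <= n)%N -> (n.+1%:R)^-1 <= e.
    move=> e0; exists (Num.bound e^-1) => n nN.
    rewrite -[e]invrK lef_pV2 ?posrE ?invr_gt0 //.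
    apply: (le_trans (ltW (archi_boundP _))); first by rewrite invr_ge0 ltW.
    by rewrite ler_nat leqW.
  have k0 : 0 < C + 1 by exact: ltr_wpDl.
  have [|w hw] := complete_seq (u := fun n => fsum b (s n)).
    move=> e e0; have [|N hN] := inv_small (e / 2 / (C + 1)); first by rewrite !divr_gt0.
    exists N => n nN; have h1 := hs n; have h2 := hs N; have h3 := bd2 (s n) (s N).
    have h4 := hN n nN; have h5 := hN N (leqnn _).
    have h6 := rnorm_tri (fsum tau (s n)) (fsum tau (s N)) x.
    rewrite (rnormBC _ x) in h6.
    have h7 : rnorm (fsum tau (s n) - fsum tau (s N)) <= e / (C + 1).
      apply: (le_trans h6); apply: le_trans (lerD (le_trans h1 h4) (le_trans h2 h5)) _.
      by rewrite le_eqVlt; apply/orP; left; apply/eqP; field; rewrite gt_eqF.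
    move: h7; rewrite ler_pdivlMr //.
    by have := rnorm_ge0 (fsum tau (s n) - fsum tau (s N)); nra.
  exists w => t; apply/ler_addgt0Pl => e e0.
  have e2 : 0 < e / 2 by lra.
  have [N1 h1] := hw _ e2; have [|N2 h2] := inv_small (e / 2 / (C + 1)); first by rewrite !divr_gt0.
  set n := maxn N1 N2; have {}h1 := h1 n (leq_maxl _ _); have {}h2 := h2 n (leq_maxr _ _).
  have h3 := rnorm_tri w (fsum b t) (fsum b (s n)); rewrite (rnormBC w (fsum b (s n))) in h3.
  have C0' := C0.
  have h4 := bd2 (s n) t; have h5 := rnorm_tri (fsum tau (s n)) (fsum tau t) x.
  rewrite (rnormBC _ x) in h5.
  have : rnorm (x - fsum tau (s n)) <= e / 2 / (C + 1) by apply: le_trans h2; exact: hs.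
  rewrite ler_pdivlMr // => h6.
  have := rnorm_ge0 (x - fsum tau (s n)) => h7.
  have : C * rnorm (fsum tau (s n) - fsum tau t) <=
         C * (rnorm (x - fsum tau (s n)) + rnorm (x - fsum tau t)) by rewrite ler_wpM2l.
  by lra.
have [h hh] := choice ex; exists h; split.
- move=> c x y; apply/eqP; rewrite -subr_eq0; apply/eqP; apply: rnorm_eps => e e0.
  have cc := cabs_ge0 c; have C0' := C0; pose K := 2 * (C + 1) * (cabs c + 1).
  have K0 : 0 < K by rewrite !mulr_gt0 //; lra.
  have [d d0 eK] : exists2 d, 0 < d & e = 2 * K * d.
    by exists (e / (2 * K)); [rewrite divr_gt0 // mulr_gt0|field; rewrite gt_eqF].
  have [s hs] := fsum_dense x d0; have [t ht] := fsum_dense y d0.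
  have h1 := hh (c *: x + y) (fscale c s ++ t); rewrite !fsum_cat !fsum_scale in h1.
  have h2 := hh x s; have h3 := hh y t.
  have -> : h (c *: x + y) - (c *: h x + h y) =
    (h (c *: x + y) - (c *: fsum b s + fsum b t)) - (c *: (h x - fsum b s) + (h y - fsum b t)).
    by lmod.
  have h4 : rnorm (c *: x + y - (c *: fsum tau s + fsum tau t)) <= cabs c * d + d.
    have -> : c *: x + y - (c *: fsum tau s + fsum tau t) = c *: (x - fsum tau s) + (y - fsum tau t) by lmod.
    by rewrite (le_trans (rnormD _ _)) // rnormZ lerD // ler_wpM2l.
  have h5 : rnorm (c *: (h x - fsum b s) + (h y - fsum b t)) <= cabs c * (C * d) + C * d.
    rewrite (le_trans (rnormD _ _)) // rnormZ lerD //.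
      by rewrite ler_wpM2l // (le_trans h2) // ler_wpM2l.
    by rewrite (le_trans h3) // ler_wpM2l.
  rewrite (le_trans (rnormB _ _)) // (le_trans (lerD h1 h5)) //.
  have h6 : C * rnorm (c *: x + y - (c *: fsum tau s + fsum tau t)) <= C * (cabs c * d + d).
    by rewrite ler_wpM2l.
  apply: (le_trans (lerD h6 (lexx _))); rewrite eK /K.
  have k1 : 0 <= C * d by rewrite mulr_ge0 ?(ltW d0).
  have k2 : 0 <= cabs c * d by rewrite mulr_ge0 ?(ltW d0).
  have k3 : 0 <= cabs c * (C * d) by rewrite mulr_ge0.
  by lra.
- by move=> x; have := hh x [::]; rewrite /fsum !big_nil !subr0.
- move=> i; have := hh (tau i) [:: (1, i)]; rewrite !fsum1 subrr rnorm0 mulr0.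
  by move/rnorm_le0/eqP; rewrite subr_eq0 => /eqP.
Qed.
End Extension.

Section Neumann.
Variables (V : completeNormedModType R[i]) (K : V -> V) (t l : R).
Hypotheses (lK : linear K) (t0 : 0 <= t) (l0 : 0 < l) (bK : forall x, rnorm (K x) <= t * rnorm x).

Lemma neumann_bd x : l * rnorm x <= rnorm ((l + t)%:C *: x - K x).
Proof.
have := rnormD ((l + t)%:C *: x - K x) (K x); rewrite subrK rnormZr ger0_norm; last exact: addr_ge0 (ltW l0) t0.
by have := bK x; lra.
Qed.
(** For [K = t - a] with [bdpos t a], the operator [(l + t) - K] is [l + a]: this supplies the
    resolvents of positive elements. The equation is the fixed point of a contraction of ratio
    [t / (l + t)], and [neumann_bd] bounds the inverse by [1 / l]. *)
Lemma neumann x : exists y, (l + t)%:C *: y - K y = x.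
Proof.
have t0' := t0; have l0' := l0; have s0 : 0 < l + t by lra.
pose f y := ((l + t)^-1)%:C *: (x + K y).
pose u n := iter n f 0; pose q := t / (l + t).
have q0 : 0 <= q by rewrite divr_ge0 // ltW.
have q1 : 0 < 1 - q by rewrite subr_gt0 ltr_pdivrMr //; lra.
have fB y y' : f y - f y' = ((l + t)^-1)%:C *: K (y - y') by rewrite linB // /f; lmod.
have fq y y' : rnorm (f y - f y') <= q * rnorm (y - y').
  rewrite fB rnormZr ger0_norm ?invr_ge0 ?(ltW s0) // /q (mulrC t) -mulrA.
  by rewrite ler_wpM2l ?invr_ge0 ?(ltW s0).
pose c := rnorm (u 1%N - u 0%N).
have [||y uy] := complete_mono (u := u) (d := fun n => c / (1 - q) * (1 - q ^+ n)) (M := c / (1 - q)).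
- move=> n; rewrite -mulrBr.
  have -> : c / (1 - q) * (1 - q ^+ n.+1 - (1 - q ^+ n)) = c * q ^+ n.
    by rewrite exprS; field; rewrite gt_eqF.
  elim: n => [|n IH]; first by rewrite mulr1.
  by rewrite (le_trans (fq _ _)) // exprS mulrCA ler_wpM2l.
- move=> n; rewrite ler_piMr ?divr_ge0 ?rnorm_ge0 ?(ltW q1) // gerBl exprn_ge0 //.
exists y; have fy : slim (fun n => f (u n)) (f y).
  by apply: (slim_bound (K := q) uy) => n; exact: fq.
have e : f y = y := slim_unique fy (slim_shift uy).
rewrite -{1}e /f scalerA -rmorphM mulfV ?gt_eqF // scale1r addrK //.
Qed.
End Neumann.
End Spans.

(** * Hilbert modules *)

Section Modules.
Context (R : realType).
Implicit Types A B C : cstarAlg R.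

Section OneModule.
Context (A B : cstarAlg R) (X : preCorr A B).
Implicit Types (x y z : X) (a : A) (b : B).

Lemma ipNl x y : ip (- x) y = - ip x y.
Proof. by rewrite -scaleN1r ip_scalel rmorphN rmorph1 scaleN1r. Qed.
Lemma ipNr x y : ip x (- y) = - ip x y.
Proof. by rewrite -scaleN1r ip_scaler scaleN1r. Qed.
Lemma ractDl x y b : ract (x + y) b = ract x b + ract y b.
Proof. exact: (linD (ract_linearl b)). Qed.
Lemma ractDr x b c : ract x (b + c) = ract x b + ract x c.
Proof. exact: (linD (ract_linearr x)). Qed.
Lemma ractZl (k : R[i]) x b : ract (k *: x) b = k *: ract x b.
Proof. exact: (linZ (ract_linearl b)). Qed.
Lemma ractZr (k : R[i]) x b : ract x (k *: b) = k *: ract x b.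
Proof. exact: (linZ (ract_linearr x)). Qed.
Lemma ractNl x b : ract (- x) b = - ract x b.
Proof. exact: (linN (ract_linearl b)). Qed.
Lemma ractNr x b : ract x (- b) = - ract x b.
Proof. exact: (linN (ract_linearr x)). Qed.
Lemma lactDl a a' x : lact (a + a') x = lact a x + lact a' x.
Proof. exact: (linD (lact_linearl x)). Qed.
Lemma lactDr a x y : lact a (x + y) = lact a x + lact a y.
Proof. exact: (linD (@lact_linear _ _ _ X a)). Qed.
Lemma lactZl (k : R[i]) a x : lact (k *: a) x = k *: lact a x.
Proof. exact: (linZ (lact_linearl x)). Qed.
Lemma lactZr (k : R[i]) a x : lact a (k *: x) = k *: lact a x.
Proof. exact: (linZ (@lact_linear _ _ _ X a)). Qed.
Lemma lactNl a x : lact (- a) x = - lact a x.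
Proof. exact: (linN (lact_linearl x)). Qed.
Lemma lactNr a x : lact a (- x) = - lact a x.
Proof. exact: (linN (@lact_linear _ _ _ X a)). Qed.

Lemma lact0l x : lact (0 : A) x = 0. Proof. exact: (lin0 (lact_linearl x)). Qed.
Lemma lact0r a : lact a (0 : X) = 0. Proof. exact: (lin0 (@lact_linear _ _ _ X a)). Qed.

Definition ipE := (ip_addl, ip_addr, ip_scalel, ip_scaler, ipNl, ipNr).
Definition ractE := (ractDl, ractDr, ractZl, ractZr, ractNl, ractNr).
Definition lactE := (lactDl, lactDr, lactZl, lactZr, lactNl, lactNr).

Lemma ip_ractl x y b : ip (ract x b) y = cmul (cadj b) (ip x y).
Proof. by rewrite -ip_adj ip_ract cadjM ip_adj. Qed.
Lemma rnorm_ip x : rnorm (ip x x) = rnorm x ^+ 2.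
Proof. by apply: complexI; rewrite rmorphXn /= -!rnormE ip_norm. Qed.
Lemma rnorm_lact a x : rnorm (lact a x) <= rnorm a * rnorm x.
Proof. by have := lact_norm a x; rewrite !rnormE -rmorphM lecR. Qed.
Lemma rnorm_ract x b : rnorm (ract x b) <= rnorm x * rnorm b.
Proof. by have := ract_bounded x b; rewrite !rnormE -rmorphM lecR. Qed.
Lemma rnorm_ip8 x y : rnorm (ip x y) <= 8 * rnorm x * rnorm y.
Proof.
have := ip_bounded x y; rewrite !rnormE -rmorphM -(rmorph_nat (real_complex R)) -rmorphM lecR.
by rewrite mulrA.
Qed.
Lemma ip0_eq0 z : (forall w, ip w z = 0) -> z = 0.
Proof.
by move=> h; apply: rnorm0_eq0; apply/eqP; rewrite -sqrf_eq0 -rnorm_ip h rnorm0.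
Qed.
Lemma ip_eq z z' : (forall w, ip w z = ip w z') -> z = z'.
Proof.
move=> h; apply/eqP; rewrite -subr_eq0; apply/eqP; apply: ip0_eq0 => w.
by rewrite !ipE h subrr.
Qed.

Lemma blin_lact a : blin (@lact _ _ _ X a).
Proof.
split; first exact: lact_linear.
by exists (rnorm a); [exact: rnorm_ge0|exact: rnorm_lact].
Qed.
Lemma blin_lactl x : blin (fun a => lact a x).
Proof.
split; first exact: lact_linearl.
exists (rnorm x); first exact: rnorm_ge0.
by move=> a; rewrite mulrC rnorm_lact.
Qed.
Lemma blin_ract b : blin (fun x => ract x b).
Proof.
split; first exact: ract_linearl.
exists (rnorm b); first exact: rnorm_ge0.
by move=> x; rewrite mulrC rnorm_ract.
Qed.
Lemma blin_ractr x : blin (ract x).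
Proof.
split; first exact: ract_linearr.
by exists (rnorm x); [exact: rnorm_ge0|exact: rnorm_ract].
Qed.
Lemma blin_ip x : blin (ip x).
Proof.
split; first exact: ip_linear.
exists (8 * rnorm x); first by rewrite mulr_ge0 ?rnorm_ge0.
by move=> y; rewrite rnorm_ip8.
Qed.

Definition posc := forall x, Pos (ip x x).

Lemma posc_cs : posc -> forall x y, rnorm (ip x y) <= rnorm x * rnorm y.
Proof.
move=> pX x y; rewrite -(@ler_pXn2r _ 2) ?nnegrE ?mulr_ge0 ?rnorm_ge0 //.
rewrite exprMn -!rnorm_ip; apply: cauchy_schwarz_gen; first exact: ip_adj.
move=> b; have := pX (y - ract x b).
by rewrite !(ipE, ip_ract, ip_ractl) ip_adj -cmulA; congr Pos; lmod.
Qed.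
End OneModule.

Lemma blin_cmul A (a : A) : blin (cmul a).
Proof.
split; first exact: cmul_linearr.
by exists (rnorm a); [exact: rnorm_ge0|exact: rnormM].
Qed.
Lemma blin_cmulr A (b : A) : blin (fun a => cmul a b).
Proof.
split; first exact: cmul_linearl.
exists (rnorm b); first exact: rnorm_ge0.
by move=> a; rewrite mulrC rnormM.
Qed.

Lemma star_hom_norm A B (f : A -> B) : star_hom f -> forall a, rnorm (f a) <= rnorm a.
Proof. by move=> [_ _ _ h] a; have := h a; rewrite !rnormE lecR. Qed.
Lemma star_hom_blin A B (f : A -> B) : star_hom f -> blin f.
Proof.
move=> hf; split; first by case: hf.
by exists 1 => // a; rewrite mul1r star_hom_norm.
Qed.
Lemma star_hom_id A : star_hom (fun a : A => a).
Proof. by split. Qed.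
(* positivity is detected by the operator norm, so it passes to subalgebras *)
Lemma Pos_reflect A B (f : A -> B) a : star_hom f -> (forall a, rnorm (f a) = rnorm a) ->
  Pos (f a) -> Pos a.
Proof.
move=> hf nf Pfa; have [lf fM fa _] := hf.
split.
  apply/eqP; rewrite -subr_eq0; apply/eqP; apply: rnorm0_eq0.
  by rewrite -nf linB // fa (Pos_sa Pfa) subrr rnorm0.
have [_ [t t0 ht]] := Pfa; exists t => // x.
by rewrite -!nf linB // linZ // fM.
Qed.

Lemma lin_fsum (V W : lmodType R[i]) (f : V -> W) I (g : I -> V) s : linear f ->
  f (fsum g s) = fsum (fun i => f (g i)) s.
Proof. by move=> lf; rewrite /fsum linS //; apply: eq_bigr => p _; rewrite linZ. Qed.

(** * Maps that preserve Gram matrices up to a homomorphism of the coefficients *)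

Section Gram.
Context (A A' B B' : cstarAlg R) (Z : preCorr A B) (V : preCorr A' B') (rho : B -> B').
Hypothesis hrho : star_hom rho.

Lemma sesqui (h : Z -> V) (S : set Z) : blin h -> (forall z, cspan S z) ->
  (forall z z', S z -> S z' -> ip (h z) (h z') = rho (ip z z')) ->
  forall z z', ip (h z) (h z') = rho (ip z z').
Proof.
move=> bh tS hS.
have [lr _ ra _] := hrho.
have h1 z : S z -> forall z', ip (h z) (h z') = rho (ip z z').
  move=> Sz z'; apply: (@blin_ext _ _ _ S (fun z' => ip (h z) (h z')) (fun z' => rho (ip z z'))) => //.
  - by apply: blin_comp; [exact: blin_ip|].
  - by apply: blin_comp; [exact: star_hom_blin|exact: blin_ip].
  - by move=> w Sw; exact: hS.
move=> z z'; apply: (@blin_ext _ _ _ S (fun z' => ip (h z) (h z')) (fun z' => rho (ip z z'))) => //.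
- by apply: blin_comp; [exact: blin_ip|].
- by apply: blin_comp; [exact: star_hom_blin|exact: blin_ip].
- by move=> w Sw; rewrite -ip_adj h1 // -ra ip_adj.
Qed.

(** Linearity over the coefficients is automatic: the inner square of the difference of the two
    sides expands to zero. *)
Lemma gram_ract (h : Z -> V) : linear h -> (forall z z', ip (h z) (h z') = rho (ip z z')) ->
  forall z b, h (ract z b) = ract (h z) (rho b).
Proof.
move=> lh hh z b; have [lr rM ra _] := hrho.
apply/eqP; rewrite -subr_eq0; apply/eqP; apply: rnorm0_eq0; apply/eqP.
rewrite -sqrf_eq0 -rnorm_ip !(ipE, ip_ract, ip_ractl) !hh !(ip_ract, ip_ractl) !rM ra.
rewrite (_ : _ + _ = 0) ?rnorm0 //; by rewrite !(cmulNr, cmulA); lmod.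
Qed.

Lemma gram_norm (h : Z -> V) : (forall z z', ip (h z) (h z') = rho (ip z z')) ->
  forall z, rnorm (h z) <= rnorm z.
Proof.
move=> hh z; rewrite -(@ler_pXn2r _ 2) ?nnegrE ?rnorm_ge0 // -!rnorm_ip hh.
exact: star_hom_norm.
Qed.

(** Matching Gram matrices bound [b(s)] by [tau(s)] on formal combinations because [rho] is
    contractive. The twist [rho] is there for the operators [U z], which cover the gauge action on
    the coefficients. *)
Lemma gram_ext I (tau : I -> Z) (b : I -> V) : (forall z, cspan (range tau) z) ->
  (forall i j, ip (b i) (b j) = rho (ip (tau i) (tau j))) ->
  exists h : Z -> V, [/\ blin h, forall i, h (tau i) = b i,
    forall z z', ip (h z) (h z') = rho (ip z z') &
    forall z c, h (ract z c) = ract (h z) (rho c)].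
Proof.
move=> tt gr; have [lr _ ra _] := hrho.
have e1 i t : ip (b i) (fsum b t) = rho (ip (tau i) (fsum tau t)).
  rewrite !(lin_fsum _ _ (ip_linear _)) (lin_fsum _ _ lr).
  by congr (fsum _ t); apply/funext => j.
have e2 s t : ip (fsum b s) (fsum b t) = rho (ip (fsum tau s) (fsum tau t)).
  rewrite (lin_fsum _ _ (ip_linear (fsum b s))) (lin_fsum _ _ (ip_linear (fsum tau s))) (lin_fsum _ _ lr).
  by congr (fsum _ t); apply/funext => j; rewrite -ip_adj e1 -ra ip_adj.
have [|h [lh nh hb]] := extension tt ler01 (b := b).
  move=> s; rewrite mul1r -(@ler_pXn2r _ 2) ?nnegrE ?rnorm_ge0 // -!rnorm_ip e2.
  exact: star_hom_norm.
have bh : blin h by split=> //; exists 1.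
have hh : forall z z', ip (h z) (h z') = rho (ip z z').
  by apply: (sesqui bh tt) => _ _ [i _ <-] [j _ <-]; rewrite !hb gr.
by exists h; split => //; exact: gram_ract.
Qed.
End Gram.

Lemma isom_surj (V W : completeNormedModType R[i]) (h : V -> W) : linear h ->
  (forall z, rnorm (h z) = rnorm z) -> (forall w, cspan (range h) w) ->
  forall w, exists z, h z = w.
Proof.
move=> lh nh tt w; apply: (@cspan_min _ _ (range h) (fun w => exists z, h z = w) _ _ w (tt w)) => [|_ [z _ <-]]; last by exists z.
split; first by exists 0; rewrite lin0.
- by move=> c _ _ [x <-] [y <-]; exists (c *: x + y); rewrite lh.
- move=> x hx; have hn (n : nat) : exists z, rnorm (x - h z) <= n.+1%:R^-1.
    by have [|_ [z <-] xz] := hx n.+1%:R^-1; [rewrite invr_gt0|exists z].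
  have [u hu] := choice hn.
  have inv_small (e : R) : 0 < e -> exists N, forall n, (N <= n)%N -> (n.+1%:R)^-1 <= e.
    move=> e0; exists (Num.bound e^-1) => n nN.
    rewrite -[e]invrK lef_pV2 ?posrE ?invr_gt0 //.
    apply: (le_trans (ltW (archi_boundP _))); first by rewrite invr_ge0 ltW.
    by rewrite ler_nat leqW.
  have hux : slim (fun n => h (u n)) x.
    by move=> e /inv_small[N hN]; exists N => n nN; rewrite rnormBC (le_trans (hu n)) // hN.
  have [|z uz] := complete_seq (u := u).
    move=> e e0; have e2 : 0 < e / 2 by lra.
    have [N hN] := hux _ e2; exists N => n nN; rewrite -nh linB //.
    have := hN n nN; have := hN N (leqnn _); have := rnorm_tri (h (u n)) (h (u N)) x.
    by rewrite (rnormBC x); lra.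
  exists z; apply: (slim_unique (u := fun n => h (u n))) => //.
  by apply: (slim_bound (K := 1) uz) => n; rewrite mul1r -linB // nh.
Qed.

Lemma cspan_range (V W : completeNormedModType R[i]) I (tau : I -> V) (h : V -> W) (b : I -> W) :
  (forall i, h (tau i) = b i) -> (forall w, cspan (range b) w) -> forall w, cspan (range h) w.
Proof.
by move=> hb tb w; apply: (cspan_mono _ (tb w)) => _ [i _ <-]; exists (tau i).
Qed.

Lemma gram_isom A A' B (Z : preCorr A B) (V : preCorr A' B) (h : Z -> V) :
  (forall z z', ip (h z) (h z') = ip z z') -> forall z, rnorm (h z) = rnorm z.
Proof.
move=> hh z; apply/eqP; rewrite -(@eqrXn2 _ 2) ?rnorm_ge0 //.
by rewrite -!rnorm_ip hh.
Qed.

(** [af] records how [A] moves the indices, so that left linearity too is compared on the total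
    families only. *)
Lemma unitary_ext A B (Z V : preCorr A B) I (tau : I -> Z) (b : I -> V) (af : A -> I -> I) :
  (forall z, cspan (range tau) z) -> (forall z, cspan (range b) z) ->
  (forall i j, ip (b i) (b j) = ip (tau i) (tau j)) ->
  (forall a i, lact a (tau i) = tau (af a i)) -> (forall a i, lact a (b i) = b (af a i)) ->
  exists h : Z -> V, unitary h /\ forall i, h (tau i) = b i.
Proof.
move=> tt tb gr at_ ab; have [h [bh hb hh hr]] := gram_ext (star_hom_id B) tt gr.
exists h; split=> //; split => //.
- exact: blin_lin.
- move=> a x; apply: (@blin_ext _ _ _ (range tau) (fun x => h (lact a x)) (fun x => lact a (h x))) => //.
  + by apply: blin_comp => //; exact: blin_lact.
  + by apply: blin_comp => //; exact: blin_lact.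
  + by move=> _ [i _ <-]; rewrite at_ !hb ab.
- apply: isom_surj; [exact: blin_lin|exact: gram_isom|exact: cspan_range hb tb].
Qed.

Lemma unitary_blin A B (X Y : preCorr A B) (f : X -> Y) : unitary f -> blin f.
Proof.
move=> [lf _ _ fi _]; split=> //; exists 1 => // x; rewrite mul1r.
by rewrite (gram_isom fi).
Qed.
Lemma unitary_inj A B (X Y : preCorr A B) (f : X -> Y) : unitary f -> injective f.
Proof.
move=> [lf _ _ fi _] x y fxy; apply/eqP; rewrite -subr_eq0; apply/eqP; apply: rnorm0_eq0.
by rewrite -(gram_isom fi) linB // fxy subrr rnorm0.
Qed.
Lemma unitary_id A B (X : preCorr A B) : unitary (fun x : X => x).
Proof. by split=> // y; exists y. Qed.
Lemma unitary_comp A B (X Y Z : preCorr A B) (g : Y -> Z) (f : X -> Y) :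
  unitary g -> unitary f -> unitary (fun x => g (f x)).
Proof.
move=> [lg gl gr gi gs] [lf fl fr fi fs]; split.
- by move=> c x y; rewrite lf lg.
- by move=> a x; rewrite fl gl.
- by move=> x b; rewrite fr gr.
- by move=> x y; rewrite gi fi.
- by move=> z; have [y <-] := gs z; have [x <-] := fs y; exists x.
Qed.
Lemma unitary_inv A B (X Y : preCorr A B) (f : X -> Y) : unitary f ->
  exists g : Y -> X, [/\ unitary g, forall x, g (f x) = x & forall y, f (g y) = y].
Proof.
move=> uf; have [lf fl fr fi fs] := uf; have finj := unitary_inj uf.
have [g gK] := choice fs; exists g; split => //; last by move=> x; exact: finj.
split.
- by move=> c x y; apply: finj; rewrite lf !gK.
- by move=> a x; apply: finj; rewrite fl !gK.
- by move=> x b; apply: finj; rewrite fr !gK.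
- by move=> x y; rewrite -fi !gK.
- by move=> x; exists (f x); apply: finj.
Qed.
End Modules.

(** * Approximate units and factorization *)

Section ApproximateUnit.
Context (R : realType) (A : cstarAlg R).
Implicit Types a e f x y : A.

(* [|1 - e| <= 1] in the unitization *)
Definition ctr e := forall x, rnorm (x - cmul e x) <= rnorm x.

Lemma ctr_norm e x : ctr e -> rnorm (cmul e x) <= 2 * rnorm x.
Proof.
move=> ce; have -> : cmul e x = x - (x - cmul e x) by lmod.
by have := rnormB x (x - cmul e x); have := ce x; lra.
Qed.
Lemma ctr_norm2 e : ctr e -> rnorm e <= 2.
Proof. by move=> ce; apply: rnorm_op => // x; exact: ctr_norm. Qed.

(** [e = h (l + h)^{-1}] for [h = a a^*]. With [x = a - e a], [x x^*] is [l] times [e^* - e e^*], of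
    norm at most [l (2 + 4)] by the crude bound [|e| <= 2]; this is the origin of [l = d^2 / 6]. *)
Lemma ctr_one a (d : R) : 0 < d -> exists2 e, ctr e & rnorm (a - cmul e a) <= d.
Proof.
move=> d0; pose h := cmul a (cadj a); have Ph : Pos h.
  by rewrite /h -{1}[a]cadjK; exact: Pos_adj_mul.
have [_ [t t0 bt]] := Ph; pose l := d ^+ 2 / 6; have l0 : 0 < l by rewrite divr_gt0 ?exprn_gt0.
pose K y := t%:C *: y - cmul h y.
have lK : linear K by move=> c x y; rewrite /K !cE; lmod.
have hK x : (l + t)%:C *: x - K x = l%:C *: x + cmul h x by rewrite /K rmorphD; lmod.
have low y : l * rnorm y <= rnorm (l%:C *: y + cmul h y).
  by rewrite -hK; apply: neumann_bd => //; exact: ltW.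
have [e] := neumann lK (ltW t0) l0 bt h; rewrite hK => he.
have inj y : l%:C *: y + cmul h y = 0 -> y = 0.
  move=> y0; apply: rnorm_le0; have := low y; rewrite y0 rnorm0 => h0.
  by rewrite -(ler_pM2l l0) mulr0.
have comm : cmul h e = cmul e h.
  apply/eqP; rewrite -subr_eq0; apply/eqP; apply: inj.
  have h1 : cmul h e = h - l%:C *: e by rewrite -{2}he; lmod.
  have h2 : cmul h (cmul e h) = cmul h h - l%:C *: cmul e h.
    by rewrite cmulA h1 !cE.
  have h3 : cmul h (cmul h e) = cmul h h - l%:C *: cmul h e by rewrite {1}h1 !cE.
  by rewrite cmulDr cmulNr h3 h2; lmod.
have ce : ctr e.
  move=> x; rewrite -(ler_pM2l l0) (le_trans (low _)) //.
  have -> : l%:C *: (x - cmul e x) + cmul h (x - cmul e x) = l%:C *: x.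
    rewrite !cE cmulA.
    have -> : cmul (cmul h e) x = cmul h x - l%:C *: cmul e x by rewrite -{2}he !cE; lmod.
    by lmod.
  by rewrite rnormZr gtr0_norm.
exists e => //; set x := a - cmul e a.
have xx : cmul x (cadj x) = l%:C *: (cadj e - cmul e (cadj e)).
  have eh : cmul e h = h - l%:C *: e by rewrite -comm -{2}he; lmod.
  have hee : cmul (cmul e a) (cadj a) = h - l%:C *: e by rewrite -cmulA.
  have he' : cmul a (cmul (cadj a) (cadj e)) = h - l%:C *: cadj e.
    have := congr1 (@cadj _ _) eh; rewrite !cadjE => h1.
    by rewrite cmulA h1.
  rewrite /x !cadjE !cE he' hee -(cmulA e) he' !cE eh.
  have -> : cmul a (cadj a) = h by [].
  by lmod.
rewrite -(@ler_pXn2r _ 2) ?nnegrE ?rnorm_ge0 ?(ltW d0) // -rnormCr xx rnormZr gtr0_norm //.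
have e2 := ctr_norm2 ce; have := rnormB (cadj e) (cmul e (cadj e)).
have := ctr_norm (cadj e) ce; rewrite rnorm_adj => h1 h2.
have : rnorm (cadj e - cmul e (cadj e)) <= 6 by lra.
move=> h3; have -> : d ^+ 2 = l * 6 by rewrite /l; lra.
by rewrite ler_wpM2l // ltW.
Qed.

(** [1 - ccomp e f = (1 - e) (1 - f)]. *)
Definition ccomp e f := e + f - cmul e f.
Lemma ctr_comp e f : ctr e -> ctr f -> ctr (ccomp e f).
Proof.
move=> ce cf x; have -> : x - cmul (ccomp e f) x = (x - cmul f x) - cmul e (x - cmul f x).
  by rewrite /ccomp !cE cmulA; lmod.
by rewrite (le_trans (ce _)).
Qed.
Lemma ctr0 : ctr 0.
Proof. by move=> x; rewrite cmul0l subr0. Qed.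

Context (B : cstarAlg R) (V : preCorr A B).
Implicit Types v w : V.

Lemma ccompE e f v : v - lact (ccomp e f) v = (v - lact f v) - lact e (v - lact f v).
Proof. by rewrite /ccomp !lactE lactM; lmod. Qed.

(** The element [d = e + e^* - e^* e] is positive in [A], since [1 - d] is the product of [1 - e]
    and its adjoint, both contractions. With [d = k^2], the defect [<v, v> - <v - e v, v - e v>]
    equals [<k v, k v>]. *)
Lemma ctr_lact e v : posc V -> ctr e -> rnorm (v - lact e v) <= rnorm v.
Proof.
move=> pV ce; pose d := e + cadj e - cmul (cadj e) e.
have ce' x : rnorm (x - cmul (cadj e) x) <= rnorm x.
  set y := x - _; have [->|y0] := eqVneq (rnorm y) 0; first exact: rnorm_ge0.
  have yp : 0 < rnorm y by rewrite lt_neqAle rnorm_ge0 eq_sym y0.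
  rewrite -(ler_pM2r yp) -[X in X <= _]expr2 -rnormC.
  have -> : cmul (cadj y) y = cmul (cadj x) (y - cmul e y).
    have -> : cadj y = cadj x - cmul (cadj x) e by rewrite /y !cadjE.
    by rewrite [LHS](cmulDl (cadj x) _ y) cmulNl [in RHS](cmulDr (cadj x) y) cmulNr cmulA.
  by rewrite (le_trans (rnormM _ _)) // rnorm_adj ler_wpM2l ?rnorm_ge0.
have Pd : Pos d.
  split; first by rewrite /d !cadjE (addrC e).
  exists 1 => // x; rewrite mul1r.
  have -> : 1%:C *: x - cmul d x = (x - cmul e x) - cmul (cadj e) (x - cmul e x).
    by rewrite /d !cE rmorph1 cmulA; lmod.
  by rewrite (le_trans (ce' _)).
have [k [[hk _] kk _]] := Pos_sqrt Pd.
rewrite -(@ler_pXn2r _ 2) ?nnegrE ?rnorm_ge0 // -!rnorm_ip; apply: Pos_mono; first exact: pV.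
have -> : ip v v - ip (v - lact e v) (v - lact e v) = ip (lact k v) (lact k v).
  by rewrite lact_adj hk -lactM kk /d !(ipE, lactE, lact_adj, lactM); lmod.
exact: pV.
Qed.

Definition nondeg := forall v, cspan [set lact a w | a in [set: A] & w in [set: V]] v.

Hypotheses (pV : posc V) (nV : nondeg).

(** The prior element [e1] makes the property stable under sums: the unit for [y] is chosen after
    the one for [x] has been applied, and the contraction [1 - e3] does not spoil what was gained
    for [x]. *)
Lemma approx_unit1 v (d : R) e1 : 0 < d -> ctr e1 ->
  exists2 e, ctr e & rnorm (v - lact e1 v - lact e (v - lact e1 v)) <= d.
Proof.
pose P (v : V) := forall (d : R) e1, 0 < d -> ctr e1 ->
  exists2 e, ctr e & rnorm (v - lact e1 v - lact e (v - lact e1 v)) <= d.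
suff : P v by apply.
move=> {d e1}.
have Pc : lin_closed P.
  split.
  - move=> d e1 d0 _; exists 0; first exact: ctr0.
    by rewrite lact0r subrr lact0r subr0 rnorm0 ltW.
  - move=> c x y hx hy d e1 d0 c1; have k0 : 0 < cabs c + 1 by have := cabs_ge0 c; lra.
    have [|e2 c2 h2] := hx (d / 2 / (cabs c + 1)) e1 _ c1; first by rewrite !divr_gt0.
    have c21 := ctr_comp c2 c1.
    have [|e3 c3 h3] := hy (d / 2) _ _ c21; first by lra.
    exists (ccomp e3 e2); first exact: ctr_comp.
    move: h3; rewrite !ccompE => h3.
    set T := fun v : V => v - lact e1 v; set T2 := fun v : V => v - lact e2 v.
    set T3 := fun v : V => v - lact e3 v.
    have -> : c *: x + y - lact e1 (c *: x + y) = c *: T x + T y by rewrite /T !lactE; lmod.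
    have -> : c *: T x + T y - lact e2 (c *: T x + T y) = c *: T2 (T x) + T2 (T y).
      by rewrite /T2 !lactE; lmod.
    have -> : c *: T2 (T x) + T2 (T y) - lact e3 (c *: T2 (T x) + T2 (T y)) =
       c *: T3 (T2 (T x)) + T3 (T2 (T y)) by rewrite /T3 !lactE; lmod.
    rewrite (le_trans (rnormD _ _)) // rnormZ.
    have h4 : rnorm (T3 (T2 (T x))) <= rnorm (T2 (T x)) by exact: ctr_lact.
    have h5 : rnorm (T2 (T x)) * (cabs c + 1) <= d / 2 by rewrite -ler_pdivlMr.
    have := rnorm_ge0 (T2 (T x)); have := cabs_ge0 c; rewrite -/(T y) -/(T2 (T y)) -/(T3 _) in h3.
    have := ler_wpM2l (cabs_ge0 c) h4; lra.
  - move=> x hx d e1 d0 c1; have d3 : 0 < d / 2 by lra.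
    have [y hy xy] := hx _ d3; have [e c h] := hy _ _ d3 c1; exists e => //.
    have -> : x - lact e1 x - lact e (x - lact e1 x) =
      (y - lact e1 y - lact e (y - lact e1 y)) + ((x - y) - lact e1 (x - y) - lact e ((x - y) - lact e1 (x - y))).
      by rewrite !lactE; lmod.
    rewrite (le_trans (rnormD _ _)) //.
    have := ctr_lact (x - y) pV c1; have := ctr_lact ((x - y) - lact e1 (x - y)) pV c; lra.
suff PS : forall z, [set lact a w | a in [set: A] & w in [set: V]] z -> P z.
  exact: (cspan_min Pc PS (@nV v)).
move=> _ [a _ [w _ <-]] d e1 d0 c1.
have k0 : 0 < rnorm w + 1 by have := rnorm_ge0 w; lra.
have [e ce he] := ctr_one (a - cmul e1 a) (divr_gt0 d0 k0).
exists e => //.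
have -> : lact a w - lact e1 (lact a w) - lact e (lact a w - lact e1 (lact a w)) =
   lact (a - cmul e1 a - cmul e (a - cmul e1 a)) w.
  by rewrite !(lactDl, lactNl, lactM).
rewrite (le_trans (rnorm_lact _ _)) //.
move: he; rewrite ler_pdivlMr // => he; have := rnorm_ge0 w.
have := rnorm_ge0 (a - cmul e1 a - cmul e (a - cmul e1 a)); nra.
Qed.

Lemma approx_unit (s : seq V) (d : R) : 0 < d ->
  exists2 e, ctr e & forall v, v \in s -> rnorm (v - lact e v) <= d.
Proof.
move=> d0; elim: s => [|v s [e1 c1 h1]]; first by exists 0; [exact: ctr0|].
have [e2 c2 h2] := approx_unit1 v d0 c1.
exists (ccomp e2 e1); first exact: ctr_comp.
move=> w; rewrite inE ccompE => /orP[/eqP -> //|ws].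
by rewrite (le_trans (ctr_lact _ pV c2)) // h1.
Qed.

Lemma approx_unit_one v (d : R) : 0 < d -> exists2 e, ctr e & rnorm (v - lact e v) <= d.
Proof.
by move=> /(approx_unit [:: v])[e ce h]; exists e => //; apply: h; rewrite inE.
Qed.

Let h n : R := 2 ^- n.
Let h0 n : 0 < h n. Proof. by rewrite invr_gt0 exprn_gt0. Qed.
Let hS n : h n.+1 = h n / 2. Proof. by rewrite /h exprS invfM mulrC. Qed.
Let h1 n : h n <= 1. Proof. by rewrite invf_le1 ?exprn_gt0 // exprn_ege1 // ler1n. Qed.
Let h_small (e : R) : 0 < e -> exists N, forall n, (N <= n)%N -> h n <= e.
Proof.
move=> e0; exists (Num.bound e^-1) => n nN; rewrite /h -[e]invrK lef_pV2 ?posrE ?invr_gt0 ?exprn_gt0 //.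
apply: (le_trans (ltW (archi_boundP _))); first by rewrite invr_ge0 ltW.
by rewrite -natrX ler_nat (leq_trans nN) // ltnW // ltn_expl.
Qed.

(** Cohen factorization. One keeps [v = (h n + a_n) y_n] in the unitization, [h n = 2^-n], with
    [a_n] within [1 - h n] of [1 - h n], so that the factor has an inverse of norm at most [2^n].
    For the next step put [a_(n+1) = a_n + h(n+1) e], where [e] fixes [y_n] up to [h n]. Applying
    the new factor to [y_(n+1) - y_n] gives [h(n+1) (y_n - e y_n)], so [y_n] moves by at most [h n].
    Both sequences converge and the scalar part disappears. *)
Lemma cohen v : exists a w, v = lact a w.
Proof.
pose inv n (p : A * V) := v = (h n)%:C *: p.2 + lact p.1 p.2 /\
  forall y : V, rnorm ((1 - h n)%:C *: y - lact p.1 y) <= (1 - h n) * rnorm y.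
have step (np : nat * (A * V)) : exists q, inv np.1 np.2 -> [/\ inv np.1.+1 q,
    rnorm (q.1 - np.2.1) <= 2 * h np.1.+1 & rnorm (q.2 - np.2.2) <= h np.1].
  case: np => n [S y] /=; have [[vE bS]|ni] := pselect (inv n (S, y)); last by exists (0, 0) => /ni.
  have [e ce he] := approx_unit_one y (h0 n).
  pose S' := S + (h n.+1)%:C *: e.
  have bS' (z : V) : rnorm ((1 - h n.+1)%:C *: z - lact S' z) <= (1 - h n.+1) * rnorm z.
    have -> : (1 - h n.+1)%:C *: z - lact S' z =
      ((1 - h n)%:C *: z - lact S z) + (h n.+1)%:C *: (z - lact e z).
      rewrite /S' !lactE !hS; have -> : 1 - h n / 2 = 1 - h n + h n / 2 by lra.
      by rewrite rmorphD; lmod.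
    rewrite (le_trans (rnormD _ _)) // rnormZr (gtr0_norm (h0 _)).
    have k1 := bS z; have k2 := ctr_lact z pV ce; have k3 : 1 - h n.+1 = 1 - h n + h n.+1 by rewrite hS; lra.
    by rewrite k3 mulrDl lerD // ler_wpM2l // ltW.
  pose K (z : V) := (1 - h n.+1)%:C *: z - lact S' z.
  have lK : linear K by move=> c x z; rewrite /K !lactE; lmod.
  have t0 : 0 <= 1 - h n.+1 by rewrite subr_ge0.
  have KE z : (h n.+1 + (1 - h n.+1))%:C *: z - K z = (h n.+1)%:C *: z + lact S' z.
    by rewrite /K !rmorphD; lmod.
  have [y' ] := neumann lK t0 (h0 n.+1) bS' v; rewrite KE => vE'.
  exists (S', y') => _; split=> //=.
  - by rewrite /S' addrC addKr rnormZr (gtr0_norm (h0 _)) mulrC ler_wpM2r ?(ltW (h0 _)) // ctr_norm2.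
  - rewrite -(ler_pM2l (h0 n.+1)).
    apply: (le_trans (neumann_bd t0 (h0 n.+1) bS' (y' - y))); rewrite KE.
    have -> : (h n.+1)%:C *: (y' - y) + lact S' (y' - y) = (h n.+1)%:C *: (y - lact e y).
      have -> : (h n.+1)%:C *: (y' - y) + lact S' (y' - y) =
         ((h n.+1)%:C *: y' + lact S' y') - ((h n.+1)%:C *: y + lact S' y) by rewrite !lactE; lmod.
      rewrite vE' vE /= /S' !lactE; have -> : h n = h n.+1 + h n.+1 by rewrite hS; lra.
      by rewrite rmorphD; lmod.
    by rewrite rnormZr (gtr0_norm (h0 _)) ler_wpM2l // ltW.
have [g hg] := choice step.
pose u := fix u n := if n is n'.+1 then g (n', u n') else (0 : A, v).
have hu n : inv n (u n).
  elim: n => [|n IH]; last by have [] := hg (n, u n) IH.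
  have h00 : h 0 = 1 by rewrite /h expr0 invr1.
  split=> [|y] /=; first by rewrite h00 rmorph1 scale1r lact0l addr0.
  by rewrite h00 subrr lact0l rmorph0 scale0r subr0 rnorm0 mul0r.
have [||a ua] := complete_mono (u := fun n => (u n).1) (d := fun n => - 2 * h n) (M := 0).
- by move=> n; have [_ k _] := hg (n, u n) (hu n); rewrite (le_trans k) //= hS; lra.
- by move=> n; have := h0 n; lra.
have [||w uw] := complete_mono (u := fun n => (u n).2) (d := fun n => - 2 * h n) (M := 0).
- by move=> n; have [_ _ k] := hg (n, u n) (hu n); rewrite (le_trans k) //= hS; lra.
- by move=> n; have := h0 n; lra.
exists a, w; apply/eqP; rewrite -subr_eq0; apply/eqP; apply: rnorm_eps => e e0.
pose k := 2 + rnorm a + rnorm w + rnorm w.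
have k0 : 0 < k by have := rnorm_ge0 a; have := rnorm_ge0 w; rewrite /k; lra.
pose d := Num.min 1 (e / k); have d0 : 0 < d by rewrite lt_min ltr01 divr_gt0.
have d1 : d <= 1 by rewrite ge_min lexx.
have d2 : d * k <= e by rewrite -ler_pdivlMr // ge_min lexx orbT.
have [N1 k1] := ua _ d0; have [N2 k2] := uw _ d0; have [N3 k3] := h_small d0.
set n := maxn N1 (maxn N2 N3).
have {}k1 := k1 n (leq_maxl _ _).
have {}k2 : rnorm ((u n).2 - w) <= d by apply: k2; rewrite /n maxnCA leq_maxl.
have {}k3 : h n <= d by apply: k3; rewrite /n maxnA leq_maxr.
have [-> _] := hu n.
have -> : (h n)%:C *: (u n).2 + lact (u n).1 (u n).2 - lact a w =
   (h n)%:C *: (u n).2 + (lact (u n).1 ((u n).2 - w) + lact ((u n).1 - a) w).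
  by rewrite !lactE; lmod.
apply: (le_trans (rnormD _ _)); rewrite rnormZr (gtr0_norm (h0 _)).
have m1 := rnormD (lact (u n).1 ((u n).2 - w)) (lact ((u n).1 - a) w).
have m2 := rnorm_lact (u n).1 ((u n).2 - w); have m3 := rnorm_lact ((u n).1 - a) w.
have m4 : rnorm (u n).1 <= rnorm a + 1 by have := rnormD ((u n).1 - a) a; rewrite subrK; move: k1 d1; clear; lra.
have m5 : rnorm (u n).2 <= rnorm w + 1 by have := rnormD ((u n).2 - w) w; rewrite subrK; move: k2 d1; clear; lra.
have m6 := rnorm_ge0 w; have m7 := rnorm_ge0 a; have m8 := h0 n.
have n1 : h n * rnorm (u n).2 <= d * (rnorm w + 1) by rewrite ler_pM ?rnorm_ge0 ?(ltW m8).
have n2 : rnorm (u n).1 * rnorm ((u n).2 - w) <= (rnorm a + 1) * d by rewrite ler_pM ?rnorm_ge0.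
have n3 : rnorm ((u n).1 - a) * rnorm w <= d * rnorm w by rewrite ler_wpM2r.
apply: le_trans d2; rewrite /k; move: k3 m1 m2 m3 n1 n2 n3; clear; lra.
Qed.
End ApproximateUnit.

(** * Functions bounded by a weight *)

Section Weighted.
Context (R : realType) (T : Type) (w : T -> R) (V : completeNormedModType R[i]).

(** Two spaces are built from this one: operators on a module ([w] the norm) and functions on formal
    tensors ([w] the seminorm [tnorm]). Completeness comes from that of [V], and both are later cut
    down to closed subspaces. *)
Definition wle (f : T -> V) (C : R) := 0 <= C /\ forall t, rnorm (f t) <= C * `|w t|.
Definition wbf_pred : {pred (T -> V)} := mem [set f : T -> V | exists C, wle f C].

Fact wbf_submod : submod_closed wbf_pred.
Proof.
split.
  by apply/mem_set; exists 0; split=> // t; rewrite rnorm0 mul0r.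
move=> c f g /set_mem[C [C0 hC]] /set_mem[D [D0 hD]]; apply/mem_set.
exists (cabs c * C + D); split; first by rewrite addr_ge0 ?mulr_ge0 ?cabs_ge0.
move=> t; rewrite (le_trans (rnormD _ _)) // rnormZ mulrDl lerD // -mulrA.
by rewrite ler_wpM2l ?cabs_ge0.
Qed.
HB.instance Definition _ := GRing.isSubmodClosed.Build _ _ _ wbf_submod.

Record wbf := WBF { wfun :> T -> V; _ : wfun \in wbf_pred }.
HB.instance Definition _ := [isSub for wfun].
HB.instance Definition _ := [Choice of wbf by <:].
HB.instance Definition _ := [SubChoice_isSubLmodule of wbf by <:].

Implicit Types f g : wbf.
Definition mkwbf (f : T -> V) C (h : wle f C) : wbf := WBF (mem_set (ex_intro _ C h)).
Lemma wbfP f : exists C, wle f C. Proof. by case: f => f /= /set_mem. Qed.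
Lemma wbf_eq f g : f =1 g -> f = g.
Proof. by move=> fg; apply: val_inj; apply/funext. Qed.
Lemma wbfD f g t : (f + g) t = f t + g t. Proof. by []. Qed.
Lemma wbfZ (c : R[i]) f t : (c *: f) t = c *: f t. Proof. by []. Qed.
Lemma wbfB f g t : (f - g) t = f t - g t. Proof. by []. Qed.

Definition wnorm f : R := inf [set C | wle f C].
Lemma wnorm_has_inf f : has_inf [set C | wle f C].
Proof. by split; [have [C hC] := wbfP f; exists C|exists 0 => C []]. Qed.
Lemma wnorm_ge0 f : 0 <= wnorm f.
Proof. by apply: lb_le_inf; [exact: (wnorm_has_inf f).1|move=> C []]. Qed.
Lemma wnorm_lub f C : 0 <= C -> (forall t, rnorm (f t) <= C * `|w t|) -> wnorm f <= C.
Proof. by move=> C0 hC; apply: ge_inf; [exact: (wnorm_has_inf f).2|]. Qed.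
Lemma wnorm_le f t : rnorm (f t) <= wnorm f * `|w t|.
Proof.
apply/ler_addgt0Pl => e e0; have k0 : 0 < `|w t| + 1 by rewrite ltr_wpDl.
have [C [C0 hC] Cf] := inf_adherent (divr_gt0 e0 k0) (wnorm_has_inf f).
apply: (le_trans (hC t)); apply: (le_trans (ler_wpM2r (normr_ge0 _) (ltW Cf))).
rewrite mulrDl addrC lerD2r mulrAC ler_pdivrMr // ler_wpM2l ?(ltW e0) //.
by rewrite lerDl.
Qed.

Definition wbf_norm f : R[i] := (wnorm f)%:C.
Fact wbf_normD f g : wbf_norm (f + g) <= wbf_norm f + wbf_norm g.
Proof.
rewrite /wbf_norm -rmorphD lecR; apply: wnorm_lub; first by rewrite addr_ge0 ?wnorm_ge0.
by move=> t; rewrite mulrDl (le_trans (rnormD _ _)) // lerD // wnorm_le.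
Qed.
Fact wbf_normZ (l : R[i]) f : wbf_norm (l *: f) = `|l| * wbf_norm f.
Proof.
have le1 (k : R[i]) g : wnorm (k *: g) <= cabs k * wnorm g.
  apply: wnorm_lub; first by rewrite mulr_ge0 ?cabs_ge0 ?wnorm_ge0.
  by move=> t; rewrite wbfZ rnormZ -mulrA ler_wpM2l ?cabs_ge0 // wnorm_le.
rewrite /wbf_norm cabsE -rmorphM; congr (_%:C); apply/eqP; rewrite eq_le le1 /=.
have [->|l0] := eqVneq l 0; first by rewrite /cabs normr0 mul0r wnorm_ge0.
have k0 : 0 < cabs l by rewrite -ltcR -cabsE normr_gt0.
have := le1 l^-1 (l *: f); rewrite scalerA mulVf // scale1r => /(ler_wpM2l (ltW k0)).
move=> /le_trans; apply; rewrite mulrA -cabsM mulfV //.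
by rewrite /cabs normr1 mul1r.
Qed.
Fact wbf_norm0 f : wbf_norm f = 0 -> f = 0.
Proof.
move=> /complexI f0; apply: wbf_eq => t; apply: rnorm_le0.
by have := wnorm_le f t; rewrite f0 mul0r.
Qed.
HB.instance Definition _ :=
  Lmodule_isNormed.Build R[i] wbf wbf_normD wbf_normZ wbf_norm0.

Lemma rnorm_wbf f : rnorm f = wnorm f. Proof. by []. Qed.

Fact wbf_complete (F : set_system wbf) : ProperFilter F -> cauchy F -> cvg F.
Proof.
move=> FF /cauchyP Fc.
have Fr (e : R) : 0 < e -> exists f : wbf, F [set g | rnorm (f - g) < e].
  move=> e0; have e0' : 0 < e%:C by rewrite ltcR.
  have [f Ff] := Fc _ e0'; exists f; move: Ff; rewrite -ball_normE; apply: filterS => g /=.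
  by rewrite rnormE ltcR.
have cvgt t : exists l : V, (fun f : wbf => f t) @ F --> l.
  have /cauchy_cvg/cvg_ex[l Fl] : cauchy ((fun f : wbf => f t) @ F).
    apply/cauchyP => e e0.
    have er : e = (complex.Re e)%:C by case: (e) e0 => a b; rewrite ltcE /= => /andP[/eqP ->].
    have r0 : 0 < complex.Re e by rewrite -ltcR -er.
    have k0 : 0 < `|w t| + 1 by rewrite ltr_wpDl.
    have [f Ff] := Fr _ (divr_gt0 r0 k0); exists (f t).
    apply: (@filterS _ F _ _ _ _ Ff) => h /=; rewrite -ball_normE /= => fh.
    rewrite rnormE er ltcR -wbfB (le_lt_trans (wnorm_le _ _)) // -rnorm_wbf.
    move: fh; rewrite ltr_pdivlMr // => fh; apply: le_lt_trans fh.
    by rewrite ler_wpM2l ?rnorm_ge0 // lerDl.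
  by exists l.
have [g gP] := choice cvgt.
have near_g (e : R) : 0 < e -> exists f : wbf,
    F [set g | rnorm (f - g) < e] /\ forall t, rnorm (f t - g t) <= e * `|w t|.
  move=> e0; have [f Ff] := Fr _ e0; exists f; split=> // t.
  apply/ler_addgt0Pl => d d0; have d0' : 0 < d%:C by rewrite ltcR.
  have /cvgrPdist_lt/(_ _ d0') Ft := gP t.
  have [h [/= fh]] := filter_ex (filterI Ff Ft); rewrite rnormE ltcR => gh.
  rewrite (le_trans (rnorm_tri _ _ (h t))) // addrC lerD //.
    by rewrite rnormBC ltW.
  by rewrite -wbfB (le_trans (wnorm_le _ _)) // -rnorm_wbf ler_wpM2r // ltW.
have [f1 [_ f1g]] := near_g _ ltr01.
have cg : wle g (wnorm f1 + 1).
  split=> [|t]; first by rewrite addr_ge0 ?wnorm_ge0.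
  have -> : g t = f1 t - (f1 t - g t) by lmod.
  by rewrite (le_trans (rnormB _ _)) // mulrDl lerD // wnorm_le.
apply/cvg_ex; exists (mkwbf cg); apply/fcvgrPdist_lt => e e0.
have er : e = (complex.Re e)%:C by case: (e) e0 => a b; rewrite ltcE /= => /andP[/eqP ->].
have r0 : 0 < complex.Re e by rewrite -ltcR -er.
have r3 : 0 < complex.Re e / 3 by lra.
have [f [Ff fg]] := near_g _ r3; move: Ff; apply: filterS => h /= fh.
rewrite rnormE er ltcR (le_lt_trans (rnorm_tri _ _ f)) //.
have : rnorm (mkwbf cg - f) <= complex.Re e / 3.
  rewrite rnorm_wbf; apply: wnorm_lub => [|t]; first exact: ltW.
  by rewrite wbfB rnormBC; exact: fg.
by lra.
Qed.
HB.instance Definition _ := Uniform_isComplete.Build wbf wbf_complete.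
End Weighted.
Arguments mkwbf {R T w V f C} h.

Lemma cval_lc (R : realType) (V : completeNormedModType R[i]) (S : closedSub V)
  (c : R[i]) (x y : csub S) : cval (c *: x + y) = c *: cval x + cval y.
Proof. by []. Qed.
Lemma cvalB (R : realType) (V : completeNormedModType R[i]) (S : closedSub V)
  (x y : csub S) : cval (x - y) = cval x - cval y.
Proof. by []. Qed.
Lemma rnorm_cval (R : realType) (V : completeNormedModType R[i]) (S : closedSub V)
  (x : csub S) : rnorm (cval x) = rnorm x.
Proof. by []. Qed.

(** * The C*-algebra of adjointable operators *)

Section Adjointable.
Context (R : realType) (A B : cstarAlg R) (X : preCorr A B).
Hypothesis pX : posc X.

Lemma adjoint_pair_sym (S T : X -> X) : adjoint_pair S T -> adjoint_pair T S.
Proof. by move=> h x y; rewrite -ip_adj -h ip_adj. Qed.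
Lemma adjoint_pair_linear (S T : X -> X) : adjoint_pair S T -> linear S.
Proof.
move=> /adjoint_pair_sym h c x y; apply: ip_eq => z.
by rewrite -h (ip_linear z) (ip_linear (T z)) !h.
Qed.
Lemma adjoint_pair_uniq (S T T' : X -> X) : adjoint_pair S T -> adjoint_pair S T' -> T = T'.
Proof. by move=> h h'; apply/funext => x; apply: ip_eq => z; rewrite -h -h'. Qed.
Lemma adjoint_pair_bd (S T : X -> X) (C : R) : adjoint_pair S T ->
  (forall x, rnorm (S x) <= C * rnorm x) -> forall x, rnorm (T x) <= C * rnorm x.
Proof.
move=> h hC x; have [->|t0] := eqVneq (rnorm (T x)) 0.
  by rewrite (le_trans (rnorm_ge0 _) (hC x)).
have tp : 0 < rnorm (T x) by rewrite lt_neqAle rnorm_ge0 eq_sym t0.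
rewrite -(ler_pM2r tp) -[X in X <= _]expr2 -rnorm_ip -h.
by rewrite (le_trans (posc_cs pX _ _)) // mulrAC ler_wpM2r ?rnorm_ge0.
Qed.

Notation W := (wbf (fun x : X => rnorm x) X).
Definition adjointable : set W := [set f : W | exists g : X -> X, adjoint_pair f g].

Lemma wbf_bd (f : W) x : rnorm (f x) <= rnorm f * rnorm x.
Proof. by have := wnorm_le f x; rewrite (ger0_norm (rnorm_ge0 x)). Qed.
Lemma wbf_lub (f : W) C : 0 <= C -> (forall x, rnorm (f x) <= C * rnorm x) -> rnorm f <= C.
Proof. by move=> C0 h; apply: wnorm_lub => // x; rewrite (ger0_norm (rnorm_ge0 x)). Qed.
Lemma wle_bd (f : X -> X) C : 0 <= C -> (forall x, rnorm (f x) <= C * rnorm x) ->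
  wle (fun x => rnorm x) f C.
Proof. by move=> C0 h; split=> // x; rewrite (ger0_norm (rnorm_ge0 x)). Qed.

Fact adjointable0 : adjointable 0.
Proof. by exists (fun=> 0) => x y; rewrite ip0r ip0l. Qed.
Fact adjointable_lin (c : R[i]) f g : adjointable f -> adjointable g -> adjointable (c *: f + g).
Proof.
move=> [f' hf] [g' hg]; exists (fun x => c^*%R *: f' x + g' x) => x y.
by rewrite wbfD wbfZ !ipE hf hg.
Qed.
(** Adjoints satisfy the same bounds ([adjoint_pair_bd]), so the adjoints of the approximants are
    Cauchy at every vector, and their pointwise limit is the adjoint. *)
Fact adjointable_closed : closed adjointable.
Proof.
move=> f /closureP clf.
have hn (n : nat) : exists p : W * (X -> X), adjoint_pair p.1 p.2 /\ rnorm (f - p.1) <= n.+1%:R^-1.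
  by have [|g [g' hg] fg] := clf n.+1%:R^-1; [rewrite invr_gt0|exists (g, g')].
have [p hp] := choice hn.
have inv_small (e : R) : 0 < e -> exists N, forall n, (N <= n)%N -> (n.+1%:R)^-1 <= e.
  move=> e0; exists (Num.bound e^-1) => n nN.
  rewrite -[e]invrK lef_pV2 ?posrE ?invr_gt0 //.
  apply: (le_trans (ltW (archi_boundP _))); first by rewrite invr_ge0 ltW.
  by rewrite ler_nat leqW.
have bd m n x : rnorm ((p m).2 x - (p n).2 x) <= (m.+1%:R^-1 + n.+1%:R^-1) * rnorm x.
  pose d := (p m).1 - (p n).1.
  have hd : adjoint_pair d (fun x => (p m).2 x - (p n).2 x).
    by move=> y z; rewrite wbfB !ipE (hp m).1 (hp n).1.
  apply: (adjoint_pair_bd hd) => y; rewrite (le_trans (wbf_bd _ _)) // ler_wpM2r ?rnorm_ge0 //.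
  rewrite /d (le_trans (rnorm_tri _ _ f)) // rnormBC lerD //; [exact: (hp m).2|exact: (hp n).2].
have cv x : exists l, slim (fun n => (p n).2 x) l.
  apply: complete_seq => e e0; have k0 : 0 < 2 * (rnorm x + 1) by have := rnorm_ge0 x; lra.
  have [N hN] := inv_small _ (divr_gt0 e0 k0); exists N => n nN; rewrite (le_trans (bd _ _ _)) //.
  have := hN n nN; have := hN N (leqnn _); rewrite !ler_pdivlMr // => h1 h2.
  have i1 : 0 < N.+1%:R^-1 :> R by rewrite invr_gt0.
  have i2 : 0 < n.+1%:R^-1 :> R by rewrite invr_gt0.
  have := rnorm_ge0 x; move: (N.+1%:R^-1) (n.+1%:R^-1) (rnorm x) i1 i2 h1 h2 => a b c.
  by clear; nra.
have [g hg] := choice cv; exists g => x y.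
have h1 : slim (fun n => ip ((p n).1 x) y) (ip (f x) y).
  move=> e e0; have k0 : 0 < rnorm x * rnorm y + 1 by have := rnorm_ge0 x; have := rnorm_ge0 y; nra.
  have [N hN] := inv_small _ (divr_gt0 e0 k0); exists N => n /hN.
  rewrite ler_pdivlMr // => h2.
  have -> : ip ((p n).1 x) y - ip (f x) y = - ip ((f - (p n).1) x) y by rewrite wbfB !ipE; lmod.
  rewrite rnormN (le_trans (posc_cs pX _ _)) //.
  have h3 := wbf_bd (f - (p n).1) x; have h4 := (hp n).2.
  have i2 : 0 < n.+1%:R^-1 :> R by rewrite invr_gt0.
  have h5 : rnorm ((f - (p n).1) x) * rnorm y <= n.+1%:R^-1 * rnorm x * rnorm y.
    by rewrite ler_wpM2r ?rnorm_ge0 // (le_trans h3) // ler_wpM2r ?rnorm_ge0.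
  move: h2 h5 i2; move: (n.+1%:R^-1) (rnorm _) (rnorm x) (rnorm y) => i Z u v.
  by clear; nra.
apply: (slim_unique h1).
apply: (slim_bound (K := rnorm x) (hg y)) => n; rewrite (hp n).1.
by rewrite -(linB (ip_linear x)) (posc_cs pX).
Qed.
Definition adjointableS := ClosedSub adjointable0 adjointable_lin adjointable_closed.
Notation L := (csub adjointableS).

Definition lop (f : L) : X -> X := cval f.
Definition ladj (f : L) : X -> X := projT1 (cid (csubP f)).
Lemma ladjP f : adjoint_pair (lop f) (ladj f).
Proof. exact: (projT2 (cid (csubP f))). Qed.
Lemma lop_bd (f : L) x : rnorm (lop f x) <= rnorm f * rnorm x.
Proof. exact: wbf_bd. Qed.
Lemma lop_lub (f : L) C : 0 <= C -> (forall x, rnorm (lop f x) <= C * rnorm x) -> rnorm f <= C.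
Proof. exact: wbf_lub. Qed.
Lemma lop_inj (f g : L) : lop f = lop g -> f = g.
Proof. by move=> fg; do 2! apply: val_inj. Qed.
Lemma lop_linear f : linear (lop f).
Proof. exact: adjoint_pair_linear (ladjP f). Qed.

Definition mklop (f g : X -> X) (C : R) (C0 : 0 <= C) (hC : forall x, rnorm (f x) <= C * rnorm x)
  (fg : adjoint_pair f g) : L := @mkcsub _ _ adjointableS (mkwbf (wle_bd C0 hC)) (ex_intro _ g fg).

Lemma lop_ex (f g : X -> X) (C : R) : 0 <= C -> (forall x, rnorm (f x) <= C * rnorm x) ->
  adjoint_pair f g -> exists2 T : L, lop T = f & rnorm T <= C.
Proof.
by move=> C0 hC fg; exists (mklop C0 hC fg) => //; apply: lop_lub.
Qed.

Fact lmul_bd (f g : L) x : rnorm (lop f (lop g x)) <= rnorm f * rnorm g * rnorm x.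
Proof.
by rewrite (le_trans (lop_bd _ _)) // -mulrA ler_wpM2l ?rnorm_ge0 // lop_bd.
Qed.
Fact lmul_adj (f g : L) : adjoint_pair (fun x => lop f (lop g x)) (fun x => ladj g (ladj f x)).
Proof. by move=> x y; rewrite !ladjP. Qed.
Definition lmul (f g : L) : L :=
  mklop (mulr_ge0 (rnorm_ge0 f) (rnorm_ge0 g)) (lmul_bd f g) (lmul_adj f g).
Definition lstar (f : L) : L :=
  mklop (rnorm_ge0 f) (adjoint_pair_bd (ladjP f) (lop_bd f)) (adjoint_pair_sym (ladjP f)).
Lemma lstarP f : adjoint_pair (lop f) (lop (lstar f)). Proof. exact: ladjP. Qed.

Lemma lop_lc (c : R[i]) (f g : L) x : lop (c *: f + g) x = c *: lop f x + lop g x.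
Proof. by rewrite /lop cval_lc wbfD wbfZ. Qed.
Lemma lop_mul (f g : L) x : lop (lmul f g) x = lop f (lop g x).
Proof. by []. Qed.

Definition adj_alg : cstarAlg R.
Proof.
refine (@CStarAlg R L lmul lstar _ _ _ _ _ _ _ _).
- move=> f c g h; apply: lop_inj; apply/funext => x.
  by rewrite lop_lc !lop_mul lop_lc lop_linear.
- move=> f c g h; apply: lop_inj; apply/funext => x.
  by rewrite lop_lc !lop_mul lop_lc.
- by move=> f g h; apply: lop_inj.
- move=> c f g; apply: lop_inj; apply: (adjoint_pair_uniq (lstarP _)).
  by move=> x y; rewrite !lop_lc !ip_addl !ip_addr ip_scalel ip_scaler !lstarP.
- move=> f; apply: lop_inj; apply: (adjoint_pair_uniq (lstarP _)).
  exact: adjoint_pair_sym (lstarP _).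
- move=> f g; apply: lop_inj; apply: (adjoint_pair_uniq (lstarP _)).
  by move=> x y; rewrite lop_mul (lstarP f) (lstarP g) -lop_mul.
- move=> f g; rewrite !rnormE -rmorphM lecR; apply: lop_lub; last exact: lmul_bd.
  by rewrite mulr_ge0 ?rnorm_ge0.
- move=> f; rewrite !rnormE -rmorphXn; congr (_%:C); apply/eqP; rewrite eq_le; apply/andP; split.
    rewrite expr2; apply: (@le_trans _ _ (rnorm (lstar f) * rnorm f)).
      by apply: lop_lub; [rewrite mulr_ge0 ?rnorm_ge0|exact: lmul_bd].
    rewrite ler_wpM2r ?rnorm_ge0 //; apply: lop_lub; first exact: rnorm_ge0.
    exact: adjoint_pair_bd (ladjP f) (lop_bd f).
  rewrite -[leRHS]sqr_sqrtr ?rnorm_ge0 // ler_pXn2r ?nnegrE ?rnorm_ge0 ?sqrtr_ge0 //.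
  apply: lop_lub; first exact: sqrtr_ge0.
  move=> x; rewrite -(@ler_pXn2r _ 2) ?nnegrE ?mulr_ge0 ?rnorm_ge0 ?sqrtr_ge0 //.
  rewrite exprMn sqr_sqrtr ?rnorm_ge0 // -rnorm_ip lstarP (le_trans (posc_cs pX _ _)) //.
  rewrite mulrC [leRHS]mulrC expr2 mulrAC ler_wpM2r ?rnorm_ge0 //.
  by rewrite mulrC; exact: (lop_bd (lmul (lstar f) f)).
Defined.
End Adjointable.

(** * Existence of interior tensor products *)

Section TensorExistence.
Context (R : realType) (A B C : cstarAlg R) (X : preCorr A B) (Y : preCorr B C).
Hypotheses (pX : posc X) (pY : posc Y).
Notation T := (seq (X * Y)).
Implicit Types (xi eta zeta : T).

Definition form xi eta : C :=
  \sum_(p <- xi) \sum_(q <- eta) ip p.2 (lact (ip p.1 q.1) q.2).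
Definition tscale (c : R[i]) xi : T := [seq (p.1, c *: p.2) | p <- xi].
Definition tract (c : C) xi : T := [seq (p.1, ract p.2 c) | p <- xi].
Definition tlact (S : X -> X) xi : T := [seq (S p.1, p.2) | p <- xi].

Lemma form_catr xi eta zeta : form xi (eta ++ zeta) = form xi eta + form xi zeta.
Proof. by rewrite /form -big_split; apply: eq_bigr => p _; rewrite big_cat. Qed.
Lemma form_catl xi eta zeta : form (xi ++ eta) zeta = form xi zeta + form eta zeta.
Proof. by rewrite /form big_cat. Qed.
Lemma form_scaler c xi eta : form xi (tscale c eta) = c *: form xi eta.
Proof.
rewrite /form scaler_sumr; apply: eq_bigr => p _; rewrite big_map scaler_sumr.
by apply: eq_bigr => q _; rewrite lactZr ip_scaler.
Qed.
Lemma form_adj xi eta : cadj (form xi eta) = form eta xi.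
Proof.
have csum I (r : seq I) (F : I -> C) : cadj (\sum_(i <- r) F i) = \sum_(i <- r) cadj (F i).
  elim: r => [|i r IH]; first by rewrite !big_nil cadj0.
  by rewrite !big_cons cadjD IH.
rewrite /form csum; under eq_bigr do rewrite csum.
rewrite exchange_big /=; apply: eq_bigr => p _; apply: eq_bigr => q _.
by rewrite ip_adj lact_adj ip_adj.
Qed.
Lemma form_scalel c xi eta : form (tscale c xi) eta = c^*%R *: form xi eta.
Proof. by rewrite -form_adj form_scaler cadjZ form_adj. Qed.
Lemma form_tractr c xi eta : form xi (tract c eta) = cmul (form xi eta) c.
Proof.
rewrite /form (linS (cmul_linearl c)); apply: eq_bigr => p _.
rewrite big_map (linS (cmul_linearl c)); apply: eq_bigr => q _ /=.
by rewrite lact_ract ip_ract.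
Qed.
Lemma form_tractl c xi eta : form (tract c xi) eta = cmul (cadj c) (form xi eta).
Proof. by rewrite -form_adj form_tractr cadjM form_adj. Qed.
Lemma form_adjoint (S S' : X -> X) xi eta : adjoint_pair S S' ->
  form (tlact S xi) eta = form xi (tlact S' eta).
Proof.
move=> h; rewrite /form big_map; apply: eq_bigr => p _; rewrite big_map.
by apply: eq_bigr => q _ /=; rewrite h.
Qed.

(* [S = 1 - theta] with [theta] a combination of two rank one positive operators *)
Lemma split_vector (x : X) (d : R) : 0 < d -> exists (S : X -> X) (z1 z2 : X),
  rnorm (S x) <= d /\
  forall u v, ip u v = ip (S u) (S v) + cmul (ip u z1) (ip z1 v) + cmul (ip u z2) (ip z2 v).
Proof.
move=> d0; set b := ip x x; have Pb : Pos b := pX x.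
have [_ [t t0 bt]] := Pb; pose l := d ^+ 2 / 6; have l0 : 0 < l by rewrite divr_gt0 ?exprn_gt0.
pose K (y : B) := t%:C *: y - cmul b y.
have lK : linear K by move=> c y z; rewrite /K !cE; lmod.
have hK y : (l + t)%:C *: y - K y = l%:C *: y + cmul b y by rewrite /K rmorphD; lmod.
have low y : l * rnorm y <= rnorm (l%:C *: y + cmul b y).
  by rewrite -hK; apply: neumann_bd => //; exact: ltW.
have [e] := neumann lK (ltW t0) l0 bt b; rewrite hK => he.
have inj y : l%:C *: y + cmul b y = 0 -> y = 0.
  move=> y0; apply: rnorm_le0; have := low y; rewrite y0 rnorm0 => h0.
  by rewrite -(ler_pM2l l0) mulr0.
have be : cmul b e = b - l%:C *: e by rewrite -{2}he; lmod.
have hb : cadj b = b := Pos_sa Pb.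
have eb : cmul e b = b - l%:C *: e.
  rewrite -be; apply/eqP; rewrite -subr_eq0; apply/eqP; apply: inj.
  have h2 : cmul b (cmul e b) = cmul b b - l%:C *: cmul e b by rewrite cmulA be !cE.
  have h3 : cmul b (cmul b e) = cmul b b - l%:C *: cmul b e by rewrite {1}be !cE.
  by rewrite cmulDr cmulNr h3 h2; lmod.
have ea : cadj e = e.
  apply/eqP; rewrite -subr_eq0; apply/eqP; apply: inj.
  have h1 : cmul b (cadj e) = b - l%:C *: cadj e.
    by have := congr1 (@cadj _ _) eb; rewrite !cadjE hb.
  by rewrite cmulDr cmulNr h1 be; lmod.
have [r [[hr _] rr _]] := Pos_sqrt Pb.
(* Since [e = b (l + b)^{-1}], [D = x (1 - e)] is the image of [x] under [S = (1 + theta/l)^{-1}],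
   where [theta u = x <x, u>]. The relation [b (1 - e) = l e] then writes [1 - S^2] as the sum of
   the rank one operators of [z1] and [z2]. *)
pose D := x - ract x e.
have DD : ip D D = l%:C *: (e - cmul e e).
  by rewrite /D !(ipE, ip_ract, ip_ractl) -/b ea !(eb, be, cE); lmod.
have uD u : ip u D = ip u x - cmul (ip u x) e by rewrite /D !ipE ip_ract.
have Du u : ip D u = ip x u - cmul e (ip x u) by rewrite -ip_adj uD !cadjE ea ip_adj.
exists (fun u => u - (l^-1)%:C *: ract D (ip x u)).
exists ((Num.sqrt (2 / l))%:C *: D), ((l^-1)%:C *: ract D r); split.
  have -> : x - (l^-1)%:C *: ract D (ip x x) = D.
    rewrite /D -/b !ractE -ractM eb !ractE.
    have -> : ract x b - (ract x b - l%:C *: ract x e) = l%:C *: ract x e by lmod.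
    by rewrite scalerA -rmorphM mulVf ?gt_eqF // rmorph1 scale1r.
  have nx : rnorm D ^+ 2 <= d ^+ 2.
    rewrite -rnorm_ip DD rnormZr gtr0_norm //.
    have ce : ctr e.
      move=> y; rewrite -(ler_pM2l l0) (le_trans (low _)) //.
      have -> : l%:C *: (y - cmul e y) + cmul b (y - cmul e y) = l%:C *: y.
        by rewrite !cE cmulA be !cE; lmod.
      by rewrite rnormZr gtr0_norm.
    have := ctr_norm2 ce; have := ce e; rewrite /l; nra.
  by rewrite -(@ler_pXn2r _ 2) ?nnegrE ?rnorm_ge0 ?(ltW d0).
move=> u v; clearbody D; have sq : (Num.sqrt (2 / l))%:C * (Num.sqrt (2 / l))%:C = (2 / l)%:C :> R[i].
  by rewrite -rmorphM -expr2 sqr_sqrtr // divr_ge0 // ltW.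
have li : (l^-1)%:C * l%:C = 1 :> R[i] by rewrite -rmorphM mulVf ?gt_eqF // rmorph1.
rewrite !(ipE, ip_ract, ip_ractl) !conj_real !(cE, scalerA) sq hr !ip_adj DD.
have -> : cmul (cmul (ip u D) r) (cmul r (ip D v)) = cmul (ip u D) (cmul b (ip D v)).
  by rewrite -cmulA (cmulA r) rr.
have bD : cmul b (ip D v) = l%:C *: cmul e (ip x v).
  by rewrite Du !cE cmulA be !cE; lmod.
rewrite bD uD Du !(cE, scalerA) !cmulA.
rewrite -[X in _ + _ *: X]scalerBr scalerA -mulrA li mulr1 scale1r.
have -> : (2 / l)%:C = 2 * (l^-1)%:C :> R[i] by rewrite rmorphM rmorph_nat.
lmod.
Qed.

Definition weight eta : R := \sum_(q <- eta) rnorm q.1 * rnorm q.2.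
Lemma weight_ge0 eta : 0 <= weight eta.
Proof. by apply: sumr_ge0 => q _; rewrite mulr_ge0 ?rnorm_ge0. Qed.
Lemma form_bd1 u y eta : rnorm (form [:: (u, y)] eta) <= rnorm u * rnorm y * weight eta.
Proof.
rewrite /form big_seq1 /= /weight; elim: eta => [|q eta IH].
  by rewrite !big_nil rnorm0 mulr0.
rewrite !big_cons mulrDr (le_trans (rnormD _ _)) // lerD //.
rewrite (le_trans (posc_cs pY _ _)) //.
have h1 := rnorm_lact (ip u q.1) q.2; have h2 := posc_cs pX u q.1.
have -> : rnorm u * rnorm y * (rnorm q.1 * rnorm q.2) = rnorm y * (rnorm u * rnorm q.1 * rnorm q.2) by ring.
rewrite ler_wpM2l ?rnorm_ge0 // (le_trans h1) // ler_wpM2r ?rnorm_ge0 //.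
Qed.

(** Induction on the number of terms. [split_vector] gives an operator [S] that makes the first
    vector [x] almost zero, while the form at [xi] is the form at [S xi] plus two inner squares in
    [Y]. Dropping the term of [S x] leaves a shorter sum, positive by induction, at the cost of a
    small error; [Pos_lim] concludes. *)
Lemma form_Pos xi : Pos (form xi xi).
Proof.
move: {2}(size xi) (leqnn (size xi)) => n; elim: n xi => [|n IH] [|[x y] xi] //= sz.
- by rewrite /form big_nil; exact: Pos0.
- by rewrite /form big_nil; exact: Pos0.
apply: Pos_lim => e e0; have w0 := weight_ge0 xi.
(* Bounds, per unit of [rnorm (S x)], the three terms that contain [S x]: its own and the two cross
   terms with the tail. *)
pose K := rnorm y * (rnorm x * rnorm y) + 2 * (rnorm y * weight xi).
have K0 : 0 <= K by rewrite addr_ge0 // !mulr_ge0 ?rnorm_ge0.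
have k1 : 0 < K + 1 by lra.
have [S [z1 [z2 [Sx hS]]]] := split_vector x (divr_gt0 e0 k1).
set d := e / (K + 1) in Sx; have d0 : 0 < d by rewrite divr_gt0.
have Sn u : rnorm (S u) <= rnorm u.
  rewrite -(@ler_pXn2r _ 2) ?nnegrE ?rnorm_ge0 // -!rnorm_ip; apply: Pos_mono; first exact: pX.
  have -> : ip u u - ip (S u) (S u) =
     cmul (cadj (ip z1 u)) (ip z1 u) + cmul (cadj (ip z2 u)) (ip z2 u).
    by rewrite {1}(hS u u) !ip_adj; lmod.
  by apply: PosD; exact: Pos_adj_mul.
pose wz z (eta : T) := \sum_(p <- eta) lact (ip z p.1) p.2.
have formS eta zeta : form eta zeta = form (tlact S eta) (tlact S zeta) +
    ip (wz z1 eta) (wz z1 zeta) + ip (wz z2 eta) (wz z2 zeta).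
  have wzE z : ip (wz z eta) (wz z zeta) =
      \sum_(p <- eta) \sum_(q <- zeta) ip p.2 (lact (cmul (ip p.1 z) (ip z q.1)) q.2).
    rewrite /wz (linS (ip_linear (\sum_(p <- eta) lact (ip z p.1) p.2))) exchange_big /=; apply: eq_bigr => q _.
    rewrite -ip_adj (linS (ip_linear (lact (ip z q.1) q.2))).
    elim: (eta) => [|p eta' IHe]; first by rewrite !big_nil cadj0.
    rewrite !big_cons cadjD IHe; congr (_ + _).
    by rewrite ip_adj lact_adj ip_adj -lactM.
  rewrite !wzE /form big_map -!big_split; apply: eq_bigr => p _ /=.
  rewrite big_map -!big_split; apply: eq_bigr => q _ /=.
  by rewrite {1}(hS p.1 q.1) !lactDl !ip_addr.
have Pw z eta : Pos (ip (wz z eta) (wz z eta)) by exact: pY.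
exists (form (tlact S xi) (tlact S xi) + ip (wz z1 ((x, y) :: xi)) (wz z1 ((x, y) :: xi)) +
   ip (wz z2 ((x, y) :: xi)) (wz z2 ((x, y) :: xi))).
  by apply: PosD => //; apply: PosD => //; apply: IH; rewrite size_map.
rewrite (formS ((x, y) :: xi)) /=.
set U := ip (wz z1 _) _; set V := ip (wz z2 _) _.
have -> : form ((S x, y) :: tlact S xi) ((S x, y) :: tlact S xi) =
   form [:: (S x, y)] [:: (S x, y)] + form [:: (S x, y)] (tlact S xi) +
   (form (tlact S xi) [:: (S x, y)] + form (tlact S xi) (tlact S xi)).
  by rewrite -!form_catr -form_catl.
set a := form [:: _] [:: _]; set b := form [:: _] (tlact S xi); set c := form _ _; set c' := form _ _.
have -> : a + b + (c + c') + U + V - (c' + U + V) = a + b + c by lmod.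
have ha : rnorm a <= d * (rnorm y * (rnorm x * rnorm y)).
  rewrite (le_trans (form_bd1 _ _ _)) // /weight big_seq1 /= -mulrA ler_pM ?mulr_ge0 ?rnorm_ge0 //.
  by rewrite ler_wpM2l ?rnorm_ge0 // ler_wpM2r ?rnorm_ge0.
have hb : rnorm b <= d * (rnorm y * weight xi).
  rewrite (le_trans (form_bd1 _ _ _)) // -mulrA ler_pM ?mulr_ge0 ?rnorm_ge0 ?weight_ge0 //.
  rewrite ler_wpM2l ?rnorm_ge0 // /weight big_map; apply: ler_sum => q _ /=.
  by rewrite ler_wpM2r ?rnorm_ge0.
have hc : rnorm c <= d * (rnorm y * weight xi) by rewrite /c -form_adj rnorm_adj.
rewrite (le_trans (rnormD _ _)) // (le_trans (lerD (rnormD _ _) (lexx _))) //.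
apply: (le_trans (lerD (lerD ha hb) hc)).
have -> : e = d * (K + 1) by rewrite divfK // gt_eqF.
by rewrite /K; move: d0; clear; lra.
Qed.

Definition tnorm xi : R := Num.sqrt (rnorm (form xi xi)).
Lemma tnorm_ge0 xi : 0 <= tnorm xi. Proof. exact: sqrtr_ge0. Qed.
Lemma tnorm_sq xi : rnorm (form xi xi) = tnorm xi ^+ 2.
Proof. by rewrite sqr_sqrtr // rnorm_ge0. Qed.
Lemma form_cs xi eta : rnorm (form xi eta) <= tnorm xi * tnorm eta.
Proof.
rewrite -(@ler_pXn2r _ 2) ?nnegrE ?mulr_ge0 ?rnorm_ge0 ?tnorm_ge0 // exprMn -!tnorm_sq.
apply: cauchy_schwarz_gen; first exact: form_adj.
move=> b; have := form_Pos (eta ++ tract b (tscale (-1) xi)).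
rewrite !(form_catl, form_catr, form_tractl, form_tractr, form_scalel, form_scaler).
by rewrite !rmorphN rmorph1 !cE form_adj; congr Pos; lmod.
Qed.
Lemma tnorm_le xi eta (K : R) : 0 <= K ->
  Pos ((K ^+ 2)%:C *: form eta eta - form xi xi) -> tnorm xi <= K * tnorm eta.
Proof.
move=> K0 /(Pos_mono (form_Pos xi)); rewrite rnormZr ger0_norm ?exprn_ge0 // !tnorm_sq -exprMn => h.
by rewrite -(@ler_pXn2r _ 2) ?nnegrE ?mulr_ge0 ?tnorm_ge0.
Qed.
Lemma tnorm_tract c xi : tnorm (tract c xi) <= rnorm c * tnorm xi.
Proof.
rewrite -(@ler_pXn2r _ 2) ?nnegrE ?mulr_ge0 ?tnorm_ge0 ?rnorm_ge0 // exprMn -!tnorm_sq.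
rewrite form_tractl form_tractr (le_trans (rnormM _ _)) // rnorm_adj.
have := rnormM (form xi xi) c; have := rnorm_ge0 c; nra.
Qed.
(** For [K] above the norm of [a], [K^2 - a^* a = K^2 (1 - w)^2] in the unitization. Letting [1 - w]
    act on the first factors, the defect becomes [K^2] times a value of the positive form. *)
Lemma tnorm_tlact a xi : tnorm (tlact (lact a) xi) <= rnorm a * tnorm xi.
Proof.
apply/ler_addgt0Pl => e e0.
have k0 : 0 < tnorm xi + 1 by have := tnorm_ge0 xi; lra.
pose d := e / (tnorm xi + 1); have d0 : 0 < d by rewrite divr_gt0.
pose K := d + rnorm a; have K0 : 0 < K by have := rnorm_ge0 a; rewrite /K; lra.
suff h : tnorm (tlact (lact a) xi) <= K * tnorm xi.
  apply: (le_trans h); rewrite /K mulrDl lerD2r /d mulrAC ler_pdivrMr //.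
  by rewrite ler_wpM2l ?(ltW e0) //; lra.
pose b := (K ^- 2)%:C *: cmul (cadj a) a.
have [||w [hw ww _]] := @sqrt_one_minus _ _ b.
- by rewrite !cadjE.
- rewrite /b rnormZr ger0_norm ?invr_ge0 ?exprn_ge0 ?(ltW K0) // rnormC ler_pdivrMl ?exprn_gt0 // mulr1.
  by rewrite ler_pXn2r ?nnegrE ?rnorm_ge0 ?(ltW K0) // /K; lra.
apply: tnorm_le; first exact: ltW.
pose S (x : X) := x - lact w x.
have -> : (K ^+ 2)%:C *: form xi xi - form (tlact (lact a) xi) (tlact (lact a) xi) =
   (K ^+ 2)%:C *: form (tlact S xi) (tlact S xi).
  rewrite (form_adjoint (S' := lact (cadj a))) => [|x y]; last exact: lact_adj.
  rewrite [in RHS](form_adjoint (S' := S)) => [|x y]; last by rewrite /S !ipE lact_adj hw.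
  rewrite /form !scaler_sumr -sumrB; apply: eq_bigr => p _.
  rewrite /tlact !big_map !scaler_sumr -sumrB; apply: eq_bigr => q _ /=.
  have -> : S (S q.1) = q.1 - lact b q.1.
    have -> : b = (2:R)%:C *: w - cmul w w by rewrite ww addrK.
    by rewrite /S !(lactE, lactM) rmorph_nat; lmod.
  have -> : lact b q.1 = (K ^- 2)%:C *: lact (cadj a) (lact a q.1) by rewrite /b lactZl lactM.
  rewrite ip_addr ipNr ip_scaler lactDl lactNl lactZl ip_addr ipNr ip_scaler scalerBr scalerA -rmorphM.
  by rewrite mulfV ?rmorph1 ?scale1r // expf_neq0 // gt_eqF.
by apply: PosZ; [rewrite exprn_ge0 // ltW|exact: form_Pos].
Qed.

(** * Completion of the formal sums *)

Notation W := (wbf tnorm C).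
Fact tvec_wle zeta : wle tnorm (form^~ zeta) (tnorm zeta).
Proof.
split=> [|xi]; first exact: tnorm_ge0.
by rewrite ger0_norm ?tnorm_ge0 // mulrC form_cs.
Qed.
(** As in a reproducing kernel space, a formal sum becomes the function [form(-, zeta)]. Sums of
    seminorm zero become the zero function, and the completion is a closed span of functions. *)
Definition tvecW zeta : W := mkwbf (tvec_wle zeta).

Fact cspan0 (V : completeNormedModType R[i]) (S : set V) : cspan S 0.
Proof. by have [h _ _] := cspan_closed S. Qed.
Fact cspan_lin (V : completeNormedModType R[i]) (S : set V) (c : R[i]) x y :
  cspan S x -> cspan S y -> cspan S (c *: x + y).
Proof. by have [_ h _] := cspan_closed S; exact: h. Qed.
Fact cspan_cl (V : completeNormedModType R[i]) (S : set V) : closed (cspan S).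
Proof.
have [_ _ h] := cspan_closed S => x /closureP hx.
by apply: h => e /hx.
Qed.
Definition cspanS (V : completeNormedModType R[i]) (S : set V) : closedSub V :=
  ClosedSub (@cspan0 V S) (@cspan_lin V S) (@cspan_cl V S).
Notation Z := (csub (cspanS (range tvecW))).

Definition tvec zeta : Z := @mkcsub _ _ (cspanS (range tvecW)) _
  (cspan_sub (ex_intro2 (fun _ => True) (fun x => tvecW x = tvecW zeta) zeta I erefl)).
Definition zev (z : Z) (xi : T) : C := (cval z : W) xi.

Lemma zev_tvec zeta xi : zev (tvec zeta) xi = form xi zeta. Proof. by []. Qed.
Lemma zev_inj z z' : zev z =1 zev z' -> z = z'.
Proof. by move=> h; apply: val_inj; apply: wbf_eq. Qed.
Lemma zev_bd z xi : rnorm (zev z xi) <= rnorm z * tnorm xi.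
Proof. by have := wnorm_le (cval z : W) xi; rewrite (ger0_norm (tnorm_ge0 _)). Qed.
Lemma zev_lub z K : 0 <= K -> (forall xi, rnorm (zev z xi) <= K * tnorm xi) -> rnorm z <= K.
Proof.
move=> K0 h; rewrite -rnorm_cval rnorm_wbf; apply: wnorm_lub => // xi.
by rewrite (ger0_norm (tnorm_ge0 _)); exact: h.
Qed.
Lemma zev_lc (c : R[i]) z z' xi : zev (c *: z + z') xi = c *: zev z xi + zev z' xi.
Proof. by rewrite /zev cval_lc wbfD wbfZ. Qed.
Lemma blin_zev xi : blin (fun z => zev z xi).
Proof.
split; first by move=> c z z'; exact: zev_lc.
by exists (tnorm xi); [exact: tnorm_ge0|move=> z; rewrite mulrC zev_bd].
Qed.
Lemma rnorm_tvec zeta : rnorm (tvec zeta) = tnorm zeta.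
Proof.
apply/eqP; rewrite eq_le; apply/andP; split.
  by apply: zev_lub => [|xi]; [exact: tnorm_ge0|rewrite zev_tvec mulrC form_cs].
have [->|n0] := eqVneq (tnorm zeta) 0; first exact: rnorm_ge0.
have np : 0 < tnorm zeta by rewrite lt_neqAle tnorm_ge0 eq_sym n0.
rewrite -(ler_pM2r np) -[X in X <= _]expr2 -tnorm_sq -zev_tvec; exact: zev_bd.
Qed.
Lemma tvec_lc (c : R[i]) xi eta : tvec (tscale c xi ++ eta) = c *: tvec xi + tvec eta.
Proof. by apply: zev_inj => zeta; rewrite zev_lc !zev_tvec form_catr form_scaler. Qed.
Lemma fsum_cons (U : lmodType R[i]) (f : T -> U) p s : fsum f (p :: s) = p.1 *: f p.2 + fsum f s.
Proof. exact: big_cons. Qed.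
Lemma tvec_fsum (s : seq (R[i] * T)) : exists zeta, fsum tvec s = tvec zeta.
Proof.
elim: s => [|p s [zeta hz]]; last first.
  by exists (tscale p.1 p.2 ++ zeta); rewrite tvec_lc -hz /fsum big_cons.
exists [::]; apply: zev_inj => xi; rewrite /fsum big_nil (lin0 (blin_lin (blin_zev xi))).
by rewrite zev_tvec /form big1 // => p _; rewrite big_nil.
Qed.
Lemma tvec_approx z (e : R) : 0 < e -> exists zeta, rnorm (z - tvec zeta) <= e.
Proof.
move=> e0; have /closureP/(_ e e0)[y [n [c [v [hv ->]]]] zy] : cspan (range tvecW) (cval z) := csubP z.
suff [zeta hz] : exists zeta, \sum_(i < n) c i *: v i = cval (tvec zeta).
  by exists zeta; rewrite -rnorm_cval cvalB -hz.
elim/big_rec: _ => [|i u _ [zeta ->]].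
  by have [zeta hz] := tvec_fsum [::]; exists zeta; rewrite -hz /fsum big_nil.
by have [eta _ <-] := hv i; exists (tscale (c i) eta ++ zeta); rewrite tvec_lc cval_lc.
Qed.
Lemma tvec_total z : cspan (range tvec) z.
Proof.
by apply/closureP => e /(tvec_approx z)[zeta h]; exists (tvec zeta) => //; apply: lspan_sub; exists zeta.
Qed.
Lemma tvec_ind (P : Z -> Prop) : lin_closed P -> (forall zeta, P (tvec zeta)) -> forall z, P z.
Proof.
move=> Pc h z; apply: (cspan_min Pc _ (@tvec_total z)) => _ [zeta _ <-]; exact: h.
Qed.
Lemma tvec_ext (V : completeNormedModType R[i]) (f g : Z -> V) : blin f -> blin g ->
  (forall zeta, f (tvec zeta) = g (tvec zeta)) -> forall z, f z = g z.
Proof. by move=> bf bg; apply: tvec_ind; exact: lin_closed_eq. Qed.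

Lemma zev_catl z xi eta : zev z (xi ++ eta) = zev z xi + zev z eta.
Proof.
rewrite -[zev z xi]scale1r; move: z; apply: (tvec_ext (f := fun z => zev z _)).
- exact: blin_zev.
- by apply: blin_lc; exact: blin_zev.
- by move=> zeta; rewrite scale1r !zev_tvec form_catl.
Qed.
Lemma blinZ (V W' : completeNormedModType R[i]) (c : R[i]) (f : V -> W') : blin f -> blin (fun x => c *: f x).
Proof.
move=> bf; have := blin_lc c bf (@blin0 _ V W').
by rewrite (_ : (fun x => c *: f x + 0) = (fun x => c *: f x)) //; apply/funext => x; rewrite addr0.
Qed.
Lemma zev_scalel z c xi : zev z (tscale c xi) = c^*%R *: zev z xi.
Proof.
move: z; apply: (tvec_ext (f := fun z => zev z _)); first exact: blin_zev.
- by apply: blinZ; exact: blin_zev.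
- by move=> zeta; rewrite !zev_tvec form_scalel.
Qed.
Lemma zev_tractl z c xi : zev z (tract c xi) = cmul (cadj c) (zev z xi).
Proof.
move: z; apply: (tvec_ext (f := fun z => zev z _)); first exact: blin_zev.
- by apply: (blin_comp (blin_cmul _) (blin_zev _)).
- by move=> zeta; rewrite !zev_tvec form_tractl.
Qed.

Lemma zip_ex z : exists f : Z -> C, [/\ linear f, forall z', rnorm (f z') <= rnorm z * rnorm z' &
  forall zeta, f (tvec zeta) = cadj (zev z zeta)].
Proof.
apply: (extension tvec_total (rnorm_ge0 z)) => s.
have h : fsum (fun zeta => cadj (zev z zeta)) s =
    cadj (zev z (flatten [seq tscale p.1 p.2 | p <- s])).
  elim: s => [|p s IH].
    rewrite /fsum big_nil /= -[[::]](_ : tscale 0 [::] = [::]) // zev_scalel rmorph0.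
    by rewrite scale0r cadj0.
  by rewrite fsum_cons IH /= zev_catl cadjD zev_scalel cadjZ conjCK.
have h' : fsum tvec s = tvec (flatten [seq tscale p.1 p.2 | p <- s]).
  elim: {h} s => [|p s IH]; last by rewrite /= tvec_lc -IH fsum_cons.
  have [zeta hz] := tvec_fsum [::]; apply: zev_inj => xi.
  rewrite /fsum big_nil (lin0 (blin_lin (blin_zev xi))).
  by rewrite zev_tvec /form big1 // => p _; rewrite big_nil.
by rewrite h h' rnorm_adj rnorm_tvec zev_bd.
Qed.
Definition zip z : Z -> C := projT1 (cid (zip_ex z)).
Lemma zip_lin z : linear (zip z). Proof. by have [] := projT2 (cid (zip_ex z)). Qed.
Lemma zip_bd z z' : rnorm (zip z z') <= rnorm z * rnorm z'.
Proof. by have [_ h _] := projT2 (cid (zip_ex z)); exact: h. Qed.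
Lemma zip_tvec z zeta : zip z (tvec zeta) = cadj (zev z zeta).
Proof. by have [_ _ h] := projT2 (cid (zip_ex z)); exact: h. Qed.
Lemma blin_zip z : blin (zip z).
Proof.
split; first exact: zip_lin.
by exists (rnorm z); [exact: rnorm_ge0|exact: zip_bd].
Qed.
Lemma zip_tvecl zeta z : zip (tvec zeta) z = zev z zeta.
Proof.
move: z; apply: tvec_ext; [exact: blin_zip|exact: blin_zev|].
by move=> eta; rewrite zip_tvec !zev_tvec form_adj.
Qed.
Lemma zip_sub z1 z2 z : zip (z1 - z2) z = zip z1 z - zip z2 z.
Proof.
move: z; apply: tvec_ext; first exact: blin_zip.
- by apply: blinB; exact: blin_zip.
- by move=> eta; rewrite !zip_tvec -cadj_sub (linB (blin_lin (blin_zev eta))).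
Qed.
Lemma zip_adj z z' : cadj (zip z z') = zip z' z.
Proof.
apply/eqP; rewrite -subr_eq0; apply/eqP; apply: rnorm_eps => e e0.
have k0 : 0 < 2 * (rnorm z + 1) by have := rnorm_ge0 z; lra.
have [zeta hz] := tvec_approx z' (divr_gt0 e0 k0).
have -> : cadj (zip z z') - zip z' z = cadj (zip z (z' - tvec zeta)) - zip (z' - tvec zeta) z.
  by rewrite zip_sub (linB (zip_lin z)) cadj_sub zip_tvecl zip_tvec cadjK; lmod.
rewrite (le_trans (rnormB _ _)) // rnorm_adj.
have h1 := zip_bd z (z' - tvec zeta); have h2 := zip_bd (z' - tvec zeta) z.
move: hz; rewrite ler_pdivlMr // => hz.
have := rnorm_ge0 z; have := rnorm_ge0 (z' - tvec zeta); move: h1 h2 hz; clear; nra.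
Qed.
Lemma zip_Pos z : Pos (zip z z).
Proof.
apply: Pos_lim => e e0; pose k := 2 * rnorm z + 1.
have k0 : 0 < k by have := rnorm_ge0 z; rewrite /k; lra.
pose d := Num.min 1 (e / k); have d0 : 0 < d by rewrite lt_min ltr01 divr_gt0.
have d1 : d <= 1 by rewrite ge_min lexx.
have d2 : d * k <= e by rewrite -ler_pdivlMr // ge_min lexx orbT.
have [zeta hz] := tvec_approx z d0.
exists (zip (tvec zeta) (tvec zeta)); first by rewrite zip_tvecl zev_tvec; exact: form_Pos.
have -> : zip z z - zip (tvec zeta) (tvec zeta) = zip z (z - tvec zeta) + zip (z - tvec zeta) (tvec zeta).
  by rewrite zip_sub (linB (zip_lin z)); lmod.
rewrite (le_trans (rnormD _ _)) //.
have h1 := zip_bd z (z - tvec zeta); have h2 := zip_bd (z - tvec zeta) (tvec zeta).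
have h3 : rnorm (tvec zeta) <= rnorm z + d.
  have := rnormB z (z - tvec zeta); rewrite opprB addrC subrK; lra.
have := rnorm_ge0 z; have := rnorm_ge0 (z - tvec zeta); have := rnorm_ge0 (tvec zeta).
rewrite /k in d2; move: d0 d1 d2 h1 h2 h3 hz; clear; nra.
Qed.
Lemma zip_norm z : rnorm (zip z z) = rnorm z ^+ 2.
Proof.
apply/eqP; rewrite eq_le zip_bd /=.
rewrite -[leRHS]sqr_sqrtr ?rnorm_ge0 // ler_pXn2r ?nnegrE ?rnorm_ge0 ?sqrtr_ge0 //.
apply: zev_lub => [|xi]; first exact: sqrtr_ge0.
rewrite -(@ler_pXn2r _ 2) ?nnegrE ?mulr_ge0 ?rnorm_ge0 ?sqrtr_ge0 ?tnorm_ge0 //.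
rewrite exprMn sqr_sqrtr ?rnorm_ge0 // -tnorm_sq -zip_tvecl mulrC.
apply: cauchy_schwarz_gen; first exact: form_adj.
move=> b; have := zip_Pos (z - tvec (tract b xi)).
rewrite zip_sub !(linB (zip_lin _)) !zip_tvec !zip_tvecl !zev_tvec !zev_tractl form_adj.
by rewrite form_tractl form_tractr cadjM cadjK; congr Pos; lmod.
Qed.

Lemma zop_ex (F : T -> T) (K : R) : 0 <= K -> (forall xi eta, F (xi ++ eta) = F xi ++ F eta) ->
  (forall c xi, F (tscale c xi) = tscale c (F xi)) -> (forall xi, tnorm (F xi) <= K * tnorm xi) ->
  exists h : Z -> Z, [/\ linear h, forall z, rnorm (h z) <= K * rnorm z &
     forall zeta, h (tvec zeta) = tvec (F zeta)].
Proof.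
move=> K0 Fc Fs Fn; apply: (extension tvec_total K0) => s.
suff [zeta [-> ->]] : exists zeta, fsum (fun z => tvec (F z)) s = tvec (F zeta) /\ fsum tvec s = tvec zeta.
  by rewrite !rnorm_tvec.
have F0 : F [::] = [::] by have := Fs 0 [::]; have := Fc [::] [::]; case: (F [::]) => // a l /(congr1 size) /=; rewrite size_cat /= => /eqP; rewrite -[X in X == _]addn0 -addSn eqn_add2l.
elim: s => [|p s [zeta [IH1 IH2]]]; last first.
  exists (tscale p.1 p.2 ++ zeta); rewrite Fc Fs !tvec_lc -IH1 -IH2.
  by rewrite /fsum !big_cons.
have t0 : tvec [::] = 0.
  apply: zev_inj => xi; rewrite (lin0 (blin_lin (blin_zev xi))).
  by rewrite zev_tvec /form big1 // => p _; rewrite big_nil.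
by exists [::]; rewrite /fsum !big_nil F0 t0.
Qed.
Lemma zract_ex c : exists h : Z -> Z, [/\ linear h, forall z, rnorm (h z) <= rnorm c * rnorm z &
     forall zeta, h (tvec zeta) = tvec (tract c zeta)].
Proof.
apply: zop_ex; [exact: rnorm_ge0|by move=> xi eta; rewrite /tract map_cat| |exact: tnorm_tract].
by move=> k xi; rewrite /tract /tscale -!map_comp; apply: eq_map => p /=; rewrite ractZl.
Qed.
Lemma zlact_ex a : exists h : Z -> Z, [/\ linear h, forall z, rnorm (h z) <= rnorm a * rnorm z &
     forall zeta, h (tvec zeta) = tvec (tlact (lact a) zeta)].
Proof.
apply: zop_ex; [exact: rnorm_ge0|by move=> xi eta; rewrite /tlact map_cat| |exact: tnorm_tlact].
by move=> k xi; rewrite /tlact /tscale -!map_comp.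
Qed.
Definition zract z c := projT1 (cid (zract_ex c)) z.
Definition zlact a z := projT1 (cid (zlact_ex a)) z.
Lemma blin_zract c : blin (zract^~ c).
Proof.
have [h1 h2 _] := projT2 (cid (zract_ex c)); split => //.
by exists (rnorm c) => //; exact: rnorm_ge0.
Qed.
Lemma blin_zlact a : blin (zlact a).
Proof.
have [h1 h2 _] := projT2 (cid (zlact_ex a)); split => //.
by exists (rnorm a) => //; exact: rnorm_ge0.
Qed.
Lemma zract_tvec c zeta : zract (tvec zeta) c = tvec (tract c zeta).
Proof. by have [_ _ h] := projT2 (cid (zract_ex c)); exact: h. Qed.
Lemma zlact_tvec a zeta : zlact a (tvec zeta) = tvec (tlact (lact a) zeta).
Proof. by have [_ _ h] := projT2 (cid (zlact_ex a)); exact: h. Qed.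
Lemma tvec_eq zeta zeta' : (forall xi, form xi zeta = form xi zeta') -> tvec zeta = tvec zeta'.
Proof. by move=> h; apply: zev_inj => xi; rewrite !zev_tvec. Qed.

Definition tensor_corr : preCorr A C.
Proof.
refine (@PreCorr R A C Z zract zip zlact _ _ _ _ _ _ _ _ _ _ _).
- move=> z k c d; move: z; apply: tvec_ext; first exact: blin_zract.
    by apply: blin_lc; exact: blin_zract.
  move=> zeta; rewrite !zract_tvec -tvec_lc; apply: tvec_eq => xi.
  by rewrite form_catr form_scaler !form_tractr !cE.
- by move=> c; exact: blin_lin (blin_zract c).
- move=> z b c; move: z; apply: tvec_ext; first exact: blin_zract.
    exact: blin_comp (blin_zract c) (blin_zract b).
  move=> zeta; rewrite !zract_tvec; apply: tvec_eq => xi.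
  by rewrite !form_tractr cmulA.
- exact: zip_lin.
- exact: zip_adj.
- move=> z z' c; move: z'; apply: (tvec_ext (f := fun z' => zip z (zract z' c)) (g := fun z' => cmul (zip z z') c)).
  + exact: blin_comp (blin_zip z) (blin_zract c).
  + exact: blin_comp (blin_cmulr c) (blin_zip z).
  + by move=> zeta; rewrite zract_tvec !zip_tvec zev_tractl cadjM cadjK.
- by move=> z; rewrite !rnormE -rmorphXn zip_norm.
- move=> z k a b; move: z; apply: tvec_ext; first exact: blin_zlact.
    by apply: blin_lc; exact: blin_zlact.
  move=> zeta; rewrite !zlact_tvec -tvec_lc; apply: tvec_eq => xi.
  rewrite form_catr form_scaler /form scaler_sumr -big_split; apply: eq_bigr => p _.
  rewrite !big_map scaler_sumr -big_split; apply: eq_bigr => q _ /=.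
  by rewrite !(lactE, ipE).
- move=> a b z; move: z; apply: tvec_ext; first exact: blin_zlact.
    exact: blin_comp (blin_zlact a) (blin_zlact b).
  move=> zeta; rewrite !zlact_tvec; congr tvec; rewrite /tlact -map_comp.
  by apply: eq_map => p /=; rewrite lactM.
- move=> a z z'; move: z'; apply: (tvec_ext (f := zip (zlact a z)) (g := fun z' => zip z (zlact (cadj a) z'))).
  + exact: blin_zip.
  + exact: blin_comp (blin_zip z) (blin_zlact _).
  + move=> zeta; rewrite zlact_tvec !zip_tvec; congr cadj; move: z.
    apply: (tvec_ext (f := fun z => zev (zlact a z) zeta) (g := fun z => zev z _)).
    * exact: blin_comp (blin_zev _) (blin_zlact a).
    * exact: blin_zev.
    * move=> eta; rewrite zlact_tvec !zev_tvec; apply/esym/form_adjoint => x y.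
      by rewrite lact_adj cadjK.
- move=> a z; rewrite !rnormE -rmorphM lecR.
  by have [_ h _] := projT2 (cid (zlact_ex a)); exact: h.
Defined.

Lemma tensor_exists : interior_tensor (Z := tensor_corr) (fun x y => tvec [:: (x, y)]).
Proof.
have f1 xi p : form xi [:: p] = \sum_(q <- xi) ip q.2 (lact (ip q.1 p.1) p.2).
  by rewrite /form; apply: eq_bigr => q _; rewrite big_seq1.
split.
- move=> x k y y'; rewrite -tvec_lc; apply: tvec_eq => xi.
  rewrite form_catr form_scaler !f1 scaler_sumr -big_split; apply: eq_bigr => q _ /=.
  by rewrite !(lactE, ipE).
- move=> y k x x'; rewrite -tvec_lc; apply: tvec_eq => xi.
  rewrite form_catr form_scaler !f1 scaler_sumr -big_split; apply: eq_bigr => q _ /=.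
  by rewrite !(lactE, ipE).
- move=> x b y; apply: tvec_eq => xi; rewrite !f1; apply: eq_bigr => q _ /=.
  by rewrite ip_ract lactM.
- by move=> a x y; rewrite /= zlact_tvec.
- by move=> x y c; rewrite /= zract_tvec.
- move=> x y x' y'; rewrite /= zip_tvecl zev_tvec f1 big_seq1 //.
- by move=> z; apply/positiveP; exact: zip_Pos.
- apply/seteqP; split=> // z _; apply: (cspan_min (@cspan_closed _ _ _) _ (@tvec_total z)) => _ [zeta _ <-].
  elim: zeta => [|[x y] zeta IH].
    have -> : tvec [::] = 0 by have [zeta hz] := tvec_fsum [::]; rewrite /fsum big_nil in hz; apply: zev_inj => xi; rewrite (lin0 (blin_lin (blin_zev xi))) zev_tvec /form big1 // => p _; rewrite big_nil.
    exact: cspan0.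
  have -> : tvec ((x, y) :: zeta) = 1 *: tvec [:: (x, y)] + tvec zeta.
    by rewrite -tvec_lc /tscale /= scale1r.
  apply: cspan_lin => //; apply: cspan_sub; exists x => //; exists y => //.
Qed.
End TensorExistence.

(** * Calculus of interior tensor products *)

Section TensorModels.
Context (R : realType) (A B C : cstarAlg R) (X : preCorr A B) (Y : preCorr B C).
Context (Z : preCorr A C) (tau : X -> Y -> Z).
Hypothesis hT : interior_tensor tau.

Lemma it_total z : cspan (range (fun p : X * Y => tau p.1 p.2)) z.
Proof.
have : closure (lspan [set tau x y | x in [set: X] & y in [set: Y]]) z by rewrite (it_dense hT).
by apply: cspan_mono => _ [x _ [y _ <-]]; exists (x, y).
Qed.
Lemma it_posc : posc Z. Proof. by move=> z; apply/positiveP; exact: (it_pos hT z). Qed.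
(** The constant comes from the polarization bound [ip_bounded], whose factor is [8 <= 3^2]. *)
Lemma it_norm x y : rnorm (tau x y) <= 3 * rnorm x * rnorm y.
Proof.
have [x0 y0] := (rnorm_ge0 x, rnorm_ge0 y).
rewrite -(@ler_pXn2r _ 2) ?nnegrE ?mulr_ge0 ?rnorm_ge0 // -rnorm_ip (it_ip hT).
have h1 := rnorm_ip8 y (lact (ip x x) y); have h2 := rnorm_lact (ip x x) y.
rewrite rnorm_ip in h2; have h3 : 8 * rnorm y * rnorm (lact (ip x x) y) <= 8 * rnorm y * (rnorm x ^+ 2 * rnorm y).
  by rewrite ler_wpM2l ?mulr_ge0.
apply: (le_trans h1); apply: (le_trans h3).
have := mulr_ge0 (mulr_ge0 x0 x0) (mulr_ge0 y0 y0); clear; rewrite !expr2; lra.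
Qed.
Lemma it_blinr x : blin (tau x).
Proof.
split; first exact: (it_linearr hT).
by exists (3 * rnorm x); [rewrite mulr_ge0 ?rnorm_ge0|move=> y; exact: it_norm].
Qed.
Lemma it_blinl y : blin (tau^~ y).
Proof.
split; first exact: (it_linearl hT).
exists (3 * rnorm y); first by rewrite mulr_ge0 ?rnorm_ge0.
by move=> x; rewrite mulrAC it_norm.
Qed.
Lemma it_ext (W : completeNormedModType R[i]) (f g : Z -> W) : blin f -> blin g ->
  (forall x y, f (tau x y) = g (tau x y)) -> forall z, f z = g z.
Proof.
move=> bf bg h z; apply: (blin_ext bf bg _ (@it_total z)) => _ [p _ <-]; exact: h.
Qed.
Lemma it_lift (A' C' : cstarAlg R) (V : preCorr A' C') (rho : C -> C') (b : X -> Y -> V) :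
  star_hom rho ->
  (forall x y x' y', ip (b x y) (b x' y') = rho (ip y (lact (ip x x') y'))) ->
  exists h : Z -> V, [/\ blin h, forall x y, h (tau x y) = b x y,
    forall z z', ip (h z) (h z') = rho (ip z z') &
    forall z c, h (ract z c) = ract (h z) (rho c)].
Proof.
move=> hr hb; have [|h [h1 h2 h3 h4]] := gram_ext hr (b := fun p => b p.1 p.2) it_total.
  by move=> p q; rewrite hb (it_ip hT).
by exists h; split=> // x y; exact: (h2 (x, y)).
Qed.
(** The annihilation operator, adjoint to the creation operator [tau x]. Its bound is obtained by
    duality: the candidate value [v] at [w] satisfies [<v, y> = <w, tau x y>], tested at [y = v]. *)
Lemma it_annih x : exists h : Z -> Y, [/\ blin h,
  forall x' y, h (tau x' y) = lact (ip x x') y & forall z y, ip (h z) y = ip z (tau x y)].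
Proof.
have C0 : 0 <= 3 * rnorm x by rewrite mulr_ge0 ?rnorm_ge0.
have [|h [h1 h2 h3]] := extension (b := fun p => lact (ip x p.1) p.2) it_total C0.
  move=> s; set v := fsum _ s; set w := fsum _ s.
  have vw y : ip v y = ip w (tau x y).
    rewrite -[LHS]ip_adj -[RHS]ip_adj; congr cadj.
    rewrite /v /w (lin_fsum _ s (ip_linear y)) (lin_fsum _ s (ip_linear (tau x y))).
    by congr fsum; apply/funext => p; rewrite (it_ip hT).
  have [->|v0] := eqVneq (rnorm v) 0; first by rewrite mulr_ge0 ?rnorm_ge0.
  have vp : 0 < rnorm v by rewrite lt_neqAle rnorm_ge0 eq_sym v0.
  rewrite -(ler_pM2r vp) -expr2 -rnorm_ip vw (le_trans (posc_cs it_posc _ _)) //.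
  by rewrite [leRHS]mulrAC mulrC ler_wpM2r ?rnorm_ge0 // it_norm.
have bh : blin h by split=> //; exists (3 * rnorm x).
exists h; split=> // [x' y|z y]; first exact: (h3 (x', y)).
rewrite -[LHS]ip_adj -[RHS]ip_adj; congr cadj; move: z.
apply: it_ext => [||x' y']; [exact: blin_comp (blin_ip y) bh|exact: blin_ip|].
by rewrite (h3 (x', y')) (it_ip hT).
Qed.
End TensorModels.
Arguments it_total {R A B C X Y Z tau} hT z.

Lemma unitary_posc (R : realType) (A B : cstarAlg R) (X Y : preCorr A B) (f : X -> Y) :
  unitary f -> posc X -> posc Y.
Proof. by case=> _ _ _ fi fs pX y; have [x <-] := fs y; rewrite fi. Qed.

Lemma it_transfer (R : realType) (A B C : cstarAlg R) (X : preCorr A B) (Y : preCorr B C)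
  (Z Z' : preCorr A C) (tau : X -> Y -> Z) (f : Z -> Z') :
  interior_tensor tau -> unitary f -> interior_tensor (fun x y => f (tau x y)).
Proof.
move=> h uf; have [fl fla fr fi fs] := uf; split.
- by move=> x c y y'; rewrite (it_linearr h) fl.
- by move=> y c x x'; rewrite (it_linearl h) fl.
- by move=> x b y; rewrite (it_balanced h).
- by move=> a x y; rewrite -fla (it_lact h).
- by move=> x y c; rewrite -fr (it_ract h).
- by move=> x y x' y'; rewrite fi (it_ip h).
- move=> z'; apply/positiveP; exact: (unitary_posc uf (it_posc h) z').
- apply/seteqP; split=> // z' _; have [z <-] := fs z'.
  apply: (cspan_map (unitary_blin uf) _ (it_total h z)) => _ [p _ <-].
  by apply: cspan_sub; exists p.1 => //; exists p.2.
Qed.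

(** * Operators [S \ot 1] on tensor products *)

Section OperatorModule.
Context (R : realType) (A B : cstarAlg R) (X : preCorr A B) (pX : posc X).
Definition op_corr : preCorr (adj_alg pX) B.
Proof.
refine (@PreCorr R (adj_alg pX) B X (@ract _ _ _ X) (@ip _ _ _ X) (fun S : adj_alg pX => lop S)
  _ _ _ _ _ _ _ _ _ _ _).
- exact: ract_linearr.
- exact: ract_linearl.
- exact: ractM.
- exact: ip_linear.
- exact: ip_adj.
- exact: ip_ract.
- exact: ip_norm.
- by move=> x c S T; rewrite lop_lc.
- by move=> S T x; rewrite lop_mul.
- by move=> S x y; exact: lstarP.
- by move=> S x; rewrite !rnormE -rmorphM lecR; exact: lop_bd.
Defined.
End OperatorModule.

(** Regard [X] as a module over the C*-algebra of its adjointable operators and form the tensor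
    product there: the norm bound and the adjoint of [S \ot 1] are then part of a left action. The
    two tensor products are identified by [f] and [g]. *)
Lemma it_op (R : realType) (A B C : cstarAlg R) (X : preCorr A B) (Y : preCorr B C)
  (Z : preCorr A C) (tau : X -> Y -> Z) (pX : posc X) (pY : posc Y) (S S' : X -> X) (c : R) :
  interior_tensor tau -> 0 <= c -> (forall x, rnorm (S x) <= c * rnorm x) -> adjoint_pair S S' ->
  exists h h' : Z -> Z, [/\ blin h, forall x y, h (tau x y) = tau (S x) y,
    forall z, rnorm (h z) <= c * rnorm z, forall x y, h' (tau x y) = tau (S' x) y & adjoint_pair h h'].
Proof.
move=> hT c0 Sc SS'; have [L LS Lc] := lop_ex pX c0 Sc SS'.
have hT' := @tensor_exists _ _ _ _ (op_corr pX) Y pX pY.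
set Z' := tensor_corr _ _ in hT'; set tau' := (fun x y => _) in hT'.
have [f [bf f1 f2 f3]] := it_lift hT (@star_hom_id _ _) (fun x y x' y' => it_ip hT' x y x' y').
have [g [bg g1 g2 g3]] := it_lift hT' (@star_hom_id _ _) (fun x y x' y' => it_ip hT x y x' y').
have fK z : g (f z) = z.
  by move: z; apply: (it_ext hT (blin_comp bg bf) (blin_id _)) => x y; rewrite f1 g1.
have gK z : f (g z) = z.
  by move: z; apply: (it_ext hT' (blin_comp bf bg) (blin_id _)) => x y; rewrite g1 f1.
have L'S : lop (lstar (L : adj_alg pX)) = S'.
  apply: (adjoint_pair_uniq (S := S)) => // x y; rewrite -LS; exact: lstarP.
exists (fun z => g (lact (L : adj_alg pX) (f z))), (fun z => g (lact (cadj (L : adj_alg pX)) (f z))); split.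
- by apply: blin_comp bg (blin_comp _ bf); exact: blin_lact.
- by move=> x y; rewrite f1 (it_lact hT') g1 /= LS.
- move=> z; rewrite (gram_isom g2) (le_trans (rnorm_lact _ _)) // (gram_isom f2).
  by rewrite ler_wpM2r ?rnorm_ge0.
- by move=> x y; rewrite f1 (it_lact hT') g1 /= L'S.
- move=> z z'; rewrite -[in RHS](fK z) g2 -lact_adj -[in LHS](fK z') g2 //.
Qed.

Section Tens.
Context (R : realType) (A B C : cstarAlg R) (X : preCorr A B) (Y : preCorr B C).
Hypotheses (pX : posc X) (pY : posc Y).

Lemma tens_it : interior_tensor (@tens _ _ _ _ X Y).
Proof.
rewrite /tens /tensor /tensor_model /some_or; case: pselect => [e|ne].
  exact: (projT2 (cid e)).
by case: ne; exists (existT (fun Z : preCorr A C => X -> Y -> Z) (tensor_corr pX pY) (fun x y => tvec pX pY [:: (x, y)])); exact: tensor_exists.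
Qed.
Lemma posc_tensor : posc (X \ox Y). Proof. exact: it_posc tens_it. Qed.

Lemma tliftP (V : completeNormedModType R[i]) (b : X -> Y -> V) (h : X \ox Y -> V) :
  blin h -> (forall x y, h (x \ot y) = b x y) -> forall w, tlift b w = h w.
Proof.
move=> bh hb w; rewrite /tlift /some_or; case: pselect => [e|ne]; last first.
  by case: ne; exists h; have [? ?] := (blinP h).1 bh; split.
have [h1 h2 h3] := projT2 (cid e); apply: (it_ext tens_it) => // [|x y].
  by apply/blinP.
by rewrite h3 hb.
Qed.
End Tens.

Section TensorMapsTheory.
Context (R : realType) (A B C : cstarAlg R).

Lemma tmapP (X X' : preCorr A B) (Y Y' : preCorr B C) (f : X -> X') (g : Y -> Y') :
  posc X -> posc Y -> unitary f -> unitary g ->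
  unitary (tmap f g) /\ forall x y, tmap f g (x \ot y) = f x \ot g y.
Proof.
move=> pX pY uf ug; have hT := tens_it pX pY.
have hT' := tens_it (unitary_posc uf pX) (unitary_posc ug pY).
have [fl fla fr fi fs] := uf; have [gl gla gr gi gs] := ug.
have [|||||h [uh hh]] := @unitary_ext _ _ _ _ (X' \ox Y') _ (fun p : X * Y => p.1 \ot p.2)
   (fun p : X * Y => f p.1 \ot g p.2) (fun a p => (lact a p.1, p.2)).
- exact: it_total hT.
- move=> w; apply: (cspan_mono _ (it_total hT' w)) => _ [[x' y'] _ <-].
  by have [[x <-] [y <-]] := (fs x', gs y'); exists (x, y).
- by move=> p q; rewrite (it_ip hT') fi -gla gi (it_ip hT).
- by move=> a p; rewrite (it_lact hT).
- by move=> a p; rewrite (it_lact hT') fla.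
have E : tmap f g = h.
  apply/funext; apply: (tliftP pX pY); first exact: unitary_blin.
  by move=> x y; rewrite (hh (x, y)).
by rewrite E; split=> // x y; exact: (hh (x, y)).
Qed.

Context (D : cstarAlg R) (X : preCorr A B) (Y : preCorr B C) (Z : preCorr C D).
Hypotheses (pX : posc X) (pY : posc Y) (pZ : posc Z).
Let hXY := tens_it pX pY.
Let hYZ := tens_it pY pZ.
Let hXY_Z := tens_it (posc_tensor pX pY) pZ.
Let hX_YZ := tens_it pX (posc_tensor pY pZ).

Lemma tens3_totall w : cspan (range (fun p : (X * Y) * Z => (p.1.1 \ot p.1.2) \ot p.2)) w.
Proof.
apply: (cspan_min (@cspan_closed _ _ _) _ (it_total hXY_Z w)) => _ [[v z] _ <-] /=.
apply: (cspan_map (it_blinl hXY_Z z) _ (it_total hXY v)) => _ [p _ <-].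
by apply: cspan_sub; exists (p, z).
Qed.
Lemma tens3_totalr w : cspan (range (fun p : (X * Y) * Z => p.1.1 \ot (p.1.2 \ot p.2))) w.
Proof.
apply: (cspan_min (@cspan_closed _ _ _) _ (it_total hX_YZ w)) => _ [[x v] _ <-] /=.
apply: (cspan_map (it_blinr hX_YZ x) _ (it_total hYZ v)) => _ [p _ <-].
by apply: cspan_sub; exists ((x, p.1), p.2).
Qed.

Lemma assocP : unitary (assoc X Y Z) /\
  forall x y z, assoc X Y Z ((x \ot y) \ot z) = x \ot (y \ot z).
Proof.
have [|||h [uh hh]] := @unitary_ext _ _ _ _ _ _ _ _ (fun a p => ((lact a p.1.1, p.1.2), p.2)) tens3_totall tens3_totalr.
- by move=> p q; rewrite (it_ip hX_YZ) (it_lact hYZ) (it_ip hYZ) (it_ip hXY_Z) (it_ip hXY).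
- by move=> a p; rewrite (it_lact hXY_Z) (it_lact hXY).
- by move=> a p; rewrite (it_lact hX_YZ).
have E : assoc X Y Z = h.
  apply/funext; apply: (tliftP (posc_tensor pX pY) pZ); first exact: unitary_blin.
  move=> v z; rewrite (tliftP pX pY (h := fun v => h (v \ot z))) //.
    exact: blin_comp (unitary_blin uh) (it_blinl hXY_Z z).
  by move=> x y; rewrite (hh ((x, y), z)).
by rewrite E; split=> // x y z; exact: (hh ((x, y), z)).
Qed.
Lemma assocVP : unitary (assocV X Y Z) /\
  forall x y z, assocV X Y Z (x \ot (y \ot z)) = (x \ot y) \ot z.
Proof.
have [[uh hh] [g [ug gK hK]]] := (assocP, unitary_inv assocP.1).
have gE x y z : g (x \ot (y \ot z)) = (x \ot y) \ot z by rewrite -hh gK.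
have E : assocV X Y Z = g.
  apply/funext; apply: (tliftP pX (posc_tensor pY pZ)); first exact: unitary_blin.
  move=> x v; rewrite (tliftP pY pZ (h := fun v => g (x \ot v))) //.
  exact: blin_comp (unitary_blin ug) (it_blinr hX_YZ x).
by rewrite E.
Qed.
End TensorMapsTheory.

(** * Covariant data in subalgebras, and generation of the Cuntz-Pimsner algebra *)

Section AuxiliaryCorrespondences.
Context (R : realType).

Definition self_corr (P : cstarAlg R) : preCorr P P.
Proof.
refine (@PreCorr R P P P (@cmul _ P) (fun a b => cmul (cadj a) b) (@cmul _ P)
  _ _ _ _ _ _ _ _ _ _ _).
- exact: cmul_linearr.
- exact: cmul_linearl.
- exact: cmulA.
- by move=> a; exact: cmul_linearr.
- by move=> a b; rewrite cadjM cadjK.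
- by move=> a b c; rewrite cmulA.
- exact: cnormC.
- exact: cmul_linearl.
- by move=> a b c; rewrite cmulA.
- by move=> a b c; rewrite cadjM cmulA.
- exact: cnormM.
Defined.

Lemma posc_self P : posc (self_corr P). Proof. by move=> a; exact: Pos_adj_mul. Qed.
Lemma nondeg_self P : nondeg (self_corr P).
Proof.
move=> a; have [_ _ cl] := cspan_closed [set lact b w | b in [set: P] & w in [set: self_corr P]].
apply: cl => e e0; have [u _ hu] := ctr_one a e0; exists (cmul u a) => //.
by apply: cspan_sub; exists u => //; exists a.
Qed.

Definition res (B Q P : cstarAlg R) (pi : B -> Q) (hpi : star_hom pi) (E : preCorr Q P) : preCorr B P.
Proof.
refine (@PreCorr R B P E (@ract _ _ _ E) (@ip _ _ _ E) (fun b => lact (pi b))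
  _ _ _ _ _ _ _ _ _ _ _).
- exact: ract_linearr.
- exact: ract_linearl.
- exact: ractM.
- exact: ip_linear.
- exact: ip_adj.
- exact: ip_ract.
- exact: ip_norm.
- by have [pl _ _ _] := hpi => x c a b; rewrite pl lact_linearl.
- by have [_ pm _ _] := hpi => a b x; rewrite pm lactM.
- by have [_ _ pa _] := hpi => a x y; rewrite pa lact_adj.
- have [_ _ _ pn] := hpi => a x; rewrite (le_trans (lact_norm _ _)) //.
  by rewrite ler_wpM2r ?normr_ge0.
Defined.

Lemma nondeg_tensor (A B C : cstarAlg R) (X : preCorr A B) (Y : preCorr B C)
  (Z : preCorr A C) (tau : X -> Y -> Z) : interior_tensor tau -> nondeg X -> nondeg Z.
Proof.
move=> hT nX z; apply: (cspan_min (@cspan_closed _ _ _) _ (it_total hT z)) => _ [[x y] _ <-] /=.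
apply: (cspan_map (it_blinl hT y) _ (@nX x)) => _ [a _ [x' _ <-]].
by apply: cspan_sub; exists a => //; exists (tau x' y) => //; rewrite (it_lact hT).
Qed.

(** Nondegeneracy is known at [q] only, so the approximate unit is found in [A \ox Q], where it
    exists everywhere, and carried over by the isometric product map [h]. The error is at most
    [1 + 1 + 2] eighths of [e]. *)
Lemma nondeg_approx (A Q : cstarAlg R) (pi : A -> Q) (hpi : star_hom pi) (q : Q) (e : R) :
  cspan [set cmul (pi a) q' | a in [set: A] & q' in [set: Q]] q -> 0 < e ->
  exists2 u, ctr u & rnorm (q - cmul (pi u) q) <= e.
Proof.
move=> hq e0; have [pl pm pa pn] := hpi.
have hT := tens_it (@posc_self A) (@posc_self Q : posc (res hpi (self_corr Q))).
have [h [bh h1 h2 _]] := it_lift (V := self_corr Q) (b := fun (a : self_corr A) (q' : res hpi (self_corr Q)) => cmul (pi a) q' : self_corr Q)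
  hT (@star_hom_id _ _) (fun x y x' y' => (ltac:(by rewrite /= pm pa cadjM !cmulA))).
have e8 : 0 < e / 8 by rewrite divr_gt0.
have [w hw] : exists w, rnorm (q - h w) <= e / 8.
  have /closureP/(_ _ e8)[y [n [c [v [hv ->]]]] qy] := hq.
  suff [w hw] : exists w, \sum_i c i *: v i = h w by exists w; rewrite -hw.
  elim/big_rec: _ => [|i z _ [w ->]]; first by exists 0; rewrite (lin0 (blin_lin bh)).
  have [a _ [q' _ <-]] := hv i.
  exists (c i *: ((a : self_corr A) \ot (q' : res hpi (self_corr Q))) + w).
  by rewrite (blin_lin bh) h1.
have [u cu hu] := approx_unit_one (it_posc hT) (nondeg_tensor hT (@nondeg_self A)) w e8.
have hl : h (lact u w) = cmul (pi u) (h w).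
  move: w {hw hu}; apply: (it_ext hT).
  - exact: blin_comp bh (blin_lact _ u).
  - exact: (blin_comp (blin_cmul (pi u)) bh).
  - by move=> a q'; rewrite (it_lact hT) !h1 /= pm cmulA.
exists u => //.
have -> : q - cmul (pi u) q = (q - h w) + (h (w - lact u w) - cmul (pi u) (q - h w)).
  by rewrite (linB (blin_lin bh)) hl !cE; lmod.
have n1 : rnorm (h (w - lact u w)) <= e / 8 by rewrite (gram_isom h2).
have n2 : rnorm (cmul (pi u) (q - h w)) <= 2 * (e / 8).
  rewrite (le_trans (rnormM _ _)) // ler_pM ?rnorm_ge0 // (le_trans (star_hom_norm hpi _)) //.
  exact: ctr_norm2.
apply: (le_trans (rnormD _ _)); apply: (@le_trans _ _ (e / 8 + (e / 8 + 2 * (e / 8)))); last by lra.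
apply: lerD => //; apply: (le_trans (rnormD _ _)); rewrite rnormN; exact: lerD.
Qed.

Lemma star_hom_comp (A B C : cstarAlg R) (g : B -> C) (f : A -> B) :
  star_hom g -> star_hom f -> star_hom (fun a => g (f a)).
Proof.
move=> [gl gm ga gn] [fl fm fa fn]; split=> [c x y|x y|x|x].
- by rewrite fl gl.
- by rewrite fm gm.
- by rewrite fa ga.
- exact: le_trans (gn _) (fn _).
Qed.

Lemma cspan_lc (V : completeNormedModType R[i]) (D : closedSub V) : lin_closed (cset D).
Proof.
split; [exact: cset0|exact: cset_lin|move=> x hx].
by apply: (@cset_closed _ _ D); apply/closureP => e /hx[y Dy xy]; exists y.
Qed.

Definition lcS (V : completeNormedModType R[i]) (P : V -> Prop) (hP : lin_closed P) : closedSub V.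
Proof.
refine (@ClosedSub R V [set v | P v] _ _ _); first by case: hP.
- by case: hP.
- by case: hP => _ _ h x /closureP hx; apply: h => e /hx[y Py xy]; exists y.
Defined.
End AuxiliaryCorrespondences.

Section SubAlgebra.
Context (R : realType) (Q : cstarAlg R) (D : closedSub Q).
Hypotheses (dM : forall a b, cset D a -> cset D b -> cset D (cmul a b))
  (dA : forall a, cset D a -> cset D (cadj a)).
Definition sub_alg : cstarAlg R.
Proof.
refine (@CStarAlg R (csub D) (fun a b => mkcsub (dM (csubP a) (csubP b)))
  (fun a => mkcsub (dA (csubP a))) _ _ _ _ _ _ _ _).
- by move=> a c x y; apply: val_inj; exact: cmul_linearr.
- by move=> a c x y; apply: val_inj; exact: (cmul_linearl (cval a)).
- by move=> a b c; apply: val_inj; exact: cmulA.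
- by move=> c a b; apply: val_inj; exact: cadj_linear.
- by move=> a; apply: val_inj; exact: cadjK.
- by move=> a b; apply: val_inj; exact: cadjM.
- by move=> a b; exact: cnormM.
- by move=> a; exact: cnormC.
Defined.
Lemma star_hom_cval : star_hom (fun a : sub_alg => cval a).
Proof. by split=> // a; exact: lexx. Qed.
End SubAlgebra.

(** * Compact operators *)

Section Compacts.
Context (R : realType) (A B : cstarAlg R) (X : preCorr A B).

Lemma rank1_adj (x y : X) : adjoint_pair (rank1 x y) (rank1 y x).
Proof. by move=> z w; rewrite /rank1 ip_ractl ip_ract ip_adj. Qed.
Lemma compacts_rank1 (x y : X) : compacts (rank1 x y).
Proof.
split=> [|e e0]; first by exists (rank1 y x); exact: rank1_adj.
by exists [:: (x, y)] => z; rewrite big_seq1 subrr normr0 mulr_ge0 // ltW.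
Qed.
Lemma compactsP (S : X -> X) : compacts S <-> (exists T, adjoint_pair S T) /\
  forall e : R, 0 < e -> exists s : seq (X * X),
       forall z, rnorm (S z - \sum_(p <- s) rank1 p.1 p.2 z) <= e * rnorm z.
Proof.
split=> -[h1 h2]; split=> // e e0.
  have [|s hs] := h2 e%:C; first by rewrite ltcR.
  by exists s => z; have := hs z; rewrite !rnormE -rmorphM lecR.
have eE : e = (complex.Re e)%:C by case: (e) e0 => a b; rewrite ltcE /= => /andP[/eqP ->].
have [|s hs] := h2 (complex.Re e); first by move: e0; rewrite eE ltcR.
by exists s => z; rewrite eE !rnormE -rmorphM lecR.
Qed.
Lemma compacts_lin (c : R[i]) S T : compacts S -> compacts T -> @compacts _ _ _ X (fun x => c *: S x + T x).
Proof.
move=> /compactsP[[S' hS] aS] /compactsP[[T' hT] aT]; apply/compactsP; split.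
  by exists (fun x => c^*%R *: S' x + T' x) => x y; rewrite !ipE hS hT.
move=> e e0; have k0 : 0 < cabs c + 1 by have := cabs_ge0 c; lra.
have [|s hs] := aS (e / 2 / (cabs c + 1)); first by rewrite !divr_gt0.
have [|t ht] := aT (e / 2); first by rewrite divr_gt0.
exists ([seq (c *: p.1, p.2) | p <- s] ++ t) => z; rewrite big_cat big_map /=.
have -> : \sum_(p <- s) rank1 (c *: p.1) p.2 z = c *: \sum_(p <- s) rank1 p.1 p.2 z.
  by rewrite scaler_sumr; apply: eq_bigr => p _; rewrite /rank1 ractZl.
have -> (a b a' b' : X) : c *: a + b - (c *: a' + b') = c *: (a - a') + (b - b') by lmod.
rewrite (le_trans (rnormD _ _)) // (_ : e = e / 2 + e / 2) ?mulrDl ?lerD //; last by lra.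
rewrite rnormZ; set r := rnorm _; have hr : r <= e / 2 / (cabs c + 1) * rnorm z := hs z.
apply: (@le_trans _ _ ((cabs c + 1) * r)); first by rewrite ler_wpM2r ?rnorm_ge0 // lerDl.
by rewrite -ler_pdivlMl // mulrA (mulrC _^-1).
Qed.
Lemma compacts_sum (s : seq (X * X)) : compacts (fun z => \sum_(p <- s) rank1 p.1 p.2 z).
Proof.
elim: s => [|p s IH].
  have := compacts_lin (-1) (compacts_rank1 0 0) (compacts_rank1 0 0).
  by congr compacts; apply/funext => z; rewrite big_nil scaleN1r addNr.
have := compacts_lin 1 (compacts_rank1 p.1 p.2) IH.
by congr compacts; apply/funext => z; rewrite big_cons scale1r.
Qed.
Lemma rank1_bd (x y z : X) : rnorm (rank1 x y z) <= 8 * rnorm x * rnorm y * rnorm z.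
Proof.
rewrite /rank1 (le_trans (rnorm_ract _ _)) // -!mulrA (mulrCA 8) ler_wpM2l ?rnorm_ge0 // mulrA.
exact: rnorm_ip8.
Qed.
Lemma compacts_bd S : @compacts _ _ _ X S -> exists2 C : R, 0 <= C & forall z, rnorm (S z) <= C * rnorm z.
Proof.
move=> /compactsP[_ /(_ 1 ltr01)[s hs]].
have [C C0 hC] : exists2 C : R, 0 <= C & forall z, rnorm (\sum_(p <- s) rank1 p.1 p.2 z) <= C * rnorm z.
  elim: s {hs} => [|p s [C C0 hC]]; first by exists 0 => // z; rewrite big_nil rnorm0 mul0r.
  exists (8 * rnorm p.1 * rnorm p.2 + C); first by rewrite addr_ge0 ?mulr_ge0 ?rnorm_ge0.
  by move=> z; rewrite big_cons mulrDl (le_trans (rnormD _ _)) // lerD // rank1_bd.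
exists (1 + C) => [|z]; first by rewrite addr_ge0.
by rewrite -[S z](subrK (\sum_(p <- s) rank1 p.1 p.2 z)) mulrDl (le_trans (rnormD _ _)) // lerD.
Qed.
Lemma compacts_comp S T T' (C : R) : 0 <= C -> (forall z, rnorm (T z) <= C * rnorm z) ->
  adjoint_pair T T' -> compacts S -> @compacts _ _ _ X (S \o T).
Proof.
move=> C0 hC hT /compactsP[[S' hS] aS]; apply/compactsP; split.
  by exists (T' \o S') => x y; rewrite /= hS hT.
move=> e e0; have k0 : 0 < C + 1 by lra.
have [|s hs] := aS (e / (C + 1)); first by rewrite divr_gt0.
exists [seq (p.1, T' p.2) | p <- s] => z; rewrite big_map /=.
have -> : \sum_(p <- s) rank1 p.1 (T' p.2) z = \sum_(p <- s) rank1 p.1 p.2 (T z).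
  by apply: eq_bigr => p _; rewrite /rank1 (adjoint_pair_sym hT).
apply: (le_trans (hs (T z))); rewrite -mulrA ler_wpM2l ?(ltW e0) // ler_pdivrMl //.
by rewrite (le_trans (hC z)) // ler_wpM2r ?rnorm_ge0 // lerDl.
Qed.
Lemma compacts_comp2 S T : compacts S -> compacts T -> @compacts _ _ _ X (S \o T).
Proof.
move=> cS cT; have [C C0 hC] := compacts_bd cT; have [[T' hT] _] := cT.
exact: compacts_comp C0 hC hT cS.
Qed.
End Compacts.

(** * Covariant pairs in subalgebras *)

Section CovariantSub.
Context (R : realType) (A : cstarAlg R) (X : preCorr A A).

(** The clause [cov_compacts] of [covariant] in isolation; it makes sense in algebras where [pi] may
    be degenerate, such as all adjointable operators. *)
Definition fiber_cond (D : cstarAlg R) (pi : A -> D) (t : X -> D) : Prop :=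
  exists psi : (X -> X) -> D,
    [/\ [/\ forall (c : R[i]) S T, compacts S -> compacts T ->
              psi (fun x => c *: S x + T x) = c *: psi S + psi T,
            forall S T, compacts S -> compacts T ->
              psi (S \o T) = cmul (psi S) (psi T),
            forall S T, compacts S -> compacts T -> adjoint_pair S T ->
              psi T = cadj (psi S) &
            forall S (c : R[i]), compacts S ->
              (forall x, `|S x| <= c * `|x|) -> 0 <= c -> `|psi S| <= c],
        forall x y, psi (rank1 x y) = cmul (t x) (cadj (t y)) &
        forall a, psi (lact a) = pi a].

Context (Q : cstarAlg R) (pi : A -> Q) (t : X -> Q).

Lemma psi_span (psi : (X -> X) -> Q) :
  (forall (c : R[i]) S T, compacts S -> compacts T ->
     psi (fun x => c *: S x + T x) = c *: psi S + psi T) ->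
  (forall S (c : R[i]), compacts S -> (forall x, `|S x| <= c * `|x|) -> 0 <= c -> `|psi S| <= c) ->
  (forall x y, psi (rank1 x y) = cmul (t x) (cadj (t y))) ->
  forall S, compacts S -> cspan [set cmul (t x) (cadj (t y)) | x in [set: X] & y in [set: X]] (psi S).
Proof.
move=> pl pn p1 S cS; have [_ _ cl] := cspan_closed [set cmul (t x) (cadj (t y)) | x in [set: X] & y in [set: X]].
apply: cl => e e0; have /compactsP[_ /(_ e e0)[s hs]] := cS.
have cs := compacts_sum s; exists (psi (fun z => \sum_(p <- s) rank1 p.1 p.2 z)).
  elim: s {hs} cs => [|p s IH] cs.
    suff -> : psi (fun z => \sum_(p <- [::]) rank1 p.1 p.2 z) = 0 by case: (cspan_closed [set cmul (t x) (cadj (t y)) | x in [set: X] & y in [set: X]]).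
    apply/eqP; rewrite -normr_eq0 eq_le normr_ge0 andbT; apply: pn => // x.
    by rewrite big_nil normr0 mul0r.
  have -> : (fun z => \sum_(q <- p :: s) rank1 q.1 q.2 z) =
     (fun z => 1 *: rank1 p.1 p.2 z + \sum_(q <- s) rank1 q.1 q.2 z).
    by apply/funext => z; rewrite big_cons scale1r.
  rewrite pl; [|exact: compacts_rank1|exact: compacts_sum].
  have [_ sl _] := cspan_closed [set cmul (t x) (cadj (t y)) | x in [set: X] & y in [set: X]].
  apply: sl; last by apply: IH; exact: compacts_sum.
  by rewrite p1; apply: cspan_sub; exists p.1 => //; exists p.2.
have -> : psi S - psi (fun z => \sum_(p <- s) rank1 p.1 p.2 z) =
    psi (fun z => (-1) *: (\sum_(p <- s) rank1 p.1 p.2 z) + S z).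
  by rewrite pl // scaleN1r addrC.
rewrite -lecR -rnormE; apply: pn; last by rewrite lecR ltW.
  exact: compacts_lin.
by move=> x; rewrite !rnormE -rmorphM lecR scaleN1r addrC; exact: hs.
Qed.

Hypotheses (hpi : star_hom pi) (tl : linear t)
  (tip : forall x y, cmul (cadj (t x)) (t y) = pi (ip x y))
  (tla : forall a x, cmul (pi a) (t x) = t (lact a x))
  (hfib : fiber_cond pi t) (pr : proper_corr X).

Context (D : closedSub Q).
Hypotheses (dM : forall a b, cset D a -> cset D b -> cset D (cmul a b))
  (dA : forall a, cset D a -> cset D (cadj a))
  (Dpi : forall a, cset D (pi a)) (Dt : forall x, cset D (t x))
  (nd : forall d, cset D d -> cspan [set cmul (pi a) q | a in [set: A] & q in [set: Q]] d).
Notation DA := (sub_alg dM dA).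

(** Shrinking the codomain to [D] yields the exact factorizations [d = pi(a) d'] that the universal
    property wants: Cohen factorization applies to [D] as a module over [A]. The values of [psi]
    stay in [D] because compacts are limits of sums of rank one operators. *)
Lemma covariant_sub : @covariant R A X DA (fun a => mkcsub (Dpi a)) (fun x => mkcsub (Dt x)).
Proof.
have [pl pm pa pn] := hpi.
have hpiD : @star_hom _ _ DA (fun a => mkcsub (Dpi a)).
  split.
  - by move=> c x y; apply: val_inj; rewrite /= pl.
  - by move=> a b; apply: val_inj; rewrite /= pm.
  - by move=> a; apply: val_inj; rewrite /= pa.
  - by move=> a; exact: pn.
split => //.
- move=> d.
  have pV : posc (res hpiD (self_corr DA)) by exact: posc_self.
  have nV : nondeg (res hpiD (self_corr DA)).
    move=> v; have [_ _ cl] := cspan_closed [set @lact _ _ _ (res hpiD (self_corr DA)) a w | a in [set: A] & w in [set: res hpiD (self_corr DA)]].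
    apply: cl => e e0; have [u _ hu] := nondeg_approx hpi (nd (csubP v)) e0.
    exists (@lact _ _ _ (res hpiD (self_corr DA)) u v).
      by apply: cspan_sub; exists u => //; exists v.
    by rewrite -rnorm_cval cvalB.
  exact: (cohen pV nV d).
- by move=> c x y; apply: val_inj; rewrite /= tl.
- by move=> x y; apply: val_inj; exact: tip.
- by move=> a x; apply: val_inj; exact: tla.
have [psi [[sl sm sa sn] s1 sp]] := hfib.
have DS S : compacts S -> cset D (psi S).
  move=> cS; apply: (cspan_min (cspan_lc D) _ (psi_span sl sn s1 cS)) => _ [x _ [y _ <-]].
  by apply: dM => //; apply: dA.
pose psiD S : DA := if pselect (compacts S) is left h then mkcsub (DS S h) else 0.
have psiE S : compacts S -> cval (psiD S) = psi S.
  by rewrite /psiD; case: pselect.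
clearbody psiD; exists psiD; split; first split.
- move=> c S T cS cT; apply: val_inj.
  by rewrite [LHS](psiE _ (compacts_lin c cS cT)) (sl _ _ _ cS cT) [RHS]cval_lc (psiE _ cS) (psiE _ cT).
- move=> S T cS cT; apply: val_inj.
  by rewrite [LHS](psiE _ (compacts_comp2 cS cT)) (sm _ _ cS cT) -(psiE _ cS) -(psiE _ cT).
- move=> S T cS cT h; apply: val_inj.
  by rewrite [LHS](psiE _ cT) (sa S T cS cT h) -(psiE _ cS).
- by move=> S c cS hS c0; rewrite -[`|_|]/`|cval _| (psiE _ cS); exact: sn.
- by move=> x y; apply: val_inj; rewrite [LHS](psiE _ (compacts_rank1 x y)) s1.
- by move=> a; apply: val_inj; rewrite [LHS](psiE _ (pr a)) sp.
Qed.
End CovariantSub.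

(** An induction principle rather than a statement on the generated subalgebra, so that it applies
    directly to predicates such as commutation with an operator. *)
Definition generates (R : realType) (A : cstarAlg R) (X : preCorr A A) (Q : cstarAlg R)
    (pi : A -> Q) (t : X -> Q) := forall P : Q -> Prop, lin_closed P ->
  (forall a b, P a -> P b -> P (cmul a b)) -> (forall a, P a -> P (cadj a)) ->
  (forall a, P (pi a)) -> (forall x, P (t x)) -> forall q, P q.

Section Generation.
Context (R : realType) (A : cstarAlg R) (X : preCorr A A) (O : cuntzPimsner X).
Hypothesis pr : proper_corr X.

(** [P] is a C*-subalgebra through which the universal pair factors. The resulting map from [O] into
    it, followed by the inclusion, is the identity of [O] by uniqueness. *)
Lemma cp_generates : generates (cp_pi O) (cp_t O).
Proof.
move=> P lP PM PA Ppi Pt q.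
have [pih nd tl tip tla hf] := cp_cov O.
have hD := @covariant_sub _ _ _ _ _ _ pih tl tip tla hf pr (lcS lP) PM PA Ppi Pt
  (fun d _ => cspan_sub (let: ex_intro a (ex_intro d' e) := nd d in
    ex_intro2 (fun a => setT a) (fun a => exists2 q, setT q & cmul (cp_pi O a) q = d) a I (ex_intro2 _ _ d' I (esym e)))).
have [s [[hs s1 s2] _]] := @cp_univ _ _ _ O _ _ _ hD.
have [u [_ hu]] := @cp_univ _ _ _ O _ _ _ (cp_cov O).
have u1 : u = fun x => x by apply: hu; split=> //; exact: star_hom_id.
have u2 : u = fun x => cval (s x).
  apply: hu; split=> [|a|x]; [|by rewrite s1|by rewrite s2].
  have [sl sm sa sn] := hs; split=> [c x y|a b|a|a].
  - by rewrite sl.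
  - by rewrite sm.
  - by rewrite sa.
  - exact: sn.
have <- : cval (s q) = q by exact: (congr1 (fun f => f q) (etrans (esym u2) u1)).
exact: (csubP (s q)).
Qed.
End Generation.

(** * Graded representations and lifts of correspondences *)

(* covariant representations in a C*-algebra with an action [r_g] of the unit
   circle, [r_g z] being arbitrary for [`|z| <> 1] *)
Record rep (R : realType) (A : cstarAlg R) (X : preCorr A A) (P : cstarAlg R) := Rep {
  r_pi : A -> P;
  r_t : X -> P;
  r_g : R[i] -> P -> P;
  r_hom : star_hom r_pi;
  r_lin : linear r_t;
  r_ip : forall x y, cmul (cadj (r_t x)) (r_t y) = r_pi (ip x y);
  r_lact : forall a x, cmul (r_pi a) (r_t x) = r_t (lact a x);
  r_ghom : forall z, `|z| = 1 -> star_hom (r_g z);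
  r_gpi : forall z a, `|z| = 1 -> r_g z (r_pi a) = r_pi a;
  r_gt : forall z x, `|z| = 1 -> r_g z (r_t x) = z *: r_t x;
  r_nd : forall p, cspan [set cmul (r_pi a) q | a in [set: A] & q in [set: P]] p;
  r_tot : forall p, cspan [set cmul (r_t x) q | x in [set: X] & q in [set: P]] p }.

Section RepTheory.
Context (R : realType) (A : cstarAlg R) (X : preCorr A A) (P : cstarAlg R) (r : rep X P).
Lemma rep_ract x a : r_t r (ract x a) = cmul (r_t r x) (r_pi r a).
Proof. by apply: (gram_ract (V := self_corr P) (r_hom r) (@r_lin _ _ _ _ r)) => y y'; exact: r_ip. Qed.
Lemma rep_blin : blin (r_t r).
Proof.
split; first exact: r_lin.
exists 1 => // x; rewrite mul1r; exact: (gram_norm (r_hom r) (fun y y' => @r_ip _ _ _ _ r y y' : ip (r_t r y : self_corr P) (r_t r y') = _)).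
Qed.
Definition rcorr : preCorr A P := res (r_hom r) (self_corr P).
Lemma posc_rcorr : posc rcorr. Proof. exact: posc_self. Qed.
End RepTheory.

Section Lifts.
Context (R : realType) (A B : cstarAlg R) (X : preCorr A A) (Y : preCorr B B) (P Q : cstarAlg R)
  (r : rep X P) (s : rep Y Q).

(* [lift_act sg w T] is the value at [(f \ot x) \ot T |-> sg f (t x T)] of [w \ot T] *)
Definition lift_act (F : preCorr B A) (E : completeNormedModType R[i]) (sg : F -> P -> E)
    (w : F \ox X) (T : P) : E :=
  tlift (fun f x => sg f (cmul (r_t r x) T)) w.

(** As a module over the coefficients [B], [E] is just [F \ox P]. The structure added is an action
    of all of [Q], tied to [Y] through [li_t], and operators [U z] that put [F] in degree 0 and
    cover the gauge actions of both algebras. *)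
Record is_lift (F : preCorr B A) (Phi : Y \ox F -> F \ox X) (E : preCorr Q P)
    (U : R[i] -> E -> E) (sg : F -> P -> E) : Prop := IsLift {
  li_it : interior_tensor (Z := res (r_hom s) E) (Y := rcorr r) sg;
  li_t : forall y f T, lact (r_t s y) (sg f T) = lift_act sg (Phi (y \ot f)) T;
  li_Ulin : forall z, `|z| = 1 -> linear (U z);
  li_U : forall z f T, `|z| = 1 -> U z (sg f T) = sg f (r_g r z T);
  li_Uq : forall z q xi, `|z| = 1 -> U z (lact q xi) = lact (r_g s z q) (U z xi);
  li_Uip : forall z xi eta, `|z| = 1 -> ip (U z xi) (U z eta) = r_g r z (ip xi eta) }.

Section LiftAct.
Context (F : preCorr B A) (E : preCorr B P) (sg : F -> P -> E).
Hypotheses (pX : posc X) (pF : posc F) (hT : interior_tensor (Y := rcorr r) sg).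

(** By [r_tot] the products [t(x) T] exhaust [P], so [(F \ox X) \ox P] is again [E]; [lift_act] is
    the elementary tensor [w \ot T] read in [E]. *)
Lemma lift_act_ex : exists J : (F \ox X) \ox rcorr r -> E, [/\ unitary J,
  forall f x T, J ((f \ot x) \ot (T : rcorr r)) = sg f (cmul (r_t r x) T) &
  forall w T, lift_act sg w T = J (w \ot (T : rcorr r))].
Proof.
have hFX := tens_it pF pX; have hP := tens_it (posc_tensor pF pX) (@posc_rcorr _ _ _ _ r).
have [||||J [uJ J1]] := @unitary_ext _ _ _ _ E _ _ (fun p => sg p.1.1 (cmul (r_t r p.1.2) p.2))
   (fun b p => ((lact b p.1.1, p.1.2), p.2)) (tens3_totall pF pX (@posc_rcorr _ _ _ _ r)).
- move=> z; apply: (cspan_min (@cspan_closed _ _ _) _ (it_total hT z)) => _ [[f p] _ <-] /=.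
  apply: (cspan_map (it_blinr hT f) _ (@r_tot _ _ _ _ r p)) => _ [x _ [q _ <-]].
  by apply: cspan_sub; exists ((f, x), q).
- move=> p q; rewrite (it_ip hT) (it_ip hP) (it_ip hFX) /= -r_ip -r_lact cadjM !cmulA //.
- by move=> b p; rewrite (it_lact hP) (it_lact hFX).
- by move=> b p; rewrite (it_lact hT).
exists J; split=> // [f x T|w T]; first exact: (J1 ((f, x), T)).
apply: (tliftP pF pX (h := fun w => J (w \ot (T : rcorr r)))).
  exact: blin_comp (unitary_blin uJ) (it_blinl hP T).
by move=> f x; rewrite (J1 ((f, x), T)).
Qed.
Lemma lift_act_blin T : blin (lift_act sg ^~ T).
Proof.
have [J [uJ _ JE]] := lift_act_ex.
have -> : lift_act sg ^~ T = fun w => J (w \ot (T : rcorr r)) by apply/funext => w.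
exact: blin_comp (unitary_blin uJ) (it_blinl (tens_it (posc_tensor pF pX) (@posc_rcorr _ _ _ _ r)) T).
Qed.
Lemma lift_actE f x T : lift_act sg (f \ot x) T = sg f (cmul (r_t r x) T).
Proof. by have [J [_ J1 ->]] := lift_act_ex. Qed.
Lemma lift_act_ip w T w' T' :
  ip (lift_act sg w T) (lift_act sg w' T') = cmul (cadj T) (cmul (r_pi r (ip w w')) T').
Proof.
have [J [[_ _ _ Ji _] J1 JE]] := lift_act_ex; rewrite !JE Ji.
by rewrite (it_ip (tens_it (posc_tensor pF pX) (@posc_rcorr _ _ _ _ r))).
Qed.
Lemma lift_act_lact b w T : lact b (lift_act sg w T) = lift_act sg (lact b w) T.
Proof.
have [J [[_ Jl _ _ _] _ JE]] := lift_act_ex; rewrite !JE -Jl.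
by rewrite (it_lact (tens_it (posc_tensor pF pX) (@posc_rcorr _ _ _ _ r))).
Qed.
Lemma lift_act_total z : cspan [set lift_act sg w T | w in [set: F \ox X] & T in [set: P]] z.
Proof.
apply: (cspan_min (@cspan_closed _ _ _) _ (it_total hT z)) => _ [[f p] _ <-] /=.
apply: (cspan_map (it_blinr hT f) _ (@r_tot _ _ _ _ r p)) => _ [x _ [q _ <-]].
by apply: cspan_sub; exists (f \ot x) => //; exists q => //; rewrite lift_actE.
Qed.
Lemma lift_act_gauge z (U : E -> E) T : `|z| = 1 -> blin U ->
  (forall f T, U (sg f T) = sg f (r_g r z T)) ->
  forall w, U (lift_act sg w T) = z *: lift_act sg w (r_g r z T).
Proof.
move=> z1 bU hU; have [_ gm _ _] := r_ghom r z1.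
apply: (it_ext (tens_it pF pX)).
- exact: blin_comp bU (lift_act_blin T).
- exact: blinZ (lift_act_blin _).
by move=> f x; rewrite !lift_actE hU gm r_gt // cmulZl (linZ (it_linearr hT f)).
Qed.
End LiftAct.
End Lifts.

Lemma ract_approx (R : realType) (A B : cstarAlg R) (X : preCorr A B) (x : X) (e : R) : 0 < e ->
  exists b, rnorm (x - ract x b) <= e.
Proof.
move=> e0; have d0 : 0 < e ^+ 2 / 3 by rewrite divr_gt0 ?exprn_gt0.
have [u cu hu] := ctr_one (ip x x) d0; exists (cadj u).
rewrite -(@ler_pXn2r _ 2) ?nnegrE ?rnorm_ge0 ?(ltW e0) // -rnorm_ip.
have -> : ip (x - ract x (cadj u)) (x - ract x (cadj u)) =
   cadj (ip x x - cmul u (ip x x)) - cmul u (cadj (ip x x - cmul u (ip x x))).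
  by rewrite !(ipE, ip_ract, ip_ractl, cadjE, cE) !ip_adj cmulA; lmod.
have := ctr_norm (cadj (ip x x - cmul u (ip x x))) cu.
have := rnormB (cadj (ip x x - cmul u (ip x x))) (cmul u (cadj (ip x x - cmul u (ip x x)))).
rewrite rnorm_adj; lra.
Qed.

Section CuntzPimsnerRep.
Context (R : realType) (A : cstarAlg R) (X : preCorr A A) (O : cuntzPimsner X).
Hypothesis pr : proper_corr X.

(** The identity off the circle, so that [r_g] takes no proof argument. *)
Definition cp_g (z : R[i]) : O -> O := if pselect (`|z| = 1) is left h then @gauge _ _ _ O z h else idfun.
Lemma cp_gE z (h : `|z| = 1) : cp_g z = @gauge _ _ _ O z h.
Proof. by rewrite /cp_g; case: pselect => // h'; rewrite (Prop_irrelevance h h'). Qed.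

(** Properness makes every [lact a] compact, and covariance then puts [pi(a)] into the span of the
    [t(x) t(y)^*]. This gives [r_tot]. *)
Lemma cp_fib a : cspan [set cmul (cp_t O x) (cadj (cp_t O y)) | x in [set: X] & y in [set: X]] (cp_pi O a).
Proof.
have [psi [[sl sm sa sn] s1 sp]] := cov_compacts (cp_cov O).
by rewrite -sp; apply: (psi_span sl sn s1 (pr a)).
Qed.

Definition cp_rep : rep X O.
Proof.
refine (@Rep R A X O (cp_pi O) (cp_t O) cp_g (cov_hom (cp_cov O)) (cov_linear (cp_cov O))
  (cov_ip (cp_cov O)) (cov_lact (cp_cov O)) _ _ _ _ _).
- by move=> z h; rewrite (cp_gE h); case: (@gaugeP _ _ _ O z h).
- by move=> z a h; rewrite (cp_gE h); case: (@gaugeP _ _ _ O z h).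
- by move=> z a h; rewrite (cp_gE h); case: (@gaugeP _ _ _ O z h).
- by move=> p; have [a [q ->]] := cov_nondeg (cp_cov O) p; apply: cspan_sub; exists a => //; exists q.
- move=> p; have [a [q ->]] := cov_nondeg (cp_cov O) p.
  apply: (cspan_map (blin_cmulr q) _ (@cp_fib a)) => _ [x _ [y _ <-]].
  by apply: cspan_sub; exists x => //; exists (cmul (cadj (cp_t O y)) q) => //; rewrite cmulA.
Defined.
End CuntzPimsnerRep.

(** * Existence of lifts *)

Section LiftExistence.
Context (R : realType) (A B : cstarAlg R) (X : preCorr A A) (Y : preCorr B B) (P : cstarAlg R)
  (r : rep X P) (O : cuntzPimsner Y).
Hypotheses (pX : posc X) (pY : posc Y) (nY : forall y : Y, exists b (y' : Y), y = lact b y') (prY : proper_corr Y).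
Context (F : preCorr B A) (Phi : Y \ox F -> F \ox X).
Hypotheses (pF : posc F) (uPhi : unitary Phi).
Notation s := (cp_rep O prY).

Notation E := (F \ox rcorr r).
Notation sg := (fun (f : F) (T : P) => f \ot (T : rcorr r)).
Let hE : interior_tensor (X := F) (Y := rcorr r) (Z := E) sg := tens_it pF (@posc_rcorr _ _ _ _ r).
Let pE : posc E := it_posc hE.
Let hYF := tens_it pY pF.
Let hYE := tens_it pY pE.

(** [Phi] carries [Y \ox E], that is [(Y \ox F) \ox P], to [(F \ox X) \ox P], which is [E]. That [W]
    is onto is what yields covariance of the operators [xi -> W (y \ot xi)]. *)
Lemma shift_ex : exists W : Y \ox E -> E, unitary W /\
  forall y f T, W (y \ot sg f T) = lift_act r sg (Phi (y \ot f)) T.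
Proof.
have [Pl Pla Pr Pi Ps] := uPhi.
have [||||W [uW W1]] := @unitary_ext _ _ _ _ E _ _ (fun p => lift_act r sg (Phi (p.1.1 \ot p.1.2)) p.2)
   (fun b p => ((lact b p.1.1, p.1.2), p.2)) (tens3_totalr pY pF (@posc_rcorr _ _ _ _ r)).
- move=> z; apply: (cspan_min (@cspan_closed _ _ _) _ (@lift_act_total _ _ _ _ _ r _ _ _ pX pF hE z)) => _ [w _ [T _ <-]].
  have [w' <-] := Ps w; have bb := blin_comp (lift_act_blin pX pF hE T) (unitary_blin uPhi).
  apply: (cspan_map bb _ (it_total hYF w')) => _ [[y f] _ <-].
  by apply: cspan_sub; exists ((y, f), T).
- move=> p q; rewrite (lift_act_ip pX pF hE) Pi (it_ip hYE) (it_lact hE) (it_ip hE) /= (it_ip hYF).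
  by [].
- by move=> b p; rewrite (it_lact hYE).
- by move=> b p; rewrite (lift_act_lact pX pF hE) -Pla (it_lact hYF).
by exists W; split=> // y f T; exact: (W1 ((y, f), T)).
Qed.

Section Shift.
Context (W : Y \ox E -> E).
Hypotheses (uW : unitary W) (WE : forall y f T, W (y \ot sg f T) = lift_act r sg (Phi (y \ot f)) T).
Let Wl b w : W (lact b w) = lact b (W w). Proof. by case: uW. Qed.
Let Wi v w : ip (W v) (W w) = ip v w. Proof. by case: uW. Qed.
Let Ws v : exists w, W w = v. Proof. by case: uW => _ _ _ _; exact. Qed.
Let WB := unitary_blin uW.

Notation L := (adj_alg pE).
(* the extension of [t] to the compacts is [S |-> W (S \ot 1) W^-1] *)
Definition implements (S : Y -> Y) (T : L) := forall y xi, lop T (W (y \ot xi)) = W (S y \ot xi).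

Lemma W_ext (V : completeNormedModType R[i]) (f g : E -> V) : blin f -> blin g ->
  (forall y xi, f (W (y \ot xi)) = g (W (y \ot xi))) -> forall xi, f xi = g xi.
Proof.
move=> bf bg h xi; have [w <-] := Ws xi; move: w.
by apply: (it_ext hYE) (h); [exact: blin_comp bf WB|exact: blin_comp bg WB].
Qed.
Lemma lop_blin (T : L) : blin (lop T).
Proof.
split; first exact: lop_linear.
by exists (rnorm T); [exact: rnorm_ge0|exact: lop_bd].
Qed.
Lemma lop_eq (S T : L) : (forall xi, lop S xi = lop T xi) -> S = T.
Proof. by move=> h; apply: lop_inj; apply/funext. Qed.
Lemma implements_uniq S T T' : implements S T -> implements S T' -> T = T'.
Proof.
move=> h h'; apply: lop_eq; apply: (W_ext (@lop_blin T) (@lop_blin T')) => y xi.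
by rewrite h h'.
Qed.
Lemma implements_ex S S' (c : R) : 0 <= c -> (forall y, rnorm (S y) <= c * rnorm y) -> adjoint_pair S S' ->
  exists T : L, [/\ implements S T, implements S' (cadj T) & rnorm T <= c].
Proof.
move=> c0 hc SS'; have [h [h' [bh h1 hb h1' ad]]] := it_op pY pE hYE c0 hc SS'.
have [V [uV VW WV]] := unitary_inv uW; have [Vl Vla Vr Vi Vs] := uV.
have Vn z : rnorm (V z) = rnorm z := gram_isom Vi z.
have Wn z : rnorm (W z) = rnorm z := gram_isom Wi z.
have [||T TE Tc] := lop_ex pE c0 (f := fun xi => W (h (V xi))) (g := fun xi => W (h' (V xi))).
- by move=> xi; rewrite Wn (le_trans (hb _)) // Vn.
- by move=> xi eta; rewrite -{1}(WV eta) Wi ad -(Wi (V xi)) WV.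
exists T; split=> // [y xi|y xi]; first by rewrite TE VW h1.
have -> : lop (cadj (T : L)) = fun xi => W (h' (V xi)).
  apply: (adjoint_pair_uniq (S := lop T)); first exact: lstarP.
  by rewrite TE => u v; rewrite -{1}(WV v) Wi ad -(Wi (V u)) WV.
by rewrite VW h1'.
Qed.

Lemma pi_ex : exists pE' : B -> L, forall b xi, lop (pE' b) xi = lact b xi.
Proof.
suff h b : exists T : L, forall xi, lop T xi = lact b xi.
  by exists (fun b => projT1 (cid (h b))) => b; exact: (projT2 (cid (h b))).
have [|T TE _] := lop_ex pE (rnorm_ge0 b) (f := lact b) (g := lact (cadj b)) (fun xi => rnorm_lact b xi).
  exact: lact_adj.
by exists T => xi; rewrite TE.
Qed.
Lemma t_ex : exists tE : Y -> L, forall y, (forall xi, lop (tE y) xi = W (y \ot xi)) /\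
  forall y' xi, lop (cadj (tE y)) (W (y' \ot xi)) = lact (ip y y') xi.
Proof.
suff h y : exists T : L, (forall xi, lop T xi = W (y \ot xi)) /\
    forall y' xi, lop (cadj T) (W (y' \ot xi)) = lact (ip y y') xi.
  by exists (fun y => projT1 (cid (h y))) => y; exact: (projT2 (cid (h y))).
have [h [bh h1 h2]] := it_annih hYE y.
have [V [uV VW WV]] := unitary_inv uW.
have c0 : 0 <= 3 * rnorm y by rewrite mulr_ge0 ?rnorm_ge0.
have ad : adjoint_pair (fun xi => W (y \ot xi)) (fun xi => h (V xi)).
  move=> xi eta; rewrite -[RHS]ip_adj h2 -{1}(WV eta) Wi ip_adj //.
have [|T TE _] := lop_ex pE c0 _ ad.
  by move=> xi; rewrite (gram_isom Wi) it_norm.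
exists T; split=> [xi|y' xi]; first by rewrite TE.
have -> : lop (cadj (T : L)) = fun xi => h (V xi).
  by apply: (adjoint_pair_uniq (S := lop T)); [exact: lstarP|rewrite TE].
by rewrite VW h1.
Qed.

Section Operators.
Context (piE : B -> L) (tE : Y -> L).
Hypotheses (piP : forall b xi, lop (piE b) xi = lact b xi)
  (tP : forall y xi, lop (tE y) xi = W (y \ot xi))
  (tadjP : forall y y' xi, lop (cadj (tE y)) (W (y' \ot xi)) = lact (ip y y') xi).

Let piS : star_hom piE.
Proof.
split.
- by move=> c a b; apply: lop_eq => xi; rewrite lop_lc !piP !lactE.
- by move=> a b; apply: lop_eq => xi; rewrite lop_mul !piP lactM.
- move=> a; apply: lop_inj; apply: (adjoint_pair_uniq (S := lop (piE a))); last exact: lstarP.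
  by move=> xi eta; rewrite !piP lact_adj.
- move=> a; rewrite !rnormE lecR; apply: lop_lub => [|xi]; first exact: rnorm_ge0.
  by rewrite piP rnorm_lact.
Qed.
Let tlin : linear tE.
Proof. by move=> c x y; apply: lop_eq => xi; rewrite lop_lc !tP (it_linearl hYE) (blin_lin WB). Qed.
Let tip x y : cmul (cadj (tE x)) (tE y) = piE (ip x y).
Proof. by apply: lop_eq => xi; rewrite lop_mul tP tadjP piP. Qed.
Let tla b y : cmul (piE b) (tE y) = tE (lact b y).
Proof. by apply: lop_eq => xi; rewrite lop_mul !tP piP -Wl (it_lact hYE). Qed.
Let tra y b : tE (ract y b) = cmul (tE y) (piE b).
Proof. by apply: lop_eq => xi; rewrite lop_mul !tP piP (it_balanced hYE). Qed.

(** [psi S] is the unique operator that implements [S], so each algebraic clause is a check on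
    vectors [W (y \ot xi)]. The covariance [psi (lact b) = piE b] is the left linearity of [W]. *)
Lemma fiber_E : fiber_cond piE tE.
Proof.
have cex S : compacts S -> exists T : L, implements S T.
  move=> cS; have [C C0 hC] := compacts_bd cS; have [[S' hS] _] := cS.
  by have [T [hT _ _]] := implements_ex C0 hC hS; exists T.
pose psi S : L := if pselect (compacts S) is left h then projT1 (cid (cex S h)) else 0.
have psiP S : compacts S -> implements S (psi S).
  by rewrite /psi; case: pselect => // h _; exact: (projT2 (cid (cex S h))).
clearbody psi; exists psi; split; first split.
- move=> c S T cS cT; apply: (implements_uniq (psiP _ (compacts_lin c cS cT))) => y xi.
  by rewrite lop_lc (psiP _ cS) (psiP _ cT) (it_linearl hYE) (blin_lin WB).
- move=> S T cS cT; apply: (implements_uniq (psiP _ (compacts_comp2 cS cT))) => y xi.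
  by rewrite lop_mul (psiP _ cT) (psiP _ cS).
- move=> S T cS cT hST; apply: (implements_uniq (psiP _ cT)).
  have [C C0 hC] := compacts_bd cS; have [T' [hT hT' _]] := implements_ex C0 hC hST.
  by rewrite (implements_uniq (psiP _ cS) hT).
- move=> S c cS hc c0; have cE' : c = (complex.Re c)%:C by case: (c) c0 => a b; rewrite lecE /= => /andP[/eqP ->].
  rewrite cE' in c0 hc *; have [[S' hS] _] := cS.
  have [|||T [hT _ Tc]] := @implements_ex S S' (complex.Re c); rewrite -?lecR //.
    by move=> y; have := hc y; rewrite normc_le.
  by rewrite (implements_uniq (psiP _ cS) hT) rnormE lecR.
- move=> x y; apply: (implements_uniq (psiP _ (compacts_rank1 x y))) => y' xi.
  by rewrite lop_mul tadjP tP /rank1 (it_balanced hYE).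
- move=> b; apply: (implements_uniq (psiP _ (prY b))) => y xi.
  by rewrite piP -Wl (it_lact hYE).
Qed.

(* [piE] need not be nondegenerate in [L], but it is in the subalgebra [D0] *)
Let G := cspan [set cmul (piE b) T | b in [set: B] & T in [set: L]].
Let Glin : lin_closed G := cspan_closed _.
(** [G] is a closed right ideal, so its intersection with its adjoints is a C*-algebra. It contains
    the images of [piE] and [tE]. *)
Let D0 (T : L) := G T /\ G (cadj T).
Lemma D0_closed : lin_closed D0.
Proof.
have [G0 Gl Gc] := Glin; split.
- by rewrite /D0 cadj0.
- by move=> c S T [h1 h2] [h3 h4]; split; [exact: Gl|rewrite cadj_linear; exact: Gl].
- move=> T hT; split; apply: Gc => e /hT[S [S1 S2] TS]; first by exists S.
  by exists (cadj S) => //; rewrite -cadj_sub rnorm_adj.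
Qed.
Lemma GM S T : G S -> G (cmul S T).
Proof.
move=> h; apply: (cspan_map (blin_cmulr T) _ h).
by move=> _ [b _ [T' _ <-]]; apply: cspan_sub; exists b => //; exists (cmul T' T) => //; rewrite cmulA.
Qed.
Lemma Gpi b T : G (cmul (piE b) T).
Proof. by apply: cspan_sub; exists b => //; exists T. Qed.
Let DM S T : D0 S -> D0 T -> D0 (cmul S T).
Proof. by move=> [h1 h2] [h3 h4]; split; [exact: GM|rewrite cadjM; exact: GM]. Qed.
Let DA S : D0 S -> D0 (cadj S). Proof. by move=> [h1 h2]; rewrite /D0 cadjK. Qed.
Let Dpi b : D0 (piE b).
Proof.
have [_ pm pa _] := piS; have Gb a : G (piE a).
  have [_ _ Gc] := Glin; apply: Gc => e e0; have [u _ hu] := ctr_one a e0.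
  exists (cmul (piE u) (piE a)); first exact: Gpi.
  by rewrite -pm -(linB (blin_lin (star_hom_blin piS))) (le_trans (star_hom_norm piS _)).
by split=> //; rewrite -pa.
Qed.
Let Dt y : D0 (tE y).
Proof.
have [_ pm pa _] := piS; split.
  by have [b [y' ->]] := nY y; rewrite -tla; exact: Gpi.
have [_ _ Gc] := Glin; apply: Gc => e e0.
have [b hb] := ract_approx y e0.
exists (cmul (piE (cadj b)) (cadj (tE y))); first exact: Gpi.
rewrite pa -cadjM -tra -cadj_sub rnorm_adj -(linB tlin).
by rewrite (le_trans _ hb) // (gram_norm (V := self_corr L) piS (fun y y' => tip y y')).
Qed.

Let Dnd d : D0 d -> cspan [set cmul (piE b) T | b in [set: B] & T in [set: L]] d.
Proof. by case. Qed.

Lemma lift_exists : exists (E' : preCorr O P) (U : R[i] -> E' -> E') (sg' : F -> P -> E'),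
  posc E' /\ is_lift r s Phi U sg'.
Proof.
have hcov := covariant_sub piS tlin tip tla fiber_E prY (D := lcS D0_closed) DM DA Dpi Dt Dnd.
have [h [[hh h1 h2] _]] := @cp_univ _ _ _ O _ _ _ hcov.
pose act (q : O) : L := cval (h q).
have actS : star_hom act := star_hom_comp (@star_hom_cval _ _ (lcS D0_closed) DM DA) hh.
have act_pi b : act (cp_pi O b) = piE b by rewrite /act h1.
have act_t y : act (cp_t O y) = tE y by rewrite /act h2.
pose E' := res actS (op_corr pE) : preCorr O P.
have hE' : interior_tensor (Z := res (r_hom s) E') (X := F) (Y := rcorr r) sg.
  split; [exact: (it_linearr hE)|exact: (it_linearl hE)|exact: (it_balanced hE)|
    |exact: (it_ract hE)|exact: (it_ip hE)|exact: (it_pos hE)|exact: (it_dense hE)].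
  move=> b f T; rewrite -[LHS]/(lop (act (cp_pi O b)) (sg f T)) act_pi piP; exact: (it_lact hE).
have Uex z : exists U : E -> E, `|z| = 1 -> [/\ blin U, forall f T, U (sg f T) = sg f (r_g r z T) &
    forall xi eta, ip (U xi) (U eta) = r_g r z (ip xi eta)].
  have [z1|] := pselect (`|z| = 1); last by exists idfun.
  have [gl gm ga gn] := r_ghom r z1.
  have [|U [U1 U2 U3 _]] := it_lift hE (V := E) (b := fun f T => sg f (r_g r z T)) (r_ghom r z1).
    by move=> f T f' T'; rewrite (it_ip hE) /= !gm ga r_gpi.
  by exists U.
pose U z := projT1 (cid (Uex z)).
have UP z : `|z| = 1 -> [/\ blin (U z), forall f T, U z (sg f T) = sg f (r_g r z T) &
    forall xi eta, ip (U z xi) (U z eta) = r_g r z (ip xi eta)] := projT2 (cid (Uex z)).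
clearbody U.
exists E', U, sg; split; first exact: pE.
split=> //.
- by move=> y f T; rewrite -[LHS]/(lop (act (cp_t O y)) (sg f T)) act_t tP WE.
- by move=> z z1; have [[]] := UP z z1.
- by move=> z f T z1; have [_ ->] := UP z z1.
- move=> z q0 xi0 z1; have [bU U1 U2] := UP z z1; have [gl gm ga gn] := r_ghom s z1.
  (* [U z] covers the gauge action instead of commuting with [Q]. Stability of [good] under adjoints
     is not evident, so the induction over the generators carries [q] and its adjoint together. *)
  pose good q := forall xi, U z (lop (act q) xi) = lop (act (r_g s z q)) (U z xi).
  have lopZ (c : R[i]) (S : L) v : lop (c *: S) v = c *: lop S v := lactZl (X := op_corr pE) c S v.
  have actB q : blin (lop (act q)) := lop_blin (act q).
  have goodP q q' : good q -> good q' -> good (cmul q q').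
    move=> h3 h4 xi; have [_ am _ _] := actS.
    by rewrite am gm am !lop_mul h3 h4.
  have good_lin (c : R[i]) q q' : good q -> good q' -> good (c *: q + q').
    move=> h3 h4 xi; have [al _ _ _] := actS.
    by rewrite al gl al !lop_lc (blin_lin bU) h3 h4.
  have good_cl q : (forall e : R, 0 < e -> exists2 q', good q' & rnorm (q - q') <= e) -> good q.
    move=> hq xi.
    have b1 : blin (fun q => U z (lop (act q) xi)).
      by apply: (blin_comp bU); exact: (blin_comp (blin_lactl (X := op_corr pE) xi) (star_hom_blin actS)).
    have b2 : blin (fun q => lop (act (r_g s z q)) (U z xi)).
      exact: (blin_comp (blin_lactl (X := op_corr pE) (U z xi)) (blin_comp (star_hom_blin actS) (star_hom_blin (r_ghom s z1)))).
    have [_ _ cl] := lin_closed_eq b1 b2; apply: cl => e /hq[q' gq' qq']; exists q' => //; exact: gq'.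
  have good_pi b : good (cp_pi O b).
    move=> xi; rewrite (r_gpi s b z1) act_pi !piP; move: xi.
    apply: (it_ext hE (blin_comp bU (blin_lact _ b)) (blin_comp (blin_lact _ b) bU)) => f T.
    exact: (etrans (congr1 (U z) (it_lact hE b f T)) (etrans (U1 _ _) (esym (etrans (congr1 (lact b) (U1 f T)) (it_lact hE b f _))))).
  have good_t y : good (cp_t O y).
    have [al _ _ _] := actS.
    move=> xi; rewrite (r_gt s y z1) (linZ al) act_t tP lopZ tP; move: xi.
    have b1 (f : E -> E) : blin f -> blin (fun xi => W (y \ot f xi)).
      by move=> bf; apply: (blin_comp WB); exact: blin_comp (it_blinr hYE y) bf.
    have b2 : blin (fun xi => z *: W (y \ot U z xi)) := blinZ z (b1 _ bU).
    apply: (it_ext hE (blin_comp bU (b1 _ (blin_id _))) b2) => f T.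
    by rewrite U1 !WE (lift_act_gauge pX pF hE T z1 bU U1).
  (* The adjoint of [tE y] is known on the vectors [W (y' \ot xi)], which span [E]; the phases
     coming from [y] and [y'] cancel. *)
  have good_tadj y : good (cadj (cp_t O y)).
    have [al _ aa _] := actS.
    have b1 : blin (fun xi => U z (lop (act (cadj (cp_t O y))) xi)) := blin_comp bU (actB _).
    have b2 : blin (fun xi => lop (act (r_g s z (cadj (cp_t O y)))) (U z xi)) := blin_comp (actB _) bU.
    apply: (W_ext b1 b2) => y' xi.
    have zz : z^*%R * z = 1 by rewrite mulrC -normCK z1 expr1n.
    have := good_t y' xi; rewrite (r_gt s y' z1) act_t tP (linZ al) act_t => ->.
    rewrite ga (r_gt s y z1) cadjZ (linZ al) aa act_t tadjP.
    rewrite (lopZ z) (lopZ z^*%R) (linZ (lop_linear (cadj (tE y)))) scalerA zz scale1r tP tadjP.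
    by have := good_pi (ip y y') xi; rewrite (r_gpi s _ z1) act_pi !piP.
  have good0 : good 0.
    have [cl _ _ _] := cov_hom (cp_cov O).
    by have := good_pi 0; rewrite (lin0 cl).
  suff hg q : good q /\ good (cadj q) by have [h3 _] := hg q0; exact: (h3 xi0).
  move: q; apply: (cp_generates prY (P := fun q => good q /\ good (cadj q))).
  + split; first by rewrite cadj0.
      by move=> c x y [h3 h4] [h5 h6]; split; [exact: good_lin|rewrite cadj_linear; exact: good_lin].
    move=> x hx; split; apply: good_cl => e /hx[x' [h3 h4] xx]; first by exists x'.
    by exists (cadj x') => //; rewrite -cadj_sub rnorm_adj.
  + by move=> a b [h3 h4] [h5 h6]; split; [exact: goodP|rewrite cadjM; exact: goodP].
  + by move=> a [h3 h4]; rewrite cadjK.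
  + by have [_ _ ca _] := cov_hom (cp_cov O) => b; split; rewrite -?ca; exact: good_pi.
  + by [].
- by move=> z xi eta z1; have [_ _ ->] := UP z z1.
Qed.
End Operators.
End Shift.

Lemma lift_ex : exists (E' : preCorr O P) (U : R[i] -> E' -> E') (sg' : F -> P -> E'),
  posc E' /\ is_lift r s Phi U sg'.
Proof.
have [W [uW WE]] := shift_ex; have [piE piP] := pi_ex; have [tE hE'] := t_ex uW.
by apply: (lift_exists uW WE piP (tE := tE)) => [y xi|y]; case: (hE' y).
Qed.
End LiftExistence.

(** * Functoriality of lifts *)

Section LiftTheory.
Context (R : realType) (A B : cstarAlg R) (X : preCorr A A) (Y : preCorr B B) (P Q : cstarAlg R)
  (r : rep X P) (s : rep Y Q).
Context (F : preCorr B A) (Phi : Y \ox F -> F \ox X) (E : preCorr Q P) (U : R[i] -> E -> E) (sg : F -> P -> E).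
Hypothesis hl : is_lift r s Phi U sg.

Lemma lift_U_blin z : `|z| = 1 -> blin (U z).
Proof.
move=> z1; split; first exact: (li_Ulin hl z1).
exists 1 => // xi; rewrite mul1r.
exact: (gram_norm (r_ghom r z1) (fun xi eta => li_Uip hl xi eta z1)).
Qed.
Lemma lift_posc : posc E. Proof. exact: it_posc (li_it hl). Qed.
Lemma lift_nondeg : nondeg F -> nondeg E.
Proof.
move=> nF; move=> xi; have := @nondeg_tensor _ _ _ _ _ _ _ _ (li_it hl) nF xi.
by apply: cspan_mono => _ [b _ [eta _ <-]]; exists (r_pi s b) => //; exists eta.
Qed.
Lemma li_pi b f T : lact (r_pi s b) (sg f T) = sg (lact b f) T.
Proof. exact: (it_lact (li_it hl) b f T). Qed.
Lemma li_ract f T T' : ract (sg f T) T' = sg f (cmul T T').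
Proof. exact: (it_ract (li_it hl) f T T'). Qed.
Lemma li_ip f T f' T' : ip (sg f T) (sg f' T') = cmul (cadj T) (cmul (r_pi r (ip f f')) T').
Proof. exact: (it_ip (li_it hl) f T f' T'). Qed.
End LiftTheory.

(** A unitary that commutes with [q] commutes with its adjoint, so only the generators have to be
    checked. *)
Lemma generates_commute (R : realType) (B : cstarAlg R) (Y : preCorr B B) (P Q : cstarAlg R) (s : rep Y Q)
    (E E' : preCorr Q P) (V : E -> E') :
  generates (r_pi s) (r_t s) -> blin V -> (forall xi eta, ip (V xi) (V eta) = ip xi eta) ->
  (forall eta, exists xi, V xi = eta) ->
  (forall b xi, V (lact (r_pi s b) xi) = lact (r_pi s b) (V xi)) ->
  (forall y xi, V (lact (r_t s y) xi) = lact (r_t s y) (V xi)) -> unitary V.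
Proof.
move=> gen bV Vi Vs Vpi Vt.
have Vr := gram_ract (@star_hom_id _ _) (blin_lin bV) Vi.
pose good q := forall xi, V (lact q xi) = lact q (V xi).
have gadj q : good q -> good (cadj q).
  move=> gq xi; apply: ip_eq => w; have [eta <-] := Vs w.
  by rewrite Vi -[RHS]ip_adj lact_adj cadjK -gq Vi -[LHS]ip_adj lact_adj cadjK.
suff gall q : good q by split => //; exact: blin_lin bV.
move: q; apply: gen => //.
- apply: lin_closedA => xi; apply: lin_closed_eq; last exact: blin_lactl.
  exact: blin_comp bV (blin_lactl xi).
- by move=> a b ga gb xi; rewrite !lactM ga gb.
Qed.

(** [V] is [Psi \ot 1]; its commutation with [t(y)] is the defining identity of a 2-arrow, read on
    [lift_act]. *)
Lemma arrow2_lift (R : realType) (A B : cstarAlg R) (X : preCorr A A) (Y : preCorr B B) (P Q : cstarAlg R)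
  (r : rep X P) (s : rep Y Q) (F : preCorr B A) (Phi : Y \ox F -> F \ox X) (E : preCorr Q P)
  (U : R[i] -> E -> E) (sg : F -> P -> E) (F' : preCorr B A) (Phi' : Y \ox F' -> F' \ox X)
  (E' : preCorr Q P) (U' : R[i] -> E' -> E') (sg' : F' -> P -> E') (Psi : F -> F') :
  posc X -> posc Y -> posc F -> generates (r_pi s) (r_t s) ->
  is_lift r s Phi U sg -> is_lift r s Phi' U' sg' -> arrow2 Phi Phi' Psi ->
  exists V : E -> E', [/\ unitary V, forall f T, V (sg f T) = sg' (Psi f) T &
    forall z xi, `|z| = 1 -> V (U z xi) = U' z (V xi)].
Proof.
move=> pX pY pF gen hl hl' [uP nat_Psi]; have [Pl Pla Pr Pi Ps] := uP.
have pF' := unitary_posc uP pF; have [hT hT'] := (li_it hl, li_it hl').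
have [|V [bV V1 V2 V3]] := it_lift hT (V := E') (b := fun f T => sg' (Psi f) T) (@star_hom_id _ _).
  by move=> f T f' T'; rewrite [LHS](it_ip hT') Pi.
have Vs : forall xi', exists xi, V xi = xi'.
  apply: (isom_surj (blin_lin bV) (gram_isom V2)) => xi'.
  apply: (cspan_mono _ (it_total hT' xi')) => _ [[f' T] _ <-].
  by have [f <-] := Ps f'; exists (sg f T).
have Vt y xi : V (lact (r_t s y) xi) = lact (r_t s y) (V xi).
  move: xi; apply: (it_ext hT (blin_comp bV (blin_lact E (r_t s y))) (blin_comp (blin_lact E' (r_t s y)) bV)) => f T.
  rewrite (li_t hl) V1 (li_t hl').
  have -> : Phi' (y \ot Psi f) = tmap Psi idfun (Phi (y \ot f)).
    by rewrite nat_Psi; have [_ ->] := tmapP pY pF (unitary_id Y) uP.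
  have [uT hTm] := tmapP pF pX uP (unitary_id X).
  have e w : V (lift_act r sg w T) = lift_act r sg' (tmap Psi idfun w) T.
    move: w; apply: (it_ext (tens_it pF pX)).
    - exact: (blin_comp bV (lift_act_blin pX pF hT T)).
    - exact: (blin_comp (lift_act_blin pX pF' hT' T) (unitary_blin uT)).
    by move=> f' x; rewrite (lift_actE pX pF hT) V1 hTm (lift_actE pX pF' hT').
  exact: e.
have Vpi b xi : V (lact (r_pi s b) xi) = lact (r_pi s b) (V xi).
  move: xi; apply: (it_ext hT (blin_comp bV (blin_lact E (r_pi s b))) (blin_comp (blin_lact E' (r_pi s b)) bV)) => f T.
  by rewrite (li_pi hl) !V1 (li_pi hl') Pla.
exists V; split=> // [|z xi z1]; first exact: (generates_commute gen).
move: xi; apply: (it_ext hT (blin_comp bV (lift_U_blin hl z1)) (blin_comp (lift_U_blin hl' z1) bV)) => f T.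
by rewrite (li_U hl) // V1 V1 (li_U hl').
Qed.

Section Odot.
Context (R : realType) (A B C : cstarAlg R) (X : preCorr A A) (Y : preCorr B B) (Z : preCorr C C).
Context (G : preCorr C B) (PhiG : Z \ox G -> G \ox Y) (F : preCorr B A) (PhiF : Y \ox F -> F \ox X).
Hypotheses (pX : posc X) (pY : posc Y) (pZ : posc Z) (pG : posc G) (pF : posc F)
  (uG : unitary PhiG) (uF : unitary PhiF).
Lemma odot_unitary : unitary (odot PhiG PhiF).
Proof.
have [a1 _] := assocVP pZ pG pF; have [a2 _] := tmapP (posc_tensor pZ pG) pF uG (unitary_id F).
have [a3 _] := assocP pG pY pF; have [a4 _] := tmapP pG (posc_tensor pY pF) (unitary_id G) uF.
have [a5 _] := assocVP pG pF pX.
exact: (unitary_comp a5 (unitary_comp a4 (unitary_comp a3 (unitary_comp a2 a1)))).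
Qed.
Lemma odotE z g f : odot PhiG PhiF (z \ot (g \ot f)) =
  assocV G F X (tmap idfun PhiF (assoc G Y F (PhiG (z \ot g) \ot f))).
Proof.
have [_ a1] := assocVP pZ pG pF; have [_ a2] := tmapP (posc_tensor pZ pG) pF uG (unitary_id F).
by rewrite /odot a1 a2.
Qed.
End Odot.

(** * Composition of lifts *)

Section LiftComposition.
Context (R : realType) (A B C : cstarAlg R) (X : preCorr A A) (Y : preCorr B B) (Z : preCorr C C).
Context (P Q S : cstarAlg R) (r : rep X P) (s : rep Y Q) (q : rep Z S).
Context (F : preCorr B A) (PhiF : Y \ox F -> F \ox X) (EF : preCorr Q P) (UF : R[i] -> EF -> EF) (sF : F -> P -> EF).
Context (G : preCorr C B) (PhiG : Z \ox G -> G \ox Y) (EG : preCorr S Q) (UG : R[i] -> EG -> EG) (sG : G -> Q -> EG).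
Hypotheses (pX : posc X) (pY : posc Y) (pZ : posc Z) (pG : posc G) (pF : posc F) (nF : nondeg F)
  (uG : unitary PhiG) (uF : unitary PhiF).
Hypotheses (lF : is_lift r s PhiF UF sF) (lG : is_lift s q PhiG UG sG).
Let pEF : posc EF := lift_posc lF.
Let pEG : posc EG := lift_posc lG.
Let hE := tens_it pEG pEF.
Let hF := li_it lF.
Let hG := li_it lG.
Notation E := (EG \ox EF).

Definition tens_U (z : R[i]) : E -> E := tlift (fun eta xi => UG z eta \ot UF z xi).

Lemma tens_UP z : `|z| = 1 -> [/\ blin (tens_U z),
  forall eta xi, tens_U z (eta \ot xi) = UG z eta \ot UF z xi &
  forall v w, ip (tens_U z v) (tens_U z w) = r_g r z (ip v w)].
Proof.
move=> z1.
have [|h [h1 h2 h3 _]] := it_lift hE (V := E) (b := fun eta xi => UG z eta \ot UF z xi) (r_ghom r z1).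
  by move=> eta xi eta' xi'; rewrite (it_ip hE) (li_Uip lG) // -(li_Uq lF) // (li_Uip lF).
have -> : tens_U z = h by apply/funext; exact: (tliftP pEG pEF).
by split.
Qed.

(* [rho] identifies [G \ox EF], over the coefficients [B], with [EG \ox EF] *)
Lemma pairing_ex : exists rho : G -> EF -> E,
  interior_tensor (X := G) (Y := res (r_hom s) EF) (Z := res (r_hom q) E) rho /\
  forall g T xi, rho g (lact T xi) = sG g T \ot xi.
Proof.
have hM := tens_it pG (pEF : posc (res (r_hom s) EF)).
have nEF := lift_nondeg lF nF.
have [|||||h [uh hh]] := @unitary_ext _ _ _ (G \ox res (r_hom s) EF) (res (r_hom q) E) _
   (fun p : G * Q * EF => p.1.1 \ot (lact p.1.2 p.2 : res (r_hom s) EF))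
   (fun p : G * Q * EF => sG p.1.1 p.1.2 \ot p.2) (fun c p => ((lact c p.1.1, p.1.2), p.2)).
- move=> w; apply: (cspan_min (@cspan_closed _ _ _) _ (it_total hM w)) => _ [[g xi] _ <-] /=.
  apply: (cspan_map (it_blinr hM g) _ (@nEF xi)) => _ [T _ [eta _ <-]].
  by apply: cspan_sub; exists ((g, T), eta).
- move=> w; apply: (cspan_min (@cspan_closed _ _ _) _ (it_total hE w)) => _ [[eta xi] _ <-] /=.
  apply: (cspan_map (it_blinl hE xi) _ (it_total hG eta)) => _ [[g T] _ <-].
  by apply: cspan_sub; exists ((g, T), xi).
- move=> p p'; rewrite (it_ip hM) [LHS](it_ip hE) (li_ip lG) /= !lactM.
  by rewrite -ip_adj -[RHS]ip_adj; congr cadj; rewrite lact_adj cadjK.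
- by move=> c p; rewrite (it_lact hM).
- by move=> c p; rewrite -[LHS]/(lact (r_pi q c) (sG p.1.1 p.1.2 \ot p.2)) (it_lact hE) (li_pi lG).
exists (fun g xi => h (g \ot (xi : res (r_hom s) EF))); split; first exact: it_transfer hM uh.
by move=> g T xi; exact: (hh ((g, T), xi)).
Qed.
(** [EG \ox EF] is [(G \ox Q) \ox EF], which [rho] identifies with [G \ox EF], that is with
    [(G \ox F) \ox P]. The clause that takes work is [li_t]. *)
Lemma odot_lift : exists sg : G \ox F -> P -> E, is_lift r q (odot PhiG PhiF) tens_U sg.
Proof.
have [rho [hR rhoE]] := pairing_ex.
have hGF := tens_it pG pF; have hGFP := tens_it (posc_tensor pG pF) (@posc_rcorr _ _ _ _ r).
have nEF := lift_nondeg lF nF.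
have [||||k [uk kE]] := @unitary_ext _ _ _ ((G \ox F) \ox rcorr r) (res (r_hom q) E) _
   _ (fun p : G * F * P => rho p.1.1 (sF p.1.2 p.2)) (fun c p => ((lact c p.1.1, p.1.2), p.2))
   (tens3_totall pG pF (@posc_rcorr _ _ _ _ r)).
- move=> w; apply: (cspan_min (@cspan_closed _ _ _) _ (it_total hR w)) => _ [[g xi] _ <-] /=.
  apply: (cspan_map (it_blinr hR g) _ (it_total hF xi)) => _ [[f T] _ <-].
  by apply: cspan_sub; exists ((g, f), T).
- move=> p p'; rewrite [LHS](it_ip hR) (it_ip hGFP) (it_ip hGF) /=.
  by rewrite (li_pi lF) (li_ip lF).
- by move=> c p; rewrite (it_lact hGFP) (it_lact hGF).
- by move=> c p; rewrite (it_lact hR).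
pose sg w T : E := k (w \ot (T : rcorr r)).
have hS : interior_tensor (X := G \ox F) (Y := rcorr r) (Z := res (r_hom q) E) sg := it_transfer hGFP uk.
have sgE g f T : sg (g \ot f) T = rho g (sF f T) := kE ((g, f), T).
clearbody sg; exists sg.
have pGF := posc_tensor pG pF.
have uO := odot_unitary pX pY pZ pG pF uG uF; have OE := odotE PhiF pZ pG pF uG.
have Urho z g xi : `|z| = 1 -> tens_U z (rho g xi) = rho g (UF z xi).
  move=> z1; have [bU U1 _] := tens_UP z1; have bUF := lift_U_blin lF z1.
  apply: (blin_ext (blin_comp bU (it_blinr hR g)) (blin_comp (it_blinr hR g) bUF) _ (@nEF xi)) => _ [T _ [eta _ <-]].
  by rewrite (rhoE g T eta) U1 (li_U lG) // (li_Uq lF) // rhoE.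
split=> //.
- move=> z w T; move: w.
  have b1 : blin (fun w => lact (r_t q z) (sg w T)) := blin_comp (blin_lact E _) (it_blinl hS T).
  have b2 : blin (fun w => lift_act r sg (odot PhiG PhiF (z \ot w)) T).
    apply: (blin_comp (lift_act_blin pX pGF hS T)); apply: (blin_comp (unitary_blin uO)).
    exact: it_blinr (tens_it pZ pGF) z.
  apply: (it_ext hGF b1 b2) => g f; rewrite sgE OE.
  have b3 : blin (fun f => lact (r_t q z) (rho g (sF f T))).
    exact: blin_comp (blin_lact E _) (blin_comp (it_blinr hR g) (it_blinl hF T)).
  have [a1 a1E] := assocVP pG pF pX.
  have [a2 a2E] := tmapP pG (posc_tensor pY pF) (unitary_id G) uF.
  have [a3 a3E] := assocP pG pY pF.
  have b4 v : blin (fun f => lift_act r sg (assocV G F X (tmap idfun PhiF (assoc G Y F (v \ot f)))) T).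
    apply: (blin_comp (lift_act_blin pX pGF hS T)); apply: (blin_comp (unitary_blin a1)).
    apply: (blin_comp (unitary_blin a2)); apply: (blin_comp (unitary_blin a3)).
    exact: it_blinr (tens_it (posc_tensor pG pY) pF) v.
  (* The action of [t(z)] is known on [sG g T \ot xi], but [rho g (sF f T)] shows no element of [Q]
     in the middle. Writing [f = b f'] supplies [pi(b)]; at the end [t(y) pi(b)] moves across the
     tensor sign to act on [EF]. *)
  apply: (blin_ext b3 (b4 (PhiG (z \ot g))) _ (@nF f)) => _ [b _ [f' _ <-]].
  rewrite -(li_pi lF) (rhoE g _ (sF f' T)) (it_lact hE) (li_t lG).
  have b5 : blin (fun v => lift_act s sG v (r_pi s b) \ot sF f' T).
    exact: blin_comp (it_blinl hE (sF f' T)) (lift_act_blin pY pG hG (r_pi s b)).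
  have b6 : blin (fun v => lift_act r sg (assocV G F X (tmap idfun PhiF (assoc G Y F (v \ot lact b f')))) T).
    apply: (blin_comp (lift_act_blin pX pGF hS T)); apply: (blin_comp (unitary_blin a1)).
    apply: (blin_comp (unitary_blin a2)); apply: (blin_comp (unitary_blin a3)).
    exact: it_blinl (tens_it (posc_tensor pG pY) pF) (lact b f').
  move: (PhiG (z \ot g)); apply: (it_ext (tens_it pG pY) b5 b6) => g' y.
  rewrite a3E a2E (lift_actE pY pG hG) /=.
  have b7 : blin (fun u => lift_act r sg (assocV G F X (g' \ot u)) T).
    apply: (blin_comp (lift_act_blin pX pGF hS T)); apply: (blin_comp (unitary_blin a1)).
    exact: it_blinr (tens_it pG (posc_tensor pF pX)) g'.
  have b8 : blin (fun u => rho g' (lift_act r sF u T)) := blin_comp (it_blinr hR g') (lift_act_blin pX pF hF T).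
  have -> : forall u, lift_act r sg (assocV G F X (g' \ot u)) T = rho g' (lift_act r sF u T).
    apply: (it_ext (tens_it pF pX) b7 b8) => f'' x.
    by rewrite a1E (lift_actE pX pGF hS) (lift_actE pX pF hF) sgE.
  by rewrite -(li_t lF) -(li_pi lF) -lactM rhoE.
- by move=> z z1; have [[]] := tens_UP z1.
- move=> z w T z1; have [bU _ _] := tens_UP z1; move: w.
  apply: (it_ext hGF (blin_comp bU (it_blinl hS T)) (it_blinl hS _)) => g f.
  by rewrite !sgE Urho // (li_U lF).
- move=> z c xi z1; have [bU U1 _] := tens_UP z1; move: xi.
  apply: (it_ext hE (blin_comp bU (blin_lact E c)) (blin_comp (blin_lact E _) bU)) => eta xi.
  by rewrite (it_lact hE) !U1 (it_lact hE) (li_Uq lG).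
- by move=> z xi eta z1; have [_ _ ->] := tens_UP z1.
Qed.
End LiftComposition.

(** * Spectral subspaces of lifts *)

Definition deg (R : realType) (V : lmodType R[i]) (g : R[i] -> V -> V) (n : int) (v : V) : Prop :=
  forall z : R[i], `|z| = 1 -> g z v = z ^ n *: v.

Section Deg.
Context (R : realType).
Implicit Types (z : R[i]) (n m : int).
Lemma unit_neq0 z : `|z| = 1 -> z != 0.
Proof. by move=> z1; rewrite -normr_eq0 z1 oner_eq0. Qed.
Lemma unit_conj z : `|z| = 1 -> z^*%R * z = 1.
Proof. by move=> z1; rewrite mulrC -normCK z1 expr1n. Qed.

(** A root of [-1] is unimodular, and the sign of [n] is immaterial because [-1] is its own
    inverse. *)
Lemma root_neg1 n : n != 0 -> exists2 z : R[i], `|z| = 1 & z ^ n = -1.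
Proof.
have pos k : (0 < k)%N -> exists2 z : R[i], `|z| = 1 & z ^+ k = -1.
  move=> k0; exists (k.-root (-1)); last exact: rootCK.
  apply/eqP; rewrite -(pexpr_eq1 k0) ?normr_ge0 // -normrX rootCK // normrN1 //.
case: n => [[|k]|k] // _; first by have [z z1 zk] := pos k.+1 isT; exists z.
have [z z1 zk] := pos k.+1 isT; exists z => //.
by rewrite /exprz zk invrN1.
Qed.

Lemma deg_closed (V : completeNormedModType R[i]) (g : R[i] -> V -> V) n :
  (forall z, `|z| = 1 -> blin (g z)) -> lin_closed (deg g n).
Proof.
move=> gb; apply: lin_closedA => z; have [z1|nz1] := pselect (`|z| = 1); last first.
  by split=> // *; case: nz1.
have [h0 h1 h2] := lin_closed_eq (gb z z1) (blinZ (z ^ n) (@blin_id _ V)).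
split=> [_|c x y hx hy _|x hx _]; [exact: h0|by apply: h1; [exact: hx|exact: hy]|].
by apply: h2 => e /hx[y hy xy]; exists y => //; exact: hy.
Qed.
End Deg.

(** * Homogeneous vectors are limits of sums of homogeneous tensors *)

Section Averaging.
Context (R : realType) (A B : cstarAlg R) (X : preCorr A A) (Y : preCorr B B) (P Q : cstarAlg R)
  (r : rep X P) (s : rep Y Q).
Context (F : preCorr B A) (Phi : Y \ox F -> F \ox X) (E : preCorr Q P) (U : R[i] -> E -> E) (sg : F -> P -> E).
Hypothesis hl : is_lift r s Phi U sg.
Hypothesis dense : forall p, cspan [set T | exists n, deg (r_g r) n T] p.

Lemma deg_sg n f T : deg (r_g r) n T -> deg U n (sg f T).
Proof. by move=> hT z z1; rewrite (li_U hl) // hT // (linZ (it_linearr (li_it hl) f)). Qed.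

Lemma rnorm_U z xi : `|z| = 1 -> rnorm (U z xi) <= rnorm xi.
Proof.
by move=> z1; exact: (gram_norm (r_ghom r z1) (fun xi eta => li_Uip hl xi eta z1)).
Qed.

(* fixes degree [n], and kills degree [m] when [z ^ (m - n) = -1] *)
Definition avg (z : R[i]) n (xi : E) : E := 2^-1 *: (xi + z ^ (- n) *: U z xi).
Lemma avg_lin z n : `|z| = 1 -> linear (avg z n).
Proof. by move=> z1 c x y; rewrite /avg (li_Ulin hl z1); lmod. Qed.
Lemma avg_norm z n xi : `|z| = 1 -> rnorm (avg z n xi) <= rnorm xi.
Proof.
move=> z1; rewrite /avg; have -> : 2^-1 = (2^-1 : R)%:C :> R[i] by rewrite fmorphV rmorph_nat.
rewrite rnormZr ger0_norm // ler_pdivrMl // mulr_natl mulr2n.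
rewrite (le_trans (rnormD _ _)) // lerD2l rnormZ.
have -> : cabs (z ^ (- n)) = 1 by apply: complexI; rewrite -cabsE norm_expz.
by rewrite mul1r rnorm_U.
Qed.
Lemma avg_deg z n m xi : `|z| = 1 -> deg U m xi -> avg z n xi = (2^-1 * (1 + z ^ (m - n))) *: xi.
Proof.
move=> z1 h; rewrite /avg h // expfzDr ?unit_neq0 //.
by rewrite -[xi in xi + _]scale1r !scalerA -scalerDl scalerA (mulrC (z ^ (- n))).
Qed.

Lemma avg_fix z n xi : `|z| = 1 -> deg U n xi -> avg z n xi = xi.
Proof.
by move=> z1 h; rewrite (avg_deg n z1 h) subrr expr0z -[1 + 1]/(2%:R) mulVf ?pnatr_eq0 // scale1r.
Qed.

Definition sg_deg n : set E := [set sg f T | f in [set: F] & T in deg (r_g r) n].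
Lemma sg_degP n xi : cspan (sg_deg n) xi -> deg U n xi.
Proof.
apply: (cspan_min (deg_closed n (lift_U_blin hl))) => _ [f _ [T hT <-]].
exact: deg_sg.
Qed.

(** A finite substitute for the Fourier projection. A term of degree [m] different from [n] is
    killed by [avg] at a root [z] with [z^(m-n) = -1]; this map is contractive, fixes [xi] and [v],
    and merely rescales the other terms. One average per term suffices. *)
Lemma deg_reduce n xi (e : R) (k : nat) (l : seq (F * P * int)) v : deg U n xi -> (size l <= k)%N ->
  (forall p, p \in l -> deg (r_g r) p.2 p.1.2) -> cspan (sg_deg n) v ->
  rnorm (xi - (v + \sum_(p <- l) sg p.1.1 p.1.2)) <= e ->
  exists2 v', cspan (sg_deg n) v' & rnorm (xi - v') <= e.
Proof.
move=> hxi; elim: k l v => [|k IH] [|[[f T] m] l] v //= sz hl' Sv.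
- by rewrite big_nil addr0; exists v.
- by rewrite big_nil addr0; exists v.
have hT : deg (r_g r) m T by apply: (hl' ((f, T), m)); rewrite mem_head.
have hl2 p : p \in l -> deg (r_g r) p.2 p.1.2 by move=> pl; apply: hl'; rewrite inE pl orbT.
rewrite big_cons /=; have [mn|mn] := eqVneq m n.
  rewrite addrA; apply: IH => //; rewrite -[v]scale1r.
  have [_ cl _] := cspan_closed (sg_deg n); apply: cl => //.
  by apply: cspan_sub; exists f => //; exists T => //; rewrite -mn.
have [z z1 zm] : exists2 z : R[i], `|z| = 1 & z ^ (m - n) = -1 by apply: root_neg1; rewrite subr_eq0.
move=> /(le_trans (avg_norm n _ z1)); have al := avg_lin n z1.
rewrite (linB al) !(linD al) (avg_fix z1 hxi) (avg_fix z1 (sg_degP Sv)).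
rewrite (avg_deg n z1 (deg_sg f hT)) zm subrr mulr0 scale0r add0r (linS al) => h.
pose c (p : F * P * int) := 2^-1 * (1 + z ^ (p.2 - n)).
apply: (IH [seq ((p.1.1, c p *: p.1.2), p.2) | p <- l] v); rewrite ?size_map //.
  move=> _ /mapP[p pl ->] /= w w1; have [gl _ _ _] := r_ghom r w1.
  by rewrite (linZ gl) (hl2 p pl w w1) !scalerA mulrC.
rewrite big_map; have <- // : \sum_(p <- l) avg z n (sg p.1.1 p.1.2) = \sum_(p <- l) sg p.1.1 (c p *: p.1.2).
rewrite big_seq [RHS]big_seq; apply: eq_bigr => p pl.
by rewrite (avg_deg n z1 (deg_sg _ (hl2 p pl))) (linZ (it_linearr (li_it hl) _)).
Qed.

Lemma deg_total n xi : deg U n xi -> cspan (sg_deg n) xi.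
Proof.
move=> hxi; have [c0 _ cl] := cspan_closed (sg_deg n); apply: cl => e e0.
(* Indices are restricted to homogeneous tensors, so that the approximating combination is a finite
   sum of homogeneous terms. *)
pose I := {p : F * P * int | asbool (deg (r_g r) p.2 p.1.2)}.
have tot eta : cspan (range (fun p : I => sg (val p).1.1 (val p).1.2)) eta.
  apply: (cspan_min (@cspan_closed _ _ _) _ (it_total (li_it hl) eta)) => _ [[f T] _ <-] /=.
  apply: (cspan_map (it_blinr (li_it hl) f) _ (@dense T)) => T' [m hT'].
  by apply: cspan_sub; exists (exist _ ((f, T'), m) (asboolT hT')).
have [l hll] := fsum_dense tot xi e0.
apply: (@deg_reduce n xi e _ [seq ((((val p.2).1.1, p.1 *: (val p.2).1.2), (val p.2).2) : F * P * int) | p <- l] 0 hxi (leqnn _)) => //.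
  move=> _ /mapP[[c p] pl ->] /= w w1; have [gl _ _ _] := r_ghom r w1.
  by have /asboolP hp := valP p; rewrite (linZ gl) hp // !scalerA mulrC.
rewrite add0r big_map; move: hll; rewrite /fsum; congr (rnorm (_ - _) <= _).
by apply: eq_bigr => p _; rewrite (linZ (it_linearr (li_it hl) _)).
Qed.
End Averaging.

(** * The degree zero part of a lift *)

(** The position of [(O^0, O^1)] inside [O], in abstract form: it also describes [C(I, O^0)] and
    [C(I, O^1)] inside [C(I, O)], which is needed for homotopies. *)
Record is_core (R : realType) (A A0 : cstarAlg R) (X : preCorr A A) (X0 : preCorr A0 A0) (P : cstarAlg R)
    (r : rep X P) (r0 : rep X0 P) : Prop := IsCore {
  co_g : r_g r0 = r_g r;
  co_norm : forall a, rnorm (r_pi r0 a) = rnorm a;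
  co_deg0 : forall p, deg (r_g r) 0 p -> exists a, r_pi r0 a = p;
  co_deg1 : forall p, deg (r_g r) 1 p -> exists x, r_t r0 x = p;
  co_dense : forall p, cspan [set T | exists n, deg (r_g r) n T] p }.

Lemma cspan_isom (R : realType) (V W : completeNormedModType R[i]) (h : V -> W) (S : set V) (x : V) :
  linear h -> (forall v, rnorm (h v) = rnorm v) -> cspan (h @` S) (h x) -> cspan S x.
Proof.
move=> lh nh /closureP hx; apply/closureP => e e0; have [y [n [c [w [hw ->]]]] xy] := hx e e0.
have [v hv] : exists v : 'I_n -> V, forall i, S (v i) /\ h (v i) = w i.
  exists (fun i => projT1 (cid2 (hw i))) => i; by have [? ?] := projT2 (cid2 (hw i)).
exists (\sum_i c i *: v i); first by exists n, c, v; split=> // i; case: (hv i).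
rewrite -nh (linB lh) (linS lh) (le_trans _ xy) //.
suff -> : \sum_(i < n) h (c i *: v i) = \sum_(i < n) c i *: w i by [].
by apply: eq_bigr => i _; rewrite (linZ lh); case: (hv i) => _ ->.
Qed.

Section CoreTheory.
Context (R : realType) (A A0 : cstarAlg R) (X : preCorr A A) (X0 : preCorr A0 A0) (P : cstarAlg R)
  (r : rep X P) (r0 : rep X0 P).
Hypothesis co : is_core r r0.
Lemma core_pi_deg a : deg (r_g r) 0 (r_pi r0 a).
Proof. by move=> z z1; rewrite -(co_g co) r_gpi // expr0z scale1r. Qed.
Lemma core_t_deg x : deg (r_g r) 1 (r_t r0 x).
Proof. by move=> z z1; rewrite -(co_g co) r_gt. Qed.
Lemma core_inj : injective (r_pi r0).
Proof.
move=> a b h; have [pl _ _ _] := r_hom r0.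
by apply/eqP; rewrite -subr_eq0; apply/eqP/rnorm0_eq0; rewrite -(co_norm co) (linB pl) h subrr rnorm0.
Qed.
(** A core is its own core. The spectral construction can therefore be applied to lifts of
    correspondences between cores. *)
Lemma core_refl : is_core r0 r0.
Proof.
case: co => cg cn c0 c1 cd; split=> //.
- by move=> p; rewrite cg; exact: c0.
- by move=> p; rewrite cg; exact: c1.
- by move=> p; rewrite cg; exact: cd.
Qed.
Lemma r_pi_deg a : deg (r_g r) 0 (r_pi r a).
Proof. by move=> z z1; rewrite r_gpi // expr0z scale1r. Qed.
Lemma core_of_pi a : exists a0, r_pi r0 a0 = r_pi r a.
Proof. exact: (co_deg0 co (r_pi_deg a)). Qed.
Lemma core_of_t x : exists x0, r_t r0 x0 = r_t r x.
Proof. by apply: (co_deg1 co) => z z1; rewrite r_gt. Qed.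
(* meaningful for [p] of degree 0 only *)
Definition core_inv (p : P) : A0 := if pselect (exists a, r_pi r0 a = p) is left e then projT1 (cid e) else 0.
Lemma core_invK p : deg (r_g r) 0 p -> r_pi r0 (core_inv p) = p.
Proof.
move=> /(co_deg0 co) e; rewrite /core_inv; case: pselect => // e'; exact: (projT2 (cid e')).
Qed.
End CoreTheory.

Section SpectralCorr.
Context (R : realType) (A A0 B B0 : cstarAlg R) (X : preCorr A A) (X0 : preCorr A0 A0)
  (Y : preCorr B B) (Y0 : preCorr B0 B0) (P Q : cstarAlg R)
  (r : rep X P) (r0 : rep X0 P) (s : rep Y Q) (s0 : rep Y0 Q).
Hypotheses (co : is_core r r0) (cs : is_core s s0).
Context (F : preCorr B A) (Phi : Y \ox F -> F \ox X) (E : preCorr Q P) (U : R[i] -> E -> E) (sg : F -> P -> E).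
Hypothesis hl : is_lift r s Phi U sg.
Let pE : posc E := lift_posc hl.

Definition spec_sub (n : int) : closedSub E := lcS (deg_closed n (lift_U_blin hl)).
Notation K n := (csub (spec_sub n)).
Lemma specP n (k : K n) : deg U n (cval k). Proof. exact: (csubP k). Qed.

Lemma ract_deg n m k xi p : k = n + m -> deg U n xi -> deg (r_g r) m p -> deg U k (ract xi p).
Proof.
move=> -> hx hp z z1.
rewrite (gram_ract (r_ghom r z1) (li_Ulin hl z1) (fun xi eta => li_Uip hl xi eta z1)) hx // hp //.
by rewrite ractZl ractZr scalerA expfzDr ?unit_neq0.
Qed.
Lemma lact_deg n m k xi q : k = m + n -> deg (r_g s) m q -> deg U n xi -> deg U k (lact q xi).
Proof.
move=> -> hq hx z z1; rewrite (li_Uq hl) // hx // hq //.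
by rewrite lactZl lactZr scalerA expfzDr ?unit_neq0.
Qed.
Lemma ip_deg n m k xi eta : k = m - n -> deg U n xi -> deg U m eta -> deg (r_g r) k (ip xi eta).
Proof.
move=> -> hx hy z z1; rewrite -(li_Uip hl) // hx // hy // ip_scalel ip_scaler scalerA.
congr (_ *: _); rewrite expfzDr ?unit_neq0 // mulrC; congr (_ * _).
by rewrite conj_expz -exprz_inv; congr (_ ^ _); rewrite invC_norm z1 expr1n invr1 mul1r.
Qed.

Definition spec_ract n (k : K n) (a : A0) : K n :=
  @mkcsub _ _ (spec_sub n) _ (ract_deg (esym (addr0 n)) (specP k) (core_pi_deg co a)).
Definition spec_lact n (b : B0) (k : K n) : K n :=
  @mkcsub _ _ (spec_sub n) _ (lact_deg (esym (add0r n)) (core_pi_deg cs b) (specP k)).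
Definition spec_ip n (k k' : K n) : A0 := core_inv r0 (ip (cval k) (cval k')).
Lemma spec_ipE n (k k' : K n) : r_pi r0 (spec_ip k k') = ip (cval k) (cval k').
Proof. by apply: (core_invK co); apply: (ip_deg (esym (subrr n))); exact: specP. Qed.

Definition spec_corr (n : int) : preCorr B0 A0.
Proof.
refine (@PreCorr R B0 A0 (K n) (@spec_ract n) (@spec_ip n) (@spec_lact n) _ _ _ _ _ _ _ _ _ _ _).
- by have [pl _ _ _] := r_hom r0 => k c a b; apply: val_inj; rewrite /= pl ract_linearr.
- by move=> a c k k'; apply: val_inj; exact: (ract_linearl (r_pi r0 a)).
- by have [_ pm _ _] := r_hom r0 => k a b; apply: val_inj; rewrite /= pm ractM.
- by have [pl _ _ _] := r_hom r0 => k c k' k''; apply: (core_inj co); rewrite pl !spec_ipE ip_linear.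
- by have [_ _ pa _] := r_hom r0 => k k'; apply: (core_inj co); rewrite pa !spec_ipE ip_adj.
- by have [_ pm _ _] := r_hom r0 => k k' a; apply: (core_inj co); rewrite pm !spec_ipE ip_ract.
- by move=> k; rewrite !rnormE -rmorphXn -(co_norm co) spec_ipE rnorm_ip rnorm_cval.
- by have [ql _ _ _] := r_hom s0 => k c a b; apply: val_inj; rewrite /= ql lact_linearl.
- by have [_ qm _ _] := r_hom s0 => a b k; apply: val_inj; rewrite /= qm lactM.
- by have [_ _ qa _] := r_hom s0 => a k k'; apply: (core_inj co); rewrite !spec_ipE /= qa lact_adj.
- move=> a k; rewrite !rnormE -rmorphM lecR -(co_norm cs) -!(rnorm_cval k) -rnorm_cval.
  exact: rnorm_lact.
Defined.
Lemma core_posc : posc X0.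
Proof.
move=> x; apply: (Pos_reflect (r_hom r0) (co_norm co)).
by rewrite -r_ip; exact: Pos_adj_mul.
Qed.
Lemma spec_posc n : posc (spec_corr n).
Proof. by move=> k; apply: (Pos_reflect (r_hom r0) (co_norm co)); rewrite spec_ipE; exact: pE. Qed.

Definition spec_sg (k : spec_corr 0) (T : P) : E := ract (cval k) T.

Lemma sg_pi_deg f a : deg U 0 (sg f (r_pi r a)).
Proof. exact: (deg_sg hl f (r_pi_deg r a)). Qed.
(** A substitute for the vector [f \ot 1], as [P] may lack a unit. *)
Definition spec_pi f a : spec_corr 0 := @mkcsub _ _ (spec_sub 0) _ (sg_pi_deg f a).
Lemma spec_piE f a T : spec_sg (spec_pi f a) T = sg f (cmul (r_pi r a) T).
Proof. exact: (li_ract hl). Qed.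
Lemma blin_sg f : blin (sg f). Proof. exact: (it_blinr (li_it hl) f). Qed.
Lemma sg_approx f T : cspan [set spec_sg (spec_pi f a) T' | a in [set: A] & T' in [set: P]] (sg f T).
Proof.
apply: (cspan_map (blin_sg f) _ (@r_nd _ _ _ _ r T)) => _ [a _ [T' _ <-]].
by apply: cspan_sub; exists a => //; exists T' => //; rewrite spec_piE.
Qed.
Lemma sg_approx_deg n f T (e : R) : deg (r_g r) n T -> 0 < e ->
  exists a, rnorm (sg f T - spec_sg (spec_pi f a) T) <= e.
Proof.
move=> hT e0; have [C C0 hC] : exists2 C : R, 0 <= C & forall T, rnorm (sg f T) <= C * rnorm T := (blin_sg f).2.
have k0 : 0 < C + 1 by lra.
have [u _ hu] := nondeg_approx (r_hom r) (@r_nd _ _ _ _ r T) (divr_gt0 e0 k0).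
exists u; rewrite spec_piE -(linB (blin_lin (blin_sg f))) (le_trans (hC _)) //.
apply: (@le_trans _ _ ((C + 1) * rnorm (T - cmul (r_pi r u) T))).
  by rewrite ler_wpM2r ?rnorm_ge0 // lerDl.
by rewrite -ler_pdivlMl // mulrC.
Qed.

Lemma spec_it : interior_tensor (X := spec_corr 0) (Y := rcorr r0) (Z := res (r_hom s0) E) spec_sg.
Proof.
split.
- by move=> k; exact: ract_linearr.
- by move=> T c k k'; exact: (ract_linearl T).
- by move=> k a T; rewrite /spec_sg /= ractM.
- by move=> b k T; rewrite /spec_sg /= lact_ract.
- by move=> k T T'; rewrite /spec_sg /= -ractM.
- by move=> k T k' T'; rewrite /spec_sg /= ip_ract ip_ractl spec_ipE cmulA.
- by move=> xi; apply/positiveP; exact: pE.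
- apply/seteqP; split=> // xi _.
  apply: (cspan_min (@cspan_closed _ _ _) _ (it_total (li_it hl) xi)) => _ [[f T] _ <-] /=.
  apply: (cspan_min (@cspan_closed _ _ _) _ (@sg_approx f T)) => _ [a _ [T' _ <-]].
  by apply: cspan_sub; exists (spec_pi f a) => //; exists T'.
Qed.

Lemma spec_actL_deg y (k : spec_corr 0) : deg U 1 (lact (r_t s0 y) (cval k)).
Proof. exact: (lact_deg (esym (addr0 1)) (core_t_deg cs y) (specP k)). Qed.
Definition spec_actL y k : spec_corr 1 := @mkcsub _ _ (spec_sub 1) _ (spec_actL_deg y k).
Lemma spec_actR_deg x (k : spec_corr 0) : deg U 1 (ract (cval k) (r_t r0 x)).
Proof. exact: (ract_deg (esym (add0r 1)) (specP k) (core_t_deg co x)). Qed.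
Definition spec_actR k x : spec_corr 1 := @mkcsub _ _ (spec_sub 1) _ (spec_actR_deg x k).

Hypotheses (nF : nondeg F)
  (sfib : forall b, cspan [set cmul (r_t s y) (cadj (r_t s y')) | y in [set: Y] & y' in [set: Y]] (r_pi s b)).

Lemma pi_approx (xi : E) (e : R) : 0 < e -> exists b, rnorm (xi - lact (r_pi s b) xi) <= e.
Proof.
move=> e0; have [u _ hu] := approx_unit_one (it_posc (li_it hl)) (nondeg_tensor (li_it hl) nF) (xi : res (r_hom s) E) e0.
by exists u.
Qed.

Lemma cval_lin n : linear (fun k : spec_corr n => cval k : E). Proof. by move=> c k k'; exact: cval_lc. Qed.

(** For surjectivity, [xi] of degree 1 is close to [pi(b) xi], hence to sums of [t(y) t(y')^* xi],
    and the vectors [t(y')^* xi] have degree 0. *)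
Lemma spec_unitL : exists m : Y0 \ox spec_corr 0 -> spec_corr 1, unitary m /\
  forall y k, m (y \ot k) = spec_actL y k.
Proof.
have pY0 : posc Y0 by move=> y; apply: (Pos_reflect (r_hom s0) (co_norm cs)); rewrite -r_ip; exact: Pos_adj_mul.
have hT := tens_it pY0 (@spec_posc 0).
have [||||m [um hm]] := @unitary_ext _ _ _ (Y0 \ox spec_corr 0) (spec_corr 1) _ _ (fun p => spec_actL p.1 p.2)
  (fun b p => (lact b p.1, p.2)) (it_total hT).
- move=> xi; apply: (cspan_isom (@cval_lin 1) (@rnorm_cval _ _ _)).
  have [_ _ cl] := cspan_closed ((fun k : spec_corr 1 => cval k : E) @` range (fun p : Y0 * spec_corr 0 => spec_actL p.1 p.2)).
  apply: cl => e e0; have [b hb] := pi_approx (cval xi) e0.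
  exists (lact (r_pi s b) (cval xi)) => //.
  apply: (cspan_map (blin_lactl (cval xi)) _ (@sfib b)) => _ [y _ [y' _ <-]].
  have [y0 hy0] := core_of_t cs y.
  have hk : deg U 0 (lact (cadj (r_t s y')) (cval xi)).
    apply: (lact_deg (m := -1) (n := 1)) (specP xi) => // z z1.
    have [_ _ ga _] := r_ghom s z1; rewrite ga r_gt // cadjZ; congr (_ *: _).
    by rewrite exprN1 invC_norm z1 expr1n invr1 mul1r.
  apply: cspan_sub; exists (spec_actL y0 (@mkcsub _ _ (spec_sub 0) _ hk)); first by exists (y0, @mkcsub _ _ (spec_sub 0) _ hk).
  by rewrite /= hy0 lactM.
- move=> p p'; apply: (core_inj co); rewrite (it_ip hT) !spec_ipE /=.
  by rewrite lact_adj -lactM r_ip.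
- by move=> b p; rewrite (it_lact hT).
- by move=> b p; apply: val_inj; rewrite /= -lactM r_lact.
by exists m; split=> // y k; exact: (hm (y, k)).
Qed.

(** For surjectivity, a vector of degree 1 is a limit of sums of [f \ot T] with [T] of degree 1 by
    [deg_total]; such a [T] is some [t(x)], and [f \ot T] is close to [(f \ot pi(a)) T]. *)
Lemma spec_unitR : exists m : spec_corr 0 \ox X0 -> spec_corr 1, unitary m /\
  forall k x, m (k \ot x) = spec_actR k x.
Proof.
have hT := tens_it (@spec_posc 0) core_posc.
have [||||m [um hm]] := @unitary_ext _ _ _ (spec_corr 0 \ox X0) (spec_corr 1) _ _ (fun p => spec_actR p.1 p.2)
  (fun b p => (lact b p.1, p.2)) (it_total hT).
- move=> xi; apply: (cspan_isom (@cval_lin 1) (@rnorm_cval _ _ _)).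
  apply: (cspan_min (@cspan_closed _ _ _) _ (deg_total hl (co_dense co) (specP xi))) => _ [f _ [T hT1 <-]].
  have [_ _ cl] := cspan_closed ((fun k : spec_corr 1 => cval k : E) @` range (fun p : spec_corr 0 * X0 => spec_actR p.1 p.2)).
  apply: cl => e e0; have [a ha] := sg_approx_deg f hT1 e0; have [x hx] := co_deg1 co hT1.
  exists (spec_sg (spec_pi f a) T) => //.
  apply: cspan_sub; exists (spec_actR (spec_pi f a) x); first by exists (spec_pi f a, x).
  by rewrite /= hx.
- move=> p p'; apply: (core_inj co); rewrite (it_ip hT) !spec_ipE /=.
  by rewrite ip_ract ip_ractl -r_ip -r_lact spec_ipE cmulA.
- by move=> b p; rewrite (it_lact hT).
- by move=> b p; apply: val_inj; rewrite /= lact_ract.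
by exists m; split=> // y k; exact: (hm (y, k)).
Qed.

Lemma spec_lift : exists PhiK : Y0 \ox spec_corr 0 -> spec_corr 0 \ox X0,
  unitary PhiK /\ is_lift r0 s0 PhiK U spec_sg.
Proof.
have [mL [uL mLE]] := spec_unitL; have [mR [uR mRE]] := spec_unitR.
have [mV [uV mVK mKV]] := unitary_inv uR.
exists (fun w => mV (mL w)); split; first exact: unitary_comp uV uL.
have hS := spec_it; split=> //.
- move=> y k T.
  have e w : lift_act r0 spec_sg w T = ract (cval (mR w)) T.
    apply: (tliftP (@spec_posc 0) core_posc (h := fun w => ract (cval (mR w)) T)).
      have bc : blin (fun k : spec_corr 1 => cval k : E).
        by split; [exact: cval_lin|exists 1 => // k'; rewrite mul1r rnorm_cval].
      exact: (blin_comp (blin_ract E T) (blin_comp bc (unitary_blin uR))).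
    by move=> k' x; rewrite mRE /= -ractM.
  by rewrite e mKV mLE /= lact_ract.
- exact: li_Ulin hl.
- move=> z k T z1; rewrite /spec_sg (gram_ract (r_ghom r z1) (li_Ulin hl z1) (fun xi eta => li_Uip hl xi eta z1)).
  by rewrite (specP k) // expr0z scale1r (co_g co).
- by move=> z q xi z1; rewrite (co_g cs) (li_Uq hl).
- by move=> z xi eta z1; rewrite (co_g co) (li_Uip hl).
Qed.

Lemma spec_nondeg : nondeg (spec_corr 0).
Proof.
move=> k; have [_ _ cl] := cspan_closed [set lact b k' | b in [set: B0] & k' in [set: spec_corr 0]].
apply: cl => e e0; have [b hb] := pi_approx (cval k) e0; have [b0 hb0] := core_of_pi cs b.
exists (lact b0 k); first by apply: cspan_sub; exists b0 => //; exists k.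
by rewrite -rnorm_cval cvalB /= hb0.
Qed.
Lemma spec_correspondence : correspondence (spec_corr 0).
Proof.
split=> k; first by apply/positiveP; exact: spec_posc.
exact: (cohen (@spec_posc 0) spec_nondeg k).
Qed.

(** [<f \ot pi(v)^*, f' \ot p> = pi(v <f, f'>) p]. As [F] is full, these elements approximate
    [pi(v u) p], and with [u] and [v] close to units this is close to [p]. *)
Lemma spec_full : full F -> full (spec_corr 0).
Proof.
move=> fF; apply/seteqP; split=> // a _; have [pl pm pa _] := r_hom r.
have pl0 : linear (r_pi r0) by case: (r_hom r0).
apply: (cspan_isom pl0 (co_norm co)); set p := r_pi r0 a.
have hp : deg (r_g r) 0 p := core_pi_deg co a.
set S := (X in cspan X); have [_ _ cl] := cspan_closed S; apply: cl => e e0.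
have [u _ hu] := nondeg_approx (r_hom r) (@r_nd _ _ _ _ r p) (ltac:(by rewrite divr_gt0) : 0 < e / 2).
have k0 : 0 < rnorm p + 1 by have := rnorm_ge0 p; lra.
have [v _ hv] := ctr_one u (divr_gt0 (ltac:(by rewrite divr_gt0) : 0 < e / 2) k0).
exists (cmul (r_pi r v) (cmul (r_pi r u) p)).
  have bb : blin (fun c => cmul (r_pi r v) (cmul (r_pi r c) p)).
    exact: blin_comp (blin_cmul _) (blin_comp (blin_cmulr p) (star_hom_blin (r_hom r))).
  have hu' : cspan [set ip x y | x in [set: F] & y in [set: F]] u by rewrite /cspan fF.
  apply: (cspan_map bb _ hu') => _ [f _ [f' _ <-]]; apply: cspan_sub.
  have hk : deg U 0 (sg f' p) by exact: (deg_sg hl f' hp).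
  exists (ip (spec_pi f (cadj v)) (@mkcsub _ _ (spec_sub 0) _ hk : spec_corr 0)).
    by exists (spec_pi f (cadj v)) => //; exists (@mkcsub _ _ (spec_sub 0) _ hk : spec_corr 0).
  by rewrite spec_ipE /= (li_ip hl) pa cadjK.
have -> : p - cmul (r_pi r v) (cmul (r_pi r u) p) =
   (p - cmul (r_pi r u) p) + cmul (r_pi r (u - cmul v u)) p by rewrite (linB pl) pm !cE cmulA; lmod.
rewrite (le_trans (rnormD _ _)) // [leRHS](splitr e) lerD // (le_trans (rnormM _ _)) //.
have h1 := star_hom_norm (r_hom r) (u - cmul v u).
have h2 : rnorm (r_pi r (u - cmul v u)) * (rnorm p + 1) <= e / 2.
  by rewrite -ler_pdivlMr // (le_trans h1).
by apply: le_trans h2; rewrite ler_wpM2l ?rnorm_ge0 // lerDl.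
Qed.

(** Vectors of the form [f a] correspond to [f \ot pi(a)] in the degree 0 part, so finite rank
    operators written with them can be transferred from [F] to it. *)
Lemma compacts_ract (S : F -> F) (e : R) : compacts S -> 0 < e -> exists l : seq ((F * A) * (F * A)),
  forall z, rnorm (S z - \sum_(p <- l) rank1 (ract p.1.1 p.1.2) (ract p.2.1 p.2.2) z) <= e * rnorm z.
Proof.
move=> /compactsP[_ cS] e0; have e2 : 0 < e / 2 by rewrite divr_gt0.
have [l hlS] := cS _ e2.
suff [l' hl'] : exists l' : seq ((F * A) * (F * A)), forall z, rnorm (\sum_(p <- l) rank1 p.1 p.2 z -
    \sum_(p <- l') rank1 (ract p.1.1 p.1.2) (ract p.2.1 p.2.2) z) <= e / 2 * rnorm z.
  exists l' => z; rewrite [X in X * _](splitr e) mulrDl.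
  by rewrite (le_trans (rnorm_tri _ _ (\sum_(p <- l) rank1 p.1 p.2 z))) // lerD.
elim: l (e / 2) e2 {hlS cS} => [|[f f'] l IH] d d0.
  by exists [::] => z; rewrite !big_nil subr0 rnorm0 mulr_ge0 ?rnorm_ge0 // ltW.
have d2 : 0 < d / 2 by rewrite divr_gt0.
have d4 : 0 < d / 4 by rewrite divr_gt0.
have [l' hl'] := IH _ d2.
have k1 : 0 < 8 * rnorm f' + 1 by have := rnorm_ge0 f'; lra.
have [a ha] := ract_approx f (divr_gt0 d4 k1).
have k2 : 0 < 8 * rnorm (ract f a) + 1 by have := rnorm_ge0 (ract f a); lra.
have [a' ha'] := ract_approx f' (divr_gt0 d4 k2).
exists (((f, a), (f', a')) :: l') => z; rewrite !big_cons /=.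
have -> : rank1 f f' z + \sum_(p <- l) rank1 p.1 p.2 z -
   (rank1 (ract f a) (ract f' a') z + \sum_(p <- l') rank1 (ract p.1.1 p.1.2) (ract p.2.1 p.2.2) z) =
   rank1 (f - ract f a) f' z + rank1 (ract f a) (f' - ract f' a') z +
   (\sum_(p <- l) rank1 p.1 p.2 z - \sum_(p <- l') rank1 (ract p.1.1 p.1.2) (ract p.2.1 p.2.2) z).
  by rewrite /rank1 ip_sublE !ractE; lmod.
have -> : d * rnorm z = d / 4 * rnorm z + d / 4 * rnorm z + d / 2 * rnorm z by field.
rewrite (le_trans (rnormD _ _)) // lerD // (le_trans (rnormD _ _)) // lerD //.
  rewrite (le_trans (rank1_bd _ _ _)) // ler_wpM2r ?rnorm_ge0 //.
  move: ha; rewrite ler_pdivlMr // => ha; apply: le_trans ha.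
  have := rnorm_ge0 (f - ract f a); lra.
rewrite (le_trans (rank1_bd _ _ _)) // ler_wpM2r ?rnorm_ge0 //.
move: ha'; rewrite ler_pdivlMr // => ha'; apply: le_trans ha'.
have := rnorm_ge0 (f' - ract f' a'); lra.
Qed.
Lemma sum_rank1_op (l : seq ((F * A) * (F * A))) (f0 : F) (T : P) :
  sg (\sum_(p <- l) rank1 (ract p.1.1 p.1.2) (ract p.2.1 p.2.2) f0) T =
  \sum_(p <- l) ract (cval (spec_pi p.1.1 p.1.2)) (ip (cval (spec_pi p.2.1 p.2.2)) (sg f0 T)).
Proof.
have [_ pm pa _] := r_hom r.
rewrite (linS (it_linearl (li_it hl) T)); apply: eq_bigr => p _ /=.
rewrite /rank1 (li_ip hl) (li_ract hl) ip_ractl -ractM (it_balanced (li_it hl)) /=.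
by rewrite !pm pa !cmulA.
Qed.

(** Write [q] as nearly [pi(b) q]. The operator [b] is compact on [F], so on [E] it is close to a
    finite sum built from vectors [spec_pi] of the degree 0 part; composition with [q] keeps the
    rank finite. *)
Lemma spec_proper : posc F -> proper_corr F -> proper_corr (spec_corr 0).
Proof.
move=> pF prF q; apply/compactsP; split; first by exists (lact (cadj q)); exact: lact_adj.
move=> e e0; set c := r_pi s0 q; have e2 : 0 < e / 2 by rewrite divr_gt0.
have [b _ hb] := nondeg_approx (r_hom s) (@r_nd _ _ _ _ s c) e2.
have k0 : 0 < rnorm c + 1 by have := rnorm_ge0 c; lra.
have [l hll] := compacts_ract (prF b) (divr_gt0 e2 k0).
set d := e / 2 / (rnorm c + 1) in hll; have d0 : 0 < d by rewrite !divr_gt0.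
pose th z := \sum_(p <- l) rank1 (ract p.1.1 p.1.2) (ract p.2.1 p.2.2) z : F.
have [[th' hth] _] := compacts_sum [seq (ract p.1.1 p.1.2, ract p.2.1 p.2.2) | p <- l].
have ad : adjoint_pair (fun z => lact b z - th z) (fun z => lact (cadj b) z - th' z).
  move=> x y; rewrite ip_sublE (linB (ip_linear x)) lact_adj -hth big_map //.
have [h [_ [bh h1 hd _ _]]] := it_op pF (@posc_rcorr _ _ _ _ r) (li_it hl) (ltW d0) hll ad.
have hE xi : h xi = lact (r_pi s b) xi -
    \sum_(p <- l) ract (cval (spec_pi p.1.1 p.1.2)) (ip (cval (spec_pi p.2.1 p.2.2)) xi).
  move: xi; have b1 : blin (fun xi : E => \sum_(p <- l) ract (cval (spec_pi p.1.1 p.1.2)) (ip (cval (spec_pi p.2.1 p.2.2)) xi)).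
    elim: (l) => [|p l' IH].
      have := @blin0 _ E E; congr blin; apply/funext => xi; by rewrite big_nil.
    have bp : blin (fun xi => ract (cval (spec_pi p.1.1 p.1.2)) (ip (cval (spec_pi p.2.1 p.2.2)) xi)).
      exact: blin_comp (blin_ractr _) (blin_ip _).
    have := blin_lc 1 bp IH; congr blin; apply/funext => xi.
    by rewrite big_cons scale1r.
  apply: (it_ext (li_it hl) bh (blinB (blin_lact E (r_pi s b)) b1)) => f T.
  by rewrite h1 (linB (it_linearl (li_it hl) T)) sum_rank1_op (li_pi hl).
(* Composing a rank one operator with [q] on the right applies [q^*] to its second vector. *)
exists [seq (spec_pi p.1.1 p.1.2, lact (cadj q) (spec_pi p.2.1 p.2.2)) | p <- l] => k.
rewrite -rnorm_cval cvalB big_map.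
have -> : cval (\sum_(p <- l) rank1 (spec_pi p.1.1 p.1.2) (lact (cadj q) (spec_pi p.2.1 p.2.2)) k) =
    lact (r_pi s b) (lact c (cval k)) - h (lact c (cval k)).
  rewrite hE subKr (linS (@cval_lin 0)); apply: eq_bigr => p _.
  rewrite /rank1 lact_adj cadjK.
  by rewrite -[LHS]/(ract (cval (spec_pi p.1.1 p.1.2)) (r_pi r0 (spec_ip (spec_pi p.2.1 p.2.2) (lact q k)))) spec_ipE.
have -> : cval (lact q k) - (lact (r_pi s b) (lact c (cval k)) - h (lact c (cval k))) =
  lact (c - cmul (r_pi s b) c) (cval k) + h (lact c (cval k)).
  by rewrite lactDl lactNl lactM /= -/c; lmod.
rewrite (le_trans (rnormD _ _)) // [X in X * _](splitr e) mulrDl lerD //.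
  by rewrite (le_trans (rnorm_lact _ _)) // rnorm_cval ler_wpM2r ?rnorm_ge0.
rewrite (le_trans (hd _)) //; have := rnorm_lact c (cval k); rewrite rnorm_cval => hc.
apply: (@le_trans _ _ (d * ((rnorm c + 1) * rnorm k))).
  rewrite ler_wpM2l ?(ltW d0) // (le_trans hc) // ler_wpM2r ?rnorm_ge0 // lerDl.
  exact: ler01.
by rewrite mulrA /d divfK ?gt_eqF.
Qed.
End SpectralCorr.

(** * Correspondences and 2-arrows recovered from their lifts *)

Section CoreLifts.
Context (R : realType) (A A0 B B0 : cstarAlg R) (X : preCorr A A) (X0 : preCorr A0 A0)
  (Y : preCorr B B) (Y0 : preCorr B0 B0) (P Q : cstarAlg R)
  (r : rep X P) (r0 : rep X0 P) (s : rep Y Q) (s0 : rep Y0 Q).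
Hypotheses (co : is_core r r0) (cs : is_core s s0).

Section Iso.
Context (K : preCorr B0 A0) (Phi : Y0 \ox K -> K \ox X0) (E : preCorr Q P) (U : R[i] -> E -> E) (sg : K -> P -> E).
Hypothesis hl : is_lift r0 s0 Phi U sg.
Notation S0 := (spec_corr (core_refl co) (core_refl cs) hl 0).

(* a correspondence is recovered from its lift as the degree 0 part *)
Lemma core_lift_iso : exists j : K -> S0, unitary j /\ forall k T, ract (cval (j k) : E) T = sg k T.
Proof.
have [pl pm pa _] := r_hom r0.
have [|||||j [uj hj]] := @unitary_ext _ _ _ K S0 _ (fun p : K * A0 => ract p.1 p.2)
   (fun p => spec_pi (core_refl co) (core_refl cs) hl p.1 p.2) (fun b p => (lact b p.1, p.2)).
- move=> k; have [_ _ cl] := cspan_closed (range (fun p : K * A0 => ract p.1 p.2)).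
  apply: cl => e e0; have [a ha] := ract_approx k e0; exists (ract k a) => //.
  by apply: cspan_sub; exists (k, a).
- move=> xi; apply: (@cspan_isom _ _ _ (fun k : S0 => cval k : E)) => [c k k'|k|]; [exact: cval_lc|exact: rnorm_cval|].
  apply: (cspan_min (@cspan_closed _ _ _) _ (deg_total hl (co_dense (core_refl co)) (specP xi))) => _ [k _ [T hT <-]].
  have [a <-] := co_deg0 (core_refl co) hT.
  by apply: cspan_sub; exists (spec_pi (core_refl co) (core_refl cs) hl k a) => //; exists (k, a).
- move=> p p'; apply: (core_inj co); rewrite (spec_ipE (core_refl co)).
  by apply: etrans (li_ip hl _ _ _ _) _; rewrite ip_ract ip_ractl !pm pa cmulA.
- by move=> b p; rewrite lact_ract.
- by move=> b p; apply: val_inj; rewrite /= (li_pi hl).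
exists j; split=> // k T.
have bj : blin (fun k => ract (cval (j k) : E) T).
  have bc : blin (fun k : S0 => cval k : E).
    by split; [move=> c x y; exact: cval_lc|exists 1 => // k'; rewrite mul1r rnorm_cval].
  exact: (blin_comp (blin_ract E T) (blin_comp bc (unitary_blin uj))).
have [_ _ cl] := lin_closed_eq bj (it_blinl (li_it hl) T).
apply: cl => e e0; have [a ha] := ract_approx k e0; exists (ract k a) => //.
by rewrite (hj (k, a)) /= (li_ract hl) (it_balanced (li_it hl)).
Qed.
End Iso.

(** If the difference [w] acts as zero, apply it to [pi(c)] with [c = <w, w>]: the inner square is
    the image of [c^3], so [c^3 = 0] and [w = 0], since [pi] is isometric on the core. *)
Lemma lift_act_eq (K : preCorr B0 A0) (E : preCorr B0 P) (sg : K -> P -> E) (u v : K \ox X0) :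
  posc K -> interior_tensor (Y := rcorr r0) sg ->
  (forall T, lift_act r0 sg u T = lift_act r0 sg v T) -> u = v.
Proof.
move=> pK hT h; have pX0 := core_posc co; have pKX := posc_tensor pK pX0.
apply/eqP; rewrite -subr_eq0; apply/eqP; set w := u - v.
have w0 T : lift_act r0 sg w T = 0.
  by rewrite /w (linB (blin_lin (lift_act_blin pX0 pK hT T))) h subrr.
have [pl pm pa _] := r_hom r0.
have := lift_act_ip pX0 pK hT w (r_pi r0 (ip w w)) w (r_pi r0 (ip w w)); set c := ip w w.
have hc : cadj c = c by rewrite ip_adj.
rewrite w0 ip0l -pa hc -!pm => /esym h0.
have c4 : cmul c (cmul c c) = 0 by apply: (core_inj co); rewrite h0 (lin0 pl).
have c2 : cmul c c = 0.
  apply/rnorm0_eq0/eqP; rewrite -sqrf_eq0 -rnormC cadjM hc -cmulA c4.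
  have -> : cmul c 0 = 0 by exact: (lin0 (cmul_linearr c)).
  by rewrite rnorm0.
have c1 : c = 0 by apply/rnorm0_eq0/eqP; rewrite -sqrf_eq0 -rnormC hc c2 rnorm0.
by apply/rnorm0_eq0/eqP; rewrite -sqrf_eq0 -rnorm_ip -/c c1 rnorm0.
Qed.

(** [V] preserves degrees, so it restricts to the degree 0 parts, which are [K] and [K'] by
    [core_lift_iso]. The identity of 2-arrows is verified after letting both sides act on [P], where
    it is the linearity of [V] over [Q]. *)
Lemma core_arrow2 (K : preCorr B0 A0) (Phi : Y0 \ox K -> K \ox X0) (E : preCorr Q P)
    (U : R[i] -> E -> E) (sg : K -> P -> E)
    (K' : preCorr B0 A0) (Phi' : Y0 \ox K' -> K' \ox X0) (E' : preCorr Q P)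
    (U' : R[i] -> E' -> E') (sg' : K' -> P -> E') (V : E -> E') :
  posc K -> unitary Phi -> unitary Phi' ->
  is_lift r0 s0 Phi U sg -> is_lift r0 s0 Phi' U' sg' -> unitary V ->
  (forall z xi, `|z| = 1 -> V (U z xi) = U' z (V xi)) ->
  exists Psi : K -> K', arrow2 Phi Phi' Psi.
Proof.
move=> pK uPhi uPhi' hl hl' uV VU; have [Vl Vla Vr Vi Vs] := uV.
have [j [uj jE]] := core_lift_iso hl; have [j' [uj' jE']] := core_lift_iso hl'.
have [i' [ui' ij' ji']] := unitary_inv uj'.
set S0 := spec_corr _ _ hl 0 in j uj jE; set S0' := spec_corr _ _ hl' 0 in j' uj' jE' i' ui' ij' ji'.
have Vdeg (k : S0) : deg U' 0 (V (cval k)).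
  by move=> z z1; rewrite -VU // (specP k) // (linZ Vl).
pose W (k : S0) : S0' := @mkcsub _ _ (spec_sub hl' 0) _ (Vdeg k).
have uW : unitary W.
  split.
  - by move=> c x y; apply: val_inj; rewrite /= Vl.
  - by move=> a x; apply: val_inj; rewrite /= Vla.
  - by move=> x a; apply: val_inj; rewrite /= Vr.
  - move=> x y; apply: (core_inj co).
    exact: (etrans (spec_ipE (core_refl co) (W x) (W y)) (etrans (Vi _ _) (esym (spec_ipE (core_refl co) x y)))).
  - move=> y; have [x hx] := Vs (cval y).
    have hd : deg U 0 x.
      by move=> z z1; apply: (unitary_inj uV); rewrite VU // hx (specP y) // (linZ Vl) hx.
    by exists (@mkcsub _ _ (spec_sub hl 0) _ hd); apply: val_inj; rewrite /= hx.
pose Psi k := i' (W (j k)).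
have uPsi : unitary Psi := unitary_comp ui' (unitary_comp uW uj).
have PsiE k T : sg' (Psi k) T = V (sg k T).
  by rewrite -jE' /Psi ji' /= -Vr jE.
clearbody Psi.
have pX0 := core_posc co; have pY0 := core_posc cs; have pK' := unitary_posc uPsi pK.
exists Psi; split=> //.
have [u1 t1] := tmapP pK pX0 uPsi (unitary_id X0).
have [u2 t2] := tmapP pY0 pK (unitary_id Y0) uPsi.
have hT := li_it hl; have hT' := li_it hl'; have hYK := tens_it pY0 pK.
have e T w : V (lift_act r0 sg w T) = lift_act r0 sg' (tmap Psi idfun w) T.
  move: w; apply: (it_ext (tens_it pK pX0)).
  - exact: (blin_comp (unitary_blin uV) (lift_act_blin pX0 pK hT T)).
  - exact: (blin_comp (lift_act_blin pX0 pK' hT' T) (unitary_blin u1)).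
  by move=> k x; rewrite (lift_actE pX0 pK hT) t1 (lift_actE pX0 pK' hT') PsiE.
move=> w; apply: (lift_act_eq pK' hT') => T; rewrite -e.
move: w; apply: (it_ext hYK).
- exact: (blin_comp (unitary_blin uV) (blin_comp (lift_act_blin pX0 pK hT T) (unitary_blin uPhi))).
- exact: (blin_comp (lift_act_blin pX0 pK' hT' T) (blin_comp (unitary_blin uPhi') (unitary_blin u2))).
by move=> y k; rewrite t2 -(li_t hl) -(li_t hl') PsiE Vla.
Qed.
End CoreLifts.

(** * Continuous paths *)

Lemma real_complex_continuous (R : realType) (T : topologicalType) (psi : T -> R) : continuous psi ->
  continuous (fun t => (psi t)%:C : R[i]^o).
Proof.
move=> cpsi t; apply/cvgrPdist_lt => e e0.
have eE : e = (complex.Re e)%:C by case: (e) e0 => a b; rewrite ltcE /= => /andP[/eqP ->].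
have e1 : 0 < complex.Re e by move: e0; rewrite eE ltcR.
have /cvgrPdist_lt/(_ _ e1) := cpsi t; apply: filterS => u hu.
by rewrite eE -rmorphB cabsE cabs_real ltcR.
Qed.

Section ContITotal.
Context (R : realType) (V : completeNormedModType R[i]).
Local Notation I := (I01 R).

Lemma I01_val_continuous : continuous (fun t : I => \val t : R).
Proof. exact: initial_continuous. Qed.

Lemma contI_near (f : contI V) (t : I) (e : R) : 0 < e ->
  exists2 d : R, 0 < d & forall u : I, `|\val t - \val u| < d -> rnorm (f t - f u) <= e.
Proof.
move=> e0; have e0' : 0 < e%:C by rewrite ltcR.
have cf : {for \val t, continuous (fun x : R => f (clamp x))}.
  by apply: continuous_comp; [exact: clamp_continuous|exact: contIP].
have /cvgrPdist_lt/(_ _ e0')/nbhs_ballP[d d0 hd] := cf.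
exists d => // u tu; have := hd (\val u); rewrite -ball_normE /= !clampK => /(_ tu).
by rewrite rnormE ltcR => /ltW.
Qed.

Lemma contI_rnormE (f : contI V) : rnorm f = contI_rnorm f. Proof. by []. Qed.
Lemma contI_rnorm_lub (f : contI V) (M : R) : (forall t, rnorm (f t) <= M) -> rnorm f <= M.
Proof. by rewrite contI_rnormE; exact: contI_lub. Qed.
Lemma contI_rnorm_le (f : contI V) t : rnorm (f t) <= rnorm f.
Proof. by rewrite contI_rnormE; exact: contI_le. Qed.

Lemma scale_continuous (psi : I -> R) (f : contI V) : continuous psi ->
  continuous (fun t => (psi t)%:C *: f t).
Proof.
move=> cpsi.
apply: (@bounded2_continuous R I (R[i]^o) V V (fun c v => c *: v) 1 (fun t => (psi t)%:C) f) => //.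
- by move=> c v; rewrite mul1r normrZ.
- by move=> c c' v; rewrite scalerBl.
- by move=> c v v'; rewrite scalerBr.
- exact: real_complex_continuous.
- exact: contIP.
Qed.
Definition contI_scale (psi : I -> R) (cpsi : continuous psi) (f : contI V) : contI V :=
  mkcontI (@scale_continuous psi f cpsi).
Definition contI_cst (v : V) : contI V := mkcontI (@cst_continuous I V v).

Definition paths : set (contI V) := [set f | exists (psi : I -> R) (c : continuous psi) v, f = contI_scale c (contI_cst v)].

Lemma blin_scale (psi : I -> R) (c : continuous psi) (M : R) : (forall t, `|psi t| <= M) -> blin (contI_scale c).
Proof.
move=> hM; have M0 : 0 <= M := le_trans (normr_ge0 _) (hM (i0 R)).
split=> [k f g|].
  apply: contI_eq => t; rewrite -[LHS]/((psi t)%:C *: (k *: f t + g t)) -[RHS]/(k *: ((psi t)%:C *: f t) + (psi t)%:C *: g t); lmod.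
exists M => // f; apply: contI_rnorm_lub => t.
by rewrite /= rnormZr ler_pM ?normr_ge0 ?rnorm_ge0 // contI_rnorm_le.
Qed.
Lemma blin_cst : blin contI_cst.
Proof.
split=> [k v w|]; first by apply: contI_eq.
by exists 1 => // v; rewrite mul1r; apply: contI_rnorm_lub.
Qed.
Lemma I01_bounded (psi : I -> R) : continuous psi -> exists M, forall t, `|psi t| <= M.
Proof.
move=> c.
have cf : {within `[0%R, 1%R], continuous (fun x => `|psi (clamp x)|)}.
  apply: continuous_subspaceT => x.
  apply: (continuous_comp (f := fun x => psi (clamp x))); last exact: norm_continuous.
  by apply: continuous_comp; [exact: clamp_continuous|exact: c].
have [x _ hx] := EVT_max ler01 cf; exists `|psi (clamp x)| => t.
by rewrite -{1}(clampK t); apply: hx; have /set_mem := valP t.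
Qed.
Lemma paths_scale (psi : I -> R) (c : continuous psi) f : cspan paths f -> cspan paths (contI_scale c f).
Proof.
have [M hM] := I01_bounded c; apply: (cspan_map (blin_scale c hM)) => _ [psi' [c' [v ->]]].
have c2 : continuous (fun t => psi t * psi' t) by move=> t; apply: (@cvgM R I (nbhs t) _ psi psi' (psi t) (psi' t)); [exact: c|exact: c'].
apply: cspan_sub; exists (fun t => psi t * psi' t), c2, v; apply: contI_eq => t /=.
by rewrite scalerA -rmorphM.
Qed.
Lemma paths_cst v : cspan paths (contI_cst v).
Proof.
apply: cspan_sub; exists (fun=> 1), (@cst_continuous I R 1), v; apply: contI_eq => t /=.
by rewrite scale1r.
Qed.

Definition ramp (a b : R) (t : I) : R := \val (clamp ((\val t - a) / (b - a))).
Lemma ramp_continuous a b : continuous (ramp a b).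
Proof.
move=> t; apply: (continuous_comp (f := fun t : I => clamp ((\val t - a) / (b - a)))); last exact: I01_val_continuous.
apply: (continuous_comp (f := fun t : I => (\val t - a) / (b - a))); last exact: clamp_continuous.
apply: (continuous_comp (f := fun t : I => \val t : R) (g := fun x : R => (x - a) / (b - a))).
  exact: I01_val_continuous.
by apply: continuousM; [apply: continuousB; [exact: cvg_id|exact: cvg_cst]|exact: cvg_cst].
Qed.

(** The supremum of all [b] such that [f] is approximated on [[0, b]] must be 1: near any point [f]
    is almost constant, and a ramp glues this constant to an approximation reached so far. *)
Lemma paths_total f : cspan paths f.
Proof.
have [_ pl cl] := cspan_closed paths; apply: (cl) => e e0.
pose good b := exists2 p, cspan paths p & forall t, \val t <= b -> rnorm (f t - p t) <= e.
(* The ramp [k] rises from 0 at [u - d] to 1 at [b]: left of [u - d] the old path is kept, right of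
   [b] the constant [f u] is used, and in between both are good, so their convex combination is. *)
have step (u : I) d b b' : (forall t, `|\val u - \val t| < d -> rnorm (f u - f t) <= e) ->
    \val u - d < b -> b' < \val u + d -> good b -> good b'.
  move=> hd ub ub' [p Sp hp]; pose q := contI_cst (f u); pose c := @ramp_continuous (\val u - d) b.
  exists (-1 *: contI_scale c (p - q) + p).
    apply: (pl) => //; apply: paths_scale; rewrite addrC -scaleN1r; apply: (pl) => //.
    exact: paths_cst.
  move=> t tb'; set k := ramp (\val u - d) b t.
  have -> : (-1 *: contI_scale c (p - q) + p) t = p t - k%:C *: (p t - f u).
    by rewrite -[LHS]/(-1 *: (k%:C *: (p t - f u)) + p t) scaleN1r addrC.
  have kE : k = Num.max 0 (Num.min 1 ((\val t - (\val u - d)) / (b - (\val u - d)))) by [].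
  have k0 : 0 <= k by rewrite kE le_max lexx.
  have k1 : k <= 1 by rewrite kE ge_max ler01 ge_min lexx.
  have bd : 0 < b - (\val u - d) by rewrite subr_gt0.
  have -> : f t - (p t - k%:C *: (p t - f u)) = (1 - k)%:C *: (f t - p t) + k%:C *: (f t - f u).
    by rewrite rmorphB rmorph1; lmod.
  have hp' : \val t <= b \/ k = 1.
    have [tb|bt] := leP (\val t) b; [by left|right].
    have h1 : 1 <= (\val t - (\val u - d)) / (b - (\val u - d)) by rewrite ler_pdivlMr // mul1r lerD2r ltW.
    by rewrite kE (min_idPl h1) (max_idPr ler01).
  have hq : \val u - d < \val t \/ k = 0.
    have [tb|bt] := leP (\val t) (\val u - d); [right|by left].
    have h1 : (\val t - (\val u - d)) / (b - (\val u - d)) <= 0 by rewrite ler_pdivrMr // mul0r subr_le0.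
    by rewrite kE; apply/max_idPl; rewrite ge_min h1 orbT.
  have hpn : (1 - k) * rnorm (f t - p t) <= (1 - k) * e.
    by case: hp' => [/hp h|->]; [rewrite ler_wpM2l ?subr_ge0|rewrite subrr !mul0r].
  have hqn : k * rnorm (f t - f u) <= k * e.
    case: hq => [h|->]; last by rewrite !mul0r.
    rewrite ler_wpM2l // -[f t - f u]opprB rnormN; apply: hd.
    move: h (le_lt_trans tb' ub'); move: (\val u) (\val t); clear => x y h1 h2.
    by rewrite ltr_norml; apply/andP; split; lra.
  rewrite (le_trans (rnormD _ _)) // !rnormZr !ger0_norm ?subr_ge0 //.
  by rewrite (_ : e = (1 - k) * e + k * e) ?lerD //; ring.
pose S := [set b | good b /\ 0 <= b <= 1].
have S0 : S 0.
  split; last by rewrite lexx ler01.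
  exists (contI_cst (f (i0 R))) => [|t t0]; first exact: paths_cst.
  suff -> : t = i0 R by rewrite subrr rnorm0 ltW.
  apply: val_inj; have /set_mem := valP t; rewrite /= in_itv /= => /andP[h _].
  by apply/eqP; rewrite eq_le h t0.
have hS : has_sup S by split; [exists 0|exists 1 => b [_ /andP[]]].
have s0 : 0 <= sup S := sup_ubound hS.2 S0.
have s1 : sup S <= 1 by apply: ge_sup; [exists 0|move=> b [_ /andP[]]].
have vS : \val (clamp (sup S)) = sup S by rewrite /= (min_idPr s1) (max_idPr s0).
have [d d0 hd] := contI_near f (clamp (sup S)) e0; rewrite vS in hd.
have [b [gb bS] sb] := sup_adherent d0 hS.
pose b' := Num.min 1 (sup S + d / 2).
have gb' : good b'.
  apply: (step (clamp (sup S)) d b b') => //; rewrite vS //.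
  by rewrite /b' gt_min; apply/orP; right; lra.
have Sb' : S b'.
  by split=> //; rewrite /b' ge_min lexx /= andbT le_min ler01 /=; lra.
have b1 : b' = 1.
  have := sup_ubound hS.2 Sb'; rewrite /b'; case: (leP 1 (sup S + d / 2)) => //; lra.
have [p Sp hp] : good 1 by rewrite -b1.
exists p => //; apply: contI_rnorm_lub => t; apply: hp.
by have /set_mem := valP t; rewrite /= in_itv /= => /andP[].
Qed.
End ContITotal.

Lemma isom_continuous (R : realType) (T : topologicalType) (V W : completeNormedModType R[i]) (f : T -> W) (g : T -> V) :
  (forall t u, rnorm (g t - g u) = rnorm (f t - f u)) -> continuous f -> continuous g.
Proof.
move=> fg cf t; apply/cvgrPdist_lt => e e0.
by have /cvgrPdist_lt/(_ _ e0) := cf t; apply: filterS => u; rewrite !rnormE fg.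
Qed.

(** * Representations on algebras of paths *)

Section ContIMaps.
Context (R : realType).

Lemma contI_map_cont (V W : completeNormedModType R[i]) (h : V -> W) (f : contI V) :
  blin h -> continuous (fun t => h (f t)).
Proof.
by move=> /blinP[_ ch] t; apply: continuous_comp; [exact: contIP|exact: ch].
Qed.
Definition contI_map (V W : completeNormedModType R[i]) (h : V -> W) (bh : blin h) (f : contI V) : contI W :=
  mkcontI (@contI_map_cont V W h f bh).
Lemma contI_map_linear (V W : completeNormedModType R[i]) (h : V -> W) (bh : blin h) : linear (contI_map bh).
Proof. by move=> c f g; apply: contI_eq => t; exact: (blin_lin bh). Qed.
Lemma contI_map_norm (V W : completeNormedModType R[i]) (h : V -> W) (bh : blin h) :
  (forall v, rnorm (h v) <= rnorm v) -> forall f, rnorm (contI_map bh f) <= rnorm f.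
Proof. by move=> nh f; apply: contI_rnorm_lub => t; rewrite (le_trans (nh _)) // contI_rnorm_le. Qed.
Lemma contI_map_isom (V W : completeNormedModType R[i]) (h : V -> W) (bh : blin h) :
  (forall v, rnorm (h v) = rnorm v) -> forall f, rnorm (contI_map bh f) = rnorm f.
Proof.
move=> nh f; apply/eqP; rewrite eq_le contI_map_norm /= => [|v]; last by rewrite nh.
by apply: contI_rnorm_lub => t; rewrite -nh; exact: (contI_rnorm_le (contI_map bh f)).
Qed.
(** Preimages chosen pointwise under an isometry form a continuous path automatically. *)
Lemma contI_map_surj (V W : completeNormedModType R[i]) (h : V -> W) (bh : blin h) (f : contI W) :
  (forall v, rnorm (h v) = rnorm v) -> (forall t, exists v, h v = f t) -> exists g, contI_map bh g = f.
Proof.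
move=> nh hf; pose g t := projT1 (cid (hf t)).
have gE t : h (g t) = f t := projT2 (cid (hf t)).
have cg : continuous g.
  apply: (isom_continuous _ (@contIP _ _ f)) => t u.
  by rewrite -!gE -(linB (blin_lin bh)) nh.
by exists (mkcontI cg); apply: contI_eq => t; exact: gE.
Qed.

Lemma contI_star_hom (A B : cstarAlg R) (h : A -> B) (hh : star_hom h) :
  @star_hom _ (contI_alg A) (contI_alg B) (contI_map (star_hom_blin hh)).
Proof.
have [hl hm ha hn] := hh; split.
- exact: contI_map_linear.
- by move=> f g; apply: contI_eq => t; exact: hm.
- by move=> f; apply: contI_eq => t; exact: ha.
- move=> f; rewrite !rnormE lecR; apply: contI_map_norm; exact: star_hom_norm.
Qed.
Lemma ev_star_hom (A : cstarAlg R) t : @star_hom _ (contI_alg A) A (fun f : contI A => f t).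
Proof. by split=> // f; rewrite !rnormE lecR; exact: contI_rnorm_le. Qed.

(** By [Pos_bd] one constant serves for all points of the path, so the norm criterion passes to the
    supremum and no continuous choice of square roots is made. *)
Lemma posc_contI (A B : cstarAlg R) (X : preCorr A B) : posc X -> posc (contI_corr X).
Proof.
move=> pX f; split; first by apply: contI_eq => t; exact: Pos_sa (pX _).
exists (rnorm (ip (f : contI_corr X) f) + 1); first by rewrite ltr_wpDl ?rnorm_ge0.
move=> g; apply: contI_rnorm_lub => t.
have N0 : 0 < rnorm (ip (f : contI_corr X) f) + 1 by rewrite ltr_wpDl ?rnorm_ge0.
have fN : rnorm (ip (f t) (f t)) <= rnorm (ip (f : contI_corr X) f) + 1.
  by rewrite (le_trans (contI_rnorm_le (ip (f : contI_corr X) f) t)) // lerDl.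
apply: (le_trans (Pos_bd (pX (f t)) N0 fN (g t))); rewrite ler_wpM2l ?(ltW N0) //.
exact: contI_rnorm_le.
Qed.

Lemma blin_path (V : completeNormedModType R[i]) (psi : I01 R -> R) (c : continuous psi) :
  blin (fun v : V => contI_scale c (contI_cst v)).
Proof. by have [M hM] := I01_bounded c; exact: (blin_comp (@blin_scale _ V psi c M hM) (@blin_cst _ V)). Qed.

Lemma paths_span (V : completeNormedModType R[i]) (S : set V) (T : set (contI V)) :
  (forall v, cspan S v) ->
  (forall (psi : I01 R -> R) (c : continuous psi) v, S v -> T (contI_scale c (contI_cst v))) ->
  forall f, cspan T f.
Proof.
move=> hS hT f; apply: (cspan_min (@cspan_closed _ _ T) _ (@paths_total _ _ f)) => _ [psi [c [v ->]]].
apply: (cspan_map (@blin_path _ _ c) _ (hS v)) => w Sw; apply: cspan_sub; exact: hT.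
Qed.

Section Rep.
Context (A : cstarAlg R) (X : preCorr A A) (P : cstarAlg R) (r : rep X P).
Definition contI_g (z : R[i]) : contI P -> contI P :=
  if pselect (`|z| = 1) is left h then contI_map (star_hom_blin (r_ghom r h)) else idfun.
Lemma contI_gE z (f : contI P) t : `|z| = 1 -> contI_g z f t = r_g r z (f t).
Proof. by move=> z1; rewrite /contI_g; case: pselect. Qed.

(** [C(I, P)] with the pointwise structure serves as the graded algebra of [C(I, X)]; both density
    clauses reduce to those of [P] by [paths_span]. *)
Definition contI_rep : rep (contI_corr X) (contI_alg P).
Proof.
refine (@Rep R (contI_alg A) (contI_corr X) (contI_alg P) (contI_map (star_hom_blin (r_hom r)))
  (contI_map (rep_blin r)) contI_g (contI_star_hom (r_hom r)) (contI_map_linear (rep_blin r)) _ _ _ _ _ _ _).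
- by move=> x y; apply: contI_eq => t; exact: r_ip.
- by move=> a x; apply: contI_eq => t; exact: r_lact.
- move=> z z1; have -> : contI_g z = contI_map (star_hom_blin (r_ghom r z1)).
    by apply/funext => f; apply: contI_eq => t; rewrite contI_gE.
  exact: contI_star_hom.
- by move=> z a z1; apply: contI_eq => t; rewrite contI_gE //; exact: r_gpi.
- by move=> z x z1; apply: contI_eq => t; rewrite contI_gE //; exact: r_gt.
- apply: (paths_span (@r_nd _ _ _ _ r)) => psi c _ [a _ [q _ <-]].
  exists (contI_cst a) => //; exists (contI_scale c (contI_cst q)) => //.
  by apply: contI_eq => t; rewrite /= cmulZr.
- apply: (paths_span (@r_tot _ _ _ _ r)) => psi c _ [x _ [q _ <-]].
  exists (contI_cst x) => //; exists (contI_scale c (contI_cst q)) => //.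
  by apply: contI_eq => t; rewrite /= cmulZr.
Defined.
End Rep.

Lemma core_t_norm (A A0 : cstarAlg R) (X : preCorr A A) (X0 : preCorr A0 A0) (P : cstarAlg R)
  (r : rep X P) (r0 : rep X0 P) : is_core r r0 -> forall x, rnorm (r_t r0 x) = rnorm x.
Proof.
move=> co x; apply/eqP; rewrite -(@eqrXn2 _ 2) ?rnorm_ge0 // -rnormC r_ip (co_norm co).
by rewrite rnorm_ip.
Qed.

Lemma contI_core (A A0 : cstarAlg R) (X : preCorr A A) (X0 : preCorr A0 A0) (P : cstarAlg R)
  (r : rep X P) (r0 : rep X0 P) : is_core r r0 -> is_core (contI_rep r) (contI_rep r0).
Proof.
move=> co; have dg n f : deg (contI_g r) n f <-> forall t, deg (r_g r) n (f t).
  split=> [h t z z1|h z z1]; first by rewrite -contI_gE // h.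
  by apply: contI_eq => t; rewrite contI_gE // h.
split.
- apply/funext => z; apply/funext => f; apply: contI_eq => t.
  have [z1|z1] := pselect (`|z| = 1); last by rewrite /= /contI_g; case: pselect.
  by rewrite /= !contI_gE // (co_g co).
- exact: contI_map_isom (co_norm co).
- move=> p /dg hp; apply: contI_map_surj (co_norm co) _ => t; exact: (co_deg0 co).
- move=> p /dg hp; apply: contI_map_surj (core_t_norm co) _ => t; exact: (co_deg1 co).
- apply: (paths_span (co_dense co)) => psi c T [n hT]; exists n; apply/dg => t z z1.
  have [gl _ _ _] := r_ghom r z1.
  by rewrite /= (linZ gl) hT // !scalerA mulrC.
Qed.
End ContIMaps.

(** * Transport to the core *)

Section CoreRep.
Context (R : realType) (A : cstarAlg R) (X : preCorr A A) (O : cuntzPimsner X).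
Hypotheses (pr : proper_corr X).

Lemma cp_deg n p : deg (@cp_g _ _ _ O) n p <-> homog (O := O) n p.
Proof.
split=> [h z z1|h z z1]; first by have := h z z1; rewrite (cp_gE O z1).
by rewrite (cp_gE O z1); exact: h.
Qed.

Definition core_rep : rep (core_corr O) O.
Proof.
refine (@Rep R (core_alg O) (core_corr O) O (fun a => cval a) (fun x => cval x) (@cp_g _ _ _ O)
  _ _ _ _ (r_ghom (cp_rep O pr)) _ _ _ _).
- by split=> // a; exact: lexx.
- by move=> c x y; exact: cval_lc.
- by [].
- by [].
- move=> z a z1; have /cp_deg h : homog (O := O) 0 (cval a) := csubP a.
  by rewrite h // expr0z scale1r.
- by move=> z a z1; have /cp_deg h : homog (O := O) 1 (cval a) := csubP a; rewrite h.
- move=> p; apply: cspan_mono (@r_nd _ _ _ _ (cp_rep O pr) p) => _ [a _ [q _ <-]].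
  have ha : homog (O := O) 0 (cp_pi O a) by apply/cp_deg; exact: (r_pi_deg (cp_rep O pr)).
  by exists (@mkcsub _ _ (homogS O 0) _ ha) => //; exists q.
- move=> p; apply: cspan_mono (@r_tot _ _ _ _ (cp_rep O pr) p) => _ [a _ [q _ <-]].
  have ha : homog (O := O) 1 (cp_t O a) by apply/cp_deg => z z1; exact: (r_gt (cp_rep O pr)).
  by exists (@mkcsub _ _ (homogS O 1) _ ha) => //; exists q.
Defined.

Lemma deg_mul n m k (p q : O) : k = n + m -> deg (@cp_g _ _ _ O) n p -> deg (@cp_g _ _ _ O) m q -> deg (@cp_g _ _ _ O) k (cmul p q).
Proof. by move=> kE /cp_deg hp /cp_deg hq; apply/cp_deg; exact: homogM kE hp hq. Qed.
Lemma deg_adj n k (p : O) : k = - n -> deg (@cp_g _ _ _ O) n p -> deg (@cp_g _ _ _ O) k (cadj p).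
Proof. by move=> kE /cp_deg hp; apply/cp_deg; exact: homog_adj kE hp. Qed.

(** For density: the closed span of the homogeneous elements contains the generators and is stable
    under products and adjoints. *)
Lemma cp_is_core : is_core (cp_rep O pr) core_rep.
Proof.
split=> //.
- by move=> p /cp_deg h; exists (@mkcsub _ _ (homogS O 0) _ h).
- by move=> p /cp_deg h; exists (@mkcsub _ _ (homogS O 1) _ h).
move=> p; set S := (X in cspan X).
apply: (cp_generates pr (P := cspan S)); first exact: cspan_closed.
- move=> a b ha hb.
  apply: (cspan_map (blin_cmulr b) _ ha) => a' [n hn].
  apply: (cspan_map (blin_cmul a') _ hb) => b' [m hm].
  by apply: cspan_sub; exists (n + m); exact: deg_mul hn hm.
- have [c0 cl cc] := cspan_closed S => a.
  apply: (cspan_min (P := fun a => cspan S (cadj a))).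
    split; first by rewrite cadj0.
      by move=> c x y hx hy; rewrite cadj_linear; exact: cl.
    move=> x hx; apply: cc => e /hx[y hy xy]; exists (cadj y) => //.
    by rewrite -cadj_sub rnorm_adj.
  by move=> a' [n hn]; apply: cspan_sub; exists (- n); exact: deg_adj hn.
- by move=> a; apply: cspan_sub; exists 0; exact: (r_pi_deg (cp_rep O pr)).
- by move=> x; apply: cspan_sub; exists 1 => z z1; exact: (r_gt (cp_rep O pr)).
Qed.
End CoreRep.

Lemma nondeg_core (R : realType) (A A0 : cstarAlg R) (X : preCorr A A) (X0 : preCorr A0 A0) (P : cstarAlg R)
  (r : rep X P) (r0 : rep X0 P) : is_core r r0 -> nondeg X0.
Proof.
move=> co x; have [_ _ cl] := cspan_closed [set lact a y | a in [set: A0] & y in [set: X0]].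
apply: cl => e e0; have [a _ ha] := nondeg_approx (r_hom r) (@r_nd _ _ _ _ r (r_t r0 x)) e0.
have [a0 ha0] := core_of_pi co a; exists (lact a0 x); first by apply: cspan_sub; exists a0 => //; exists x.
by rewrite -(core_t_norm co) (linB (@r_lin _ _ _ _ r0)) -r_lact ha0.
Qed.

Definition good (R : realType) (A B : cstarAlg R) (X : preCorr A A) (Y : preCorr B B) (F : preCorr B A)
  (Phi : Y \ox F -> F \ox X) := [/\ posc F, nondeg F & unitary Phi].

Lemma odot_good (R : realType) (A B C : cstarAlg R) (X : preCorr A A) (Y : preCorr B B) (Z : preCorr C C)
    (G : preCorr C B) (PhiG : Z \ox G -> G \ox Y) (F : preCorr B A) (PhiF : Y \ox F -> F \ox X) :
  posc X -> posc Y -> posc Z -> good PhiG -> good PhiF -> good (odot PhiG PhiF).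
Proof.
move=> pX pY pZ [pG nG uG] [pF nF uF]; split; first exact: posc_tensor.
  exact: nondeg_tensor (tens_it pG pF) nG.
exact: odot_unitary.
Qed.

(* [E] is a lift of [Phi] and of [PhiK], with the same operators [U] *)
Definition bilift (R : realType) (A A0 B B0 : cstarAlg R) (X : preCorr A A) (X0 : preCorr A0 A0)
    (Y : preCorr B B) (Y0 : preCorr B0 B0) (P Q : cstarAlg R)
    (r : rep X P) (r0 : rep X0 P) (s : rep Y Q) (s0 : rep Y0 Q)
    (F : preCorr B A) (Phi : Y \ox F -> F \ox X) (K : preCorr B0 A0) (PhiK : Y0 \ox K -> K \ox X0) :=
  [/\ good Phi, good PhiK & exists (E : preCorr Q P) (U : R[i] -> E -> E) (sg : F -> P -> E) (sg0 : K -> P -> E),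
    is_lift r s Phi U sg /\ is_lift r0 s0 PhiK U sg0].

Section Bilift.
Context (R : realType) (A A0 B B0 : cstarAlg R) (X : preCorr A A) (X0 : preCorr A0 A0)
    (Y : preCorr B B) (Y0 : preCorr B0 B0) (P Q : cstarAlg R)
    (r : rep X P) (r0 : rep X0 P) (s : rep Y Q) (s0 : rep Y0 Q).
Hypotheses (co : is_core r r0) (cs : is_core s s0) (pX : posc X) (pY : posc Y).

Lemma bilift_arrow2 (F : preCorr B A) (Phi : Y \ox F -> F \ox X) (K : preCorr B0 A0) (PhiK : Y0 \ox K -> K \ox X0)
    (F' : preCorr B A) (Phi' : Y \ox F' -> F' \ox X) (K' : preCorr B0 A0) (PhiK' : Y0 \ox K' -> K' \ox X0)
    (Psi : F -> F') : generates (r_pi s) (r_t s) ->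
  bilift r r0 s s0 Phi PhiK -> bilift r r0 s s0 Phi' PhiK' -> arrow2 Phi Phi' Psi ->
  exists Psi' : K -> K', arrow2 PhiK PhiK' Psi'.
Proof.
move=> gen [[pF nF uF] [pK nK uK] [E [U [sg [sg0 [l l0]]]]]] [[_ _ uF'] [_ _ uK'] [E' [U' [sg' [sg0' [l' l0']]]]]] a2.
have [V [uV _ VU]] := arrow2_lift pX pY pF gen l l' a2.
exact: (core_arrow2 co cs pK uK uK' l0 l0' uV VU).
Qed.

Lemma bilift_odot (C C0 : cstarAlg R) (Z : preCorr C C) (Z0 : preCorr C0 C0) (S : cstarAlg R)
    (q : rep Z S) (q0 : rep Z0 S)
    (F : preCorr B A) (PhiF : Y \ox F -> F \ox X) (KF : preCorr B0 A0) (PhiKF : Y0 \ox KF -> KF \ox X0)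
    (G : preCorr C B) (PhiG : Z \ox G -> G \ox Y) (KG : preCorr C0 B0) (PhiKG : Z0 \ox KG -> KG \ox Y0) :
  is_core q q0 -> posc Z -> bilift s s0 q q0 PhiG PhiKG -> bilift r r0 s s0 PhiF PhiKF ->
  bilift r r0 q q0 (odot PhiG PhiF) (odot PhiKG PhiKF).
Proof.
move=> cq pZ [gG gKG [EG [UG [sG [sG0 [lG lG0]]]]]] [gF gKF [EF [UF [sF [sF0 [lF lF0]]]]]].
have [pX0 pY0 pZ0] := And3 (core_posc co) (core_posc cs) (core_posc cq).
split; [exact: odot_good|exact: odot_good|].
have [pG nG uG] := gG; have [pKG nKG uKG] := gKG; have [pF nF uF] := gF; have [pKF nKF uKF] := gKF.
have [sg hsg] := odot_lift pX pY pZ pG pF nF uG uF lF lG.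
have [sg0 hsg0] := odot_lift pX0 pY0 pZ0 pKG pKF nKF uKG uKF lF0 lG0.
by exists (EG \ox EF), (tens_U UF UG), sg, sg0.
Qed.
End Bilift.

Lemma bilift_exists (R : realType) (A A0 B : cstarAlg R) (X : preCorr A A) (X0 : preCorr A0 A0)
    (Y : preCorr B B) (P : cstarAlg R) (r : rep X P) (r0 : rep X0 P) (O : cuntzPimsner Y)
    (prY : proper_corr Y) (F : preCorr B A) (Phi : Y \ox F -> F \ox X) :
  is_core r r0 -> posc X -> correspondence Y -> good Phi ->
  exists (K : preCorr (core_alg O) A0) (PhiK : core_corr O \ox K -> K \ox X0),
    [/\ bilift r r0 (cp_rep O prY) (core_rep O prY) Phi PhiK, correspondence K,
        full F -> full K & proper_corr F -> proper_corr K].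
Proof.
move=> co pX [pY' nY] gPhi; have [pF nF uPhi] := gPhi.
have pY : posc Y by move=> y; apply/positiveP; exact: pY'.
have cs := cp_is_core O prY.
have [E [U [sg [pE hl]]]] := lift_ex r O pX pY nY prY pF uPhi.
have [PhiK [uK lK]] := spec_lift co cs hl nF (@cp_fib _ _ _ O prY).
exists (spec_corr co cs hl 0), PhiK; split.
- split=> //; last by exists E, U, sg, (@spec_sg _ _ _ _ _ _ _ _ _ _ _ _ _ _ _ co cs _ _ _ _ _ hl).
  by split=> //; [exact: spec_posc|exact: spec_nondeg].
- exact: spec_correspondence.
- exact: spec_full.
- exact: spec_proper.
Qed.

(** * Lifts of the powers of [X] *)

Section ShiftLift.
Context (R : realType) (A : cstarAlg R) (X : preCorr A A) (P : cstarAlg R) (r : rep X P).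
Hypothesis pX : posc X.

(** [X \ox P] is [P] itself through [x \ot T -> t(x) T]. A lift must give [X] degree 0, whereas
    [t(x)] has degree 1; the factor [z^-1] makes up for it. *)
Lemma shift_lift : is_lift r r (idfun : X \ox X -> X \ox X) (E := self_corr P)
  (fun z xi => z^-1 *: r_g r z xi) (fun x T => cmul (r_t r x) T).
Proof.
have hT : interior_tensor (X := X) (Y := rcorr r) (Z := res (r_hom r) (self_corr P)) (fun x T => cmul (r_t r x) T).
  split.
  - by move=> x; exact: cmul_linearr.
  - by move=> T c x x'; rewrite r_lin cmul_linearl.
  - by move=> x a T; rewrite rep_ract /= cmulA.
  - by move=> a x T; rewrite /= cmulA r_lact.
  - by move=> x T T'; rewrite /= cmulA.
  - by move=> x T x' T'; rewrite /= cadjM -r_ip !cmulA.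
  - by move=> z; apply/positiveP; exact: posc_self.
  - by apply/seteqP; split=> // p _; exact: r_tot.
split=> //.
- by move=> y x T; rewrite (lift_actE pX pX hT) /=.
- by move=> z z1 c x y; have [gl _ _ _] := r_ghom r z1; rewrite gl; lmod.
- move=> z x T z1; have [_ gm _ _] := r_ghom r z1.
  by rewrite gm r_gt // cmulZl scalerA mulVf ?unit_neq0 // scale1r.
- move=> z q xi z1; have [_ gm _ _] := r_ghom r z1.
  by rewrite /= gm cmulZr.
- move=> z xi eta z1; have [_ gm ga _] := r_ghom r z1.
  have z1' : `|z^-1| = 1 by rewrite normfV z1 invr1.
  by rewrite /= cadjZ cmulZl cmulZr scalerA unit_conj // scale1r -ga -gm.
Qed.
End ShiftLift.

(** The right-hand side is the recursive clause of [tpowS_shift]: a power of [X] is the composite of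
    [X], with the identity of [X \ox X], and the previous power. *)
Lemma odot_idfun (R : realType) (A : cstarAlg R) (X : preCorr A A)
    (F : preCorr A A) (PhiF : X \ox F -> F \ox X) : posc X -> posc F ->
  odot (idfun : X \ox X -> X \ox X) PhiF = fun w => assocV X F X (tmap idfun PhiF w).
Proof.
move=> pX pF; apply/funext => w; rewrite /odot; congr (assocV _ _ _ (tmap _ _ _)).
have pXX := posc_tensor pX pX.
have [u1 e1] := assocVP pX pX pF; have [u2 e2] := tmapP pXX pF (unitary_id (X \ox X)) (unitary_id F).
have [u3 e3] := assocP pX pX pF.
have b : blin (fun w => assoc X X F (tmap idfun idfun (assocV X X F w))).
  exact: blin_comp (unitary_blin u3) (blin_comp (unitary_blin u2) (unitary_blin u1)).
apply: (blin_ext b (@blin_id _ _) _ (@tens3_totalr _ _ _ _ _ _ _ _ pX pX pF w)) => _ [[[x y] z] _ <-] /=.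
by rewrite e1 e2 e3.
Qed.

Lemma bilift_tpow (R : realType) (A A0 : cstarAlg R) (X : preCorr A A) (X0 : preCorr A0 A0) (P : cstarAlg R)
    (r : rep X P) (r0 : rep X0 P) (n : nat) :
  is_core r r0 -> posc X -> nondeg X ->
  bilift r r0 r r0 (@tpowS_shift _ A X n) (@tpowS_shift _ A0 X0 n).
Proof.
move=> co pX nX; have [pX0 nX0] := conj (core_posc co) (nondeg_core co).
have b0 : bilift r r0 r r0 (idfun : X \ox X -> X \ox X) (idfun : X0 \ox X0 -> X0 \ox X0).
  split; [by split=> //; exact: unitary_id|by split=> //; exact: unitary_id|].
  exists (self_corr P), (fun z xi => z^-1 *: r_g r z xi), (fun x T => cmul (r_t r x) T), (fun x T => cmul (r_t r0 x) T).
  by split; [exact: shift_lift|rewrite -(co_g co); exact: shift_lift].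
elim: n => [//|n IH]; have [[pF nF uF] [pF0 nF0 uF0] _] := IH.
have := bilift_odot co co pX pX co pX b0 IH.
by rewrite (odot_idfun _ pX pF) (odot_idfun _ pX0 pF0).
Qed.

(** * Lifts of the evaluations *)

Section Evaluation.
Context (R : realType) (A : cstarAlg R) (X : preCorr A A) (t : I01 R).
Hypotheses (pX : posc X) (nX : nondeg X).

Lemma posc_ev : posc (ev_corr A t). Proof. by move=> a; exact: Pos_adj_mul. Qed.
Lemma nondeg_ev : nondeg (ev_corr A t).
Proof.
move=> a; apply: cspan_mono (@nondeg_self _ A a) => _ [b _ [c _ <-]].
by exists (contI_cst b : contI_alg A) => //; exists c.
Qed.
Let hE := tens_it posc_ev pX.
Let pC := posc_contI pX.
Let hC := tens_it pC posc_ev.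
Notation X' := (res (ev_star_hom A t) X).

Lemma ev_mul_unitary : unitary (@ev_mul _ A X t : ev_corr A t \ox X -> X') /\
  forall (a : ev_corr A t) (x : X), ev_mul (a \ot x) = lact (a : A) x.
Proof.
have [||||h [uh hh]] := @unitary_ext _ _ _ _ X' _ (fun p : ev_corr A t * X => p.1 \ot p.2)
  (fun p => lact (p.1 : A) p.2) (fun f p => (lact f p.1, p.2)) (it_total hE).
- by move=> x; apply: cspan_mono (@nX x) => _ [a _ [y _ <-]]; exists (a, y).
- by move=> p q; rewrite (it_ip hE) /= lactM lact_adj.
- by move=> f p; rewrite (it_lact hE).
- by move=> f p; rewrite /= lactM.
have E : @ev_mul _ A X t = h.
  apply/funext; apply: (tliftP posc_ev pX); first exact: (unitary_blin uh).
  by move=> a x; rewrite (hh (a, x)).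
by rewrite E; split=> // a x; exact: (hh (a, x)).
Qed.

(** Both tensor products are identified with [X], seen as a module over [C(I, A)] by evaluation;
    [eta] is one identification followed by the inverse of the other. *)
Lemma etaP : unitary (@eta _ A X t) /\
  forall (f : contI_corr X) (a : ev_corr A t), ev_mul (@eta _ A X t (f \ot a)) = ract ((f : contI X) t) a.
Proof.
have [uM _] := ev_mul_unitary; have [V [uV VM MV]] := unitary_inv uM.
have [||||h [uh hh]] := @unitary_ext _ _ _ _ X' _ (fun p : contI_corr X * ev_corr A t => p.1 \ot p.2)
  (fun p => ract ((p.1 : contI X) t) (p.2 : A)) (fun f p => (lact f p.1, p.2)) (it_total hC).
- move=> x; have [_ _ cl] := cspan_closed (range (fun p : contI_corr X * ev_corr A t => ract ((p.1 : contI X) t) (p.2 : A))).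
  apply: cl => e e0; have [a ha] := ract_approx x e0; exists (ract x a) => //.
  by apply: cspan_sub; exists (contI_cst x : contI_corr X, a : ev_corr A t).
- by move=> p q; rewrite (it_ip hC) /= ip_ract ip_ractl cmulA.
- by move=> f p; rewrite (it_lact hC).
- by move=> f p; rewrite /= lact_ract.
rewrite /eta /some_or; case: pselect => [e|ne]; first exact: (projT2 (cid e)).
case: ne; exists (fun w => V (h w)); split; first exact: unitary_comp uV uh.
by move=> f a; rewrite MV (hh (f, a)).
Qed.
Lemma good_eta : good (@eta _ A X t).
Proof. by split; [exact: posc_ev|exact: nondeg_ev|case: etaP]. Qed.

Context (P : cstarAlg R) (r : rep X P).
(** Evaluation at [t] lifts to evaluation at [t] of paths in [P], with the gauge action itself as
    the operators [U]. *)
Lemma eta_lift : is_lift r (contI_rep r) (@eta _ A X t) (E := ev_corr P t) (r_g r)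
  (fun (a : ev_corr A t) (T : P) => cmul (r_pi r a) T).
Proof.
have [pl pm pa pn] := r_hom r.
have hT : interior_tensor (X := ev_corr A t) (Y := rcorr r) (Z := res (r_hom (contI_rep r)) (ev_corr P t))
    (fun a T => cmul (r_pi r a) T).
  split.
  - by move=> a; exact: cmul_linearr.
  - by move=> T c a a'; rewrite pl cmul_linearl.
  - by move=> a b T; rewrite /= pm cmulA.
  - by move=> f a T; rewrite /= pm cmulA.
  - by move=> a T T'; rewrite /= cmulA.
  - by move=> a T a' T'; rewrite /= cadjM pm pa !cmulA.
  - by move=> z; apply/positiveP; exact: Pos_adj_mul.
  - by apply/seteqP; split=> // p _; exact: r_nd.
have [uM mE] := ev_mul_unitary.
have actE w T : lift_act r (fun (a : ev_corr A t) (T : P) => cmul (r_pi r a) T : ev_corr P t) w T = cmul (r_t r (ev_mul w)) T.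
  apply: (tliftP posc_ev pX (h := fun w => cmul (r_t r (ev_mul w)) T : ev_corr P t)).
    exact: (blin_comp (blin_cmulr T) (blin_comp (rep_blin r) (unitary_blin uM))).
  by move=> a x; rewrite mE -r_lact cmulA.
split=> //.
- by move=> y a T; rewrite actE; have [_ ->] := etaP; rewrite rep_ract /= cmulA.
- by move=> z z1; have [] := r_ghom r z1.
- by move=> z a T z1; have [_ gm _ _] := r_ghom r z1; rewrite gm r_gpi.
- by move=> z q xi z1; have [_ gm _ _] := r_ghom r z1; rewrite /= gm contI_gE.
- by move=> z xi eta z1; have [_ gm ga _] := r_ghom r z1; rewrite /= gm ga.
Qed.
End Evaluation.

Lemma bilift_ev (R : realType) (A A0 : cstarAlg R) (X : preCorr A A) (X0 : preCorr A0 A0) (P : cstarAlg R)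
    (r : rep X P) (r0 : rep X0 P) (t : I01 R) :
  is_core r r0 -> posc X -> nondeg X ->
  bilift r r0 (contI_rep r) (contI_rep r0) (@eta _ A X t) (@eta _ A0 X0 t).
Proof.
move=> co pX nX; have [pX0 nX0] := conj (core_posc co) (nondeg_core co).
split; [exact: good_eta|exact: good_eta|].
exists (ev_corr P t), (r_g r), (fun (a : ev_corr A t) T => cmul (r_pi r a) T), (fun (a : ev_corr A0 t) T => cmul (r_pi r0 a) T).
by split; [exact: eta_lift|rewrite -(co_g co); exact: eta_lift].
Qed.

Lemma correspondence_nondeg (R : realType) (A B : cstarAlg R) (X : preCorr A B) :
  correspondence X -> posc X /\ nondeg X.
Proof.
move=> [pX nX]; split=> x; first by apply/positiveP; exact: pX.
by have [a [y ->]] := nX x; apply: cspan_sub; exists a => //; exists y.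
Qed.

Lemma cp_rep_generates (R : realType) (A : cstarAlg R) (X : preCorr A A) (O : cuntzPimsner X)
  (prX : proper_corr X) : generates (r_pi (cp_rep O prX)) (r_t (cp_rep O prX)).
Proof. exact: (cp_generates prX). Qed.

(** * Transport of the two equivalences *)

Section Transport.
Context (R : realType) (A B : cstarAlg R) (X : preCorr A A) (Y : preCorr B B).
Context (OX : cuntzPimsner X) (OY : cuntzPimsner Y).
Hypotheses (cX : correspondence X) (cY : correspondence Y) (prX : proper_corr X) (prY : proper_corr Y).
Let coX := cp_is_core OX prX.
Let coY := cp_is_core OY prY.
Let pX := (correspondence_nondeg cX).1.
Let pY := (correspondence_nondeg cY).1.
Let nX := (correspondence_nondeg cX).2.
Let nY := (correspondence_nondeg cY).2.

Lemma arrow_bilift (M : preCorr A B) (PhiM : X \ox M -> M \ox Y) : correspondence M -> unitary PhiM ->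
  exists (K : preCorr (core_alg OX) (core_alg OY)) (PhiK : core_corr OX \ox K -> K \ox core_corr OY),
    [/\ bilift (cp_rep OY prY) (core_rep OY prY) (cp_rep OX prX) (core_rep OX prX) PhiM PhiK,
        correspondence K, full M -> full K & proper_corr M -> proper_corr K].
Proof.
move=> cM uM; have [pM nM] := correspondence_nondeg cM.
by apply: bilift_exists => //; split.
Qed.

(** [H] is lifted over the algebra of paths in [OX], whose core is the algebra of paths in the core.
    Its degree 0 part [L] is therefore directly a correspondence with coefficients in [C(I, O^0)],
    as a homotopy requires. *)
Lemma homotopic_core (M : preCorr A A) (Phi : X \ox M -> M \ox X) n
    (K : preCorr (core_alg OX) (core_alg OX)) (PhiK : core_corr OX \ox K -> K \ox core_corr OX) :
  bilift (cp_rep OX prX) (core_rep OX prX) (cp_rep OX prX) (core_rep OX prX) Phi PhiK ->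
  homotopic Phi (@tpowS_shift _ A X n) -> homotopic PhiK (@tpowS_shift _ _ (core_corr OX) n).
Proof.
move=> bM [H [PhiH [[cH fH prH uH] [h0 a0] [h1 a1]]]].
have [pH nH] := correspondence_nondeg cH.
have coI := contI_core coX; have pI := posc_contI pX.
have [|L [PhiL [bL cL fL prL]]] := bilift_exists (Phi := PhiH) OX prX coI pI cX; first by split.
have gen := @cp_rep_generates _ _ _ OX prX.
(* [L] composed with evaluation and [H] composed with evaluation share a lift, so the 2-arrow at
   each end point is transported. *)
have tw t (F0 : preCorr A A) (Phi0 : X \ox F0 -> F0 \ox X) (K0 : preCorr (core_alg OX) (core_alg OX))
    (PhiK0 : core_corr OX \ox K0 -> K0 \ox core_corr OX) (Psi : H \ox ev_corr A t -> F0) :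
  bilift (cp_rep OX prX) (core_rep OX prX) (cp_rep OX prX) (core_rep OX prX) Phi0 PhiK0 ->
  arrow2 (odot PhiH (@eta _ A X t)) Phi0 Psi ->
  exists Psi' : L \ox ev_corr (core_alg OX) t -> K0, arrow2 (odot PhiL (@eta _ _ (core_corr OX) t)) PhiK0 Psi'.
  have bo := bilift_odot coX coI pX pI coX pX bL (bilift_ev t coX pX nX).
  by move=> b0; apply: (bilift_arrow2 coX coX pX pX gen bo b0).
exists L, PhiL; split.
- by split; [exact: cL|exact: fL|exact: prL|case: bL => _ []].
- exact: tw bM a0.
- exact: tw (bilift_tpow n coX pX nX) a1.
Qed.
End Transport.

Theorem theorem4p5 (R : realType) (A B : cstarAlg R)
    (X : preCorr A A) (Y : preCorr B B)
    (hX : object X) (hY : object Y)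
    (OX : cuntzPimsner X) (OY : cuntzPimsner Y) :
  (aligned_shift_equivalent X Y ->
     aligned_shift_equivalent (core_corr OX) (core_corr OY)) /\
  (homotopy_shift_equivalent X Y ->
     homotopy_shift_equivalent (core_corr OX) (core_corr OY)).
Proof.
have [cX _ [_ prX]] := hX; have [cY _ [_ prY]] := hY.
have [pX nX] := correspondence_nondeg cX; have [pY nY] := correspondence_nondeg cY.
have coX := cp_is_core OX prX; have coY := cp_is_core OY prY.
split.
- move=> [n [[M N PhiM PhiN PsiX PsiY cM cN uM uN uX uY] [aX aY]]].
  have [KM [PhiKM [bM cKM _ _]]] := arrow_bilift OX OY cX cY prX prY cM uM.
  have [KN [PhiKN [bN cKN _ _]]] := arrow_bilift OY OX cY cX prY prX cN uN.
  (* Unitarity and alignment together say that [PsiX] is a 2-arrow from the composite to the power,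
     so the transport of 2-arrows returns the aligned data for the cores. *)
  have [PX [uPX aPX]] := bilift_arrow2 coX coX pX pX (@cp_rep_generates _ _ _ OX prX)
    (bilift_odot coX coY pX pY coX pX bM bN) (bilift_tpow n coX pX nX) (conj uX aX).
  have [PY [uPY aPY]] := bilift_arrow2 coY coY pY pY (@cp_rep_generates _ _ _ OY prY)
    (bilift_odot coY coX pY pX coY pY bN bM) (bilift_tpow n coY pY nY) (conj uY aY).
  have [[_ _ uKM] [_ _ uKN]] : good PhiKM /\ good PhiKN by case: bM => _ ? _; case: bN.
  by exists n, (ConcreteShift cKM cKN uKM uKN uPX uPY).
move=> [n [M [PhiM [N [PhiN [[cM fM prM uM] [cN fN prN uN] hMN hNM]]]]]].
have [KM [PhiKM [bM cKM fKM prKM]]] := arrow_bilift OX OY cX cY prX prY cM uM.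
have [KN [PhiKN [bN cKN fKN prKN]]] := arrow_bilift OY OX cY cX prY prX cN uN.
(* The lag is unchanged, since powers of [X] transport to the same powers of the core
   correspondence. *)
exists n, KM, PhiKM, KN, PhiKN; split.
- by split; [exact: cKM|exact: fKM|exact: prKM|case: bM => _ []].
- by split; [exact: cKN|exact: fKN|exact: prKN|case: bN => _ []].
- exact: (homotopic_core cX (bilift_odot coX coY pX pY coX pX bM bN) hMN).
- exact: (homotopic_core cY (bilift_odot coY coX pY pX coY pY bN bM) hNM).
Qed.
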